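(* Let $(d,p,q)$ be Schrödinger admissible with $q$ an even integer which divides $p$; that is, let $(d,p,q)$ be one of $(1,6,6)$, $(1,8,4)$, $(2,4,4)$. Let $f \in L^2(\mathbb{R}^d)$. Then the quantity $$Q_{p,q}(t) := \big\| e^{is\Delta}\big( (e^{t\Delta}|f|^2)^{1/2}\big) \big\|_{L^p_sL^q_x(\mathbb{R}\times\mathbb{R}^d)}$$ is nondecreasing for all $t>0$ (i.e. $t \mapsto Q_{p,q}(t)$ is a nondecreasing function on $(0,\infty)$).
   Context: Functions on $\mathbb{R}^d$ are complex-valued. The Fourier transform is $\widehat{f}(\xi) = (2\pi)^{-d/2}\int_{\mathbb{R}^d} e^{-ix\cdot\xi} f(x)\,dx$. For $s\in\mathbb{R}$, the Schrödinger operator $e^{is\Delta}$ is the Fourier multiplier operator given by $\widehat{e^{is\Delta}g}(\xi) = e^{-is|\xi|^2}\widehat{g}(\xi)$, extended to $g \in L^2(\mathbb{R}^d)$ as a unitary operator. For $t>0$ the heat operator $e^{t\Delta}$ is the Fourier multiplier operator with multiplier $e^{-t|\xi|^2}$, i.e. $e^{t\Delta}h = H_t * h$ with $H_t(x) = (4\pi t)^{-d/2} e^{-|x|^2/4t}$; it is applied here to $h=|f|^2\in L^1(\mathbb{R}^d)$. The mixed norm is $\|u\|_{L^p_sL^q_x(\mathbb{R}\times\mathbb{R}^d)} = \big(\int_{\mathbb{R}} \big(\int_{\mathbb{R}^d} |u(s,x)|^q\,dx\big)^{p/q} ds\big)^{1/p}$. The triple $(d,p,q)$, with $d\in\mathbb{N}$,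 is Schrödinger admissible if $p,q\ge 2$, $(d,p,q)\ne(2,2,\infty)$ and $\frac{2}{p}+\frac{d}{q}=\frac{d}{2}$. *)

(* Defs.v *)
From HB Require Import structures.
From mathcomp Require Import all_boot all_order all_algebra.
From mathcomp Require Import all_classical all_reals all_analysis.
From mathcomp Require Import complex.

Set Implicit Arguments.
Unset Strict Implicit.
Unset Printing Implicit Defensive.
Import Order.TTheory GRing.Theory Num.Theory.
Import numFieldNormedType.Exports.

Local Open Scope classical_set_scope.
Local Open Scope ring_scope.
Local Open Scope complex_scope.

(* Points of R^d are d-tuples: matrices carry no sigma-algebra in the library,
   whereas tuples carry the product Borel sigma-algebra. *)
Notation euclid R d := (d.-tuple (measurableTypeR R)).

Section lebesgue_tuple.
Context {R : realType}.

Definition consR d (z : measurableTypeR R * euclid R d) : euclid R d.+1 :=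
  [tuple of z.1 :: z.2].

Lemma measurable_consR d :
  measurable_fun [set: measurableTypeR R * euclid R d] (@consR d).
Proof. exact: measurable_cons. Qed.

Section step.
Variables (d : nat) (mu : {sigma_finite_measure set (euclid R d) -> \bar R}).

Definition leb_step : set (euclid R d.+1) -> \bar R :=
  pushforward (lebesgue_measure \x mu)%E (@consR d).

Let leb_step0 : leb_step set0 = 0%E.
Proof. by rewrite /leb_step /pushforward preimage_set0 measure0. Qed.

Let leb_step_ge0 A : (0 <= leb_step A)%E.
Proof. exact: (measure_ge0 (lebesgue_measure \x mu)%E). Qed.

Let leb_step_sigma_additive : semi_sigma_additive leb_step.
Proof.
have mcons A : measurable A -> measurable (@consR d @^-1` A).
  by move=> mA; rewrite -[X in measurable X]setTI; exact: measurable_consR.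
move=> F mF tF mUF; rewrite /leb_step /pushforward preimage_bigcup.
apply: measure_semi_sigma_additive.
- by move=> n; exact: mcons.
- apply/trivIsetP => /= i j _ _ ij; rewrite -preimage_setI.
  by move/trivIsetP : tF => /(_ _ _ _ _ ij) ->//; rewrite preimage_set0.
- by rewrite -preimage_bigcup; exact: mcons.
Qed.

HB.instance Definition _ := isMeasure.Build _ _ _ leb_step
  leb_step0 leb_step_ge0 leb_step_sigma_additive.

Let leb_step_sigma_finite : sigma_finite setT leb_step.
Proof.
have /sigma_finiteP[F [TF ndF Foo]] := sigma_finiteT (@lebesgue_measure R).
have /sigma_finiteP[G [TG ndG Goo]] := sigma_finiteT mu.
pose g (x : euclid R d.+1) : measurableTypeR R * euclid R d :=
  (thead x, [tuple of behead x]).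
have mg : measurable_fun setT g.
  apply/measurable_fun_pairP; split.
    exact: (@measurable_tnth _ (measurableTypeR R) _ ord0).
  exact: measurable_behead.
have gK z : g (consR z) = z.
  by case: z => a b; rewrite /g /consR theadE /=; congr pair; exact: val_inj.
exists (fun n => g @^-1` (F n `*` G n)).
  rewrite -preimage_bigcup -[LHS](preimage_setT g); congr (g @^-1` _).
  rewrite -setXTT TF TG predeqE => -[x y]; split.
    move=> [/= [n _ Fnx] [k _ Gky]]; exists (maxn n k) => //; split.
    - by move: x Fnx; exact/subsetPset/ndF/leq_maxl.
    - by move: y Gky; exact/subsetPset/ndG/leq_maxr.
  by move=> [n _ []/= ? ?]; split; exists n.
move=> k; have [? ?] := Foo k; have [? ?] := Goo k; split.
  by rewrite -[X in measurable X]setTI; apply: mg => //; exact: measurableX.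
rewrite /leb_step /pushforward (_ : _ @^-1` _ = F k `*` G k); last first.
  by apply/funext => z; exact: (congr1 (F k `*` G k) (gK z)).
by rewrite product_measure1E// lte_mul_pinfty// ge0_fin_numE.
Qed.

HB.instance Definition _ := Measure_isSigmaFinite.Build _ _ _
  leb_step leb_step_sigma_finite.
End step.

Fixpoint leb (d : nat) : {sigma_finite_measure set (euclid R d) -> \bar R} :=
  match d with
  | 0 => dirac [tuple]
  | d'.+1 => leb_step (leb d')
  end.

End lebesgue_tuple.

Section strichartz.
Context {R : realType} {d : nat}.
Implicit Types (x y xi : euclid R d) (g G u : euclid R d -> R[i]) (s t : R).

Definition dot x y : R := \sum_(i < d) tnth x i * tnth y i.

Definition sqnorm x : R := dot x x.

Definition subv x y : euclid R d := [tuple tnth x i - tnth y i | i < d].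

Definition cabs (z : R[i]) : R := ComplexField.Normc.normc z.

(* e^{i theta} *)
Definition cis (theta : R) : R[i] := cos theta +i* sin theta.

Definition cmeasurable g : Prop :=
  measurable_fun setT (fun x => complex.Re (g x)) /\
  measurable_fun setT (fun x => complex.Im (g x)).

Definition Lpnorm (p : \bar R) g : \bar R :=
  Lnorm (leb d) p (fun x => (cabs (g x))%:E).

(* f \in L^p(R^d), as a function and not as an a.e. class. *)
Definition memLp (p : \bar R) g : Prop := cmeasurable g /\ (Lpnorm p g < +oo)%E.

Definition cintegral g : R[i] :=
  Rintegral (leb d) setT (fun x => complex.Re (g x))
  +i* Rintegral (leb d) setT (fun x => complex.Im (g x)).

(* The integral formula, meaningful for g in L^1. *)
Definition fourier g xi : R[i] :=
  ((2 * pi) `^ (- (d%:R / 2)))%:C * cintegral (fun x => cis (- dot x xi) * g x).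

(* G is (a representative of) the Fourier transform of g in L^2: the graph of
   the continuous extension of [fourier] from L^1 \cap L^2 to L^2. *)
Definition is_fourierL2 g G : Prop :=
  [/\ memLp 2%:E g, memLp 2%:E G &
    exists g_ : nat -> euclid R d -> R[i],
    [/\ forall n, memLp 1%:E (g_ n) /\ memLp 2%:E (g_ n),
        Lpnorm 2%:E (fun x => g_ n x - g x) @[n --> \oo] --> 0%E &
        Lpnorm 2%:E (fun xi => fourier (g_ n) xi - G xi) @[n --> \oo] --> 0%E]].

Definition is_schrodinger s g u : Prop :=
  exists2 G, is_fourierL2 g G &
    is_fourierL2 u (fun xi => cis (- (s * sqnorm xi)) * G xi).

(* e^{is\Delta} g for g in L^2. By Plancherel's theorem a function u as below
   exists for every such g and is unique up to a null set; [xget] picks a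
   representative. *)
Definition schrodinger s g : euclid R d -> R[i] :=
  xget (fun _ => 0) [set u | is_schrodinger s g u].

Definition heat_kernel t x : R :=
  (4 * pi * t) `^ (- (d%:R / 2)) * expR (- (sqnorm x / (4 * t))).

(* e^{t\Delta} h = H_t * h *)
Definition heat t (h : euclid R d -> R) x : R :=
  Rintegral (leb d) setT (fun y => heat_kernel t (subv x y) * h y).

Definition mixed_norm (p q : \bar R) (v : R -> euclid R d -> R[i]) : \bar R :=
  Lnorm (@lebesgue_measure R) p (fun s => Lpnorm q (v s)).

Definition Q (p q : \bar R) (f : euclid R d -> R[i]) t : \bar R :=
  mixed_norm p q (fun s => schrodinger s
    (fun x => (Num.sqrt (heat t (fun y => cabs (f y) ^+ 2) x))%:C)).

End strichartz.

(* The extended-real inverse satisfies +oo^-1 = 0. *)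
Definition schrodinger_admissible {R : realType} (d : nat) (p q : \bar R) : Prop :=
  [/\ (0 < d)%N, (2%:E <= p)%E, (2%:E <= q)%E,
      ~ [/\ d = 2%N, p = 2%:E & q = +oo%E] &
      (2%:E / p + d%:R%:E / q = (d%:R / 2)%:E)%E].

(* Main.v *)
(* Let p = q = 2N; the case (8, 4) is dealt with below. The N-th power of e^{is Delta} g
   is the restriction to the diagonal of the evolution of the tensor power of g.
   After an orthogonal change of variables z = (w, m), with m proportional to the
   sum of the frequencies, it is the integral of e^{i (a x.m - s |z|^2)} F(z),
   with F the transform of the tensor power. In each case w is two-dimensional,
   so polar coordinates in w turn Lebesgue measure into d(|w|^2) dm: the integral
   is a Fourier transform in (|z|^2, m) of the average of F over the rotations of
   w, and Plancherel gives
     ||e^{is Delta} g||^p = C || average of (g (x) ... (x) g) o Phi o R ||_2^2,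
   because averaging commutes with the Fourier transform. For
   (d,p,q) = (1,8,4), the square of the inner norm is a spatial norm of g (x) g
   in dimension 2, which brings back (2,4,4).

   Expanding the square with g = sqrt(e^{t Delta} |f|^2) leaves a double average
   over rotations R, R' of the integral of sqrt(U_t(R z) U_t(R' z)), where U_t is
   the heat flow of a tensor power, composed with an orthogonal map. Each of these is
   nondecreasing: by the semigroup law U_{t+h} = H_h * U_t, and Cauchy-Schwarz in
   the convolution variable gives
     H_h * sqrt(U_t V_t) <= sqrt((H_h * U_t) (H_h * V_t)),
   while convolution with H_h preserves the integral of the left-hand side. *)
Require Import Defs.
From HB Require Import structures.
From mathcomp Require Import all_boot all_order all_algebra.
From mathcomp Require Import all_classical all_reals all_analysis.
From mathcomp Require Import measurable_realfun complex ring lra zify.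
Set Implicit Arguments.
Unset Strict Implicit.
Unset Printing Implicit Defensive.
Import Order.TTheory GRing.Theory Num.Theory.
Import numFieldNormedType.Exports.
Local Open Scope classical_set_scope.
Local Open Scope ring_scope.
Local Open Scope complex_scope.

(** The plane of [w] has dimension (N - 1) d, which is two exactly for d = 1, N = 3 and for d = 2, N
    = 2. In any other dimension the density of |w|^2 is not constant, and Plancherel would give a
    weighted norm of the average instead of a plain one.

    The obstacle is analytic. The L^2 transform is only given as a graph of limits, and
    [schrodinger] picks a representative for each time separately, so nothing makes it measurable in
    (s, x). The identities are therefore proved first for data with integrable transform, where the
    evolution is an absolutely convergent integral at every point. The passage to the limit uses
    squared distances [n2] that decrease like 8^-m, fast enough for almost everywhere convergence in
    space-time: the N-th power is not linear in the data, so its limit has to be identified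
    pointwise. Plancherel itself rests on Abel summation, whose kernels have elementary integrals.

    The multiplicative constants met on the way depend on the dimension and the exponents but not on
    the data, so monotonicity only asks for their sign. *)

Section complex_numbers.
Context {R : realType}.
Implicit Types (z w : R[i]) (a b : R).

Lemma cabs2 z : cabs z ^+ 2 = complex.Re z ^+ 2 + complex.Im z ^+ 2.
Proof. by case: z => a b; rewrite /cabs /= sqr_sqrtr// addr_ge0// sqr_ge0. Qed.

Lemma cabs_ge0 z : 0 <= cabs z.
Proof. by case: z => a b; rewrite /cabs /= sqrtr_ge0. Qed.

Lemma cabsE z : cabs z = Num.sqrt (complex.Re z ^+ 2 + complex.Im z ^+ 2).
Proof. by case: z. Qed.

Lemma cabsM z w : cabs (z * w) = cabs z * cabs w.
Proof. exact: ComplexField.Normc.normcM. Qed.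

Lemma cabs0 : cabs (0 : R[i]) = 0.
Proof. exact: ComplexField.Normc.normc0. Qed.

Lemma cabsN z : cabs (- z) = cabs z.
Proof. by case: z => a b; rewrite /cabs /= !sqrrN. Qed.

Lemma cabs_conj z : cabs (conjc z) = cabs z.
Proof. by case: z => a b; rewrite /cabs /= sqrrN. Qed.

Lemma cabsD z w : cabs (z + w) <= cabs z + cabs w.
Proof. exact: le_normcD. Qed.

Lemma cabsB z w : cabs (z - w) = cabs (w - z).
Proof. by rewrite -cabsN opprB. Qed.

Lemma cabs_real a : cabs a%:C = `|a|.
Proof. by rewrite cabsE /= expr0n addr0 sqrtr_sqr. Qed.

Lemma cabsX z n : cabs (z ^+ n) = cabs z ^+ n.
Proof.
elim: n => [|n IH]; last by rewrite !exprS cabsM IH.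
by rewrite !expr0 (_ : 1 = 1%:C)// cabs_real normr1.
Qed.

Lemma cabs_cis a : cabs (cis a) = 1.
Proof. by rewrite cabsE /= cos2Dsin2 sqrtr1. Qed.

Lemma cabs_eq0 z : cabs z = 0 -> z = 0.
Proof. exact: ComplexField.Normc.eq0_normc. Qed.

Lemma normRe_le z : `|complex.Re z| <= cabs z.
Proof. by rewrite cabsE -sqrtr_sqr ler_wsqrtr// lerDl sqr_ge0. Qed.

Lemma normIm_le z : `|complex.Im z| <= cabs z.
Proof. by rewrite cabsE -sqrtr_sqr ler_wsqrtr// lerDr sqr_ge0. Qed.

Lemma cabs_le z : cabs z <= `|complex.Re z| + `|complex.Im z|.
Proof.
rewrite -(@ler_pXn2r _ 2)// ?nnegrE ?cabs_ge0 ?addr_ge0//.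
rewrite cabs2 sqrrD !real_normK ?num_real// -addrA lerD2l lerDr.
by rewrite mulrn_wge0// mulr_ge0.
Qed.

Lemma cisD a b : cis (a + b) = cis a * cis b.
Proof. by rewrite /cis cosD sinD; simpc; congr (_ +i* _); rewrite addrC. Qed.

Lemma cis0 : cis (0 : R) = 1.
Proof. by rewrite /cis cos0 sin0. Qed.

Lemma conj_cis a : conjc (cis a) = cis (- a).
Proof. by rewrite /cis cosN sinN. Qed.

Lemma mul_conj z : z * conjc z = (cabs z ^+ 2)%:C.
Proof.
by rewrite cabs2; case: z => a b; simpc; congr (_ +i* _); ring.
Qed.

Lemma complex_eq z w :
  complex.Re z = complex.Re w -> complex.Im z = complex.Im w -> z = w.
Proof. by case: z w => [? ?] [? ?] /= -> ->. Qed.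

Lemma cReD z w : complex.Re (z + w) = complex.Re z + complex.Re w.
Proof. by case: z w => [? ?] [? ?]. Qed.
Lemma cImD z w : complex.Im (z + w) = complex.Im z + complex.Im w.
Proof. by case: z w => [? ?] [? ?]. Qed.
Lemma cReN z : complex.Re (- z) = - complex.Re z.
Proof. by case: z. Qed.
Lemma cImN z : complex.Im (- z) = - complex.Im z.
Proof. by case: z. Qed.
Lemma cReJ z : complex.Re (conjc z) = complex.Re z.
Proof. by case: z. Qed.
Lemma cImJ z : complex.Im (conjc z) = - complex.Im z.
Proof. by case: z. Qed.
Lemma cReM z w : complex.Re (z * w) =
  complex.Re z * complex.Re w - complex.Im z * complex.Im w.
Proof. by case: z w => [? ?] [? ?]. Qed.
Lemma cImM z w : complex.Im (z * w) =
  complex.Re z * complex.Im w + complex.Im z * complex.Re w.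
Proof. by case: z w => [? ?] [? ?]. Qed.

(* The substitute for Minkowski's inequality: with [e] free it still gives the
   continuity of the norm. *)
Lemma cabs2D_le e z w : 0 < e ->
  cabs (z + w) ^+ 2 <= (1 + e) * cabs z ^+ 2 + (1 + e^-1) * cabs w ^+ 2.
Proof.
move=> e0; apply: (@le_trans _ _ ((cabs z + cabs w) ^+ 2)).
  by rewrite ler_pXn2r ?nnegrE ?cabs_ge0 ?cabsD// addr_ge0 ?cabs_ge0.
set x := cabs z; set y := cabs w.
have e1 : e * e^-1 = 1 by rewrite divff ?gt_eqF.
have : 0 <= e^-1 * (e * x - y) ^+ 2 by rewrite mulr_ge0 ?sqr_ge0// invr_ge0 ltW.
have -> : e^-1 * (e * x - y) ^+ 2 =
  (e * e^-1) * e * x ^+ 2 - 2 * (e * e^-1) * x * y + e^-1 * y ^+ 2 by ring.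
rewrite e1; nra.
Qed.

Lemma cabs2D_le2 z w : cabs (z + w) ^+ 2 <= 2 * cabs z ^+ 2 + 2 * cabs w ^+ 2.
Proof. by have := @cabs2D_le 1 z w ltr01; rewrite invr1 -[1 + 1]/2. Qed.

End complex_numbers.

(** * Measurability of complex-valued functions *)

Section complex_measurable.
Context {R : realType} {d} {T : measurableType d}.
Implicit Types f g : T -> R[i].

(** [cmeasurable] for an arbitrary domain, product spaces included; on [euclid R d] the two unfold
    to the same proposition. *)
Definition cmeas f : Prop :=
  measurable_fun setT (fun x => complex.Re (f x)) /\
  measurable_fun setT (fun x => complex.Im (f x)).

Lemma cmeas_cst (z : R[i]) : cmeas (fun=> z).
Proof. by split; exact: measurable_cst. Qed.

Lemma cmeasD f g : cmeas f -> cmeas g -> cmeas (fun x => f x + g x).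
Proof.
move=> [f1 f2] [g1 g2]; split.
  by under eq_fun do rewrite cReD; exact: measurable_funD.
by under eq_fun do rewrite cImD; exact: measurable_funD.
Qed.

Lemma cmeasN f : cmeas f -> cmeas (fun x => - f x).
Proof.
move=> [f1 f2]; split.
  by under eq_fun do rewrite cReN; exact: measurableT_comp.
by under eq_fun do rewrite cImN; exact: measurableT_comp.
Qed.

Lemma cmeasB f g : cmeas f -> cmeas g -> cmeas (fun x => f x - g x).
Proof. by move=> mf mg; apply: cmeasD => //; exact: cmeasN. Qed.

Lemma cmeasM f g : cmeas f -> cmeas g -> cmeas (fun x => f x * g x).
Proof.
move=> [f1 f2] [g1 g2]; split.
  by under eq_fun do rewrite cReM; apply: measurable_funB; exact: measurable_funM.
by under eq_fun do rewrite cImM; apply: measurable_funD; exact: measurable_funM.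
Qed.

Lemma cmeas_conj f : cmeas f -> cmeas (fun x => conjc (f x)).
Proof.
move=> [f1 f2]; split; first by under eq_fun do rewrite cReJ.
by under eq_fun do rewrite cImJ; exact: measurableT_comp.
Qed.

Lemma cmeas_real (h : T -> R) : measurable_fun setT h -> cmeas (fun x => (h x)%:C).
Proof. by move=> mh; split. Qed.

Lemma cmeas_cis (h : T -> R) : measurable_fun setT h -> cmeas (fun x => cis (h x)).
Proof.
move=> mh; split => /=.
  by apply: measurableT_comp => //; apply: continuous_measurable_fun; exact: continuous_cos.
by apply: measurableT_comp => //; apply: continuous_measurable_fun; exact: continuous_sin.
Qed.

Lemma cmeasX f n : cmeas f -> cmeas (fun x => f x ^+ n).
Proof.
move=> mf; elim: n => [|n IH]; first by under eq_fun do rewrite expr0; exact: cmeas_cst.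
by under eq_fun do rewrite exprS; exact: cmeasM.
Qed.

Lemma measurable_cabs2 f : cmeas f -> measurable_fun setT (fun x => cabs (f x) ^+ 2).
Proof.
move=> [f1 f2]; under eq_fun do rewrite cabs2.
by apply: measurable_funD; exact: measurable_funX.
Qed.

Lemma measurable_cabs f : cmeas f -> measurable_fun setT (fun x => cabs (f x)).
Proof.
move=> mf; have -> : (fun x => cabs (f x)) = fun x => Num.sqrt (cabs (f x) ^+ 2).
  by apply/funext => x; rewrite sqrtr_sqr ger0_norm ?cabs_ge0.
apply: measurableT_comp; last exact: measurable_cabs2.
by apply: continuous_measurable_fun; exact: sqrt_continuous.
Qed.

Lemma eq_cmeas f g : f =1 g -> cmeas f -> cmeas g.
Proof. by move=> /funext ->. Qed.

End complex_measurable.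

Lemma cmeas_comp {R : realType} d1 d2 (T1 : measurableType d1) (T2 : measurableType d2)
    (f : T2 -> R[i]) (h : T1 -> T2) :
  cmeas f -> measurable_fun setT h -> cmeas (fun x => f (h x)).
Proof. by move=> [f1 f2] mh; split; [exact: (measurableT_comp f1 mh)|exact: (measurableT_comp f2 mh)]. Qed.

(** * Measure-preserving maps *)

Section measure_preserving.
Context {R : realType} d1 d2 (T1 : measurableType d1) (T2 : measurableType d2).
Variables (mu : {measure set T1 -> \bar R}) (nu : {measure set T2 -> \bar R}).

(** The two measures may differ in scale: with a rescaled target, changes of variables of constant
    density are covered as well ([mp_sqnorm], and the dilation in [n2_scalev]). *)
Definition mp (h : T1 -> T2) : Prop :=
  measurable_fun setT h /\
  forall A, measurable A -> mu (h @^-1` A) = nu A.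

Variable h : T1 -> T2.
Hypothesis mph : mp h.

Lemma mp_ge0 (f : T2 -> \bar R) : measurable_fun setT f -> (forall x, 0 <= f x)%E ->
  (\int[mu]_x f (h x) = \int[nu]_x f x)%E.
Proof.
case: mph => mh E mf f0.
rewrite -(@eq_measure_integral _ _ _ setT nu (pushforward mu h)); last first.
  by move=> A mA _; exact: E.
by rewrite (@ge0_integral_pushforward _ _ _ _ _ h mh mu)// => x _; exact: f0.
Qed.

Lemma mp_int (f : T2 -> \bar R) : measurable_fun setT f ->
  (\int[mu]_x f (h x) = \int[nu]_x f x)%E.
Proof.
move=> mf; rewrite integralE [RHS]integralE; congr (_ - _)%E.
    rewrite -(mp_ge0 (measurable_funepos mf) (funepos_ge0 f)).
  by apply: eq_integral => x _; rewrite !unlock.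
rewrite -(mp_ge0 (measurable_funeneg mf) (funeneg_ge0 f)).
by apply: eq_integral => x _; rewrite !unlock.
Qed.

End measure_preserving.

(** * Complex-valued integrals *)

Section complex_integral.
Context {R : realType} d (T : measurableType d).
Variable mu : {measure set T -> \bar R}.
Implicit Types f g : T -> R[i].

Definition cint f : R[i] :=
  Rintegral mu setT (fun x => complex.Re (f x))
  +i* Rintegral mu setT (fun x => complex.Im (f x)).

Definition cL1 f : Prop := cmeas f /\ (\int[mu]_x (cabs (f x))%:E < +oo)%E.

(** The square of the L^2 norm. All L^2 distances are measured by it, so that they remain plain
    integrals; [n2D_le] then plays the part of the triangle inequality. *)
Definition n2 f : \bar R := (\int[mu]_x (cabs (f x) ^+ 2)%:E)%E.

Definition cL2 f : Prop := cmeas f /\ (n2 f < +oo)%E.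

Lemma cL1_Re f : cL1 f -> mu.-integrable setT (fun x => (complex.Re (f x))%:E).
Proof.
move=> [mf fi]; apply/integrableP; split; first by apply/measurable_EFinP; case: mf.
apply: le_lt_trans fi; apply: ge0_le_integral => //.
- by apply: measurableT_comp => //; apply/measurable_EFinP; case: mf.
- by apply/measurable_EFinP; exact: measurable_cabs.
- by move=> x _; rewrite lee_fin normRe_le.
Qed.

Lemma cL1_Im f : cL1 f -> mu.-integrable setT (fun x => (complex.Im (f x))%:E).
Proof.
move=> [mf fi]; apply/integrableP; split; first by apply/measurable_EFinP; case: mf.
apply: le_lt_trans fi; apply: ge0_le_integral => //.
- by apply: measurableT_comp => //; apply/measurable_EFinP; case: mf.
- by apply/measurable_EFinP; exact: measurable_cabs.
- by move=> x _; rewrite lee_fin normIm_le.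
Qed.

Lemma cL1_cabs f : cL1 f -> mu.-integrable setT (fun x => (cabs (f x))%:E).
Proof.
move=> [mf fi]; apply/integrableP; split.
  by apply/measurable_EFinP; exact: measurable_cabs.
by under eq_integral do rewrite /= ger0_norm ?cabs_ge0//.
Qed.

Lemma le_cL1 f (g : T -> \bar R) : cmeas f -> measurable_fun setT g ->
  (forall x, (cabs (f x))%:E <= g x)%E -> (\int[mu]_x g x < +oo)%E -> cL1 f.
Proof.
move=> mf mg fg gi; split => //; apply: le_lt_trans gi.
apply: ge0_le_integral => //; first by move=> x _; rewrite lee_fin cabs_ge0.
by apply/measurable_EFinP; exact: measurable_cabs.
Qed.

Lemma cL1D f g : cL1 f -> cL1 g -> cL1 (fun x => f x + g x).
Proof.
move=> [mf fi] [mg gi].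
apply: (@le_cL1 _ (fun x => (cabs (f x))%:E + (cabs (g x))%:E)%E).
- exact: cmeasD.
- by apply: emeasurable_funD; apply/measurable_EFinP; exact: measurable_cabs.
- by move=> x; rewrite lee_fin cabsD.
rewrite ge0_integralD//; [exact: lte_add_pinfty| | | |].
- by move=> x _; rewrite lee_fin cabs_ge0.
- by apply/measurable_EFinP; exact: measurable_cabs.
- by move=> x _; rewrite lee_fin cabs_ge0.
- by apply/measurable_EFinP; exact: measurable_cabs.
Qed.

Lemma cL1N f : cL1 f -> cL1 (fun x => - f x).
Proof.
by move=> [mf fi]; split; [exact: cmeasN|under eq_integral do rewrite cabsN].
Qed.

Lemma cL1B f g : cL1 f -> cL1 g -> cL1 (fun x => f x - g x).
Proof. by move=> lf lg; apply: cL1D => //; exact: cL1N. Qed.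

Lemma cL1M_bounded f g (c : R) : cmeas f -> (forall x, cabs (f x) <= c) ->
  cL1 g -> cL1 (fun x => f x * g x).
Proof.
move=> mf fc [mg gi].
apply: (@le_cL1 _ (fun x => (`|c| * cabs (g x))%:E)).
- exact: cmeasM.
- by apply/measurable_EFinP; apply: measurable_funM => //; exact: measurable_cabs.
- move=> x; rewrite lee_fin cabsM ler_wpM2r ?cabs_ge0//.
  exact: (le_trans (fc x) (ler_norm _)).
under eq_integral do rewrite EFinM.
rewrite ge0_integralZl//.
- by rewrite lte_mul_pinfty// lee_fin.
- by apply/measurable_EFinP; exact: measurable_cabs.
- by move=> x _; rewrite lee_fin cabs_ge0.
Qed.

Lemma cL1M_bounded_eq f g : cmeas f -> (forall x, cabs (f x) = 1) ->
  cL1 g -> cL1 (fun x => f x * g x).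
Proof. by move=> mf f1; apply: (@cL1M_bounded _ _ 1) => // x; rewrite f1. Qed.

Lemma cL1_cst_mul (c : R[i]) f : cL1 f -> cL1 (fun x => c * f x).
Proof. by apply: (@cL1M_bounded _ _ (cabs c)) => //; exact: cmeas_cst. Qed.

Lemma cL1_conj f : cL1 f -> cL1 (fun x => conjc (f x)).
Proof.
by move=> [mf fi]; split; [exact: cmeas_conj|under eq_integral do rewrite cabs_conj].
Qed.

Lemma cintD f g : cL1 f -> cL1 g -> cint (fun x => f x + g x) = cint f + cint g.
Proof.
move=> lf lg; apply: complex_eq => /=.
  under eq_Rintegral do rewrite cReD.
  by rewrite RintegralD//; exact: cL1_Re.
under eq_Rintegral do rewrite cImD.
by rewrite RintegralD//; exact: cL1_Im.
Qed.

Lemma Rintegral_scale (k : R) (h : T -> R) : mu.-integrable setT (fun x => (h x)%:E) ->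
  Rintegral mu setT (fun x => k * h x) = k * Rintegral mu setT h.
Proof. by move=> hi; rewrite RintegralZl. Qed.

Lemma cintZ (c : R[i]) f : cL1 f -> cint (fun x => c * f x) = c * cint f.
Proof.
move=> lf; have lr := cL1_Re lf; have li := cL1_Im lf.
have er k : Rintegral mu setT (fun x => k * complex.Re (f x)) =
  k * Rintegral mu setT (fun x => complex.Re (f x)) := Rintegral_scale k lr.
have ei k : Rintegral mu setT (fun x => k * complex.Im (f x)) =
  k * Rintegral mu setT (fun x => complex.Im (f x)) := Rintegral_scale k li.
have lr' (k : R) : mu.-integrable setT (fun x => (k * complex.Re (f x))%:E).
  by under eq_fun do rewrite EFinM; exact: integrableZl.
have li' (k : R) : mu.-integrable setT (fun x => (k * complex.Im (f x))%:E).
  by under eq_fun do rewrite EFinM; exact: integrableZl.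
apply: complex_eq; rewrite ?cReM ?cImM /=.
  under eq_Rintegral do rewrite cReM.
  by rewrite -er -ei; apply: RintegralB => //; [exact: lr'|exact: li'].
under eq_Rintegral do rewrite cImM.
by rewrite -er -ei; apply: RintegralD => //; [exact: li'|exact: lr'].
Qed.

Lemma cintN f : cL1 f -> cint (fun x => - f x) = - cint f.
Proof.
move=> lf; rewrite -[RHS]mulN1r -cintZ//; congr cint.
by apply/funext => x; rewrite mulN1r.
Qed.

Lemma cintB f g : cL1 f -> cL1 g -> cint (fun x => f x - g x) = cint f - cint g.
Proof. by move=> lf lg; rewrite cintD//; [rewrite cintN|exact: cL1N]. Qed.

Lemma cint_conj f : cL1 f -> cint (fun x => conjc (f x)) = conjc (cint f).
Proof.
move=> lf; apply: complex_eq; rewrite ?cReJ ?cImJ /=.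
  by under eq_Rintegral do rewrite cReJ.
under eq_Rintegral do rewrite cImJ -mulN1r.
by rewrite RintegralZl ?mulN1r//; exact: cL1_Im.
Qed.

Lemma cint_real (h : T -> R) : cint (fun x => (h x)%:C) = (Rintegral mu setT h)%:C.
Proof.
by apply: complex_eq => //=; rewrite /Rintegral integral0.
Qed.

Lemma eq_cint f g : f =1 g -> cint f = cint g.
Proof. by move=> /funext ->. Qed.

(* No integrability hypothesis: otherwise the right-hand side is [+oo]. *)
Lemma le_cabs_cint f : cmeas f -> ((cabs (cint f))%:E <= \int[mu]_x (cabs (f x))%:E)%E.
Proof.
move=> mf; have [fi|] := ltP (\int[mu]_x (cabs (f x))%:E)%E +oo%E; last first.
  by rewrite leye_eq => /eqP ->; rewrite leey.
have lf : cL1 f by split.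
set z := cint f.
have [z0|z0] := eqVneq (cabs z) 0.
  by rewrite z0 integral_ge0// => x _; rewrite lee_fin cabs_ge0.
pose c := conjc z * ((cabs z)^-1)%:C.
have cz : c * z = (cabs z)%:C.
  rewrite /c mulrAC (mulrC _ z) mul_conj -rmorphM /=.
  by congr (_%:C); rewrite expr2 mulfK.
have c1 : cabs c = 1.
  by rewrite /c cabsM cabs_conj cabs_real ger0_norm ?invr_ge0 ?cabs_ge0// divff.
have lcf := cL1_cst_mul c lf.
have -> : cabs z = complex.Re (cint (fun x => c * f x)) by rewrite cintZ// -/z cz.
rewrite /= /Rintegral fineK; last exact: integrable_fin_num (cL1_Re lcf).
apply: le_integral => //; [exact: cL1_Re|exact: cL1_cabs|].
move=> x _; rewrite lee_fin (le_trans (ler_norm _))// (le_trans (normRe_le _))//.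
by rewrite cabsM c1 mul1r.
Qed.

Lemma n2_ge0 f : (0 <= n2 f)%E.
Proof. by apply: integral_ge0 => x _; rewrite lee_fin sqr_ge0. Qed.

Lemma measurable_EFin_cabs2 f : cmeas f ->
  measurable_fun setT (fun x => (cabs (f x) ^+ 2)%:E).
Proof. by move=> mf; apply/measurable_EFinP; exact: measurable_cabs2. Qed.

Lemma measurable_EFin_cabs f : cmeas f ->
  measurable_fun setT (fun x => (cabs (f x))%:E).
Proof. by move=> mf; apply/measurable_EFinP; exact: measurable_cabs. Qed.

Lemma le_n2 f g : cmeas f -> cmeas g -> (forall x, cabs (f x) <= cabs (g x)) ->
  (n2 f <= n2 g)%E.
Proof.
move=> mf mg fg; apply: ge0_le_integral => //.
- by move=> x _; rewrite lee_fin sqr_ge0.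
- exact: measurable_EFin_cabs2.
- exact: measurable_EFin_cabs2.
- by move=> x _; rewrite lee_fin ler_pXn2r ?nnegrE ?cabs_ge0.
Qed.

Lemma eq_n2 f g : (forall x, cabs (f x) = cabs (g x)) -> n2 f = n2 g.
Proof. by move=> fg; apply: eq_integral => x _; rewrite fg. Qed.

Lemma n2Z (c : R[i]) f : cmeas f -> n2 (fun x => c * f x) = ((cabs c ^+ 2)%:E * n2 f)%E.
Proof.
move=> mf; rewrite /n2; under eq_integral do rewrite cabsM exprMn EFinM.
rewrite ge0_integralZl// ?lee_fin ?sqr_ge0//; first exact: measurable_EFin_cabs2.
by move=> x _; rewrite lee_fin sqr_ge0.
Qed.

Lemma n2D_le e f g : 0 < e -> cmeas f -> cmeas g ->
  (n2 (fun x => f x + g x)%R <= (1 + e)%:E * n2 f + (1 + e^-1)%:E * n2 g)%E.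
Proof.
move=> e0 mf mg.
have p1 : (0 <= (1 + e)%:E :> \bar R)%E by rewrite lee_fin addr_ge0// ltW.
have p2 : (0 <= (1 + e^-1)%:E :> \bar R)%E by rewrite lee_fin addr_ge0// invr_ge0 ltW.
have q (h : T -> R[i]) x : setT x -> (0 <= (cabs (h x) ^+ 2)%:E)%E.
  by move=> _; rewrite lee_fin sqr_ge0.
rewrite /n2 -ge0_integralZl//; [|exact: measurable_EFin_cabs2|exact: q].
rewrite -ge0_integralZl//; [|exact: measurable_EFin_cabs2|exact: q].
have m1 (h : T -> R[i]) k : cmeas h -> measurable_fun setT (fun x => k%:E * (cabs (h x) ^+ 2)%:E)%E.
  by move=> ?; apply: measurable_funeM; exact: measurable_EFin_cabs2.
rewrite -ge0_integralD//; [|by move=> x _; rewrite mule_ge0// q|exact: m1|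
  by move=> x _; rewrite mule_ge0// q|exact: m1].
apply: ge0_le_integral => //.
- exact: q.
- by apply: measurable_EFin_cabs2; exact: cmeasD.
- by apply: emeasurable_funD; exact: m1.
- by move=> x _; rewrite -!EFinM -EFinD lee_fin cabs2D_le.
Qed.

Lemma n2N f : n2 (fun x => - f x) = n2 f.
Proof. by apply: eq_n2 => x; rewrite cabsN. Qed.

Lemma n2Bsym f g : n2 (fun x => f x - g x) = n2 (fun x => g x - f x).
Proof. by apply: eq_n2 => x; rewrite cabsB. Qed.

Lemma cL2D f g : cL2 f -> cL2 g -> cL2 (fun x => f x + g x).
Proof.
move=> [mf fi] [mg gi]; split; first exact: cmeasD.
apply: le_lt_trans (n2D_le ltr01 mf mg) _.
by apply: lte_add_pinfty; rewrite lte_mul_pinfty// lee_fin addr_ge0// ?invr_ge0.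
Qed.

Lemma cL2N f : cL2 f -> cL2 (fun x => - f x).
Proof. by move=> [mf fi]; split; [exact: cmeasN|rewrite n2N]. Qed.

Lemma cL2B f g : cL2 f -> cL2 g -> cL2 (fun x => f x - g x).
Proof. by move=> lf lg; apply: cL2D => //; exact: cL2N. Qed.

Lemma le_cL2 f g : cmeas f -> (forall x, cabs (f x) <= cabs (g x)) -> cL2 g -> cL2 f.
Proof. by move=> mf fg [mg gi]; split => //; apply: le_lt_trans gi; exact: le_n2. Qed.

Lemma n2D_le2 f g : cmeas f -> cmeas g ->
  (n2 (fun x => f x + g x)%R <= 2%:E * n2 f + 2%:E * n2 g)%E.
Proof. by move=> mf mg; have := n2D_le ltr01 mf mg; rewrite invr1 -[1 + 1]/2. Qed.

Lemma n2B_trans g f h : cmeas f -> cmeas g -> cmeas h ->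
  (n2 (fun x => f x - h x)%R <=
   2%:E * n2 (fun x => f x - g x)%R + 2%:E * n2 (fun x => g x - h x)%R)%E.
Proof.
move=> mf mg mh.
have -> : (fun x => f x - h x) = fun x => (f x - g x) + (g x - h x).
  by apply/funext => x; ring.
by apply: n2D_le2; exact: cmeasB.
Qed.

Lemma n2_eq0 f : cmeas f -> n2 f = 0%E -> {ae mu, forall x, f x = 0}.
Proof.
move=> mf; rewrite /n2 => f0.
have : (\int[mu]_x `|(cabs (f x) ^+ 2)%:E| = 0)%E.
  by rewrite -f0; apply: eq_integral => x _; rewrite gee0_abs// lee_fin sqr_ge0.
move/(ae_eq_integral_abs mu measurableT (measurable_EFin_cabs2 mf)).
apply: filterS => x /(_ I) /= [] /eqP; rewrite sqrf_eq0 => /eqP.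
exact: cabs_eq0.
Qed.

Lemma ae_eq_n2 f g : cmeas f -> cmeas g -> {ae mu, forall x, f x = g x} -> n2 f = n2 g.
Proof.
move=> mf mg fg; apply: ge0_ae_eq_integral => //.
- exact: measurable_EFin_cabs2.
- exact: measurable_EFin_cabs2.
- by move=> x _; rewrite lee_fin sqr_ge0.
- by move=> x _; rewrite lee_fin sqr_ge0.
- by apply: filterS fg => x -> _.
Qed.

Lemma poweR2 (x : \bar R) : (0 <= x)%E -> (x `^ 2 = x * x)%E.
Proof.
case: x => [r| |]//; last by rewrite poweRyr// mulyy.
by rewrite lee_fin => r0; rewrite poweR_EFin powR_mulrn// expr2 EFinM.
Qed.

(** Hoelder's inequality with both exponents 2, squared: no root of an extended real appears, and
    infinite norms are allowed. *)
Lemma cauchy_schwarz (f g : T -> R) : measurable_fun setT f -> measurable_fun setT g ->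
  ((\int[mu]_x `|f x * g x|%:E) * (\int[mu]_x `|f x * g x|%:E) <=
   (\int[mu]_x (f x ^+ 2)%:E) * \int[mu]_x (g x ^+ 2)%:E)%E.
Proof.
move=> mf mg; have h1 : (2^-1 + 2^-1 = 1 :> R) by lra.
have := hoelder mu mf mg (ltr0n _ 2) (ltr0n _ 2) h1.
have sq (k : T -> R) : (Lnorm mu 2%:E (EFin \o k) * Lnorm mu 2%:E (EFin \o k)
    = \int[mu]_x (k x ^+ 2)%:E)%E.
  rewrite -poweR2 ?Lnorm_ge0// poweR_Lnorm//.
  by apply: eq_integral => x _; rewrite /= powR_mulrn// real_normK ?num_real.
rewrite -!sq Lnorm1 => H.
rewrite muleACA; apply: lee_pmul => //; exact: integral_ge0.
Qed.

End complex_integral.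

Section mp_complex.
Context {R : realType} d1 d2 (T1 : measurableType d1) (T2 : measurableType d2).
Variables (mu : {measure set T1 -> \bar R}) (nu : {measure set T2 -> \bar R}).
Variable h : T1 -> T2.
Hypothesis mph : mp mu nu h.

Lemma mp_cint (f : T2 -> R[i]) : cmeas f -> cint mu (fun x => f (h x)) = cint nu f.
Proof.
move=> [m1 m2]; rewrite /cint /Rintegral.
rewrite (mp_int mph (f := fun x => (complex.Re (f x))%:E)); last exact/measurable_EFinP.
by rewrite (mp_int mph (f := fun x => (complex.Im (f x))%:E)); last exact/measurable_EFinP.
Qed.

Lemma mp_n2 (f : T2 -> R[i]) : cmeas f -> n2 mu (fun x => f (h x)) = n2 nu f.
Proof.
move=> mf; rewrite /n2 (mp_ge0 mph (f := fun x => (cabs (f x) ^+ 2)%:E))//.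
  exact: measurable_EFin_cabs2.
by move=> x; rewrite lee_fin sqr_ge0.
Qed.

Lemma mp_cL1 (f : T2 -> R[i]) : cL1 nu f -> cL1 mu (fun x => f (h x)).
Proof.
move=> [mf fi]; split; first exact: (cmeas_comp mf (proj1 mph)).
rewrite (mp_ge0 mph (f := fun x => (cabs (f x))%:E))//.
  exact: measurable_EFin_cabs.
by move=> x; rewrite lee_fin cabs_ge0.
Qed.

Lemma mp_cL2 (f : T2 -> R[i]) : cL2 nu f -> cL2 mu (fun x => f (h x)).
Proof.
move=> [mf fi]; split; first exact: (cmeas_comp mf (proj1 mph)).
by rewrite mp_n2.
Qed.
End mp_complex.

Lemma mp_comp {R : realType} d1 d2 d3 (T1 : measurableType d1) (T2 : measurableType d2)
    (T3 : measurableType d3) (m1 : {measure set T1 -> \bar R})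
    (m2 : {measure set T2 -> \bar R}) (m3 : {measure set T3 -> \bar R}) h k :
  mp m1 m2 h -> mp m2 m3 k -> mp m1 m3 (fun x => k (h x)).
Proof.
move=> [mh e1] [mk e2]; split; first exact: (measurableT_comp mk mh).
move=> A mA; rewrite -e2// -e1//.
by rewrite -[X in measurable X]setTI; exact: mk.
Qed.

(** * Product measures and Fubini's theorem *)

Section fubini.
Context {R : realType} d1 d2 (T1 : measurableType d1) (T2 : measurableType d2).
Variables (m1 : {sigma_finite_measure set T1 -> \bar R}).
Variables (m2 : {sigma_finite_measure set T2 -> \bar R}).

(** A product of sigma-finite measures is determined by its values on rectangles; [mp_prod] rests on
    the same uniqueness. *)
Lemma mp_swap : mp (m1 \x m2)%E (m2 \x m1)%E (fun z => (z.2, z.1)).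
Proof.
have ms : measurable_fun setT (fun z : T1 * T2 => (z.2, z.1)).
  exact: measurable_fun_pair.
split => // A mA; apply/esym.
transitivity (pushforward (m1 \x m2)%E (fun z : T1 * T2 => (z.2, z.1)) A) => //.
apply: (@product_measure_unique _ _ _ _ _ m2 m1 (pushforward (m1 \x m2)%E _)) => // B C mB mC.
transitivity ((m1 \x m2)%E (C `*` B)); last by rewrite product_measure1E// muleC.
have e : (fun z : T1 * T2 => (z.2, z.1)) @^-1` (B `*` C) = C `*` B.
  by apply/seteqP; split => -[x y] /= [].
exact: (congr1 (m1 \x m2)%E e).
Qed.

(** Tonelli's measurability reaches signed functions through positive and negative parts, with no
    integrability assumed. *)
Lemma measurable_Fubini1 (f : T1 * T2 -> \bar R) : measurable_fun setT f ->
  measurable_fun setT (fun x => \int[m2]_y f (x, y))%E.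
Proof.
move=> mf.
have -> : (fun x => \int[m2]_y f (x, y))%E =
   fun x => ((\int[m2]_y f^\+ (x, y)) - (\int[m2]_y f^\- (x, y)))%E.
  apply/funext => x; rewrite integralE; congr (_ - _)%E.
    by apply: eq_integral => y _; rewrite !unlock.
  by apply: eq_integral => y _; rewrite !unlock.
apply: emeasurable_funB.
  by apply: measurable_fun_fubini_tonelli_F => //; exact: measurable_funepos.
by apply: measurable_fun_fubini_tonelli_F => //; exact: measurable_funeneg.
Qed.

Lemma cmeas_cint1 (f : T1 * T2 -> R[i]) : cmeas f ->
  cmeas (fun x => cint m2 (fun y => f (x, y))).
Proof.
move=> [f1 f2]; split => /=; apply: measurableT_comp => //.
  by apply: (measurable_Fubini1 (f := fun z => (complex.Re (f z))%:E)); exact/measurable_EFinP.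
by apply: (measurable_Fubini1 (f := fun z => (complex.Im (f z))%:E)); exact/measurable_EFinP.
Qed.

Lemma cL1_prod (f : T1 * T2 -> R[i]) : cmeas f ->
  (\int[m1]_x \int[m2]_y (cabs (f (x, y)))%:E < +oo)%E -> cL1 (m1 \x m2)%E f.
Proof.
move=> mf fi; split => //; rewrite fubini_tonelli1//.
  exact: measurable_EFin_cabs.
by move=> z; rewrite lee_fin cabs_ge0.
Qed.

Lemma cint_fubini1 (f : T1 * T2 -> R[i]) : cL1 (m1 \x m2)%E f ->
  cint m1 (fun x => cint m2 (fun y => f (x, y))) = cint (m1 \x m2)%E f.
Proof.
move=> lf; have [[mr mi] _] := lf.
have aux (h : T1 * T2 -> R) : (m1 \x m2)%E.-integrable setT (EFin \o h) ->
   Rintegral m1 setT (fun x => Rintegral m2 setT (fun y => h (x, y))) =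
   Rintegral (m1 \x m2)%E setT h.
  move=> ih; rewrite /Rintegral -integral12_prod_meas1//=; congr fine.
  have mh : measurable_fun setT (EFin \o h) by exact: measurable_int ih.
  have mF := measurable_Fubini1 mh.
  apply: ae_eq_integral => //.
    by apply: measurableT_comp => //; exact: measurableT_comp.
  (* The inner integral may be infinite on a null set of [x], where [fine] returns 0; the outer
     integral does not see it. *)
  have := integrable_ae measurableT (integrable_fubini_F ih).
  apply: filterS => x /(_ I) xfin _ /=.
  by rewrite fineK.
apply: complex_eq => /=.
  exact: (aux (fun z => complex.Re (f z)) (cL1_Re lf)).
exact: (aux (fun z => complex.Im (f z)) (cL1_Im lf)).
Qed.

Lemma cL1_fubini1 (f : T1 * T2 -> R[i]) : cL1 (m1 \x m2)%E f ->
  cL1 m1 (fun x => cint m2 (fun y => f (x, y))).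
Proof.
move=> [mf fi]; have mc := measurable_EFin_cabs mf.
apply: (@le_cL1 _ _ _ _ _ (fun x => \int[m2]_y (cabs (f (x, y)))%:E)%E).
- exact: cmeas_cint1.
- exact: (measurable_Fubini1 mc).
- by move=> x; apply: le_cabs_cint; apply: (cmeas_comp mf); exact: measurable_fun_pair.
- have := fi; rewrite fubini_tonelli1//.
  by move=> z; rewrite lee_fin cabs_ge0.
Qed.

Lemma cL1_ae1 (f : T1 * T2 -> R[i]) : cL1 (m1 \x m2)%E f ->
  {ae m1, forall x, cL1 m2 (fun y => f (x, y))}.
Proof.
move=> lf; have [mf fi] := lf.
have := ae_integrable1 (cL1_cabs lf).
apply: filterS => x /integrableP[mx ix]; split.
  by apply: (cmeas_comp mf); exact: measurable_fun_pair.
by apply: le_lt_trans ix; apply: ge0_le_integral => //;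
  [move=> y _; rewrite lee_fin cabs_ge0|exact: measurableT_comp|
   move=> y _; exact: lee_abs].
Qed.

End fubini.

Section fubini_swap.
Context {R : realType} d1 d2 (T1 : measurableType d1) (T2 : measurableType d2).
Variables (m1 : {sigma_finite_measure set T1 -> \bar R}).
Variables (m2 : {sigma_finite_measure set T2 -> \bar R}).

Lemma cint_fubini (f : T1 -> T2 -> R[i]) : cL1 (m1 \x m2)%E (fun z => f z.1 z.2) ->
  cint m1 (fun x => cint m2 (fun y => f x y)) =
  cint m2 (fun y => cint m1 (fun x => f x y)).
Proof.
move=> lf; rewrite (cint_fubini1 lf).
have lf' : cL1 (m2 \x m1)%E (fun z => f z.2 z.1) := mp_cL1 (mp_swap m2 m1) lf.
rewrite (cint_fubini1 lf').
by rewrite -(mp_cint (mp_swap m2 m1))//; case: lf.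
Qed.
End fubini_swap.

(** * L^2 limits *)

Section limits.
Context {R : realType}.

(** Convergence to 0 of nonnegative extended reals in epsilon form, which can be compared termwise
    with no finiteness condition; [tends0P] links it to filters. *)
Definition tends0 (a : nat -> \bar R) :=
  forall e : R, 0 < e -> exists N, forall n, (N <= n)%N -> (a n <= e%:E)%E.

Lemma tends0P (a : nat -> \bar R) : (forall n, 0 <= a n)%E ->
  (a n @[n --> \oo] --> 0%E) <-> tends0 a.
Proof.
move=> a0; split.
  move=> /fine_cvgP[[N _ afin] /cvgrPdist_le acvg] e e0.
  have [M _ aM] := acvg _ e0.
  exists (maxn N M) => n; rewrite geq_max => /andP[Nn Mn].
  have := aM _ Mn; rewrite /= sub0r normrN ger0_norm ?fine_ge0// => h.
  by rewrite -(fineK (afin _ Nn)) lee_fin.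
move=> ta; apply/fine_cvgP; split.
  have [N aN] := ta 1 ltr01; exists N => // n /= /aN a1.
  by rewrite ge0_fin_numE// (le_lt_trans a1)// ltry.
apply/cvgrPdist_le => e e0; have [N aN] := ta e e0; exists N => // n /= /aN ae.
rewrite sub0r normrN ger0_norm ?fine_ge0//.
by rewrite -lee_fin fineK// ge0_fin_numE// (le_lt_trans ae)// ltry.
Qed.

Lemma tends0_le (a b : nat -> \bar R) : (forall n, a n <= b n)%E -> tends0 b -> tends0 a.
Proof.
move=> ab tb e e0; have [N bN] := tb e e0; exists N => n Nn.
exact: le_trans (ab n) (bN n Nn).
Qed.

Lemma tends0D (a b : nat -> \bar R) : tends0 a -> tends0 b -> tends0 (fun n => a n + b n)%E.
Proof.
move=> ta tb e e0; have e2 : 0 < e / 2 by rewrite divr_gt0.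
have [N aN] := ta _ e2; have [M bM] := tb _ e2.
exists (maxn N M) => n; rewrite geq_max => /andP[Nn Mn].
by rewrite [e]splitr EFinD leeD// ?aN ?bM.
Qed.

Lemma tends0Z (k : R) (a : nat -> \bar R) : 0 <= k -> tends0 a -> tends0 (fun n => k%:E * a n)%E.
Proof.
move=> k0 ta e e0; have k1 : 0 < k + 1 by rewrite ltr_wpDl.
have [N aN] := ta _ (divr_gt0 e0 k1).
exists N => n /aN h; apply: (@le_trans _ _ (k%:E * (e / (k + 1))%:E)%E).
  by apply: lee_wpmul2l; rewrite ?lee_fin.
rewrite -EFinM lee_fin mulrA mulrAC -[leRHS]mul1r ler_wpM2r ?ltW//.
by rewrite lter_pdivrMr// mul1r ltrDl.
Qed.

Lemma tends0_cst_le (c : \bar R) (a : nat -> \bar R) : (0 <= c)%E ->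
  (forall n, c <= a n)%E -> tends0 a -> c = 0%E.
Proof.
move=> c0 ca ta; apply/eqP; rewrite eq_le c0 andbT.
apply/lee_addgt0Pr => e e0; rewrite add0e; have [N aN] := ta _ e0.
exact: le_trans (ca N) (aN _ (leqnn N)).
Qed.

Definition ccvg (u : nat -> R[i]) (l : R[i]) := cabs (u n - l) @[n --> \oo] --> (0 : R).

Lemma ccvg_ReIm u l : ccvg u l <->
  (complex.Re (u n) @[n --> \oo] --> complex.Re l) /\
  (complex.Im (u n) @[n --> \oo] --> complex.Im l).
Proof.
rewrite /ccvg; split.
  move=> /cvgrPdist_le h; split; apply/cvgrPdist_le => e e0;
    have [N _ hN] := h e e0; exists N => // n /hN /=;
    rewrite sub0r normrN ger0_norm ?cabs_ge0// => hn; apply: le_trans hn.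
    by rewrite distrC -cReN -cReD normRe_le.
  by rewrite distrC -cImN -cImD normIm_le.
move=> [h1 h2].
apply: (@squeeze_cvgr _ _ _ _ (fun=> 0)
  (fun n => `|complex.Re (u n) - complex.Re l| + `|complex.Im (u n) - complex.Im l|)).
- near=> n; rewrite cabs_ge0/= (le_trans (cabs_le _))//.
  by rewrite cReD cReN cImD cImN.
- exact: cvg_cst.
rewrite -[0 in X in _ --> X](addr0 0).
apply: cvgD; rewrite -(@normr0 _ R); apply: cvg_norm.
  by rewrite -(subrr (complex.Re l)); apply: cvgB => //; exact: cvg_cst.
by rewrite -(subrr (complex.Im l)); apply: cvgB => //; exact: cvg_cst.
Unshelve. all: by end_near. Qed.

Lemma ccvg_cabs2B u l (w : R[i]) : ccvg u l ->
  cabs (u n - w) ^+ 2 @[n --> \oo] --> cabs (l - w) ^+ 2.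
Proof.
move=> /ccvg_ReIm[h1 h2].
under eq_fun do rewrite cabs2 cReD cReN cImD cImN.
rewrite cabs2 cReD cReN cImD cImN.
by apply: cvgD; (under eq_fun do rewrite expr2; rewrite expr2; apply: cvgM; apply: cvgB => //; exact: cvg_cst).
Qed.

Context d (T : measurableType d).
Variable mu : {measure set T -> \bar R}.

(** Superior limits give a function that is measurable and defined everywhere, and equal to the
    limit wherever [F] converges ([climitE]). *)
Definition climit (F : nat -> T -> R[i]) (x : T) : R[i] :=
  fine (limn_esup (fun n => (complex.Re (F n x))%:E)) +i*
  fine (limn_esup (fun n => (complex.Im (F n x))%:E)).

Lemma cmeas_climit F : (forall n, cmeas (F n)) -> cmeas (climit F).
Proof.
move=> mF; split => /=; apply: measurableT_comp => //.
  apply: (measurable_fun_limn_esup (f := fun n x => (complex.Re (F n x))%:E)) => n.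
  by apply/measurable_EFinP; case: (mF n).
apply: (measurable_fun_limn_esup (f := fun n x => (complex.Im (F n x))%:E)) => n.
by apply/measurable_EFinP; case: (mF n).
Qed.

Lemma climitE F x l : ccvg (F^~ x) l -> climit F x = l.
Proof.
move=> /ccvg_ReIm[h1 h2]; apply: complex_eq => /=.
  have h : (complex.Re (F n x))%:E @[n --> \oo] --> (complex.Re l)%:E.
    by apply: cvg_EFin h1; near=> n.
  by rewrite (cvg_limn_einf_sup h).2.
have h : (complex.Im (F n x))%:E @[n --> \oo] --> (complex.Im l)%:E.
  by apply: cvg_EFin h2; near=> n.
by rewrite (cvg_limn_einf_sup h).2.
Unshelve. all: by end_near. Qed.

(** Fatou's lemma for the distance to a fixed [H]. With [H = 0] it bounds the norm of a limit; with
    [H] a term of the sequence it turns a Cauchy bound into a bound on the distance to the limit. *)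
Lemma n2_fatou (F : nat -> T -> R[i]) G H B N :
  (forall n, cmeas (F n)) -> cmeas G -> cmeas H ->
  {ae mu, forall x, ccvg (F^~ x) (G x)} ->
  (forall n, (N <= n)%N -> (n2 mu (fun x => F n x - H x)%R <= B)%E) ->
  (n2 mu (fun x => G x - H x)%R <= B)%E.
Proof.
move=> mF mG mH FG FB.
pose a n x := (cabs (F (n + N)%N x - H x) ^+ 2)%:E.
have ma n : measurable_fun setT (a n) by apply: measurable_EFin_cabs2; exact: cmeasB.
have a0 n x : (0 <= a n x)%E by rewrite lee_fin sqr_ge0.
apply: (@le_trans _ _ (\int[mu]_x limn_einf (a^~ x))%E).
  apply: ae_ge0_le_integral => //.
  - by move=> x _; rewrite lee_fin sqr_ge0.
  - by apply: measurable_EFin_cabs2; exact: cmeasB.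
  - move=> x _; rewrite limn_einf_lim; apply: lime_ge; first exact: is_cvg_einfs.
    by near=> n; apply: le_ereal_inf_tmp => _ [m _ <-].
  - under eq_fun do rewrite /limn_einf.
    apply: measurableT_comp => //; apply: measurable_fun_limn_esup => n.
    exact: measurableT_comp.
  - apply: filterS FG => x Fx _.
    have h : a n x @[n --> \oo] --> (cabs (G x - H x) ^+ 2)%:E.
      have h' : cabs (F (n + N)%N x - H x) ^+ 2 @[n --> \oo] --> cabs (G x - H x) ^+ 2.
        have := ccvg_cabs2B (w := H x) Fx.
        by rewrite -(cvg_shiftn N).
      by apply: cvg_EFin h'; near=> n.
    by rewrite (cvg_limn_einf_sup h).1.
apply: le_trans (fatou mu measurableT ma (fun n x _ => a0 n x)) _.
rewrite limn_einf_lim; apply: lime_le; first exact: is_cvg_einfs.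
near=> n; apply: (@le_trans _ _ (\int[mu]_x a n x)%E).
  by apply: ereal_inf_lbound; exists n => /=.
exact: (FB _ (leq_addl _ _)).
Unshelve. all: by end_near. Qed.

End limits.

(** * Completeness of L^2 and almost everywhere convergence *)

Section L2_limits.
Context {R : realType} d (T : measurableType d).
Variable mu : {measure set T -> \bar R}.
Implicit Types (F : nat -> T -> R[i]) (G H : T -> R[i]).

(** Extracts continuity from inequalities of the shape of [n2D_le]: [eta = e / (2 (M + 1))] keeps
    [eta * y] below [e / 2] whenever [y <= M], and [dl] then keeps the other term below [e / 2]. *)
Lemma eta_bound (M e : R) : 0 <= M -> 0 < e -> exists2 dl : R, 0 < dl &
  forall x y z : R, 0 <= y -> y <= M -> z <= dl ->
   (forall eta : R, 0 < eta -> x <= (1 + eta) * y + (1 + eta^-1) * z) -> x <= y + e.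
Proof.
move=> M0 e0; pose eta := e / (2 * (M + 1)).
have M1 : 0 < M + 1 by rewrite ltr_wpDl.
have eta0 : 0 < eta by rewrite divr_gt0// mulr_gt0.
have k0 : 0 < 1 + eta^-1 by rewrite addr_gt0// invr_gt0.
exists (e / 2 / (1 + eta^-1)); first by rewrite !divr_gt0.
move=> x y z y0 yM zd /(_ _ eta0) h; apply: (le_trans h).
rewrite mulrDl mul1r -addrA lerD2l [e]splitr lerD//.
  apply: (@le_trans _ _ (eta * M)); first by rewrite ler_wpM2l// ltW.
  rewrite /eta mulrAC ler_pdivrMr ?mulr_gt0//.
  by rewrite -subr_ge0 (_ : _ - _ = e) ?ltW//; field.
by rewrite mulrC -ler_pdivlMr.
Qed.

Lemma n2_cvg F G : (forall n, cL2 mu (F n)) -> cL2 mu G ->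
  tends0 (fun n => n2 mu (fun x => F n x - G x)%R) ->
  n2 mu (F n) @[n --> \oo] --> n2 mu G.
Proof.
move=> lF [mG G2] FG.
have fin f : cL2 mu f -> n2 mu f \is a fin_num.
  by move=> [_ ?]; rewrite ge0_fin_numE// n2_ge0.
have finG : n2 mu G \is a fin_num by exact: fin.
have finF n : n2 mu (F n) \is a fin_num by exact: fin.
have finD n : n2 mu (fun x => F n x - G x) \is a fin_num.
  by apply: fin; apply: cL2B.
set g := fine (n2 mu G); pose b n := fine (n2 mu (F n)).
pose dd n := fine (n2 mu (fun x => F n x - G x)).
have g0 : 0 <= g by rewrite fine_ge0// n2_ge0.
have b0 n : 0 <= b n by rewrite fine_ge0// n2_ge0.
have h1 n eta : 0 < eta -> b n <= (1 + eta) * g + (1 + eta^-1) * dd n.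
  move=> e0; rewrite -lee_fin EFinD !EFinM !fineK//.
  have -> : F n = (fun x => G x + (F n x - G x)) by apply/funext => x; rewrite addrC subrK.
  have -> : (fun x => G x + (F n x - G x) - G x) = (fun x => F n x - G x).
    by apply/funext => x; ring.
  by apply: n2D_le => //; apply: cmeasB => //; case: (lF n).
have h2 n eta : 0 < eta -> g <= (1 + eta) * b n + (1 + eta^-1) * dd n.
  move=> e0; rewrite -lee_fin EFinD !EFinM !fineK// n2Bsym.
  have {1}-> : G = (fun x => F n x + (G x - F n x)) by apply/funext => x; rewrite addrC subrK.
  by apply: n2D_le => //; [case: (lF n)|apply: cmeasB => //; case: (lF n)].
rewrite -(fineK finG); apply: cvg_EFin; first by near=> n; exact: finF.
apply/cvgrPdist_le => e e0.
have [d1 d10 H1] := eta_bound g0 e0.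
(* Here [b n] takes the place of the bounded term; its bound [g + e] is the outcome of the first
   application. *)
have [d2 d20 H2] := eta_bound (addr_ge0 g0 (ltW e0)) e0.
have d0 : 0 < Num.min d1 d2 by rewrite lt_min d10.
have [N FGN] := FG _ d0; exists N => // n /= Nn.
have ddn : dd n <= Num.min d1 d2 by rewrite -lee_fin fineK// FGN.
move: ddn; rewrite le_min => /andP[dd1 dd2].
have bg : b n <= g + e by exact: (H1 _ _ _ g0 (lexx g) dd1 (h1 n)).
have gb : g <= b n + e by exact: (H2 _ _ _ (b0 n) bg dd2 (h2 n)).
by rewrite -/g ler_distl; apply/andP; split; [rewrite lerBlDr|].
Unshelve. all: by end_near. Qed.

Lemma n2_dominated F G (K : T -> \bar R) : (forall n, cmeas (F n)) -> cmeas G ->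
  (forall x, ccvg (F^~ x) (G x)) -> measurable_fun setT K ->
  (\int[mu]_x K x < +oo)%E ->
  (forall n x, (cabs (F n x - G x) ^+ 2)%:E <= K x)%E ->
  tends0 (fun n => n2 mu (fun x => F n x - G x)%R).
Proof.
move=> mF mG FG mK Kfin FK; apply/tends0P; first by move=> n; exact: n2_ge0.
have K0 x : (0 <= K x)%E by apply: le_trans (FK 0%N x); rewrite lee_fin sqr_ge0.
have mz : measurable_fun setT (fun _ : T => 0%E : \bar R) by exact: measurable_cst.
have mn n : measurable_fun setT (fun x => (cabs (F n x - G x) ^+ 2)%:E).
  by apply: measurable_EFin_cabs2; exact: cmeasB.
have h1 : {ae mu, forall x, setT x -> (cabs (F n x - G x) ^+ 2)%:E @[n --> \oo] --> (0 : \bar R)}.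
  apply: aeW => x _.
  have h : cabs (F n x - G x) ^+ 2 @[n --> \oo] --> (0 : R).
    have := ccvg_cabs2B (w := G x) (FG x).
    by rewrite subrr cabs0 expr0n.
  by apply: cvg_EFin h; near=> n.
have h2 : mu.-integrable setT K.
  apply/integrableP; split => //.
  by under eq_integral do rewrite gee0_abs//.
have h3 : {ae mu, forall x n, setT x -> (`|(cabs (F n x - G x) ^+ 2)%:E| <= K x)%E}.
  by apply: aeW => x n _; rewrite gee0_abs// lee_fin sqr_ge0.
have [_ _] := dominated_convergence measurableT mn mz h1 h2 h3.
by rewrite integral0.
Unshelve. all: by end_near. Qed.

Lemma cabs_telescope (u : nat -> R[i]) (C : R) : 
  (forall n, cabs (u n.+1 - u n) <= C * 2^-1 ^+ n) -> exists l, ccvg u l.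
Proof.
move=> h.
have aux (v : nat -> R) : (forall n, `|v n.+1 - v n| <= C * 2^-1 ^+ n) -> cvgn v.
  move=> hv; rewrite (_ : v = fun n => v 0%N + series (fun k => v k.+1 - v k) n); last first.
    by apply/funext => n; rewrite /series /= telescope_sumr// addrC subrK.
  apply: is_cvgD; first exact: is_cvg_cst.
  apply: normed_cvg.
  apply: (@series_le_cvg _ (fun k => `|v k.+1 - v k|) (geometric C 2^-1)) => //.
  - move=> n; rewrite /geometric /= mulr_ge0 ?exprn_ge0//.
    by have := le_trans (normr_ge0 _) (hv 0%N); rewrite expr0 mulr1.
  - by apply: is_cvg_geometric_series; rewrite ger0_norm// invf_lt1// ltr1n.
have c1 : cvgn (fun n => complex.Re (u n)).
  apply: aux => n; apply: le_trans (h n).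
  by rewrite -cReN -cReD normRe_le.
have c2 : cvgn (fun n => complex.Im (u n)).
  apply: aux => n; apply: le_trans (h n).
  by rewrite -cImN -cImD normIm_le.
exists (limn (fun n => complex.Re (u n)) +i* limn (fun n => complex.Im (u n))).
by apply/ccvg_ReIm.
Qed.

(* The series of [4 ^ n * |D n|^2] has finite integral. *)
Lemma ae_fast_bound (D : nat -> T -> R[i]) : (forall n, cmeas (D n)) ->
  (forall n, n2 mu (D n) <= (8^-1 ^+ n)%:E)%E ->
  {ae mu, forall x, exists C : R, forall n, cabs (D n x) <= C * 2^-1 ^+ n}.
Proof.
move=> mF F8.
pose a n x := ((4 ^+ n)%:E * (cabs (D n x) ^+ 2)%:E)%E.
have a0 n x : (0 <= a n x)%E by rewrite /a -EFinM lee_fin mulr_ge0 ?sqr_ge0// exprn_ge0.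
have ma n : measurable_fun setT (a n).
  by apply: measurable_funeM; apply: measurable_EFin_cabs2.
have ia : mu.-integrable setT (fun x => \sum_(n <oo) a n x)%E.
  apply/integrableP; split; first exact: ge0_emeasurable_sum.
  under eq_integral do rewrite gee0_abs ?nneseries_ge0//.
  rewrite integral_nneseries//.
  apply: (@le_lt_trans _ _ (\sum_(n <oo) ((2^-1 ^+ n)%:E))%E).
    apply: lee_nneseries => [n _ _|n _]; first exact: integral_ge0.
    rewrite ge0_integralZl//; last 2 first.
      by apply: measurable_EFin_cabs2.
      by move=> x _; rewrite lee_fin sqr_ge0.
    apply: (@le_trans _ _ ((4 ^+ n)%:E * (8^-1 ^+ n)%:E)%E).
      by apply: lee_wpmul2l; [rewrite lee_fin exprn_ge0|exact: F8].
    rewrite -EFinM lee_fin -exprMn (_ : 4 * 8^-1 = 2^-1 :> R)//.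
    by lra.
  have := @cvg_geometric_eseries_half R 2 0.
  rewrite (_ : eseries _ = eseries (fun n => (2^-1 ^+ n)%:E)); last first.
    congr eseries; apply/funext => k; congr (_%:E).
    by rewrite natrX addn1 exprS exprVn; field; rewrite expf_neq0.
  by move=> /cvg_lim => ->//; rewrite expr0 divr1 ltry.
have := integrable_ae measurableT ia; apply: filterS => x /(_ I) afin.
set S := (\sum_(n <oo) a n x)%E in afin.
have aS n : (a n x <= S)%E.
  apply: (@le_trans _ _ (\sum_(0 <= k < n.+1) a k x)%E); last exact: nneseries_lim_ge.
  by rewrite big_nat_recr//= leeDr// sume_ge0.
have S0 : (0 <= S)%E by exact: le_trans (aS 0%N).
exists (Num.sqrt (fine S)) => n.
have h : 4 ^+ n * cabs (D n x) ^+ 2 <= fine S by rewrite -lee_fin fineK// EFinM; exact: aS.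
rewrite -(@ler_pXn2r _ 2)// ?nnegrE ?cabs_ge0 ?mulr_ge0 ?sqrtr_ge0 ?exprn_ge0//.
rewrite exprMn (sqr_sqrtr (fine_ge0 S0)) -exprM mulnC exprM.
rewrite -(@ler_pM2l _ (4 ^+ n)) ?exprn_gt0//.
apply: (le_trans h); rewrite mulrCA.
have -> : 4 ^+ n * (2^-1 ^+ 2) ^+ n = 1 :> R; last by rewrite mulr1.
by rewrite -exprMn (_ : 4 * 2^-1 ^+ 2 = 1 :> R) ?expr1n//; field.
Qed.

(** Squared gaps [8^-1 ^+ n] against the weights [4 ^+ n] of [ae_fast_bound] leave a series of ratio
    1/2. Almost everywhere the gaps are then at most C 2^-n, and they telescope. *)
Lemma ae_ccvg_of_fast F : (forall n, cmeas (F n)) ->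
  (forall n, n2 mu (fun x => F n.+1 x - F n x)%R <= (8^-1 ^+ n)%:E)%E ->
  {ae mu, forall x, exists l, ccvg (F^~ x) l}.
Proof.
move=> mF /(ae_fast_bound (fun n => cmeasB (mF n.+1) (mF n))).
by apply: filterS => x [C]; exact: cabs_telescope.
Qed.

Lemma ae_ccvg_of_summable F G : (forall n, cmeas (F n)) -> cmeas G ->
  (forall n, n2 mu (fun x => F n x - G x)%R <= (8^-1 ^+ n)%:E)%E ->
  {ae mu, forall x, ccvg (F^~ x) (G x)}.
Proof.
move=> mF mG /(ae_fast_bound (fun n => cmeasB (mF n) mG)).
apply: filterS => x [C CF].
apply: (@squeeze_cvgr _ _ _ _ (fun=> 0) (geometric C 2^-1)).
- by near=> n; rewrite cabs_ge0 CF.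
- exact: cvg_cst.
- by apply: cvg_geometric; rewrite ger0_norm// invf_lt1// ltr1n.
Unshelve. all: by end_near. Qed.

Definition n2cauchy F := forall e : R, 0 < e ->
  exists N, forall m n, (N <= m)%N -> (N <= n)%N ->
    (n2 mu (fun x => F m x - F n x)%R <= e%:E)%E.

Lemma n2cauchy_of_cvg F G : (forall n, cmeas (F n)) -> cmeas G ->
  tends0 (fun n => n2 mu (fun x => F n x - G x)%R) -> n2cauchy F.
Proof.
move=> mF mG FG e e0; have e4 : 0 < e / 4 by rewrite divr_gt0.
have [N FN] := FG _ e4; exists N => m n Nm Nn.
apply: le_trans (n2B_trans mu (mF m) mG (mF n)) _.
rewrite (n2Bsym _ G (F n)).
apply: (@le_trans _ _ (2%:E * (e / 4)%:E + 2%:E * (e / 4)%:E)%E).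
  by apply: leeD; apply: lee_wpmul2l; rewrite ?lee_fin// FN.
by rewrite -!EFinM -EFinD lee_fin; lra.
Qed.

Lemma fast_subsequence (P : nat -> nat -> Prop) :
  (forall k, exists N, forall n, (N <= n)%N -> P k n) ->
  exists phi : nat -> nat, (forall k, (k <= phi k)%N) /\ {homo phi : a b / (a <= b)%N} /\
    forall k n, (phi k <= n)%N -> P k n.
Proof.
move=> /choice[N NP].
(* Partial sums make [phi] monotone and at least [N k]; the summand [k] gives [k <= phi k]. *)
pose phi k := (k + \sum_(i < k.+1) N i)%N.
have le_sum a b : (a <= b)%N -> (\sum_(i < a) N i <= \sum_(i < b) N i)%N.
  move=> ab; rewrite -(subnKC ab) big_split_ord /= leq_addr//.
exists phi; split; first by move=> k; rewrite leq_addr.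
split; first by move=> a b ab; rewrite leq_add// le_sum.
move=> k n kn; apply: NP; apply: leq_trans kn.
by rewrite /phi big_ord_recr /= addnA leq_addl.
Qed.

(** A subsequence with squared gaps 8^-k converges almost everywhere. Its [climit] is the limit, and
    Fatou's lemma against each [F n] turns the Cauchy bound into convergence of the whole
    sequence. *)
Lemma riesz_fischer F : (forall n, cL2 mu (F n)) -> n2cauchy F ->
  exists G, cL2 mu G /\ tends0 (fun n => n2 mu (fun x => F n x - G x)%R).
Proof.
move=> lF cF; have mF n : cmeas (F n) by case: (lF n).
have [phi [phik [phih phiP]]] : exists phi : nat -> nat, (forall k, (k <= phi k)%N) /\
    {homo phi : a b / (a <= b)%N} /\ forall k n, (phi k <= n)%N ->
   forall m, (n <= m)%N -> (n2 mu (fun x => F m x - F n x)%R <= (8^-1 ^+ k)%:E)%E.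
  apply: (@fast_subsequence (fun k n => forall m, (n <= m)%N ->
    (n2 mu (fun x => F m x - F n x)%R <= (8^-1 ^+ k)%:E)%E)) => k.
  have e0 : 0 < 8^-1 ^+ k :> R by rewrite exprn_gt0.
  have [N FN] := cF _ e0; exists N => n Nn m nm.
  by apply: FN => //; exact: leq_trans nm.
pose F' k := F (phi k).
have cv : {ae mu, forall x, exists l, ccvg (F'^~ x) l}.
  apply: ae_ccvg_of_fast => k; first exact: mF.
  by apply: phiP => //; apply: phih.
pose G := climit F'.
have mG : cmeas G by apply: cmeas_climit => k; exact: mF.
have F'G : {ae mu, forall x, ccvg (F'^~ x) (G x)}.
  by apply: filterS cv => x [l h]; rewrite /G (climitE h).
have tG : tends0 (fun n => n2 mu (fun x => F n x - G x)%R).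
  move=> e e0; have [N FN] := cF _ e0; exists N => n Nn.
  rewrite n2Bsym; apply: (@n2_fatou _ _ _ mu F' G (F n) e%:E N) => // [k|k Nk].
    exact: mF.
  by apply: FN => //; apply: leq_trans (phik k).
exists G; split => //; split => //.
have [N FN] := tG 1 ltr01.
have -> : G = (fun x => F N x - (F N x - G x)) by apply/funext => x; ring.
have lN : cL2 mu (fun x => F N x - G x).
  by split; [exact: cmeasB|apply: le_lt_trans (FN N (leqnn _)) _; rewrite ltry].
exact: (proj2 (cL2B (lF N) lN)).
Qed.

End L2_limits.

Section mp_product.
Context {R : realType} d1 d2 d3 d4 (T1 : measurableType d1) (T2 : measurableType d2)
  (T3 : measurableType d3) (T4 : measurableType d4).
Variables (m1 : {sigma_finite_measure set T1 -> \bar R})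
  (m2 : {sigma_finite_measure set T2 -> \bar R})
  (n1 : {sigma_finite_measure set T3 -> \bar R})
  (n2 : {sigma_finite_measure set T4 -> \bar R}).

Lemma mp_prod (f : T1 -> T3) (g : T2 -> T4) : mp m1 n1 f -> mp m2 n2 g ->
  mp (m1 \x m2)%E (n1 \x n2)%E (fun z => (f z.1, g z.2)).
Proof.
move=> [mf ef] [mg eg].
have mfg : measurable_fun setT (fun z : T1 * T2 => (f z.1, g z.2)).
  by apply: measurable_fun_pair; exact: measurableT_comp.
split => // A mA; apply/esym.
transitivity (pushforward (m1 \x m2)%E (fun z : T1 * T2 => (f z.1, g z.2)) A) => //.
apply: (@product_measure_unique _ _ _ _ _ n1 n2 (pushforward (m1 \x m2)%E _)) => // B C mB mC.
transitivity ((m1 \x m2)%E ((f @^-1` B) `*` (g @^-1` C))) => //.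
rewrite product_measure1E ?ef ?eg//.
  by rewrite -[X in measurable X]setTI; exact: mf.
by rewrite -[X in measurable X]setTI; exact: mg.
Qed.

End mp_product.

(** * Lebesgue measure on tuples *)

Section euclid.
Context {R : realType}.
Implicit Types d : nat.

Lemma tnth_consR0 d (z : measurableTypeR R * euclid R d) : tnth (consR z) ord0 = z.1.
Proof. by []. Qed.

Lemma tnth_consRS d (z : measurableTypeR R * euclid R d) (j : 'I_d) :
  tnth (consR z) (lift ord0 j) = tnth z.2 j.
Proof. by rewrite /consR tnthS. Qed.

Definition uncons d (x : euclid R d.+1) : measurableTypeR R * euclid R d :=
  (thead x, [tuple of behead x]).

Lemma consRK d : cancel (@consR R d) (@uncons d).
Proof.
by case=> a b; rewrite /uncons /consR theadE /=; congr pair; exact: val_inj.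
Qed.

Lemma unconsK d : cancel (@uncons d) (@consR R d).
Proof. by move=> x; rewrite /consR /uncons [x in RHS]tuple_eta. Qed.

Lemma measurable_uncons d : measurable_fun setT (@uncons d).
Proof.
apply: measurable_fun_pair; first exact: (@measurable_tnth _ (measurableTypeR R) _ ord0).
exact: measurable_behead.
Qed.

Lemma mp_consR d : mp (lebesgue_measure \x leb d)%E (leb d.+1) (@consR R d).
Proof. by split => //; exact: measurable_consR. Qed.

Lemma mp_uncons d : mp (leb d.+1) (lebesgue_measure \x leb d)%E (@uncons d).
Proof.
split; first exact: measurable_uncons.
move=> A mA; transitivity ((lebesgue_measure \x leb d)%E (@consR R d @^-1` (@uncons d @^-1` A))) => //.
by congr (_ _); apply/seteqP; split => z /=; rewrite consRK.
Qed.

Lemma leb_ge0_cons d (f : euclid R d.+1 -> \bar R) : measurable_fun setT f ->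
  (forall x, 0 <= f x)%E ->
  (\int[leb d.+1]_x f x = \int[lebesgue_measure]_a \int[leb d]_x f (consR (a, x)))%E.
Proof.
move=> mf f0; rewrite -(mp_ge0 (mp_consR d) mf f0) fubini_tonelli1//.
by apply: measurableT_comp => //; exact: measurable_consR.
Qed.

Lemma measurable_mktuple d dT (T : measurableType dT) (f : 'I_d -> T -> R) :
  (forall i, measurable_fun setT (f i)) ->
  measurable_fun setT (fun x => [tuple f i x | i < d] : euclid R d).
Proof.
move=> mf; apply/measurable_fun_tnthP => i.
rewrite (_ : _ \o _ = f i); first exact: mf.
by apply/funext => x /=; rewrite tnth_mktuple.
Qed.

Definition vadd d (x y : euclid R d) : euclid R d := [tuple tnth x i + tnth y i | i < d].
Definition negv d (x : euclid R d) : euclid R d := [tuple - tnth x i | i < d].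
Definition scalev d (a : R) (x : euclid R d) : euclid R d := [tuple a * tnth x i | i < d].
Definition zerov d : euclid R d := [tuple 0 | i < d].

Lemma measurable_tnthR d (i : 'I_d) dT (T : measurableType dT) (f : T -> euclid R d) :
  measurable_fun setT f -> measurable_fun setT (fun x => tnth (f x) i : R).
Proof. by move=> mf; apply: (measurableT_comp (@measurable_tnth _ (measurableTypeR R) d i) mf). Qed.

Lemma measurable_vadd d dT (T : measurableType dT) (f g : T -> euclid R d) :
  measurable_fun setT f -> measurable_fun setT g ->
  measurable_fun setT (fun x => vadd (f x) (g x)).
Proof.
move=> mf mg; apply: measurable_mktuple => i.
by apply: measurable_funD; exact: measurable_tnthR.
Qed.

Lemma measurable_subv d dT (T : measurableType dT) (f g : T -> euclid R d) :
  measurable_fun setT f -> measurable_fun setT g ->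
  measurable_fun setT (fun x => subv (f x) (g x)).
Proof.
move=> mf mg; apply: measurable_mktuple => i.
by apply: measurable_funB; exact: measurable_tnthR.
Qed.

Lemma measurable_negv d dT (T : measurableType dT) (f : T -> euclid R d) :
  measurable_fun setT f -> measurable_fun setT (fun x => negv (f x)).
Proof.
move=> mf; apply: measurable_mktuple => i.
by apply: measurableT_comp => //; exact: measurable_tnthR.
Qed.

Lemma measurable_scalev d (a : R) dT (T : measurableType dT) (f : T -> euclid R d) :
  measurable_fun setT f -> measurable_fun setT (fun x => scalev a (f x)).
Proof.
move=> mf; apply: measurable_mktuple => i.
by apply: measurable_funM => //; exact: measurable_tnthR.
Qed.

Lemma measurable_dot d dT (T : measurableType dT) (f g : T -> euclid R d) :
  measurable_fun setT f -> measurable_fun setT g ->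
  measurable_fun setT (fun x => dot (f x) (g x)).
Proof.
move=> mf mg; apply: measurable_sum => i.
by apply: measurable_funM; exact: measurable_tnthR.
Qed.

Lemma measurable_sqnorm d dT (T : measurableType dT) (f : T -> euclid R d) :
  measurable_fun setT f -> measurable_fun setT (fun x => sqnorm (f x)).
Proof. by move=> mf; exact: measurable_dot. Qed.

Lemma dotC d (x y : euclid R d) : dot x y = dot y x.
Proof. by apply: eq_bigr => i _; rewrite mulrC. Qed.

Lemma dotDl d (x y z : euclid R d) : dot (vadd x y) z = dot x z + dot y z.
Proof. by rewrite -big_split /=; apply: eq_bigr => i _; rewrite tnth_mktuple mulrDl. Qed.

Lemma dotDr d (x y z : euclid R d) : dot z (vadd x y) = dot z x + dot z y.
Proof. by rewrite dotC dotDl !(dotC z). Qed.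

Lemma dotBl d (x y z : euclid R d) : dot (subv x y) z = dot x z - dot y z.
Proof.
rewrite /dot -sumrB; apply: eq_bigr => i _; by rewrite tnth_mktuple mulrBl.
Qed.

Lemma dotBr d (x y z : euclid R d) : dot z (subv x y) = dot z x - dot z y.
Proof. by rewrite dotC dotBl !(dotC z). Qed.

Lemma dotNl d (x z : euclid R d) : dot (negv x) z = - dot x z.
Proof. by rewrite /dot -sumrN; apply: eq_bigr => i _; rewrite tnth_mktuple mulNr. Qed.

Lemma dotNr d (x z : euclid R d) : dot z (negv x) = - dot z x.
Proof. by rewrite dotC dotNl dotC. Qed.

Lemma dotZl d a (x z : euclid R d) : dot (scalev a x) z = a * dot x z.
Proof. by rewrite /dot mulr_sumr; apply: eq_bigr => i _; rewrite tnth_mktuple mulrA. Qed.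

Lemma dotZr d a (x z : euclid R d) : dot z (scalev a x) = a * dot z x.
Proof. by rewrite dotC dotZl dotC. Qed.

Lemma dot_consR d (a b : R) (x y : euclid R d) :
  dot (consR (a, x)) (consR (b, y)) = a * b + dot x y.
Proof.
rewrite /dot big_ord_recl; congr (_ + _).
by apply: eq_bigr => i _; rewrite !tnth_consRS.
Qed.

Lemma sqnorm_ge0 d (x : euclid R d) : 0 <= sqnorm x.
Proof. by apply: sumr_ge0 => i _; rewrite -expr2 sqr_ge0. Qed.

Lemma sqnormN d (x : euclid R d) : sqnorm (negv x) = sqnorm x.
Proof. by rewrite /sqnorm dotNl dotNr opprK. Qed.

Lemma tnth_le_sqnorm d (x : euclid R d) i : tnth x i ^+ 2 <= sqnorm x.
Proof.
rewrite /sqnorm /dot (bigD1 i)//= -expr2 lerDl sumr_ge0// => j _.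
by rewrite -expr2 sqr_ge0.
Qed.

Lemma vaddC d (x y : euclid R d) : vadd x y = vadd y x.
Proof. by apply: eq_from_tnth => i; rewrite !tnth_mktuple addrC. Qed.

Lemma vaddK d (x y : euclid R d) : subv (vadd x y) y = x.
Proof. by apply: eq_from_tnth => i; rewrite !tnth_mktuple addrK. Qed.

Lemma negvK d (x : euclid R d) : negv (negv x) = x.
Proof. by apply: eq_from_tnth => i; rewrite !tnth_mktuple opprK. Qed.

Lemma vadd_consR d (a b : R) (x y : euclid R d) :
  vadd (consR (a, x)) (consR (b, y)) = consR (a + b, vadd x y).
Proof.
apply: eq_from_tnth => i; rewrite tnth_mktuple.
by case: (unliftP ord0 i) => [j ->|->//]; rewrite !tnth_consRS tnth_mktuple.
Qed.

Lemma euclid0 (x y : euclid R 0) : x = y.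
Proof. by rewrite (tuple0 x) (tuple0 y). Qed.

Lemma mp_addR (c : R) : mp lebesgue_measure lebesgue_measure
  (fun x : measurableTypeR R => x + c : measurableTypeR R).
Proof.
have ms : measurable_fun setT (fun x : measurableTypeR R => x + c : measurableTypeR R).
  by apply: measurable_funD.
split => // A mA; apply/esym.
transitivity (pushforward (@lebesgue_measure R) (fun x : measurableTypeR R => x + c : measurableTypeR R) A) => //.
apply: (@lebesgue_measure_unique R (pushforward lebesgue_measure _)) => // X [[a b] _ <-] /=.
transitivity (@lebesgue_measure R (`](a - c), (b - c)]%classic)); last first.
  congr (_ _); apply/seteqP; split => x /=; rewrite !in_itv /= ltrBlDr lerBrDr//.
rewrite !lebesgue_measure_itv /= !lte_fin ltrD2r; case: ifP => // _.
by rewrite -!EFinD opprB addrA subrK.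
Qed.

Lemma mp_vadd d (v : euclid R d) : mp (leb d) (leb d) (fun x => vadd x v).
Proof.
elim: d v => [|d IH] v.
  rewrite (_ : (fun x => _) = id); last by apply/funext => x; exact: euclid0.
  by split => //; exact: measurable_id.
rewrite (_ : (fun x => _) = fun x => consR ((uncons x).1 + (uncons v).1,
    vadd (uncons x).2 (uncons v).2)); last first.
  apply/funext => x; rewrite -{1}(unconsK x) -{1}(unconsK v).
  by case: (uncons x) (uncons v) => [a y] [b z]; rewrite vadd_consR.
apply: mp_comp (mp_consR d).
exact: (mp_comp (mp_uncons d) (mp_prod (mp_addR (uncons v).1) (IH (uncons v).2))).
Qed.

Definition boxr d (r : R) : set (euclid R d) := [set x | forall i, `|tnth x i| <= r].

Arguments boxr d r : clear implicits.

Lemma boxrS d (r : R) : boxr d.+1 r = @uncons d @^-1` ([set a : measurableTypeR R | `|a| <= r] `*` boxr d r).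
Proof.
apply/seteqP; split => x /=.
  move=> h; split; first exact: (h ord0).
  by move=> i; have := h (lift ord0 i); rewrite -{1}(unconsK x) tnth_consRS.
move=> [h1 h2] i; rewrite -(unconsK x).
by case: (unliftP ord0 i) => [j ->|->//]; rewrite tnth_consRS; exact: h2.
Qed.

Lemma absE (r : R) : [set a : measurableTypeR R | `|a| <= r] = `[- r, r]%classic.
Proof. by apply/seteqP; split => x /=; rewrite in_itv /= ler_norml. Qed.

Lemma measurable_abs (r : R) : measurable [set a : measurableTypeR R | `|a| <= r].
Proof. by rewrite absE; exact: measurable_itv. Qed.

Lemma measurable_boxr d (r : R) : measurable (boxr d r).
Proof.
elim: d => [|d IH].
  by rewrite (_ : boxr _ _ = setT)//; apply/seteqP; split => // x _ [].
rewrite boxrS -[X in measurable X]setTI; apply: measurable_uncons => //.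
by apply: measurableX => //; exact: measurable_abs.
Qed.

Arguments measurable_boxr d r : clear implicits.

Lemma leb_boxr d (r : R) : 0 <= r -> leb d (boxr d r) = ((r + r) ^+ d)%:E.
Proof.
move=> r0; elim: d => [|d IH].
  have -> : boxr 0 r = setT by apply/seteqP; split => // x _ [].
  by rewrite /= diracT.
rewrite boxrS (mp_uncons d).2; last first.
  by apply: measurableX; [exact: measurable_abs|exact: measurable_boxr].
transitivity (lebesgue_measure [set a : measurableTypeR R | (`|a| <= r)%R] * leb d (boxr d r))%E.
  exact: (product_measure1E lebesgue_measure (leb d) (measurable_abs r) (measurable_boxr d r)).
rewrite IH absE lebesgue_measure_itv /= lte_fin exprS EFinM; congr (_ * _)%E.
case: ltP => h; first by rewrite -EFinD opprK.
by congr (_%:E); lra.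
Qed.

(** * Uniqueness of translation-invariant measures *)

Section haar.
Context dX (X : measurableType dX) d.
Variable m : {sigma_finite_measure set X -> \bar R}.
Variable T : X -> euclid R d.
Hypothesis mT : measurable_fun setT T.
Hypothesis inv : forall A v, measurable A ->
  m (T @^-1` [set x | A (vadd x v)]) = m (T @^-1` A).

(* Tonelli for [1_A (T x + y) 1_Q y], after the substitution [y := y - T x]. *)
Lemma haar (A Q : set (euclid R d)) : measurable A -> measurable Q ->
  (m (T @^-1` A) * leb d Q = leb d A * m (T @^-1` [set x | Q (negv x)]))%E.
Proof.
move=> mA mQ.
have mI (B : set (euclid R d)) dT (Y : measurableType dT) (f : Y -> euclid R d) :
  measurable B -> measurable_fun setT f -> measurable_fun setT (fun x => (\1_B (f x))%:E : \bar R).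
  move=> mB mf; apply: (measurableT_comp (f := fun x => (\1_B x)%:E : \bar R)) => //.
  by apply/measurable_EFinP; exact: measurable_indic.
pose f (z : X * euclid R d) := ((\1_A (vadd (T z.1) z.2))%:E * (\1_Q z.2)%:E : \bar R)%E.
pose g (z : X * euclid R d) := ((\1_A z.2)%:E * (\1_Q (subv z.2 (T z.1)))%:E : \bar R)%E.
have mT1 : measurable_fun setT (fun z : X * euclid R d => T z.1) by exact: measurableT_comp.
have mf : measurable_fun setT f.
  by apply: emeasurable_funM; apply: mI => //; exact: measurable_vadd.
have mg : measurable_fun setT g.
  by apply: emeasurable_funM; apply: mI => //; exact: measurable_subv.
have f0 z : (0 <= f z)%E by rewrite /f mule_ge0.
have g0 z : (0 <= g z)%E by rewrite /g mule_ge0.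
have pre (B : set (euclid R d)) (h : X -> euclid R d) : measurable B -> measurable_fun setT h ->
    (\int[m]_x (\1_B (h x))%:E = m (h @^-1` B))%E.
  move=> mB mh; rewrite -(setIT (h @^-1` B)) -integral_indic//.
  by rewrite -[X in measurable X]setTI; exact: mh.
have pre' (B : set (euclid R d)) : measurable B -> (\int[leb d]_x (\1_B x)%:E = leb d B)%E.
  by move=> mB; rewrite integral_indic// setIT.
have e1 : (\int[m]_x \int[leb d]_y f (x, y) = \int[m]_x \int[leb d]_y g (x, y))%E.
  apply: eq_integral => x _.
  rewrite -[RHS](mp_ge0 (mp_vadd (T x)) (f := fun y => g (x, y)))//; last first.
    by apply: measurableT_comp => //; exact: measurable_fun_pair.
  by apply: eq_integral => y _; rewrite /g /f /= vaddK vaddC.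
have -> : (m (T @^-1` A) * leb d Q = \int[leb d]_y \int[m]_x f (x, y))%E.
  rewrite -(pre' Q mQ).
  apply: (etrans (esym (ge0_integralZl (leb d) measurableT (mI Q _ _ id mQ (@measurable_id _ _ _)) _ _))) => //.
  apply: eq_integral => y _.
  have mTy : measurable_fun setT (fun x => vadd (T x) y) by exact: measurable_vadd.
  apply/esym; apply: (etrans (ge0_integralZr m measurableT (mI A _ _ _ mA mTy) (k := (\1_Q y)%:E) _ _)) => //.
  by apply: (congr1 (fun u => u * _)%E); rewrite (pre A _ mA mTy) -(inv y mA).
have -> : (leb d A * m (T @^-1` [set x | Q (negv x)]) = \int[leb d]_y \int[m]_x g (x, y))%E.
  rewrite -(pre' A mA).
  apply: (etrans (esym (ge0_integralZr (leb d) measurableT (mI A _ _ id mA (@measurable_id _ _ _)) _ _))) => //.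
  apply: eq_integral => y _.
  have mTy : measurable_fun setT (fun x => subv y (T x)) by exact: measurable_subv.
  apply/esym; apply: (etrans (ge0_integralZl m measurableT (mI Q _ _ _ mQ mTy) (k := (\1_A y)%:E) _ _)) => //.
  apply: congr1; rewrite (pre Q _ mQ mTy).
  have mQ' : measurable [set x | Q (negv x)].
    by rewrite -[X in measurable X]setTI; apply: (measurable_negv (@measurable_id _ _ setT)).
  rewrite -(inv (negv y) mQ'); apply: congr1; apply/seteqP; split => x /=;
    by rewrite (_ : subv _ _ = negv (vadd (T x) (negv y)))//;
      apply: eq_from_tnth => i; rewrite !tnth_mktuple; ring.
by rewrite -!fubini_tonelli.
Qed.
End haar.

End euclid.

Arguments boxr {R} d r.
Arguments measurable_boxr {R} d r.

(** * Orthogonal maps, dilations, splitting of coordinates, radial coordinate *)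

Section euclid_maps.
Context {R : realType}.

Lemma preimage_measurable d1 d2 (T1 : measurableType d1) (T2 : measurableType d2)
    (f : T1 -> T2) (A : set T2) :
  measurable_fun setT f -> measurable A -> measurable (f @^-1` A).
Proof. by move=> mf mA; rewrite -[X in measurable X]setTI; exact: mf. Qed.

Lemma mule_cancelr (a b : \bar R) (q : R) : 0 < q -> (a * q%:E = b * q%:E)%E -> a = b.
Proof.
move=> q0 /(congr1 (fun x => x * q^-1%:E)%E).
by rewrite -!muleA -EFinM divff ?gt_eqF// !mule1.
Qed.

(** No determinant is involved: additivity and surjectivity make the image measure translation
    invariant, so [haar] compares it with Lebesgue measure, and the factor is one because the
    preimage of a centred ball is that ball. *)
Lemma mp_orth d (T : euclid R d -> euclid R d) : measurable_fun setT T ->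
  (forall x y, T (vadd x y) = vadd (T x) (T y)) -> (forall v, exists u, T u = v) ->
  (forall x, sqnorm (T x) = sqnorm x) -> mp (leb d) (leb d) T.
Proof.
move=> mT addT surT normT; split => // A mA.
(* The bound [d] puts this ball between [boxr d 1] and [boxr d d], so its measure is positive and
   finite and can be cancelled. *)
pose Q : set (euclid R d) := [set x | sqnorm x <= d%:R].
have mQ : measurable Q.
  have -> : Q = (fun x => sqnorm x) @^-1` `]-oo, d%:R]%classic.
    by apply/seteqP; split => x /=; rewrite in_itv.
  by apply: preimage_measurable => //; exact: measurable_sqnorm.
have inv B v : measurable B -> leb d (T @^-1` [set x | B (vadd x v)]) = leb d (T @^-1` B).
  move=> mB; have [u <-] := surT v.
  have mTB : measurable (T @^-1` B) by exact: preimage_measurable.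
  rewrite -((mp_vadd u).2 _ mTB); congr (_ _).
  by apply/seteqP; split => x /=; rewrite addT.
have := haar mT inv mA mQ.
have -> : T @^-1` [set x | Q (negv x)] = Q.
  by apply/seteqP; split => x /=; rewrite /Q /= sqnormN normT.
have Q1 : (leb d Q < +oo)%E.
  apply: (@le_lt_trans _ _ (leb d (boxr d d%:R))); last by rewrite leb_boxr// ltry.
  apply: le_measure; rewrite ?inE//; first exact: measurable_boxr.
  move=> x Qx i; rewrite -(@ler_pXn2r _ 2)// ?nnegrE// real_normK ?num_real//.
  apply: (le_trans (tnth_le_sqnorm x i)); apply: (le_trans Qx).
  rewrite -natrX ler_nat; have : (0 < d)%N by apply: leq_ltn_trans (ltn_ord i).
  by move=> d0; rewrite -{1}(expn1 d) leq_pexp2l.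
have Q0 : (0 < leb d Q)%E.
  apply: (@lt_le_trans _ _ (leb d (boxr d 1))).
    by rewrite leb_boxr// lte_fin exprn_gt0.
  apply: le_measure; rewrite ?inE//; first exact: measurable_boxr.
  move=> x /= h; rewrite /Q /= /sqnorm /dot.
  apply: (@le_trans _ _ (\sum_(i < d) 1)); last by rewrite sumr_const card_ord.
  by apply: ler_sum => i _; rewrite -expr2 -real_normK ?num_real// expr_le1.
have fQ : leb d Q \is a fin_num by rewrite ge0_fin_numE// ltW.
rewrite -(fineK fQ) => h; apply: mule_cancelr h.
by rewrite -lte_fin fineK.
Qed.

Lemma mp_negv d : mp (leb d) (leb d) (@negv R d).
Proof.
apply: mp_orth.
- by apply: measurable_negv.
- by move=> x y; apply: eq_from_tnth => i; rewrite !tnth_mktuple opprD.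
- by move=> v; exists (negv v); exact: negvK.
- exact: sqnormN.
Qed.

Lemma mp_subvl d (v : euclid R d) : mp (leb d) (leb d) (fun x => subv v x).
Proof.
have := mp_comp (mp_negv d) (mp_vadd v); congr (mp _ _ _).
by apply/funext => x; apply: eq_from_tnth => i; rewrite !tnth_mktuple addrC.
Qed.

Lemma leb_scalev d (a : R) (A : set (euclid R d)) : 0 < a -> measurable A ->
  leb d (scalev a @^-1` A) = ((a^-1 ^+ d)%:E * leb d A)%E.
Proof.
move=> a0 mA.
have mT : measurable_fun setT (@scalev R d a) by apply: measurable_scalev.
have inv (B : set (euclid R d)) v : measurable B ->
    leb d (scalev a @^-1` [set x | B (vadd x v)]) = leb d (scalev a @^-1` B).
  move=> mB; have mTB : measurable (scalev a @^-1` B) by exact: preimage_measurable.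
  rewrite -((mp_vadd (scalev a^-1 v)).2 _ mTB); congr (_ _).
  apply/seteqP; split => x /=; rewrite (_ : vadd (scalev a x) v = scalev a (vadd x (scalev a^-1 v)))//;
  by apply: eq_from_tnth => i; rewrite !tnth_mktuple mulrDr mulVKf ?gt_eqF.
(* This cube has side 1, hence measure 1, and its preimage under the dilation is again a cube. *)
have := haar mT inv mA (measurable_boxr d 2^-1).
rewrite leb_boxr//.
have -> : (2^-1 + 2^-1 = 1 :> R) by lra.
rewrite expr1n mule1 => ->; rewrite muleC; congr (_ * _)%E.
have -> : scalev a @^-1` [set x | boxr d 2^-1 (negv x)] = boxr d (2^-1 * a^-1).
  by apply/seteqP; split => x /= h i; have := h i;
    rewrite !tnth_mktuple normrN normrM gtr0_norm// ler_pdivlMr// mulrC.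
rewrite leb_boxr; last by rewrite mulr_ge0// invr_ge0 ltW.
by congr ((_ ^+ _)%:E); lra.
Qed.

Definition catv a b (z : euclid R a * euclid R b) : euclid R (a + b) := [tuple of z.1 ++ z.2].
Definition lv a b (v : euclid R (a + b)) : euclid R a := [tuple tnth v (lshift b i) | i < a].
Definition rv a b (v : euclid R (a + b)) : euclid R b := [tuple tnth v (rshift a i) | i < b].

Lemma lv_cat a b z : lv (@catv a b z) = z.1.
Proof. by apply: eq_from_tnth => i; rewrite tnth_mktuple tnth_lshift. Qed.

Lemma rv_cat a b z : rv (@catv a b z) = z.2.
Proof. by apply: eq_from_tnth => i; rewrite tnth_mktuple tnth_rshift. Qed.

Lemma catvK a b v : @catv a b (lv v, rv v) = v.
Proof.
apply: eq_from_tnth => i; case: (split_ordP i) => j ->.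
  by rewrite tnth_lshift tnth_mktuple.
by rewrite tnth_rshift tnth_mktuple.
Qed.

Lemma measurable_catv a b : measurable_fun setT (@catv a b).
Proof.
apply/measurable_fun_tnthP => i; case: (split_ordP i) => j ->.
  rewrite (_ : _ \o _ = fun z => tnth z.1 j); first exact: measurable_tnthR.
  by apply/funext => z /=; rewrite tnth_lshift.
rewrite (_ : _ \o _ = fun z => tnth z.2 j); first exact: measurable_tnthR.
by apply/funext => z /=; rewrite tnth_rshift.
Qed.

Lemma measurable_lv a b : measurable_fun setT (@lv a b).
Proof. by apply: measurable_mktuple => i; exact: measurable_tnthR. Qed.

Lemma measurable_rv a b : measurable_fun setT (@rv a b).
Proof. by apply: measurable_mktuple => i; exact: measurable_tnthR. Qed.

Lemma dot_catv a b x y : dot (@catv a b x) (catv y) = dot x.1 y.1 + dot x.2 y.2.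
Proof.
rewrite /dot big_split_ord /=; congr (_ + _); apply: eq_bigr => i _.
  by rewrite !tnth_lshift.
by rewrite !tnth_rshift.
Qed.

Lemma vadd_catv a b x y : vadd (@catv a b x) (catv y) = catv (vadd x.1 y.1, vadd x.2 y.2).
Proof.
apply: eq_from_tnth => i; rewrite tnth_mktuple; case: (split_ordP i) => j ->.
  by rewrite !tnth_lshift tnth_mktuple.
by rewrite !tnth_rshift tnth_mktuple.
Qed.

Lemma catv_consR a b r x y : @catv a.+1 b (consR (r, x), y) = consR (r, catv (x, y)).
Proof. exact: val_inj. Qed.

Lemma leb_ge0_cat a b (f : euclid R (a + b) -> \bar R) : measurable_fun setT f ->
  (forall x, 0 <= f x)%E ->
  (\int[leb (a + b)]_v f v = \int[leb a]_x \int[leb b]_y f (catv (x, y)))%E.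
Proof.
elim: a f => [|a IH] f mf f0.
  rewrite [RHS]integral_dirac//; last first.
    apply: (measurable_Fubini1 (leb b) (f := fun z => f (catv z))).
    by apply: (measurableT_comp mf); exact: measurable_catv.
  rewrite diracT mul1e; apply: eq_integral => y _; congr (f _).
  exact: val_inj.
have mfc r : measurable_fun setT (fun v : euclid R (a + b) => f (consR (r, v))).
  by apply: (measurableT_comp mf); apply: (measurableT_comp (@measurable_consR R _)); exact: measurable_fun_pair.
rewrite [LHS](leb_ge0_cons mf f0) [RHS]leb_ge0_cons; last 2 first.
- apply: (measurable_Fubini1 (leb b) (f := fun z => f (catv z))).
  by apply: (measurableT_comp mf); exact: measurable_catv.
- by move=> x; exact: integral_ge0.
apply: eq_integral => r _; rewrite IH//.
by apply: eq_integral => x _; apply: eq_integral => y _; rewrite catv_consR.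
Qed.

Lemma mp_catv a b : mp (leb a \x leb b)%E (leb (a + b)) (@catv a b).
Proof.
have mT := @measurable_catv a b; split => // A mA.
have mI : measurable_fun setT (fun v => (\1_A v)%:E : \bar R).
  by apply/measurable_EFinP; exact: measurable_indic.
transitivity (\int[leb (a + b)]_v (\1_A v)%:E)%E; last by rewrite integral_indic// setIT.
have mP : measurable (@catv a b @^-1` A) by exact: preimage_measurable.
transitivity (\int[leb a \x leb b]_z (\1_(@catv a b @^-1` A) z)%:E)%E.
  by rewrite integral_indic// setIT.
rewrite leb_ge0_cat// fubini_tonelli1//.
by apply/measurable_EFinP; exact: measurable_indic.
Qed.

Lemma mp_uncatv a b : mp (leb (a + b)) (leb a \x leb b)%E (fun v => (@lv a b v, rv v)).
Proof.
have mu : measurable_fun setT (fun v => (@lv a b v, rv v)).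
  by apply: measurable_fun_pair; [exact: measurable_lv|exact: measurable_rv].
split => // A mA; rewrite -(mp_catv a b).2; last exact: preimage_measurable.
by congr (_ _); apply/seteqP; split => -[x y] /=; rewrite lv_cat rv_cat.
Qed.

(* The dimension is kept abstract to prevent the unfolding of [leb n]. *)
Section disc.
Variable n : nat.
Hypothesis n_2 : n = 2%N.

(** Here [r] is the square of the radius, so that in dimension two the area is linear in [r]. *)
Definition disc (r : R) : set (euclid R n) := [set x | sqnorm x <= r].

Lemma measurable_disc r : measurable (disc r).
Proof.
have -> : disc r = (fun x => sqnorm x) @^-1` `]-oo, r]%classic.
  by apply/seteqP; split => x /=; rewrite in_itv.
by apply: preimage_measurable => //; exact: measurable_sqnorm.
Qed.

(** In dimension two this is pi, kept as an abstract constant. *)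
Definition disc_area : R := fine (leb n (disc 1)).

Lemma disc_area_ge0 : 0 <= disc_area. Proof. by rewrite fine_ge0. Qed.

Lemma disc1_lty : (leb n (disc 1) < +oo)%E.
Proof.
apply: (@le_lt_trans _ _ (leb n (boxr n (1 : R)))); last by rewrite leb_boxr// ltry.
apply: le_measure; rewrite ?inE//; [exact: measurable_disc|exact: measurable_boxr|].
move=> x h i; rewrite -(@ler_pXn2r _ 2)// ?nnegrE// real_normK ?num_real//.
by rewrite expr1n; apply: le_trans (tnth_le_sqnorm x i) h.
Qed.

Lemma leb_disc_gt0 r : 0 < r -> leb n (disc r) = (disc_area * r)%:E.
Proof.
move=> r0; have s0 : 0 < Num.sqrt r by rewrite sqrtr_gt0.
have -> : disc r = scalev (Num.sqrt r)^-1 @^-1` disc 1.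
  apply/seteqP; split => x /=; rewrite /disc /= /sqnorm dotZl dotZr mulrA -expr2 exprVn;
  by rewrite sqr_sqrtr ?(ltW r0)// mulrC ler_pdivrMr// mul1r.
rewrite leb_scalev ?invr_gt0//; last exact: measurable_disc.
have sr : Num.sqrt r ^+ n = r by rewrite n_2 sqr_sqrtr// ltW.
rewrite invrK sr muleC EFinM fineK// ge0_fin_numE//.
exact: disc1_lty.
Qed.

Lemma leb_disc r : 0 <= r -> leb n (disc r) = (disc_area * r)%:E.
Proof.
rewrite le_eqVlt => /orP[/eqP <-|]; last exact: leb_disc_gt0.
rewrite mulr0; apply/eqP; rewrite eq_le measure_ge0 andbT.
apply/lee_addgt0Pr => e e0; rewrite add0e.
have k0 : 0 < disc_area + 1 by rewrite ltr_wpDl// disc_area_ge0.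
apply: (@le_trans _ _ (leb n (disc (e / (disc_area + 1))))).
  apply: le_measure; rewrite ?inE; [exact: measurable_disc|exact: measurable_disc|].
  by move=> x /= h; apply: (le_trans h); rewrite divr_ge0// ltW.
rewrite leb_disc_gt0; last by rewrite divr_gt0.
rewrite lee_fin mulrA ler_pdivrMr// mulrC ler_wpM2l ?lerDl//; exact: ltW.
Qed.

(** In dimension n the law of rho = |w|^2 has density proportional to rho^((n - 2) / 2): it is
    constant on the half-line exactly when n = 2. *)
Definition radial_measure := mscale (NngNum disc_area_ge0)
  (mrestr (@lebesgue_measure R) (measurable_itv `[0, +oo[)).

(** Two measures that agree on the intervals ]a, b] and are finite on an exhausting sequence of them
    coincide. On the left such an interval gives the area of an annulus; the case distinction
    follows the signs of [a] and [b]. *)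
Lemma mp_sqnorm : mp (leb n) radial_measure (fun w => sqnorm w : measurableTypeR R).
Proof.
have ms : measurable_fun setT (fun w : euclid R n => sqnorm w : measurableTypeR R).
  by apply: measurable_sqnorm.
split => // A mA.
transitivity (pushforward (leb n) (fun w : euclid R n => sqnorm w : measurableTypeR R) A) => //.
pose g (k : nat) : set (measurableTypeR R) := `](- k%:R), k%:R]%classic.
have D0 r : r < 0 -> disc r = set0.
  move=> r0; apply/seteqP; split => // x /= h.
  by have := le_lt_trans (le_trans (sqnorm_ge0 x) h) r0; rewrite ltxx.
have Dfin r : (leb n (disc r) < +oo)%E.
  case: (leP 0 r) => r0; first by rewrite leb_disc// ltry.
  by rewrite D0// measure0.
apply: (@measure_unique _ _ (measurableTypeR R) (@ocitv R) g _ _ _ _ (pushforward (leb n) _) radial_measure) => //.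
- exact: ocitvI.
- by move=> i; exists (- i%:R, i%:R).
- apply/seteqP; split => // x _.
  exists (Num.truncn `|x|).+1 => //; rewrite /g /= in_itv /=.
  have := truncnS_gt `|x|; rewrite ltr_norml => /andP[-> /ltW ->] //.
- move=> B [[a b] _ <-] /=.
  have [ab|ba] := leP a b; last first.
    have -> : `]a, b]%classic = set0 :> set R by rewrite set_itv_ge// bnd_simp -leNgt ltW.
    by rewrite !measure0.
  transitivity (leb n (disc b `\` disc a)).
    congr (leb n _); apply/seteqP; split => x /=; rewrite in_itv /=.
      by move=> /andP[h1 h2]; split => //; apply/negP; rewrite -ltNge.
    by move=> [h1 /negP]; rewrite -ltNge => h2; rewrite h2 h1.
  rewrite measureD; [|exact: measurable_disc|exact: measurable_disc|exact: Dfin].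
  have -> : disc b `&` disc a = disc a.
    by apply/seteqP; split => x /=; [case|move=> h; split => //; exact: le_trans ab].
  rewrite /radial_measure /mscale /= /mrestr.
  have [b0|b0] := ltP b 0.
    have -> : `]a, b]%classic `&` `[0, +oo[%classic = set0 :> set R.
      apply/seteqP; split => // x /=; rewrite !in_itv /= andbT => -[/andP[_ xb] x0].
      by have := le_lt_trans (le_trans x0 xb) b0; rewrite ltxx.
    by rewrite (D0 _ b0) (D0 _ (le_lt_trans ab b0)) !measure0 mule0 sube0.
  rewrite (leb_disc b0).
  have [a0|a0] := ltP a 0.
    have -> : `]a, b]%classic `&` `[0, +oo[%classic = `[0, b]%classic :> set R.
      apply/seteqP; split => x /=; rewrite !in_itv /= andbT.
        by move=> [/andP[_ ->] ->].
      by move=> /andP[x0 ->]; rewrite (lt_le_trans a0 x0).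
    rewrite (D0 _ a0) measure0 sube0 lebesgue_measure_itv /= lte_fin.
    case: ltP => h; first by rewrite oppr0 adde0 EFinM.
    by have -> : b = 0 by apply/eqP; rewrite eq_le h b0.
  have -> : `]a, b]%classic `&` `[0, +oo[%classic = `]a, b]%classic :> set R.
    apply/seteqP; split => x /=; rewrite !in_itv /= andbT; first by case.
    by move=> /andP[ax ->]; rewrite ax (le_trans a0 (ltW ax)).
  rewrite (leb_disc a0) lebesgue_measure_itv /= lte_fin.
  case: ltP => h; first by rewrite -!EFinD -EFinM mulrBr.
  have -> : b = a by apply/eqP; rewrite eq_le h ab.
  by rewrite subee// mule0.
- move=> k; apply: (@le_lt_trans _ _ (leb n (disc k%:R))) => //.
  apply: (le_measure (leb n)); rewrite ?inE; [|exact: measurable_disc|].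
    by apply: (preimage_measurable ms); exact: measurable_itv.
  by move=> x; rewrite /g /= in_itv /= => /andP[].
Qed.

End disc.

End euclid_maps.

(** * Abel and Poisson kernels *)

Section one_dim.
Context {R : realType}.
Implicit Types (e x y a b : R).

Lemma continuous_of_is_derive (f df : R -> R) :
  (forall x, is_derive x (1 : R) f (df x)) -> continuous f.
Proof.
move=> h x; apply: differentiable_continuous; apply/derivable1_diffP.
exact: ex_derive.
Qed.

Lemma FTC0y (f F : R -> R) l : (forall x, is_derive x (1 : R) F (f x)) ->
  continuous f -> (forall x, 0 <= x -> 0 <= f x) -> F x @[x --> +oo] --> l ->
  (\int[lebesgue_measure]_(x in `[0%R, +oo[) (f x)%:E = (l - F 0)%:E)%E.
Proof.
move=> dF cf f0 Fl; rewrite (@ge0_continuous_FTC2y _ f F 0 l) ?EFinB//.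
- exact: continuous_subspaceT.
- by apply: cvg_at_right_filter; exact: continuous_of_is_derive dF 0.
- by move=> x _; rewrite derive1E; apply: derive_val.
Qed.

Lemma FTC_seg (f F : R -> R) a b : a <= b -> (forall x, is_derive x (1 : R) F (f x)) ->
  continuous f ->
  (\int[lebesgue_measure]_(x in `[a, b]) (f x)%:E = (F b - F a)%:E)%E.
Proof.
rewrite le_eqVlt => /orP[/eqP <- _ _|ab dF cf].
  by rewrite set_itv1 integral_set1 subrr.
have cF := continuous_of_is_derive dF.
rewrite (@continuous_FTC2 _ f F)// ?EFinB//.
- exact: continuous_subspaceT.
- split.
  + by move=> x _; apply: ex_derive.
  + by apply: cvg_at_right_filter; exact: cF.
  + by apply: cvg_at_left_filter; exact: cF.
- by move=> x _; rewrite derive1E; apply: derive_val.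
Qed.

Lemma is_derive_lin c x : is_derive x (1 : R) (fun t => c * t) c.
Proof. by apply: is_derive_eq; rewrite /GRing.scale /= ?mulr1 ?mulr0 ?addr0. Qed.

Lemma is_derive_coslin c x :
  is_derive x (1 : R) (fun t => cos (c * t)) (- c * sin (c * x)).
Proof.
have := @is_derive1_comp _ cos (fun t => c * t) x _ c (is_derive_cos _) (is_derive_lin c x).
by rewrite mulrC mulrN mulNr.
Qed.

Lemma sqD_gt0 e y : 0 < e -> 0 < e ^+ 2 + y ^+ 2.
Proof. by move=> e0; rewrite ltr_wpDr ?sqr_ge0// exprn_gt0. Qed.

(** This weight regularises Fourier integrals. Its transform is a multiple of the Poisson kernel
    [pois], and both have elementary antiderivatives, so the fundamental theorem of calculus
    evaluates every integral involved. *)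
Definition abel e x := expR (- (e * `|x|)).
Definition pois e y := e / (e ^+ 2 + y ^+ 2) / pi.

Lemma cvg_bounded_expN e (h : R -> R) M : 0 < e -> (forall x, `|h x| <= M) ->
  expR (- (e * x)) * h x @[x --> +oo] --> (0 : R).
Proof.
move=> e0 hM.
have e1 : expR (- (e * x)) @[x --> +oo] --> (0 : R).
  apply: (@cvg_comp _ _ _ (fun x => e * x) (fun z => expR (- z)) _ (pinfty_nbhs R)); last exact: cvgr_expR.
  exact: gt0_cvgMry.
apply: (@squeeze_cvgr _ _ _ _ (fun x => - (expR (- (e * x)) * M)) (fun x => expR (- (e * x)) * M)).
- near=> x; rewrite -ler_norml normrM ger0_norm ?expR_ge0//.
  by rewrite ler_wpM2l// expR_ge0.
- by rewrite -oppr0 -(mul0r M); apply: cvgN; apply: cvgM => //; exact: cvg_cst.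
- by rewrite -(mul0r M); apply: cvgM => //; exact: cvg_cst.
Unshelve. all: by end_near. Qed.

(** The summand 1 makes the integrand nonnegative, as the improper fundamental theorem behind
    [FTC0y] demands; [fourier_abel] recovers the cosine alone by subtraction. *)
Lemma integral_abel_half e y : 0 < e ->
  (\int[lebesgue_measure]_(x in `[0%R, +oo[) (expR (- (e * x)) * (1 + cos (y * x)))%:E =
   (e^-1 + e / (e ^+ 2 + y ^+ 2))%:E)%E.
Proof.
move=> e0; have k0 := sqD_gt0 y e0.
(* The antiderivative is [expR (- (e * t)) * h t]: the two terms of [h] account for the summands [1]
   and [cos (y * t)]. *)
pose h t := - e^-1 + (e ^+ 2 + y ^+ 2)^-1 * (y * sin (y * t) + (- e) * cos (y * t)).
have dh t : is_derive t (1 : R) h ((e ^+ 2 + y ^+ 2)^-1 * (y * (y * cos (y * t)) + (- e) * (- y * sin (y * t)))).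
  by apply: is_derive_eq; rewrite /GRing.scale /=; ring.
have dF t : is_derive t (1 : R) (fun t => expR (- (e * t)) * h t) (expR (- (e * t)) * (1 + cos (y * t))).
  apply: is_derive_eq; rewrite /GRing.scale /= /h; field.
  by rewrite !gt_eqF.
rewrite (@FTC0y _ _ 0 dF).
- congr (_%:E); rewrite /h mulr0 oppr0 expR0 mulr0 sin0 cos0; field.
  by rewrite !gt_eqF.
- have dg t : is_derive t (1 : R) (fun t => expR (- (e * t)) * (1 + cos (y * t)))
    (expR (- (e * t)) * (- y * sin (y * t)) + (1 + cos (y * t)) * (- e * expR (- (e * t)))).
    by apply: is_derive_eq; rewrite /GRing.scale /=; ring.
  exact: (continuous_of_is_derive dg).
- by move=> x _; rewrite mulr_ge0 ?expR_ge0// -lerBlDl sub0r cos_geN1.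
- apply: (@cvg_bounded_expN _ _ (e^-1 + (e ^+ 2 + y ^+ 2)^-1 * (`|y| + e))) => // x.
  rewrite /h; apply: (le_trans (ler_normD _ _)); apply: lerD.
    by rewrite normrN ger0_norm// invr_ge0 ltW.
  rewrite normrM ger0_norm ?invr_ge0 ?(ltW k0)// ler_wpM2l ?invr_ge0 ?(ltW k0)//.
  apply: (le_trans (ler_normD _ _)); apply: lerD.
    by rewrite normrM ler_piMr// ler_norml sin_geN1 sin_le1.
  rewrite normrM normrN (gtr0_norm e0) ler_piMr ?(ltW e0)//.
  by rewrite ler_norml cos_geN1 cos_le1.
Qed.

Lemma integral_even (f : R -> R) : (forall x, 0 <= f x) -> continuous f ->
  (forall x, f (- x) = f x) ->
  (\int[lebesgue_measure]_x (f x)%:E = 2%:E * \int[lebesgue_measure]_(x in `[0%R, +oo[) (f x)%:E)%E.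
Proof.
move=> f0 cf fN; rewrite (@ge0_symfun_integralT _ f)//; last by move=> x /=; rewrite fN.
by congr (_ * integral _ _ _)%E; apply/seteqP; split => x /=; rewrite in_itv /= andbT.
Qed.

Lemma continuous_abel e : continuous (abel e).
Proof.
move=> x; apply: continuous_comp; last exact: continuous_expR.
by apply: cvgN; apply: cvgM; [exact: cvg_cst|exact: norm_continuous].
Qed.

Lemma abel_ge0 e x : 0 <= abel e x. Proof. exact: expR_ge0. Qed.

Lemma abel_le1 e x : 0 <= e -> abel e x <= 1.
Proof. by move=> e0; rewrite /abel -expR0 ler_expR oppr_le0 mulr_ge0. Qed.

Lemma integral_abel e y : 0 < e ->
  (\int[lebesgue_measure]_x (abel e x * (1 + cos (y * x)))%:E =
   (2 * (e^-1 + e / (e ^+ 2 + y ^+ 2)))%:E)%E.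
Proof.
move=> e0; rewrite integral_even.
- rewrite EFinM -(integral_abel_half y e0); apply: congr1.
  apply: eq_integral => x; rewrite inE /= in_itv /= andbT => x0.
  by rewrite /abel ger0_norm.
- by move=> x; rewrite mulr_ge0 ?abel_ge0// -lerBlDl sub0r cos_geN1.
- move=> x; apply: cvgM; first exact: continuous_abel.
  apply: cvgD; first exact: cvg_cst.
  exact: (continuous_of_is_derive (is_derive_coslin y)).
- by move=> x; rewrite /abel normrN mulrN cosN.
Qed.

Lemma integral_abel0 e : 0 < e ->
  (\int[lebesgue_measure]_x (abel e x)%:E = (2 / e)%:E)%E.
Proof.
move=> e0; have := integral_abel 0 e0.
under eq_integral do rewrite mul0r cos0 (_ : 1 + 1 = 2 :> R)// mulrC EFinM.
rewrite ge0_integralZl//; last 2 first.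
- by apply/measurable_EFinP; apply: continuous_measurable_fun; exact: continuous_abel.
- by move=> x _; rewrite lee_fin abel_ge0.
move=> h; apply: (@mule_cancelr _ _ _ 2 (ltr0n _ 2)); rewrite muleC h -EFinM.
by congr (_%:E); field; rewrite gt_eqF.
Qed.

Lemma integrable_abel e : 0 < e ->
  lebesgue_measure.-integrable setT (fun x : measurableTypeR R => (abel e x)%:E).
Proof.
move=> e0; apply/integrableP; split.
  by apply/measurable_EFinP; apply: continuous_measurable_fun; exact: continuous_abel.
under eq_integral do rewrite gee0_abs ?lee_fin ?abel_ge0//.
by rewrite integral_abel0// ltry.
Qed.

Lemma mp_oppR : mp lebesgue_measure lebesgue_measure
  (fun x : measurableTypeR R => - x : measurableTypeR R).
Proof.
split; first exact: measurable_funN.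
by move=> A mA; exact: lebesgue_measureN.
Qed.

Lemma cL1_abel_cis e y : 0 < e ->
  cL1 lebesgue_measure (fun x : measurableTypeR R => (abel e x)%:C * cis (- (x * y))).
Proof.
move=> e0; have := integrable_abel e0 => /integrableP[mh hi].
split.
  apply: cmeasM; first by apply: cmeas_real; exact/measurable_EFinP.
  by apply: cmeas_cis; apply: measurable_funN; apply: measurable_funM.
under eq_integral do rewrite cabsM cabs_cis mulr1 cabs_real.
exact: hi.
Qed.

Lemma fourier_abel e y : 0 < e ->
  cint lebesgue_measure (fun x : measurableTypeR R => (abel e x)%:C * cis (- (x * y)))
  = (2 * pi * pois e y)%:C.
Proof.
move=> e0; have l1 := cL1_abel_cis y e0.
have lr := cL1_Re l1; have li := cL1_Im l1.
pose f := fun x : measurableTypeR R => (abel e x)%:C * cis (- (x * y)).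
apply: complex_eq.
  change (Rintegral lebesgue_measure setT (fun x => complex.Re (f x)) = 2 * pi * pois e y).
  rewrite /f; have e1 x : complex.Re ((abel e x)%:C * cis (- (x * y))) = abel e x * (1 + cos (y * x)) - abel e x.
    by rewrite cReM /= mul0r subr0 cosN (mulrC x); ring.
  have e2 x : abel e x * (1 + cos (y * x)) = complex.Re ((abel e x)%:C * cis (- (x * y))) + abel e x.
    by rewrite e1; ring.
  under eq_Rintegral do rewrite e1.
  have i1 : lebesgue_measure.-integrable setT (fun x : measurableTypeR R => (abel e x * (1 + cos (y * x)))%:E).
    under eq_fun do rewrite e2 EFinD.
    by apply: integrableD => //; exact: integrable_abel.
  rewrite RintegralB//; last exact: integrable_abel.
  rewrite /Rintegral integral_abel// integral_abel0//= /pois.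
  have k0 : e ^+ 2 + y ^+ 2 != 0 by rewrite gt_eqF// sqD_gt0.
  have p0 : (pi : R) != 0 by rewrite gt_eqF// pi_gt0.
  have e2' : e != 0 by rewrite gt_eqF.
  by move: p0; generalize (pi : R) => P p0; field; rewrite ?e2' ?k0 ?p0.
change (Rintegral lebesgue_measure setT (fun x => complex.Im (f x)) = 0).
rewrite /f; have e1 x : complex.Im ((abel e x)%:C * cis (- (x * y))) = - (abel e x * sin (x * y)).
  by rewrite cImM /= mul0r addr0 sinN; ring.
have eN x : complex.Im ((abel e (- x))%:C * cis (- (- x * y))) = - complex.Im ((abel e x)%:C * cis (- (x * y))).
  by rewrite !e1 /abel normrN mulNr sinN; ring.
set I := Rintegral _ _ _.
(* The imaginary part is odd in [x], so reflecting the line changes the sign of its integral. *)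
suff : I = - I by move=> h; lra.
rewrite /I -[RHS]mulN1r -Rintegral_scale// /Rintegral; congr fine.
rewrite -[LHS](mp_int mp_oppR); last by have /integrableP[] := li.
by apply: eq_integral => x _; rewrite eN mulN1r.
Qed.

Lemma pois_ge0 e y : 0 < e -> 0 <= pois e y.
Proof. by move=> e0; rewrite !divr_ge0 ?pi_ge0 ?(ltW e0)// ltW// sqD_gt0. Qed.

Lemma is_derive_atan_scale e a y : 0 < e ->
  is_derive y (1 : R) (fun t => atan (e^-1 * (t - a)) / pi) (pois e (y - a)).
Proof.
move=> e0.
have d1 : is_derive y (1 : R) (fun t => e^-1 * (t - a)) e^-1.
  by apply: is_derive_eq; rewrite /GRing.scale /=; ring.
have d2 := @is_derive1_comp _ atan (fun t => e^-1 * (t - a)) y _ _ (is_derive1_atan _) d1.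
apply: is_derive_eq.
rewrite /GRing.scale /= mulr0 add0r /pois; have := sqD_gt0 (y - a) e0 => k0.
have p0 : (pi : R) != 0 by rewrite gt_eqF// pi_gt0.
have q0 : 1 + (e^-1 * (y - a)) ^+ 2 != 0 by rewrite gt_eqF// ltr_pwDl// sqr_ge0.
have e1 : e != 0 by rewrite gt_eqF.
have k1 : e ^+ 2 + (y - a) ^+ 2 != 0 by rewrite gt_eqF.
have -> : (1 + (e^-1 * (y - a)) ^+ 2) = (e ^+ 2 + (y - a) ^+ 2) / e ^+ 2 by field.
by move: p0; generalize (pi : R) => P p0; field; rewrite ?e1 ?k1 ?p0.
Qed.

Lemma continuous_pois e a : 0 < e -> continuous (fun y => pois e (y - a)).
Proof.
move=> e0 x; apply: cvgM; last exact: cvg_cst.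
apply: cvgM; first exact: cvg_cst.
apply: cvgV; first by rewrite gt_eqF// sqD_gt0.
apply: cvgD; first exact: cvg_cst.
apply: (@continuous_comp _ _ _ (fun y => y - a) (fun y => y ^+ 2)); last exact: exprn_continuous.
by apply: cvgB; [exact: cvg_id|exact: cvg_cst].
Qed.

Lemma integral_pois e : 0 < e -> (\int[lebesgue_measure]_x (pois e x)%:E = 1)%E.
Proof.
move=> e0.
have -> : pois e = fun x => pois e (x - 0) by apply/funext => x; rewrite subr0.
rewrite integral_even; last 3 first.
- by move=> x; rewrite pois_ge0.
- exact: continuous_pois.
- by move=> x; rewrite !subr0 /pois sqrrN.
rewrite (@FTC0y _ _ 2^-1 (fun y => is_derive_atan_scale 0 y e0)).
- rewrite subrr mulr0 atan0 mul0r subr0 -EFinM; congr (_%:E); lra.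
- exact: continuous_pois.
- by move=> x _; rewrite pois_ge0.
have -> : 2^-1 = pi / 2 / pi :> R by rewrite mulrAC divff ?mul1r// gt_eqF// pi_gt0.
have ei : 0 < e^-1 by rewrite invr_gt0.
have -> : (fun x => atan (e^-1 * (x - 0)) / pi) = (fun x => atan (e^-1 * x) / pi).
  by apply/funext => x; rewrite subr0.
apply: cvgM; last exact: cvg_cst.
apply: (@cvg_comp _ _ _ (fun x => e^-1 * x) atan _ (pinfty_nbhs R)); last exact: cvgy_atan.
exact: gt0_cvgMry.
Qed.

(** Makes the Poisson average of an interval explicit, so that its limit as [e] tends to 0 can be
    read off from the arctangent. *)
Lemma integral_pois_itv e a b x : 0 < e -> a <= b ->
  (\int[lebesgue_measure]_y (pois e (x - y) * \1_(`]a, b]%classic : set R) y)%:E =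
   (atan (e^-1 * (b - x)) / pi - atan (e^-1 * (a - x)) / pi)%:E)%E.
Proof.
move=> e0 ab; rewrite -(FTC_seg ab (fun y => is_derive_atan_scale x y e0) (continuous_pois (a := x) e0)).
rewrite -integral_itv_obnd_cbnd; last first.
  apply/measurable_EFinP; apply: measurable_funTS.
  by apply: continuous_measurable_fun; exact: continuous_pois.
rewrite [RHS]integral_mkcond; apply: eq_integral => y _.
rewrite patchE indicE; case: ifP => h; last by rewrite mulr0.
by rewrite mulr1 /pois -[x - y]opprB sqrrN.
Qed.

Lemma cvg_atan_inv c : c != 0 ->
  atan ((n.+1%:R : R) * c) / pi @[n --> \oo] --> (if 0 < c then 2^-1 else - 2^-1 : R).
Proof.
have pos (k : R) : 0 < k -> atan ((n.+1%:R : R) * k) / pi @[n --> \oo] --> (2^-1 : R).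
  move=> k0; have -> : 2^-1 = pi / 2 / pi :> R by rewrite mulrAC divff ?mul1r// gt_eqF// pi_gt0.
  apply: cvgM; last exact: cvg_cst.
  apply: (@cvg_comp _ _ _ (fun n => (n.+1%:R : R) * k) atan _ (pinfty_nbhs R)); last exact: cvgy_atan.
  under eq_fun do rewrite mulrC.
  apply: (@cvg_comp _ _ _ (fun n => (n.+1%:R : R)) (fun z => k * z) _ (pinfty_nbhs R)); last exact: gt0_cvgMry.
  apply/cvgryPge => A.
  near=> n; rewrite (le_trans (ler_norm A))// (le_trans (ltW (truncnS_gt _)))//.
  by rewrite ler_nat; near: n; exists (Num.truncn `|A|).
rewrite neq_lt => /orP[c0|c0]; last by rewrite c0; exact: pos.
rewrite ltNge (ltW c0) /= -[c]opprK.
under eq_fun do rewrite mulrN atanN mulNr.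
by apply: cvgN; apply: pos; rewrite oppr_gt0.
Unshelve. all: by end_near. Qed.

End one_dim.

(** * Products of one-dimensional functions, and functions determined by boxes *)

Section tensor_products.
Context {R : realType}.

Definition tprod d (f : 'I_d -> R -> R[i]) (x : euclid R d) : R[i] :=
  \prod_(i < d) f i (tnth x i).

Lemma tprod_consR d (f : 'I_d.+1 -> R -> R[i]) a x :
  tprod f (consR (a, x)) = f ord0 a * tprod (fun j => f (lift ord0 j)) x.
Proof.
rewrite /tprod big_ord_recl; congr (_ * _).
by apply: eq_bigr => i _; rewrite tnth_consRS.
Qed.

Lemma cL1_cint_tprod d (f : 'I_d -> R -> R[i]) :
  (forall i, cL1 lebesgue_measure (f i : measurableTypeR R -> R[i])) ->
  cL1 (leb d) (tprod f) /\
  cint (leb d) (tprod f) = \prod_(i < d) cint lebesgue_measure (f i : measurableTypeR R -> R[i]).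
Proof.
elim: d f => [|d IH] f lf.
  have -> : tprod f = fun=> 1 by apply/funext => x; rewrite /tprod big_ord0.
  rewrite big_ord0; split.
    split; first exact: cmeas_cst.
    by rewrite /= integral_dirac// diracT mul1e ltry.
  rewrite (cint_real _ (fun=> 1)) /Rintegral /= integral_dirac//.
  by rewrite diracT mul1e.
have [l1 e1] := IH _ (fun j => lf (lift ord0 j)).
pose g (z : measurableTypeR R * euclid R d) := f ord0 z.1 * tprod (fun j => f (lift ord0 j)) z.2.
have mg : cmeas g.
  apply: cmeasM; first by apply: (cmeas_comp (proj1 (lf ord0))).
  by apply: (cmeas_comp (proj1 l1)).
have lg : cL1 (lebesgue_measure \x leb d)%E g.
  apply: cL1_prod => //.
  have m1 := measurable_EFin_cabs (proj1 (lf ord0)).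
  have m2 := measurable_EFin_cabs (proj1 l1).
  under eq_integral => x _.
    under eq_integral => y _ do rewrite /g /= cabsM EFinM.
    rewrite ge0_integralZl//; last 2 first.
    - by move=> y _; rewrite lee_fin cabs_ge0.
    - by rewrite lee_fin cabs_ge0.
    over.
  rewrite ge0_integralZr//; last 2 first.
  - by move=> y _; rewrite lee_fin cabs_ge0.
  - by apply: integral_ge0 => y _; rewrite lee_fin cabs_ge0.
  apply: lte_mul_pinfty; [|by have := cL1_cabs (lf ord0); exact: integrable_fin_num|by case: l1].
  by apply: integral_ge0 => y _; rewrite lee_fin cabs_ge0.
have gE x : tprod f x = g (uncons x).
  by rewrite -{1}(unconsK x); case: (uncons x) => a y; rewrite tprod_consR.
have -> : tprod f = fun x => g (uncons x) by apply/funext.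
split; first exact: (mp_cL1 (mp_uncons d) lg).
rewrite (mp_cint (mp_uncons d) mg) -cint_fubini1// big_ord_recl -e1.
transitivity (cint lebesgue_measure (fun x : measurableTypeR R => cint (leb d) (tprod (fun j => f (lift ord0 j))) * f ord0 x)).
  by apply: eq_cint => a; rewrite /g /= cintZ// mulrC.
by rewrite cintZ// mulrC.
Qed.

Lemma cis_sum n (F : 'I_n -> R) : cis (\sum_(i < n) F i) = \prod_(i < n) cis (F i).
Proof.
elim: n F => [|n IH] F; first by rewrite !big_ord0 cis0.
by rewrite !big_ord_recl cisD IH.
Qed.

(** A product over the coordinates rather than a radial weight, so that its transform factors
    ([cL1_cint_tprod]); [kern e] is that transform up to a constant. *)
Definition phi d e (x : euclid R d) : R := \prod_(i < d) abel e (tnth x i).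
Definition kern d e (x : euclid R d) : R := \prod_(i < d) pois e (tnth x i).

Lemma phi_ge0 d e (x : euclid R d) : 0 <= phi e x.
Proof. by apply: prodr_ge0 => i _; exact: abel_ge0. Qed.

Lemma phi_le1 d e (x : euclid R d) : 0 <= e -> phi e x <= 1.
Proof.
move=> e0; apply: (@le_trans _ _ (\prod_(i < d) (1 : R))); last by rewrite big1.
by apply: ler_prod => i _; rewrite abel_ge0 abel_le1.
Qed.

Lemma kern_ge0 d e (x : euclid R d) : 0 < e -> 0 <= kern e x.
Proof. by move=> e0; apply: prodr_ge0 => i _; exact: pois_ge0. Qed.

Lemma kernN d e (x : euclid R d) : kern e (negv x) = kern e x.
Proof. by apply: eq_bigr => i _; rewrite tnth_mktuple /pois sqrrN. Qed.

Lemma kernB d e (x y : euclid R d) : kern e (subv x y) = kern e (subv y x).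
Proof.
by rewrite -kernN; congr kern; apply: eq_from_tnth => i; rewrite !tnth_mktuple opprB.
Qed.

Lemma phiN d e (x : euclid R d) : phi e (negv x) = phi e x.
Proof. by apply: eq_bigr => i _; rewrite tnth_mktuple /abel normrN. Qed.

Lemma measurable_prod_fun dT (T : measurableType dT) d (h : 'I_d -> T -> R) :
  (forall i, measurable_fun setT (h i)) ->
  measurable_fun setT (fun x => \prod_(i < d) h i x).
Proof.
elim: d h => [|d IH] h mh.
  by under eq_fun do rewrite big_ord0; exact: measurable_cst.
under eq_fun do rewrite big_ord_recl.
by apply: measurable_funM => //; exact: IH.
Qed.

Lemma measurable_phi d e : measurable_fun setT (@phi d e).
Proof.
apply: measurable_prod_fun => i.
apply: (measurableT_comp (f := abel e : measurableTypeR R -> R)); last exact: measurable_tnth.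
by apply: continuous_measurable_fun; exact: continuous_abel.
Qed.

Lemma measurable_pois e : 0 < e -> measurable_fun setT (pois e : measurableTypeR R -> R).
Proof.
move=> e0; apply: continuous_measurable_fun.
have := continuous_pois (a := 0) e0.
by under eq_fun do rewrite subr0.
Qed.

Lemma measurable_kern d e : 0 < e -> measurable_fun setT (@kern d e).
Proof.
move=> e0; apply: measurable_prod_fun => i.
apply: (measurableT_comp (measurable_pois e0)); exact: measurable_tnth.
Qed.

Lemma real_prod n (F : 'I_n -> R) : (\prod_(i < n) F i)%:C = \prod_(i < n) (F i)%:C.
Proof. exact: rmorph_prod. Qed.

Lemma cL1_real dT (T : measurableType dT) (mu : {measure set T -> \bar R}) (h : T -> R) :
  (forall x, 0 <= h x) -> mu.-integrable setT (fun x => (h x)%:E) -> cL1 mu (fun x => (h x)%:C).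
Proof.
move=> h0 /integrableP[mh ih]; split; first by apply: cmeas_real; exact/measurable_EFinP.
by under eq_integral do rewrite cabs_real.
Qed.

Lemma cL1_phi_cis d e (y : euclid R d) : 0 < e ->
  cL1 (leb d) (fun x => (phi e x)%:C * cis (- dot x y)) /\
  cint (leb d) (fun x => (phi e x)%:C * cis (- dot x y)) = ((2 * pi) ^+ d * kern e y)%:C.
Proof.
move=> e0.
have E : (fun x => (phi e x)%:C * cis (- dot x y)) =
  tprod (fun i t => (abel e t)%:C * cis (- (t * tnth y i))).
  apply/funext => x; rewrite /phi real_prod /dot -sumrN cis_sum -big_split /=.
  by apply: eq_bigr.
have [l1 e1] := cL1_cint_tprod (fun i => cL1_abel_cis (tnth y i) e0).
rewrite E e1; split => //.
under eq_bigr do rewrite fourier_abel//.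
rewrite -real_prod big_split /= /kern; congr ((_ * _)%:C).
by rewrite prodr_const card_ord.
Qed.

Lemma cL1_phi d e : 0 < e -> cL1 (leb d) (fun x => (phi e x)%:C).
Proof.
move=> e0; have [l1 _] := cL1_phi_cis (zerov d) e0.
suff -> : (fun x : euclid R d => (phi e x)%:C) = (fun x => (phi e x)%:C * cis (- dot x (zerov d))) by [].
apply/funext => x; rewrite (_ : dot x (zerov d) = 0) ?oppr0 ?cis0 ?mulr1//.
by apply: big1 => i _; rewrite tnth_mktuple mulr0.
Qed.

Lemma cL1_pois e : 0 < e -> cL1 lebesgue_measure (fun x : measurableTypeR R => (pois e x)%:C).
Proof.
move=> e0; apply: cL1_real; first by move=> x; exact: pois_ge0.
apply/integrableP; split; first by apply/measurable_EFinP; exact: measurable_pois.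
under eq_integral do rewrite gee0_abs ?lee_fin ?pois_ge0//.
by rewrite integral_pois// ltry.
Qed.

Lemma integral_kern d e : 0 < e -> (\int[leb d]_x (kern e x)%:E = 1)%E.
Proof.
move=> e0; have [l1 e1] := cL1_cint_tprod (fun (i : 'I_d) => cL1_pois e0).
have E : tprod (fun (i : 'I_d) x => (pois e x)%:C) = fun x => (kern e x)%:C.
  by apply/funext => x; rewrite /kern real_prod.
rewrite E in l1 e1.
have := cL1_Re l1 => /= /(integrable_fin_num measurableT) fin.
rewrite -(fineK fin); congr (_%:E); apply: (@complexI R).
transitivity (cint (leb d) (fun x => (kern e x)%:C)); first by rewrite cint_real.
rewrite e1 big1// => i _; rewrite (cint_real _ (pois e : measurableTypeR R -> R)).
by rewrite /Rintegral integral_pois.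
Qed.

Lemma integral_kernl d e (v : euclid R d) : 0 < e -> (\int[leb d]_x (kern e (subv v x))%:E = 1)%E.
Proof.
move=> e0; rewrite -[RHS](integral_kern d e0).
rewrite -[RHS](mp_ge0 (mp_subvl v) (f := fun x => (kern e x)%:E))//.
  by apply/measurable_EFinP; exact: measurable_kern.
by move=> x; rewrite lee_fin kern_ge0.
Qed.

Lemma integral_kernr d e (v : euclid R d) : 0 < e -> (\int[leb d]_x (kern e (subv x v))%:E = 1)%E.
Proof. by move=> e0; under eq_integral do rewrite kernB; exact: integral_kernl. Qed.

(** Half-open boxes are stable under intersection and generate the measurable sets, as Dynkin's
    lemma requires. *)
Definition bx d (a b : euclid R d) : set (euclid R d) :=
  [set x | forall i, tnth a i < tnth x i <= tnth b i].

Lemma indic_bx d (a b x : euclid R d) :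
  (\1_(bx a b) x : R) = \prod_(i < d) \1_(`]tnth a i, tnth b i]%classic : set R) (tnth x i).
Proof.
rewrite indicE; case: (boolP (x \in bx a b)) => h.
  rewrite big1// => i _; move/set_mem: h => /(_ i) h.
  by rewrite indicE mem_set// in_itv.
have [i Hi] : exists i, ~~ (tnth a i < tnth x i <= tnth b i).
  apply/not_existsP => nh; move/negP: h; apply; apply/mem_set => i.
  by have /negP := nh i; rewrite negbK.
rewrite (bigD1 i)//= indicE memNset ?mul0r//=.
by rewrite in_itv /=; exact/negP.
Qed.

Lemma measurable_bx d (a b : euclid R d) : measurable (bx a b).
Proof.
apply/(@measurable_indicP _ _ R).
have -> : \1_(bx a b) = fun x => \prod_(i < d) \1_(`]tnth a i, tnth b i]%classic : set R) (tnth x i) :> R.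
  by apply/funext => x; rewrite indic_bx.
apply: measurable_prod_fun => i.
apply: (measurableT_comp (f := \1_(`]tnth a i, tnth b i]%classic : set R) : measurableTypeR R -> R)); last exact: measurable_tnth.
by apply: measurable_indic; exact: measurable_itv.
Qed.

Lemma bxI d (a b a' b' : euclid R d) : bx a b `&` bx a' b' =
  bx [tuple Num.max (tnth a i) (tnth a' i) | i < d] [tuple Num.min (tnth b i) (tnth b' i) | i < d].
Proof.
apply/seteqP; split => x /=.
  move=> [h1 h2] i; rewrite !tnth_mktuple gt_max le_min.
  by have /andP[-> ->] := h1 i; have /andP[-> ->] := h2 i.
move=> h; split => i; have := h i; rewrite !tnth_mktuple gt_max le_min;
  by move=> /andP[/andP[? ?] /andP[? ?]]; apply/andP.
Qed.

Definition cube d (r : R) : set (euclid R d) := bx [tuple - r | i < d] [tuple r | i < d].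

Arguments cube d r : clear implicits.

Lemma cube_cover d (x : euclid R d) : exists n : nat, cube d n%:R x.
Proof.
exists (Num.truncn (\sum_(i < d) `|tnth x i|)).+1 => i; rewrite !tnth_mktuple.
have h : `|tnth x i| < (Num.truncn (\sum_(i < d) `|tnth x i|)).+1%:R.
  apply: le_lt_trans (truncnS_gt _).
  by rewrite (bigD1 i)//= lerDl sumr_ge0.
by move: h; rewrite ltr_norml => /andP[-> /ltW ->].
Qed.

Lemma leb_bx_lty d (a b : euclid R d) : (leb d (bx a b) < +oo)%E.
Proof.
pose r := \sum_(i < d) (`|tnth a i| + `|tnth b i|).
have r0 : 0 <= r by apply: sumr_ge0 => i _; rewrite addr_ge0.
apply: (@le_lt_trans _ _ (leb d (boxr d r))); last by rewrite leb_boxr// ltry.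
apply: le_measure; rewrite ?inE; [exact: measurable_bx|exact: measurable_boxr|].
move=> x h i; have /andP[h1 h2] := h i.
have : `|tnth a i| + `|tnth b i| <= r.
  by rewrite /r (bigD1 i)//= lerDl sumr_ge0// => j _; rewrite addr_ge0.
apply: le_trans; rewrite ler_norml; apply/andP; split.
  by apply: le_trans (ltW h1); rewrite lerNl (le_trans (ler_norm _))// normrN lerDl.
by apply: (le_trans h2); apply: (le_trans (ler_norm _)); rewrite lerDr.
Qed.

(** The sigma-algebra of tuples is generated by slabs, the preimages of intervals under one
    coordinate; a slab is a countable union of boxes. *)
Lemma measurable_sigma_bx d :
  @measurable _ (euclid R d) = <<s [set B | exists a b, B = bx a b] >>.
Proof.
set G := [set B | _]; apply/seteqP; split; last first.
  apply: smallest_sub; first exact: sigma_algebra_measurable.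
  by move=> B [a [b ->]]; exact: measurable_bx.
apply: smallest_sub; first exact: smallest_sigma_algebra.
move=> A; rewrite -bigcup_seq /= => -[i _] [B mB <-]; rewrite setTI.
have H : sigma_algebra setT [set B : set R | <<s G >> ((fun x : euclid R d => tnth x i) @^-1` B)].
  split => /=.
  - by rewrite preimage_set0; exact: sigma_algebra0.
  - move=> C hC; rewrite setTD preimage_setC -setTD; exact: sigma_algebraCD.
  - move=> F hF; rewrite preimage_bigcup; exact: sigma_algebra_bigcup.
move: B mB; apply: smallest_sub => // B [[a b] _ <-] /=.
have -> : (fun x : euclid R d => tnth x i) @^-1` `]a, b]%classic =
  \bigcup_n bx [tuple if j == i then a else - n%:R | j < d] [tuple if j == i then b else n%:R | j < d].
  apply/seteqP; split => x /=; rewrite in_itv /=.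
    move=> xab; have [n hn] := cube_cover x; exists n => // j.
    by rewrite !tnth_mktuple; case: eqVneq => [->//|_]; have := hn j; rewrite !tnth_mktuple.
  by move=> [n _ /(_ i)]; rewrite !tnth_mktuple eqxx.
by apply: sigma_algebra_bigcup => n; apply: sub_sigma_algebra; do 2 eexists.
Qed.

Lemma adde_cancell (x a b : \bar R) : x \is a fin_num -> (x + a = x + b -> a = b)%E.
Proof. by move=> fx /(congr1 (fun z => z - x)%E); rewrite ![(x + _)%E]addeC !addeK. Qed.

(** On a fixed cube both functions are integrable, and Dynkin's lemma extends the equality of
    integrals from boxes to all measurable subsets of that cube; countably many cubes cover the
    space. *)
Lemma ae_eq_of_bx_real d (g1 g2 : euclid R d -> R) :
  (forall a b, (leb d).-integrable (bx a b) (EFin \o g1)) ->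
  (forall a b, (leb d).-integrable (bx a b) (EFin \o g2)) ->
  (forall a b, \int[leb d]_(x in bx a b) (g1 x)%:E = \int[leb d]_(x in bx a b) (g2 x)%:E)%E ->
  {ae leb d, forall x, g1 x = g2 x}.
Proof.
move=> i1 i2 e12.
have loc n : {ae leb d, forall x, cube d n%:R x -> g1 x = g2 x}.
  have mD : measurable (cube d n%:R) by exact: measurable_bx.
  have iS (g : euclid R d -> R) E : (forall a b, (leb d).-integrable (bx a b) (EFin \o g)) ->
     measurable E -> E `<=` cube d n%:R -> (leb d).-integrable E (EFin \o g).
    by move=> ig mE ED; apply: (integrableS mD mE ED); exact: ig.
  have P S : measurable S -> (\int[leb d]_(x in cube d n%:R `&` S) (g1 x)%:E =
      \int[leb d]_(x in cube d n%:R `&` S) (g2 x)%:E)%E.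
    rewrite {1}measurable_sigma_bx; move: S.
    apply: (dynkin_induction (measurable_sigma_bx d)).
    - by move=> A B [a [b ->]] [a' [b' ->]]; rewrite bxI; do 2 eexists.
    - by rewrite setIT; exact: e12.
    - by move=> B [a [b ->]]; rewrite /cube bxI; exact: e12.
    - move=> S mS PS; rewrite -setDE.
      have mDS : measurable (cube d n%:R `&` S) by exact: measurableI.
      have mDC : measurable (cube d n%:R `\` S) by exact: measurableD.
      have split g : (forall a b, (leb d).-integrable (bx a b) (EFin \o g)) ->
        (\int[leb d]_(x in cube d n%:R) (g x)%:E = \int[leb d]_(x in cube d n%:R `&` S) (g x)%:E +
          \int[leb d]_(x in cube d n%:R `\` S) (g x)%:E)%E.
        move=> ig; rewrite -integral_setU//.
        + by rewrite setUIDK.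
        + by rewrite setUIDK; exact: measurable_int (ig _ _).
        + by apply/disj_setPS => x [[_ ?] [_ /(_ _)]].
      have fin g : (forall a b, (leb d).-integrable (bx a b) (EFin \o g)) ->
         (\int[leb d]_(x in cube d n%:R `&` S) (g x)%:E)%E \is a fin_num.
        by move=> ig; apply: integrable_fin_num => //; apply: iS => //; exact: subIsetl.
      have := e12 [tuple - n%:R | i < d] [tuple n%:R | i < d].
      rewrite -/(cube d n%:R) (split _ i1) (split _ i2) PS.
      by apply: adde_cancell; exact: fin.
    - move=> F mF tF PF; rewrite setI_bigcupr.
      have tF' : trivIset setT (fun k => cube d n%:R `&` F k).
        exact: trivIset_setIl.
      have mF' k : measurable (cube d n%:R `&` F k) by exact: measurableI.
      have mU : measurable (\bigcup_k (cube d n%:R `&` F k)) by exact: bigcupT_measurable.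
      have sU : \bigcup_k (cube d n%:R `&` F k) `<=` cube d n%:R.
        by move=> x [k _ []].
      rewrite !integral_bigcup//; try exact: iS.
      by apply: eq_eseriesr => k _; exact: PF.
  have hE E : E `<=` cube d n%:R -> measurable E ->
      (\int[leb d]_(x in E) (EFin \o g1) x = \int[leb d]_(x in E) (EFin \o g2) x)%E.
    move=> ED mE; have := P E mE.
    by rewrite setIidr.
  have h : ae_eq (leb d) (cube d n%:R) (EFin \o g1) (EFin \o g2).
    apply: integral_ae_eq => //; first exact: i1.
    by apply: (measurable_int (leb d)); exact: i2.
  by move: h; apply: filterS => x h /h [].
have : \forall x \ae leb d, forall n : nat, cube d n%:R x -> g1 x = g2 x.
  apply/ae_foralln => n; exact: loc.
apply: filterS => x h; have [n hn] := cube_cover x; exact: h hn.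
Qed.

End tensor_products.

Arguments cube {R} d r.

(** * The L^2 Fourier transform *)

Section fourier_L2.
Context {R : realType}.

Lemma tends0_dominated d (T : measurableType d) (mu : {measure set T -> \bar R})
    (h : nat -> T -> R) (K : T -> R) : (forall n, measurable_fun setT (h n)) ->
  measurable_fun setT K -> (\int[mu]_x (K x)%:E < +oo)%E ->
  (forall n x, 0 <= h n x <= K x) -> {ae mu, forall x, h n x @[n --> \oo] --> (0 : R)} ->
  tends0 (fun n => \int[mu]_x (h n x)%:E)%E.
Proof.
move=> mh mK iK hK h0.
have K0 x : 0 <= K x by have /andP[a b] := hK 0%N x; exact: le_trans b.
apply/tends0P; first by move=> n; apply: integral_ge0 => x _; rewrite lee_fin; case/andP: (hK n x).
have mz : measurable_fun setT (fun _ : T => 0%E : \bar R) by exact: measurable_cst.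
have mn n : measurable_fun setT (fun x => (h n x)%:E) by exact/measurable_EFinP.
have h1 : {ae mu, forall x, setT x -> (h n x)%:E @[n --> \oo] --> (0 : \bar R)}.
  by apply: filterS h0 => x hx _; apply: cvg_EFin hx; near=> n.
have h2 : mu.-integrable setT (EFin \o K).
  apply/integrableP; split; first exact/measurable_EFinP.
  by under eq_integral => x _ do rewrite [(EFin \o K) x]/= gee0_abs ?lee_fin ?K0//.
have h3 : {ae mu, forall x n, setT x -> (`|(h n x)%:E| <= (EFin \o K) x)%E}.
  by apply: aeW => x n _; case/andP: (hK n x) => a b; rewrite gee0_abs lee_fin.
have [_ _] := dominated_convergence measurableT mn mz h1 h2 h3.
by rewrite integral0.
Unshelve. all: by end_near. Qed.

Definition indc d (a b x : euclid R d) : R[i] := (\1_(bx a b) x)%:C.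

Lemma cmeas_indc d (a b : euclid R d) : cmeas (indc a b).
Proof. by apply: cmeas_real; apply: measurable_indic; exact: measurable_bx. Qed.

Lemma cabs_indc d (a b x : euclid R d) : cabs (indc a b x) = \1_(bx a b) x.
Proof. by rewrite cabs_real ger0_norm// indicE. Qed.

Lemma indc_sq d (a b x : euclid R d) : cabs (indc a b x) ^+ 2 = \1_(bx a b) x.
Proof. by rewrite cabs_indc indicE; case: (_ \in _); rewrite ?expr1n ?expr0n. Qed.

Lemma n2_indc d (a b : euclid R d) : n2 (leb d) (indc a b) = leb d (bx a b).
Proof.
rewrite /n2; under eq_integral do rewrite indc_sq.
by rewrite integral_indic ?setIT//; exact: measurable_bx.
Qed.

Lemma cL2_indc d (a b : euclid R d) : cL2 (leb d) (indc a b).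
Proof. by split; [exact: cmeas_indc|rewrite n2_indc leb_bx_lty]. Qed.

Lemma cL1_mul dT (T : measurableType dT) (mu : {measure set T -> \bar R}) (f g : T -> R[i]) :
  cL2 mu f -> cL2 mu g -> cL1 mu (fun x => f x * g x).
Proof.
move=> [mf f2] [mg g2].
apply: (@le_cL1 _ _ _ _ _ (fun x => (cabs (f x) ^+ 2)%:E + (cabs (g x) ^+ 2)%:E)%E).
- exact: cmeasM.
- by apply: emeasurable_funD; exact: measurable_EFin_cabs2.
- move=> x; rewrite lee_fin cabsM.
  by have := sqr_ge0 (cabs (f x) - cabs (g x)); have := mulr_ge0 (cabs_ge0 (f x)) (cabs_ge0 (g x)); nra.
rewrite ge0_integralD//; last 4 first.
- by move=> x _; rewrite lee_fin sqr_ge0.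
- exact: measurable_EFin_cabs2.
- by move=> x _; rewrite lee_fin sqr_ge0.
- exact: measurable_EFin_cabs2.
exact: lte_add_pinfty.
Qed.

Lemma cabs_cint_mul_le dT (T : measurableType dT) (mu : {measure set T -> \bar R}) (f g : T -> R[i]) :
  cmeas f -> cmeas g ->
  ((cabs (cint mu (fun x => (f x * g x)%R)) ^+ 2)%:E <= n2 mu f * n2 mu g)%E.
Proof.
move=> mf mg.
have h := le_cabs_cint mu (cmeasM mf mg).
apply: le_trans (cauchy_schwarz mu (measurable_cabs mf) (measurable_cabs mg)).
have E : (\int[mu]_x (cabs (f x * g x))%:E = \int[mu]_x `|cabs (f x) * cabs (g x)|%:E)%E.
  by apply: eq_integral => x _; rewrite cabsM ger0_norm// mulr_ge0// cabs_ge0.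
rewrite expr2 EFinM -E.
by apply: lee_pmul; rewrite ?lee_fin ?cabs_ge0.
Qed.

Lemma ae_eq_of_boxes d (g1 g2 : euclid R d -> R[i]) : cmeas g1 -> cmeas g2 ->
  (forall a b, cL1 (leb d) (fun x => indc a b x * g1 x)) ->
  (forall a b, cL1 (leb d) (fun x => indc a b x * g2 x)) ->
  (forall a b, cint (leb d) (fun x => indc a b x * g1 x) =
     cint (leb d) (fun x => indc a b x * g2 x)) ->
  {ae leb d, forall x, g1 x = g2 x}.
Proof.
move=> m1 m2 l1 l2 e12.
have ERe a b (g : euclid R d -> R[i]) x : complex.Re (indc a b x * g x) = \1_(bx a b) x * complex.Re (g x).
  by rewrite cReM /= mul0r subr0.
have EIm a b (g : euclid R d -> R[i]) x : complex.Im (indc a b x * g x) = \1_(bx a b) x * complex.Im (g x).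
  by rewrite cImM /= mul0r addr0.
have iR (h : euclid R d -> R) a b : (leb d).-integrable setT (fun x => (\1_(bx a b) x * h x)%:E) ->
    (leb d).-integrable (bx a b) (EFin \o h).
  move=> ih; have mB : measurable (bx a b) by exact: measurable_bx.
  apply/(integrable_mkcond (EFin \o h) mB).
  apply: eq_integrable ih => // x _.
  by rewrite patchE /= indicE; case: ifP => _; rewrite ?mul1r ?mul0r.
have iE (h : euclid R d -> R) a b : (\int[leb d]_(x in bx a b) (h x)%:E = \int[leb d]_x (\1_(bx a b) x * h x)%:E)%E.
  rewrite integral_mkcond; apply: eq_integral => x _.
  by rewrite patchE /= indicE; case: ifP => _; rewrite ?mul1r ?mul0r.
have key (pr : R[i] -> R) : 
   (forall (a b : euclid R d) (g : euclid R d -> R[i]) x, pr (indc a b x * g x) = \1_(bx a b) x * pr (g x)) ->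
   (forall (a b : euclid R d) (g : euclid R d -> R[i]), cL1 (leb d) (fun x => indc a b x * g x) ->
      (leb d).-integrable setT (fun x => (pr (indc a b x * g x))%:E)) ->
   (forall a b, Rintegral (leb d) setT (fun x => pr (indc a b x * g1 x)) =
      Rintegral (leb d) setT (fun x => pr (indc a b x * g2 x))) ->
   {ae leb d, forall x, pr (g1 x) = pr (g2 x)}.
  move=> E L e; apply: ae_eq_of_bx_real => a b.
  - apply: iR; have := L a b _ (l1 a b); apply: eq_integrable => // x _.
 by rewrite -E.
  - apply: iR; have := L a b _ (l2 a b); apply: eq_integrable => // x _.
 by rewrite -E.
  rewrite !iE; under eq_integral do rewrite -E.
  under [RHS]eq_integral do rewrite -E.
  rewrite -[LHS]fineK; last exact: integrable_fin_num (L a b _ (l1 a b)).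
  rewrite -[RHS]fineK; last exact: integrable_fin_num (L a b _ (l2 a b)).
  congr (_%:E); exact: e.
have hR := key (@complex.Re R) ERe (fun a b g h => cL1_Re h) (fun a b => congr1 (@complex.Re R) (e12 a b)).
have hI := key (@complex.Im R) EIm (fun a b g h => cL1_Im h) (fun a b => congr1 (@complex.Im R) (e12 a b)).
by apply: filterS2 hR hI => x; exact: complex_eq.
Qed.

(** Each arctangent tends to plus or minus 1/2 according to the side on which [y] lies. At an
    endpoint of a nonempty interval the limit would be 1/2, hence the two exclusions. *)
Lemma cvg_pois_itv a b y : y != a -> y != b ->
  Rintegral lebesgue_measure setT
    (fun x : measurableTypeR R => pois (n.+1%:R^-1) (y - x) * \1_(`]a, b]%classic : set R) x)
  @[n --> \oo] --> (\1_(`]a, b]%classic : set R) y : R).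
Proof.
move=> ya yb; have [ab|ba] := leP a b; last first.
  have e x : (\1_(`]a, b]%classic : set R) x : R) = 0.
    by rewrite set_itv_ge ?indic0// bnd_simp -leNgt ltW.
  rewrite e; apply: cvg_near_cst; near=> n.
  by rewrite /Rintegral; under eq_integral do rewrite e mulr0; rewrite integral0.
have E n : Rintegral lebesgue_measure setT
    (fun x : measurableTypeR R => pois (n.+1%:R^-1) (y - x) * \1_(`]a, b]%classic : set R) x) =
   atan (n.+1%:R * (b - y)) / pi - atan (n.+1%:R * (a - y)) / pi.
  by rewrite /Rintegral integral_pois_itv ?invr_gt0// invrK.
under eq_fun do rewrite E.
have by0 : b - y != 0 by rewrite subr_eq0 eq_sym.
have ay0 : a - y != 0 by rewrite subr_eq0 eq_sym.
suff -> : (\1_(`]a, b]%classic : set R) y : R) =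
  (if 0 < b - y then 2^-1 else - 2^-1) - (if 0 < a - y then 2^-1 else - 2^-1).
  exact: cvgB (cvg_atan_inv by0) (cvg_atan_inv ay0).
rewrite indicE !subr_gt0.
case: (ltrgtP y a) ya => // ya _; case: (ltrgtP y b) yb => // yb _.
- by rewrite memNset ?subrr//= in_itv /= => /andP[+ _]; rewrite ltNge ltW.
- by have := lt_trans (le_lt_trans ab yb) ya; rewrite ltxx.
- by rewrite mem_set /= ?in_itv /= ?ya ?ltW//; lra.
- by rewrite memNset /= ?in_itv /= ?subrr// => /andP[_]; rewrite leNgt yb.
Unshelve. all: by end_near. Qed.

Lemma null_hyperplane d (i : 'I_d) (c : R) : {ae leb d, forall x, tnth x i != c}.
Proof.
have mA e (j : 'I_e) : measurable [set x : euclid R e | tnth x j = c].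
  rewrite -[X in measurable X]setTI.
  by apply: (@measurable_tnth _ (measurableTypeR R) _ j measurableT [set c]); exact: measurable_set1.
have n0 : leb d [set x | tnth x i = c] = 0%E.
  elim: d i => [[]//|d IH] i.
  rewrite -(proj2 (mp_consR d) _ (mA _ i)).
  case: (unliftP ord0 i) => [j|] ->.
    have -> : @consR R d @^-1` [set x | tnth x (lift ord0 j) = c] = setT `*` [set x | tnth x j = c].
      by apply/seteqP; split => -[a x] /=; rewrite tnth_consRS// => -[].
    by apply: etrans (product_measure1E lebesgue_measure (leb d) measurableT (mA _ j)) _; rewrite IH mule0.
  have -> : @consR R d @^-1` [set x | tnth x ord0 = c] = [set c] `*` setT.
    by apply/seteqP; split => -[a x] /=; rewrite tnth_consR0// => -[].
  have mc : measurable [set c : measurableTypeR R] by exact: measurable_set1.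
  apply: etrans (product_measure1E lebesgue_measure (leb d) mc measurableT) _.
  rewrite -[RHS](mul0e (leb d setT)); congr (_ * _)%E; exact: lebesgue_measure_set1.
by exists [set x | tnth x i = c]; split; [exact: mA|exact: n0|] => x /= /negP; rewrite negbK => /eqP.
Qed.

Lemma measurable_kern_sub d e dT (T : measurableType dT) (f g : T -> euclid R d) : 0 < e ->
  measurable_fun setT f -> measurable_fun setT g ->
  measurable_fun setT (fun x => kern e (subv (f x) (g x))).
Proof.
move=> e0 mf mg; apply: (measurableT_comp (f := @kern R d e)); first exact: measurable_kern.
exact: measurable_subv.
Qed.

Lemma ae_eq_cint dT (T : measurableType dT) (mu : {measure set T -> \bar R}) (f g : T -> R[i]) :
  cmeas f -> cmeas g -> {ae mu, forall x, f x = g x} -> cint mu f = cint mu g.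
Proof.
move=> [f1 f2] [g1 g2] fg; rewrite /cint /Rintegral; congr (_ +i* _); congr fine.
  apply: ae_eq_integral => //; try exact/measurable_EFinP.
  by apply: filterS fg => x ->.
apply: ae_eq_integral => //; try exact/measurable_EFinP.
by apply: filterS fg => x ->.
Qed.

(** Convolution with the Poisson kernel: this is what inserting the weight [phi e] into the
    inversion integral produces ([fourier_phi_ifourier]). *)
Definition econv d e (g : euclid R d -> R[i]) x : R[i] :=
  cint (leb d) (fun y => (kern e (subv x y))%:C * g y).

Lemma cmeas_kern d e : 0 < e ->
  cmeas (fun z : euclid R d * euclid R d => (kern e (subv z.1 z.2))%:C : R[i]).
Proof.
move=> e0; apply: cmeas_real.
exact: measurable_kern_sub.
Qed.

Lemma integral_kern_mul d e (h : euclid R d -> \bar R) : 0 < e -> measurable_fun setT h ->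
  (forall y, 0 <= h y)%E ->
  (\int[leb d]_x \int[leb d]_y ((kern e (subv x y))%:E * h y) = \int[leb d]_y h y)%E.
Proof.
move=> e0 mh h0.
have mk : measurable_fun setT (fun z : euclid R d * euclid R d => (kern e (subv z.1 z.2))%:E * h z.2)%E.
  apply: emeasurable_funM; last exact: measurableT_comp.
  by apply/measurable_EFinP; exact: measurable_kern_sub.
have k0 (z : euclid R d * euclid R d) : (0 <= (kern e (subv z.1 z.2))%:E * h z.2)%E.
  by rewrite mule_ge0// lee_fin kern_ge0.
apply: etrans (fubini_tonelli (m1 := leb d) (m2 := leb d) _ mk k0) _ => /=.
apply: eq_integral => y _; rewrite ge0_integralZr//.
- by rewrite integral_kernr// mul1e.
- by apply/measurable_EFinP; exact: measurable_kern_sub.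
- by move=> x _; rewrite lee_fin kern_ge0.
Qed.

Lemma cL1_kern d e (g : euclid R d -> R[i]) : 0 < e -> cL1 (leb d) g ->
  cL1 (leb d \x leb d)%E (fun z => (kern e (subv z.1 z.2))%:C * g z.2).
Proof.
move=> e0 [mg ig]; apply: cL1_prod.
  by apply: cmeasM; [exact: cmeas_kern|apply: (cmeas_comp mg)].
under eq_integral => x _ do under eq_integral => y _ do
  rewrite cabsM cabs_real ger0_norm ?kern_ge0// EFinM.
rewrite (integral_kern_mul e0 (h := fun y => (cabs (g y))%:E))//.
- exact: measurable_EFin_cabs.
- by move=> y; rewrite lee_fin cabs_ge0.
Qed.

Lemma cmeas_econv d e (g : euclid R d -> R[i]) : 0 < e -> cmeas g -> cmeas (econv e g).
Proof.
move=> e0 mg; apply: (@cmeas_cint1 _ _ _ _ _ (leb d) (fun z => (kern e (subv z.1 z.2))%:C * g z.2)).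
by apply: cmeasM; [exact: cmeas_kern|apply: (cmeas_comp mg)].
Qed.

(** Schur's test: under the kernel, |f(x)| |g(y)| is at most half the sum of the squares, and the
    kernel has mass one in each variable separately. *)
Lemma cabs_econv_mul_le d e (f g : euclid R d -> R[i]) : 0 < e -> cmeas f -> cmeas g ->
  (\int[leb d]_x (cabs (f x) * cabs (econv e g x))%:E <=
    2^-1%:E * (n2 (leb d) f + n2 (leb d) g))%E.
Proof.
move=> e0 mf mg.
have mk1 x : measurable_fun setT (fun y : euclid R d => (kern e (subv x y))%:E).
  by apply/measurable_EFinP; exact: measurable_kern_sub.
have mf2 := measurable_EFin_cabs2 mf; have mg2 := measurable_EFin_cabs2 mg.
have mg1 := measurable_EFin_cabs mg.
have half : (0 <= 2^-1%:E :> \bar R)%E by rewrite lee_fin.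
have P x : ((cabs (f x) * cabs (econv e g x))%:E <= 2^-1%:E * ((cabs (f x) ^+ 2)%:E +
    \int[leb d]_y ((kern e (subv x y))%:E * (cabs (g y) ^+ 2)%:E)))%E.
  have h1 : ((cabs (econv e g x))%:E <= \int[leb d]_y ((kern e (subv x y))%:E * (cabs (g y))%:E))%E.
    apply: le_trans (le_cabs_cint _ _) _.
      apply: cmeasM => //; apply: cmeas_real; exact: measurable_kern_sub.
    by under eq_integral => y _ do rewrite cabsM cabs_real ger0_norm ?kern_ge0// EFinM.
  rewrite EFinM; apply: (@le_trans _ _ ((cabs (f x))%:E *
      \int[leb d]_y ((kern e (subv x y))%:E * (cabs (g y))%:E))%E).
    by apply: lee_wpmul2l; rewrite // lee_fin cabs_ge0.
  rewrite -ge0_integralZl//; last 3 first.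
  - exact: emeasurable_funM.
  - by move=> y _; rewrite mule_ge0// lee_fin ?kern_ge0 ?cabs_ge0.
  - by rewrite lee_fin cabs_ge0.
  have -> : ((cabs (f x) ^+ 2)%:E = \int[leb d]_y ((kern e (subv x y))%:E * (cabs (f x) ^+ 2)%:E))%E.
    rewrite ge0_integralZr ?integral_kernl ?mul1e//.
    - by move=> y _; rewrite lee_fin kern_ge0.
    - by rewrite lee_fin sqr_ge0.
  rewrite -ge0_integralD//; last 4 first.
  - by move=> y _; rewrite mule_ge0// lee_fin ?kern_ge0 ?sqr_ge0.
  - by apply: emeasurable_funM => //; exact: measurable_cst.
  - by move=> y _; rewrite mule_ge0// lee_fin ?kern_ge0 ?sqr_ge0.
  - exact: emeasurable_funM.
  rewrite -ge0_integralZl//; last 2 first.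
  - by apply: emeasurable_funD; apply: emeasurable_funM => //; exact: measurable_cst.
  - by move=> y _; rewrite adde_ge0// mule_ge0// lee_fin ?kern_ge0 ?sqr_ge0.
  apply: ge0_le_integral => //.
  - by move=> y _; rewrite !mule_ge0// lee_fin ?kern_ge0 ?cabs_ge0.
  - by apply: emeasurable_funM; [exact: measurable_cst|exact: emeasurable_funM].
  - apply: emeasurable_funM; first exact: measurable_cst.
    by apply: emeasurable_funD; apply: emeasurable_funM => //; exact: measurable_cst.
  move=> y _; rewrite -[leLHS]/((cabs (f x) * (kern e (subv x y) * cabs (g y)))%:E).
  rewrite -[leRHS]/((2^-1 * (kern e (subv x y) * cabs (f x) ^+ 2 + kern e (subv x y) * cabs (g y) ^+ 2))%:E) lee_fin.
  have := kern_ge0 (subv x y) e0; have := sqr_ge0 (cabs (f x) - cabs (g y)).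
  move: (kern _ _) (cabs _) (cabs _) => k a b h k0.
  by have := mulr_ge0 k0 h; lra.
have mI : measurable_fun setT (fun x => \int[leb d]_y ((kern e (subv x y))%:E * (cabs (g y) ^+ 2)%:E))%E.
  apply: (@measurable_Fubini1 _ _ _ _ _ (leb d) (fun z => (kern e (subv z.1 z.2))%:E * (cabs (g z.2) ^+ 2)%:E)%E).
  apply: emeasurable_funM; last by apply: measurable_EFin_cabs2; apply: (cmeas_comp mg).
  by apply/measurable_EFinP; exact: measurable_kern_sub.
have I0 x : (0 <= \int[leb d]_y ((kern e (subv x y))%:E * (cabs (g y) ^+ 2)%:E))%E.
  by apply: integral_ge0 => y _; rewrite mule_ge0// lee_fin ?kern_ge0 ?sqr_ge0.
have mec := cmeas_econv e0 mg.
apply: (@le_trans _ _ (\int[leb d]_x (2^-1%:E * ((cabs (f x) ^+ 2)%:E +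
    \int[leb d]_y ((kern e (subv x y))%:E * (cabs (g y) ^+ 2)%:E))))%E).
  apply: ge0_le_integral => //.
  - by move=> x _; rewrite lee_fin mulr_ge0 ?cabs_ge0.
  - by apply/measurable_EFinP; apply: measurable_funM; exact: measurable_cabs.
  - by apply: emeasurable_funM; [exact: measurable_cst|exact: emeasurable_funD].
rewrite ge0_integralZl//; last 2 first.
- exact: emeasurable_funD.
- by move=> x _; rewrite adde_ge0// lee_fin sqr_ge0.
rewrite ge0_integralD//; last by move=> x _; rewrite lee_fin sqr_ge0.
rewrite (integral_kern_mul e0 (h := fun y => (cabs (g y) ^+ 2)%:E))//.
by move=> y; rewrite lee_fin sqr_ge0.
Qed.

Lemma cvg_prodr n (F : nat -> 'I_n -> R) (l : 'I_n -> R) :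
  (forall i, F m i @[m --> \oo] --> l i) -> \prod_(i < n) F m i @[m --> \oo] --> \prod_(i < n) l i.
Proof.
elim: n F l => [|n IH] F l h.
  by under eq_fun do rewrite big_ord0; rewrite big_ord0; exact: cvg_cst.
under eq_fun do rewrite big_ord_recr; rewrite big_ord_recr.
by apply: cvgM; [exact: (IH (fun m i => F m (widen_ord (leqnSn n) i)))|exact: h].
Qed.

Lemma cint_kern_box d e (a b y : euclid R d) : 0 < e ->
  cint (leb d) (fun x => (kern e (subv x y))%:C * indc a b x) =
  (\prod_(i < d) Rintegral lebesgue_measure setT (fun x : measurableTypeR R =>
     pois e (tnth y i - x) * \1_(`]tnth a i, tnth b i]%classic : set R) x))%:C.
Proof.
move=> e0.
pose f (i : 'I_d) (x : R) : R[i] := (pois e (tnth y i - x) * \1_(`]tnth a i, tnth b i]%classic : set R) x)%:C.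
have E : (fun x => (kern e (subv x y))%:C * indc a b x) = tprod f.
  apply/funext => x; rewrite kernB /indc indic_bx /kern -rmorphM /= -big_split real_prod.
  by apply: eq_bigr => i _; rewrite tnth_mktuple.
have mi (i : 'I_d) : measurable_fun setT ((fun x => \1_(`]tnth a i, tnth b i]%classic : set R) x) : measurableTypeR R -> R).
  by apply: measurable_indic; exact: measurable_itv.
have mp i : measurable_fun setT (fun x : measurableTypeR R => pois e (tnth y i - x)).
  apply: (measurableT_comp (f := pois e : measurableTypeR R -> R)); first exact: measurable_pois.
  exact: measurable_funB.
have lf i : cL1 lebesgue_measure (f i : measurableTypeR R -> R[i]).
  apply: cL1_real; first by move=> x; rewrite mulr_ge0// ?pois_ge0// indicE.
  apply/integrableP; split; first by apply/measurable_EFinP; exact: measurable_funM.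
  have [ab|ba] := leP (tnth a i) (tnth b i); last first.
    rewrite integral0_eq ?ltry// => x _.
    by rewrite set_itv_ge ?indic0 ?mulr0 ?abse0// bnd_simp -leNgt ltW.
  have nn x : 0 <= pois e (tnth y i - x) * \1_(`]tnth a i, tnth b i]%classic : set R) x.
    by rewrite mulr_ge0// ?pois_ge0// indicE.
  by under eq_integral => x _ do rewrite gee0_abs ?lee_fin ?nn//; rewrite integral_pois_itv// ltry.
have [_ e1] := cL1_cint_tprod lf.
rewrite E e1 real_prod; apply: eq_bigr => i _.
exact: (cint_real _ (fun x : measurableTypeR R => pois e (tnth y i - x) * \1_(`]tnth a i, tnth b i]%classic : set R) x)).
Qed.

(** The integral factors into one-dimensional ones, which converge off the endpoints; the
    hyperplanes carrying the faces of the box are null. *)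
Lemma ae_cvg_kern_box d (a b : euclid R d) :
  {ae leb d, forall y, ccvg (fun n => cint (leb d) (fun x => (kern (n.+1%:R^-1) (subv x y))%:C * indc a b x))
     (indc a b y)}.
Proof.
have h1 : {ae leb d, forall y, forall i : 'I_d, tnth y i != tnth a i}.
  by apply: filter_forall => i; exact: null_hyperplane.
have h2 : {ae leb d, forall y, forall i : 'I_d, tnth y i != tnth b i}.
  by apply: filter_forall => i; exact: null_hyperplane.
apply: filterS2 h1 h2 => y ya yb; apply/ccvg_ReIm.
have e0 n : 0 < n.+1%:R^-1 :> R by rewrite invr_gt0.
split.
  under eq_fun do rewrite cint_kern_box//=.
  rewrite /= indic_bx; apply: (@cvg_prodr _ (fun n i => _)) => i.
  exact: cvg_pois_itv.
by under eq_fun do rewrite cint_kern_box//=; exact: cvg_cst.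
Qed.

Lemma cabs_kern_box_le1 d e (a b y : euclid R d) : 0 < e ->
  cabs (cint (leb d) (fun x => (kern e (subv x y))%:C * indc a b x)) <= 1.
Proof.
move=> e0; rewrite -lee_fin.
have mk : measurable_fun setT (fun x => kern e (subv x y)) by exact: measurable_kern_sub.
have mkc : cmeas (fun x => (kern e (subv x y))%:C * indc a b x).
  by apply: cmeasM; [exact: cmeas_real|exact: cmeas_indc].
apply: le_trans (le_cabs_cint _ mkc) _.
rewrite -(integral_kernr y e0); apply: ge0_le_integral => //.
- by move=> x _; rewrite lee_fin cabs_ge0.
- exact: measurable_EFin_cabs.
- exact/measurable_EFinP.
move=> x _; rewrite lee_fin cabsM cabs_indc cabs_real ger0_norm ?kern_ge0//.
by rewrite ler_piMr ?kern_ge0// indicE; case: (_ \in _).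
Qed.

(** Fubini moves the kernel from [g] onto the box, where the convergence is explicit and bounded;
    dominated convergence with 2 |g| concludes. This weak statement identifies the L^2 limit in
    [tends0_econv]. *)
Lemma weak_econv d (g : euclid R d -> R[i]) (a b : euclid R d) : cL1 (leb d) g ->
  tends0 (fun n => (cabs (cint (leb d) (fun x => indc a b x * econv (n.+1%:R^-1) g x)
     - cint (leb d) (fun x => indc a b x * g x)))%:E).
Proof.
move=> lg; have [mg ig] := lg.
have e0 n : 0 < n.+1%:R^-1 :> R by rewrite invr_gt0.
pose K n y := cint (leb d) (fun x => (kern (n.+1%:R^-1) (subv x y))%:C * indc a b x).
have mI2 : cmeas (fun z : euclid R d * euclid R d => indc a b z.1).
  by apply: (cmeas_comp (cmeas_indc a b)).
have mK n : cmeas (K n).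
  apply: (@cmeas_cint1 _ _ _ _ _ (leb d) (fun z => (kern (n.+1%:R^-1) (subv z.2 z.1))%:C * indc a b z.2)).
  apply: cmeasM; last by apply: (cmeas_comp (cmeas_indc a b)).
  by apply: cmeas_real; exact: measurable_kern_sub.
have K1 n y : cabs (K n y) <= 1 by exact: cabs_kern_box_le1.
have lKg n : cL1 (leb d) (fun y => K n y * g y) by exact: (cL1M_bounded (mK n) (K1 n) lg).
have I1 x : cabs (indc a b x) <= 1 by rewrite cabs_indc indicE; case: (_ \in _).
have lIg : cL1 (leb d) (fun y => indc a b y * g y) by exact: (cL1M_bounded (cmeas_indc a b) I1 lg).
have E n : cint (leb d) (fun x => indc a b x * econv (n.+1%:R^-1) g x) - cint (leb d) (fun x => indc a b x * g x)
   = cint (leb d) (fun y => (K n y - indc a b y) * g y).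
  transitivity (cint (leb d) (fun y => K n y * g y) - cint (leb d) (fun x => indc a b x * g x)); last first.
    by rewrite -cintB//; apply: eq_cint => y; ring.
  congr (_ - _).
  have lk := cL1_kern (e0 n) lg.
  have lk2 : cL1 (leb d \x leb d)%E (fun z => indc a b z.1 * ((kern (n.+1%:R^-1) (subv z.1 z.2))%:C * g z.2)).
    by apply: (cL1M_bounded mI2 (fun z => I1 z.1)).
  transitivity (cint (leb d) (fun x => cint (leb d) (fun y => indc a b x * ((kern (n.+1%:R^-1) (subv x y))%:C * g y)))).
    apply: ae_eq_cint.
    - by apply: cmeasM; [exact: cmeas_indc|exact: cmeas_econv].
    - exact: (cmeas_cint1 (leb d) (proj1 lk2)).
    by apply: filterS (cL1_ae1 lk) => x lx; rewrite cintZ.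
  rewrite (cint_fubini (f := fun x y => indc a b x * ((kern (n.+1%:R^-1) (subv x y))%:C * g y)))//.
  apply: eq_cint => y; rewrite /K [RHS]mulrC -cintZ.
    by apply: eq_cint => x; ring.
  rewrite (_ : (fun x => _) = (fun x => indc a b x * (kern (n.+1%:R^-1) (subv x y))%:C)); last by apply/funext => x; rewrite mulrC.
  apply: (cL1M_bounded (cmeas_indc a b) I1).
  apply: cL1_real; first by move=> x; exact: kern_ge0.
  apply/integrableP; split; first by apply/measurable_EFinP; exact: measurable_kern_sub.
  under eq_integral do rewrite gee0_abs ?lee_fin ?kern_ge0//.
  by rewrite integral_kernr// ltry.
have mD n : cmeas (fun y => (K n y - indc a b y)) by apply: cmeasB => //; exact: cmeas_indc.
apply: (@tends0_le _ _ (fun n => \int[leb d]_y (cabs (K n y - indc a b y) * cabs (g y))%:E)%E).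
  move=> n; rewrite E; apply: le_trans (le_cabs_cint _ (cmeasM (mD n) mg)) _.
  by under eq_integral do rewrite cabsM.
apply: (@tends0_dominated _ _ _ _ (fun y => 2 * cabs (g y))).
- by move=> n; apply: measurable_funM; exact: measurable_cabs.
- by apply: measurable_funM => //; exact: measurable_cabs.
- under eq_integral do rewrite EFinM.
  rewrite ge0_integralZl//.
  + by rewrite lte_mul_pinfty// lee_fin.
  + exact: measurable_EFin_cabs.
  + by move=> x _; rewrite lee_fin cabs_ge0.
- move=> n x; rewrite mulr_ge0 ?cabs_ge0// ler_wpM2r ?cabs_ge0//.
  by have := cabsD (K n x) (- indc a b x); rewrite cabsN; have := K1 n x; have := I1 x; lra.
apply: filterS (ae_cvg_kern_box a b) => y h.
rewrite -[0](mul0r (cabs (g y))); apply: cvgM; [exact: h|exact: cvg_cst].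
Qed.

End fourier_L2.

(** * Abel summation of Fourier integrals and the contraction property *)

Section plancherel.
Context {R : realType}.

Lemma conjcM (z w : R[i]) : conjc (z * w) = conjc z * conjc w.
Proof. exact: rmorphM. Qed.

Lemma real_cM (x y : R) : (x * y)%:C = x%:C * y%:C :> R[i].
Proof. exact: rmorphM. Qed.

Definition fnorm d : R := (2 * pi) `^ (- (d%:R / 2)).

Lemma fnorm_ge0 d : 0 <= fnorm d. Proof. exact: powR_ge0. Qed.

Lemma fnorm_sq d : fnorm d * fnorm d * (2 * pi) ^+ d = 1.
Proof.
have p0 : 0 < 2 * pi :> R by rewrite mulr_gt0// pi_gt0.
have n0 : 2 * pi != 0 :> R by rewrite gt_eqF.
rewrite /fnorm -(powR_mulrn _ (ltW p0)) -!powRD ?n0 ?implybT//.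
by rewrite (_ : - (d%:R / 2) - d%:R / 2 + d%:R = 0) ?powRr0//; field.
Qed.

Definition ifourier d (g : euclid R d -> R[i]) (xi : euclid R d) : R[i] :=
  (fnorm d)%:C * cint (leb d) (fun x => cis (dot x xi) * g x).

Lemma fourierE d (g : euclid R d -> R[i]) (xi : euclid R d) :
  fourier g xi = (fnorm d)%:C * cint (leb d) (fun x => cis (- dot x xi) * g x).
Proof. by []. Qed.

Lemma fourier_negv d (g : euclid R d -> R[i]) (xi : euclid R d) : fourier g (negv xi) = ifourier g xi.
Proof. by rewrite fourierE; under eq_cint do rewrite dotNr opprK. Qed.

Lemma ifourier_negv d (g : euclid R d -> R[i]) (xi : euclid R d) : ifourier g (negv xi) = fourier g xi.
Proof. by rewrite /ifourier; under eq_cint do rewrite dotNr. Qed.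

Lemma measurable_negvT d : measurable_fun setT (@negv R d).
Proof. by apply: measurable_negv. Qed.

Lemma cmeas_cis_dot d (g : euclid R d -> R[i]) (xi : euclid R d) : cmeas g ->
  cmeas (fun x => cis (dot x xi) * g x).
Proof. by move=> mg; apply: cmeasM => //; apply: cmeas_cis; apply: measurable_dot. Qed.

Lemma cL1_cis_dot d (g : euclid R d -> R[i]) (xi : euclid R d) : cL1 (leb d) g ->
  cL1 (leb d) (fun x => cis (dot x xi) * g x).
Proof.
move=> lg; apply: cL1M_bounded_eq => //; last by move=> x; exact: cabs_cis.
by apply: cmeas_cis; apply: measurable_dot.
Qed.

Lemma cL1_cisN_dot d (g : euclid R d -> R[i]) (xi : euclid R d) : cL1 (leb d) g ->
  cL1 (leb d) (fun x => cis (- dot x xi) * g x).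
Proof.
move=> /(cL1_cis_dot (negv xi)) lg.
suff <- : (fun x => cis (dot x (negv xi)) * g x) = (fun x => cis (- dot x xi) * g x) by [].
by apply/funext => x; rewrite dotNr.
Qed.

Lemma ifourier_comp_negv d (g : euclid R d -> R[i]) (xi : euclid R d) : cmeas g ->
  fourier (fun x => g (negv x)) xi = ifourier g xi.
Proof.
move=> mg; rewrite fourierE /ifourier; congr (_ * _).
rewrite -(mp_cint (mp_negv d) (cmeas_cis_dot xi mg)).
by apply: eq_cint => x; rewrite dotNl.
Qed.

Lemma cmeas_fourier d (g : euclid R d -> R[i]) : cmeas g -> cmeas (fourier g).
Proof.
move=> mg; apply: cmeasM; first exact: cmeas_cst.
apply: (@cmeas_cint1 _ _ _ _ _ (leb d) (fun z => cis (- dot z.2 z.1) * g z.2)).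
apply: cmeasM; last by apply: (cmeas_comp mg).
by apply: cmeas_cis; apply: measurable_funN; apply: measurable_dot.
Qed.

Lemma cmeas_ifourier d (g : euclid R d -> R[i]) : cmeas g -> cmeas (ifourier g).
Proof.
move=> /cmeas_fourier mg.
have := cmeas_comp mg (@measurable_negvT d).
by apply: eq_cmeas => x; rewrite fourier_negv.
Qed.

Lemma conj_fourier d (g : euclid R d -> R[i]) (xi : euclid R d) : cL1 (leb d) g ->
  conjc (fourier g xi) = ifourier (fun x => conjc (g x)) xi.
Proof.
move=> lg; rewrite fourierE /ifourier rmorphM; congr (_ * _); first by rewrite /= oppr0.
rewrite -[LHS]/(conjc _) -cint_conj; last exact: cL1_cisN_dot.
by apply: eq_cint => x; rewrite conjcM conj_cis opprK.
Qed.

Lemma fourierB d (f g : euclid R d -> R[i]) (xi : euclid R d) : cL1 (leb d) f -> cL1 (leb d) g ->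
  fourier (fun x => f x - g x) xi = fourier f xi - fourier g xi.
Proof.
move=> lf lg; rewrite !fourierE -mulrBr -cintB; try exact: cL1_cisN_dot.
by congr (_ * _); apply: eq_cint => x; rewrite mulrBr.
Qed.

Lemma ifourierB d (f g : euclid R d -> R[i]) (xi : euclid R d) : cL1 (leb d) f -> cL1 (leb d) g ->
  ifourier (fun x => f x - g x) xi = ifourier f xi - ifourier g xi.
Proof. by move=> lf lg; rewrite -!fourier_negv fourierB. Qed.

Lemma fourier_bounded d (g : euclid R d -> R[i]) : cL1 (leb d) g ->
  exists C : R, forall xi, cabs (fourier g xi) <= C.
Proof.
move=> lg; exists (fnorm d * fine (\int[leb d]_x (cabs (g x))%:E)) => xi.
rewrite fourierE cabsM cabs_real ger0_norm ?fnorm_ge0// ler_wpM2l ?fnorm_ge0//.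
rewrite -lee_fin fineK; last exact: integrable_fin_num (cL1_cabs lg).
apply: le_trans (le_cabs_cint _ (proj1 (cL1_cisN_dot xi lg))) _.
by under eq_integral do rewrite cabsM cabs_cis mul1r.
Qed.

Lemma cL1_tensor2 d1 d2 (T1 : measurableType d1) (T2 : measurableType d2)
    (m1 : {sigma_finite_measure set T1 -> \bar R}) (m2 : {sigma_finite_measure set T2 -> \bar R}) f g :
  cL1 m1 f -> cL1 m2 g -> cL1 (m1 \x m2)%E (fun z => f z.1 * g z.2).
Proof.
move=> lf lg; have [mf _] := lf; have [mg _] := lg.
apply: cL1_prod; first by apply: cmeasM; [apply: (cmeas_comp mf)|apply: (cmeas_comp mg)].
have mf1 := measurable_EFin_cabs mf; have mg1 := measurable_EFin_cabs mg.
under eq_integral => x _.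
  under eq_integral => y _ do rewrite /= cabsM EFinM.
  rewrite ge0_integralZl//; last 2 first.
  - by move=> y _; rewrite lee_fin cabs_ge0.
  - by rewrite lee_fin cabs_ge0.
  over.
rewrite ge0_integralZr//; last 2 first.
- by move=> y _; rewrite lee_fin cabs_ge0.
- by apply: integral_ge0 => y _; rewrite lee_fin cabs_ge0.
apply: lte_mul_pinfty; [|by have := cL1_cabs lf; exact: integrable_fin_num|by case: lg].
by apply: integral_ge0 => y _; rewrite lee_fin cabs_ge0.
Qed.

(** The multiplication formula: up to [fnorm d], both sides are the double integral of e^{-i x.y}
    f(x) g(y). *)
Lemma fourier_dual d (f g : euclid R d -> R[i]) : cL1 (leb d) f -> cL1 (leb d) g ->
  cint (leb d) (fun x => f x * fourier g x) = cint (leb d) (fun x => fourier f x * g x).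
Proof.
move=> lf lg; have [mf _] := lf; have [mg _] := lg.
have lfg := cL1_tensor2 lf lg.
have lk : cL1 (leb d \x leb d)%E (fun z => cis (- dot z.2 z.1) * (f z.1 * g z.2)).
  apply: cL1M_bounded_eq => //; last by move=> x; exact: cabs_cis.
  by apply: cmeas_cis; apply: measurable_funN; apply: measurable_dot.
have [C hC] := fourier_bounded lg; have [C' hC'] := fourier_bounded lf.
have E1 x : f x * fourier g x = (fnorm d)%:C * cint (leb d) (fun y => cis (- dot y x) * (f x * g y)).
  rewrite fourierE mulrCA; congr (_ * _); rewrite -cintZ; last exact: cL1_cisN_dot.
  by apply: eq_cint => y; rewrite mulrCA.
have E2 x : fourier f x * g x = (fnorm d)%:C * cint (leb d) (fun y => cis (- dot x y) * (f y * g x)).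
  rewrite fourierE -mulrA; congr (_ * _); rewrite mulrC -cintZ; last exact: cL1_cisN_dot.
  by apply: eq_cint => y; rewrite dotC; ring.
rewrite (eq_cint _ E1) (eq_cint _ E2).
have l1 : cL1 (leb d) (fun x => cint (leb d) (fun y => cis (- dot y x) * (f x * g y))) := cL1_fubini1 lk.
have l2 : cL1 (leb d) (fun x => cint (leb d) (fun y => cis (- dot x y) * (f y * g x))).
  exact: (cL1_fubini1 (mp_cL1 (mp_swap _ _) lk)).
apply: (etrans (cintZ _ l1)); apply: (etrans _ (esym (cintZ _ l2))); apply: congr1.
exact: (cint_fubini (f := fun x y => cis (- dot y x) * (f x * g y))).
Qed.

Lemma cmeas_phi d e : cmeas (fun x : euclid R d => (phi e x)%:C).
Proof. by apply: cmeas_real; exact: measurable_phi. Qed.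

Lemma cabs_phi d e (x : euclid R d) : cabs (phi e x)%:C = phi e x.
Proof. by rewrite cabs_real ger0_norm// phi_ge0. Qed.

Lemma phi_sq d e (x : euclid R d) : phi e x ^+ 2 = phi (2 * e) x.
Proof.
rewrite /phi expr2 -big_split; apply: eq_bigr => i _ /=.
by rewrite /abel -expRD; congr expR; ring.
Qed.

Lemma cL2_phi d (e : R) : 0 < e -> cL2 (leb d) (fun x => (phi e x)%:C).
Proof.
move=> e0; split; first exact: cmeas_phi.
rewrite /n2; under eq_integral do rewrite cabs_phi phi_sq.
have [_] : cL1 (leb d) (fun x => (phi (2 * e) x)%:C) by apply: cL1_phi; rewrite mulr_gt0.
by under eq_integral do rewrite cabs_phi.
Qed.

Lemma cL1_phiM d e (g : euclid R d -> R[i]) (C : R) : 0 < e -> cmeas g -> (forall x, cabs (g x) <= C) ->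
  cL1 (leb d) (fun x => (phi e x)%:C * g x).
Proof.
move=> e0 mg gC; have := cL1M_bounded mg gC (cL1_phi d e0).
by under eq_fun do rewrite mulrC.
Qed.

Lemma pois_le0 (e y : R) : 0 < e -> pois e y <= pois e 0.
Proof.
move=> e0; rewrite /pois; apply: ler_wpM2r; first by rewrite invr_ge0 pi_ge0.
apply: ler_wpM2l; first exact: ltW.
by rewrite lef_pV2 ?posrE ?sqD_gt0// lerD2l expr0n sqr_ge0.
Qed.

(** The weight makes the double integral absolutely convergent. Integrating out the variable that
    carries the weight leaves the transform of [phi e], that is [kern e], and [fnorm_sq] cancels the
    constants. *)
Lemma fourier_phi_ifourier d e (g : euclid R d -> R[i]) (xi : euclid R d) : 0 < e -> cL1 (leb d) g ->
  fourier (fun x => (phi e x)%:C * ifourier g x) xi = econv e g xi.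
Proof.
move=> e0 lg; have [mg _] := lg.
have lp := cL1_tensor2 (cL1_phi d e0) lg.
have lk : cL1 (leb d \x leb d)%E (fun z => cis (- dot z.1 (subv xi z.2)) * ((phi e z.1)%:C * g z.2)).
  apply: cL1M_bounded_eq => //; last by move=> x; exact: cabs_cis.
  apply: cmeas_cis; apply: measurable_funN; apply: measurable_dot => //.
  by apply: measurable_subv.
have E1 x : cis (- dot x xi) * ((phi e x)%:C * ifourier g x) =
    (fnorm d)%:C * cint (leb d) (fun y => cis (- dot x (subv xi y)) * ((phi e x)%:C * g y)).
  rewrite /ifourier mulrCA !mulrA -mulrA mulrC -mulrA; congr (_ * _).
  rewrite mulrC -cintZ; last exact: cL1_cis_dot.
  apply: eq_cint => y; rewrite dotBr opprB cisD (dotC x y); ring.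
have l1 : cL1 (leb d) (fun x => cint (leb d) (fun y => cis (- dot x (subv xi y)) * ((phi e x)%:C * g y))) := cL1_fubini1 lk.
rewrite fourierE (eq_cint _ E1) (cintZ _ l1).
rewrite (cint_fubini (f := fun x y => cis (- dot x (subv xi y)) * ((phi e x)%:C * g y)))//.
have E2 y : cint (leb d) (fun x => cis (- dot x (subv xi y)) * ((phi e x)%:C * g y)) =
   ((2 * pi) ^+ d)%:C * ((kern e (subv xi y))%:C * g y).
  have [l3 e1] := cL1_phi_cis (subv xi y) e0.
  rewrite mulrA -real_cM -e1 mulrC -(cintZ _ l3).
  by apply: eq_cint => x; ring.
have lk1 : cL1 (leb d) (fun y => (kern e (subv xi y))%:C * g y).
  have [C hC] : exists C : R, forall y, cabs ((kern e (subv xi y))%:C : R[i]) <= C.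
    exists (pois e 0 ^+ d) => y; rewrite cabs_real ger0_norm ?kern_ge0//.
    rewrite -[X in _ ^+ X]card_ord -prodr_const; apply: ler_prod => i _.
    rewrite pois_ge0//=; exact: pois_le0.
  by apply: (cL1M_bounded _ hC lg); apply: cmeas_real; exact: measurable_kern_sub.
rewrite (eq_cint _ E2) (cintZ _ lk1) mulrA mulrA -!real_cM.
by rewrite fnorm_sq mul1r.
Qed.

Lemma ifourier_phi_fourier d e (g : euclid R d -> R[i]) (xi : euclid R d) : 0 < e -> cL1 (leb d) g ->
  ifourier (fun x => (phi e x)%:C * fourier g x) xi = econv e g xi.
Proof.
move=> e0 lg; rewrite -ifourier_comp_negv; last first.
  by apply: cmeasM; [exact: cmeas_phi|apply: cmeas_fourier; case: lg].
apply: etrans _ (fourier_phi_ifourier xi e0 lg).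
have -> : (fun x => (phi e (negv x))%:C * fourier g (negv x)) = (fun x => (phi e x)%:C * ifourier g x).
  by apply/funext => x; rewrite phiN fourier_negv.
by [].
Qed.

Lemma n2_comp_negv d (g : euclid R d -> R[i]) : cmeas g ->
  n2 (leb d) (fun x => g (negv x)) = n2 (leb d) g.
Proof. exact: (mp_n2 (mp_negv d)). Qed.

Lemma n2_ifourier d (g : euclid R d -> R[i]) : cmeas g ->
  n2 (leb d) (ifourier g) = n2 (leb d) (fourier g).
Proof.
move=> mg; rewrite -n2_comp_negv; last exact: cmeas_ifourier.
by congr n2; apply/funext => x; rewrite ifourier_negv.
Qed.

Lemma cL1_fourier_phi d (e : R) (g : euclid R d -> R[i]) : 0 < e -> cL1 (leb d) g ->
  cL1 (leb d) (fun x => (phi e x)%:C * fourier g x).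
Proof.
move=> e0 lg; have [C hC] := fourier_bounded lg.
by apply: cL1_phiM hC => //; apply: cmeas_fourier; case: lg.
Qed.

(** Since the square of [phi e] is [phi (2 * e)], the left side is the pairing of [fourier g] with
    [f], the conjugate of [fourier g] weighted by [phi (2 * e)]. The multiplication formula moves
    the transform onto [f], where it becomes the Poisson average of the conjugate of [g], and
    [cabs_econv_mul_le] bounds the pairing of that with [g]. *)
Lemma n2_phi_fourier d e (g : euclid R d -> R[i]) : 0 < e -> cL1 (leb d) g ->
  (n2 (leb d) (fun x => ((phi e x)%:C * fourier g x)%R) <= n2 (leb d) g)%E.
Proof.
move=> e0 lg; have [mg _] := lg; have e20 : 0 < 2 * e by rewrite mulr_gt0.
have lc := cL1_conj lg; have [mc _] := lc.
have mF := cmeas_fourier mg.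
pose f (x : euclid R d) := (phi (2 * e) x)%:C * ifourier (fun x => conjc (g x)) x.
have [C hC] := fourier_bounded lg.
have fE x : f x * fourier g x = (phi (2 * e) x * cabs (fourier g x) ^+ 2)%:C.
  by rewrite /f -conj_fourier// -mulrA [conjc _ * _]mulrC mul_conj -real_cM.
have lf : cL1 (leb d) f.
  apply: (cL1_phiM (C := C) e20); first exact: cmeas_ifourier.
  by move=> x; rewrite -conj_fourier// cabs_conj.
have dual := fourier_dual lf lg.
rewrite (eq_cint _ fE) in dual.
have lfg : cL1 (leb d) (fun x => f x * fourier g x).
  have := cL1M_bounded mF hC lf.
  by under eq_fun do rewrite mulrC.
have n2E : n2 (leb d) (fun x => (phi e x)%:C * fourier g x) = (\int[leb d]_x (phi (2 * e) x * cabs (fourier g x) ^+ 2)%:E)%E.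
  by apply: eq_integral => x _; rewrite cabsM cabs_phi exprMn phi_sq.
have fin : n2 (leb d) (fun x => (phi e x)%:C * fourier g x) \is a fin_num.
  rewrite n2E; apply: integrable_fin_num => //.
  have := cL1_Re lfg; apply: eq_integrable => // x _.
  by rewrite fE.
have -> : n2 (leb d) (fun x => (phi e x)%:C * fourier g x) =
    (cabs (cint (leb d) (fun x => fourier f x * g x)))%:E.
  rewrite -dual cint_real cabs_real /Rintegral -n2E ger0_norm; first by rewrite fineK.
  by rewrite fine_ge0// n2_ge0.
apply: le_trans (le_cabs_cint _ (cmeasM (cmeas_fourier (proj1 lf)) mg)) _.
have E x : fourier f x = econv (2 * e) (fun x => conjc (g x)) x by rewrite /f fourier_phi_ifourier.
under eq_integral => x _ do rewrite cabsM E mulrC.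
apply: le_trans (cabs_econv_mul_le e20 mg mc) _.
rewrite (@eq_n2 _ _ _ (leb d) (fun x => conjc (g x)) g); last by move=> x; rewrite cabs_conj.
have : (0 <= n2 (leb d) g)%E by exact: n2_ge0.
case: (n2 (leb d) g) => [r _|_|//]; last by rewrite leey.
by rewrite -EFinD -EFinM lee_fin; lra.
Qed.

Definition en n : R := n.+1%:R^-1.

Lemma en_gt0 n : 0 < en n. Proof. by rewrite invr_gt0. Qed.

Lemma cvg_phi d (x : euclid R d) : phi (en n) x @[n --> \oo] --> (1 : R).
Proof.
rewrite (_ : 1 = \prod_(i < d) 1); last by rewrite big1.
apply: (@cvg_prodr _ _ (fun n i => abel (en n) (tnth x i)) (fun=> 1)) => i.
rewrite /abel -[1]expR0 -[X in expR X]oppr0 -[X in expR (- X)](mul0r `|tnth x i|).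
apply: (@cvg_comp _ _ _ (fun n => - (en n * `|tnth x i|)) expR); last exact: continuous_expR.
apply: cvgN; apply: cvgM; [exact: cvg_harmonic|exact: cvg_cst].
Qed.

Lemma tends0_phi d (h : euclid R d -> R[i]) : cL2 (leb d) h ->
  tends0 (fun n => n2 (leb d) (fun x => ((phi (en n) x)%:C * h x - h x)%R)).
Proof.
move=> [mh h2]; apply: (@n2_dominated _ _ _ _ _ _ (fun x => (cabs (h x) ^+ 2)%:E)) => //.
- by move=> n; apply: cmeasM => //; exact: cmeas_phi.
- move=> x; rewrite /ccvg.
  under eq_fun do rewrite -[X in _ - X]mul1r -mulrBl cabsM -[1]/(1%:C) -rmorphB cabs_real.
  rewrite -[0](mul0r (cabs (h x))); apply: cvgM; last exact: cvg_cst.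
  rewrite -[0](@normr0 _ R); apply: cvg_norm; rewrite -[0](subrr 1).
  by apply: cvgB; [exact: cvg_phi|exact: cvg_cst].
- exact: measurable_EFin_cabs2.
- move=> n x; rewrite lee_fin -[X in _ - X]mul1r -mulrBl cabsM -[1]/(1%:C) -rmorphB cabs_real exprMn.
  rewrite ler_piMl ?sqr_ge0// real_normK ?num_real//.
  have := phi_ge0 (en n) x; have := phi_le1 x (ltW (en_gt0 n)).
  by move: (phi _ _) => p; nra.
Qed.

(** The weights [phi (en n)] tend to 1, and Fatou's lemma removes them from [n2_phi_fourier]. *)
Lemma n2_fourier_le d (g : euclid R d -> R[i]) : cL1 (leb d) g ->
  (n2 (leb d) (fourier g) <= n2 (leb d) g)%E.
Proof.
move=> lg; have [mg _] := lg; have mF := cmeas_fourier mg.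
rewrite (_ : fourier g = fun x => fourier g x - 0); last by apply/funext => x; rewrite subr0.
apply: (@n2_fatou _ _ _ (leb d) (fun n x => (phi (en n) x)%:C * fourier g x) _ (fun=> 0) _ 0).
- by move=> n; apply: cmeasM => //; exact: cmeas_phi.
- by [].
- exact: cmeas_cst.
- apply: aeW => x; rewrite /ccvg.
  under eq_fun do rewrite -[X in _ - X]mul1r -mulrBl cabsM -[1]/(1%:C) -rmorphB cabs_real.
  rewrite -[0](mul0r (cabs (fourier g x))); apply: cvgM; last exact: cvg_cst.
  rewrite -[0](@normr0 _ R); apply: cvg_norm; rewrite -[0](subrr 1).
  by apply: cvgB; [exact: cvg_phi|exact: cvg_cst].
- move=> n _; apply: le_trans (n2_phi_fourier (en_gt0 n) lg).
  by rewrite (@eq_n2 _ _ _ (leb d) _ (fun x => (phi (en n) x)%:C * fourier g x))// => x; rewrite subr0.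
Qed.

Lemma tends0_sq (a : nat -> R) : (forall n, 0 <= a n) -> tends0 (fun n => (a n)%:E) ->
  tends0 (fun n => (a n ^+ 2)%:E).
Proof.
move=> a0 ta e e0; have m0 : 0 < Num.min e 1 by rewrite lt_min e0 ltr01.
have [N hN] := ta _ m0.
exists N => n /hN; rewrite !lee_fin le_min => /andP[h1 h2].
by apply: le_trans h1; rewrite expr2 ler_piMr.
Qed.

Lemma cL2_econv d e (g : euclid R d -> R[i]) : 0 < e -> cL1 (leb d) g -> cL2 (leb d) g ->
  cL2 (leb d) (econv e g).
Proof.
move=> e0 lg [mg g2]; split; first exact: cmeas_econv.
have lp := cL1_fourier_phi e0 lg.
rewrite (_ : econv e g = ifourier (fun x => (phi e x)%:C * fourier g x)); last first.
  by apply/funext => x; rewrite ifourier_phi_fourier.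
rewrite n2_ifourier; last by case: lp.
by apply: le_lt_trans (n2_fourier_le lp) _; apply: le_lt_trans (n2_phi_fourier e0 lg) _.
Qed.

(** The averages are inverse transforms of [phi (en n)] times [fourier g], a convergent sequence, so
    the contraction property makes them Cauchy. Their limit has the same integrals over boxes as [g]
    by [weak_econv]. *)
Lemma tends0_econv d (g : euclid R d -> R[i]) : cL1 (leb d) g -> cL2 (leb d) g ->
  tends0 (fun n => n2 (leb d) (fun x => (econv (en n) g x - g x)%R)).
Proof.
move=> lg l2g; have [mg _] := lg; have [_ g2] := l2g.
have lF n : cL2 (leb d) (econv (en n) g) by apply: cL2_econv => //; exact: en_gt0.
have mF n : cmeas (econv (en n) g) by case: (lF n).
have mh := cmeas_fourier mg.
have lh : cL2 (leb d) (fourier g).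
  by split => //; apply: le_lt_trans (n2_fourier_le lg) _.
have lp n := cL1_fourier_phi (en_gt0 n) lg.
have mp n : cmeas (fun x => (phi (en n) x)%:C * fourier g x) by case: (lp n).
have cF : n2cauchy (leb d) (fun n => econv (en n) g).
  move=> e e0; have [N hN] := n2cauchy_of_cvg mp mh (tends0_phi lh) e0.
  exists N => m n Nm Nn; apply: le_trans (hN m n Nm Nn).
  apply: le_trans (n2_fourier_le (cL1B (lp m) (lp n))).
  rewrite -n2_ifourier; last exact: cmeasB.
  rewrite (@eq_n2 _ _ _ (leb d) _ (ifourier (fun x => (phi (en m) x)%:C * fourier g x - (phi (en n) x)%:C * fourier g x)))//.
  by move=> x; rewrite ifourierB// !ifourier_phi_fourier// en_gt0.
have [G [[mG G2] tG]] := riesz_fischer lF cF.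
suff Gg : {ae leb d, forall x, G x = g x}.
  move=> e e0; have [N hN] := tG e e0; exists N => n /hN.
  suff -> : n2 (leb d) (fun x => econv (en n) g x - G x) = n2 (leb d) (fun x => econv (en n) g x - g x) by [].
  apply: ae_eq_n2; [exact: cmeasB|exact: cmeasB|].
  by apply: filterS Gg => x ->.
apply: ae_eq_of_boxes => // a b.
- by apply: cL1_mul => //; exact: cL2_indc.
- by apply: cL1_mul => //; exact: cL2_indc.
have lI (h : euclid R d -> R[i]) : cL2 (leb d) h -> cL1 (leb d) (fun x => indc a b x * h x).
  by move=> lh'; apply: cL1_mul => //; exact: cL2_indc.
set x := cint _ _; set y := cint _ _.
pose a_ n := cint (leb d) (fun x => indc a b x * econv (en n) g x).
have t1 : tends0 (fun n => (cabs (a_ n - y) ^+ 2)%:E).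
  by apply: tends0_sq => [n|]; [exact: cabs_ge0|exact: weak_econv].
have t2 : tends0 (fun n => (cabs (x - a_ n) ^+ 2)%:E).
  have fI : n2 (leb d) (indc a b) \is a fin_num by rewrite ge0_fin_numE ?n2_ge0//; case: (cL2_indc a b).
  have I0 : 0 <= fine (n2 (leb d) (indc a b)) by rewrite fine_ge0// n2_ge0.
  apply: tends0_le (tends0Z I0 tG) => n.
  rewrite fineK// cabsB.
  rewrite (_ : a_ n - x = cint (leb d) (fun x => indc a b x * (econv (en n) g x - G x))).
    by apply: cabs_cint_mul_le; [exact: cmeas_indc|exact: cmeasB].
  rewrite /a_ /x -cintB; [|exact: lI|exact: lI].
  by apply: eq_cint => z; rewrite mulrBr.
apply/eqP; rewrite -subr_eq0; apply/eqP; apply: cabs_eq0; apply/eqP; rewrite -sqrf_eq0; apply/eqP.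
suff : (cabs (x - y) ^+ 2)%:E = 0%E by case.
apply: (@tends0_cst_le _ _ (fun n => 2%:E * (cabs (x - a_ n) ^+ 2)%:E + 2%:E * (cabs (a_ n - y) ^+ 2)%:E)%E).
- by rewrite lee_fin sqr_ge0.
- move=> n; rewrite -!EFinM -EFinD lee_fin.
  by have := cabs2D_le2 (x - a_ n) (a_ n - y); rewrite addrA subrK.
by apply: tends0D; apply: tends0Z.
Qed.

End plancherel.

(** * Plancherel's theorem, the L^2 transform as a graph, the Schrödinger group *)

Section L2_fourier.
Context {R : realType}.

Lemma sq_lty (a : \bar R) : (0 <= a)%E -> ((a * a < +oo) <-> (a < +oo))%E.
Proof.
case: a => [r| |]// _.
by rewrite -EFinM !ltry.
Qed.

Lemma tends0_sqe (a : nat -> \bar R) : (forall n, 0 <= a n)%E ->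
  tends0 a <-> tends0 (fun n => a n * a n)%E.
Proof.
move=> a0; split => ta e e0.
  have m0 : 0 < Num.min e 1 by rewrite lt_min e0 ltr01.
  have [N hN] := ta _ m0; exists N => n /hN.
  case: (a n) (a0 n) => [r|//|//]; rewrite !lee_fin => r0.
  by rewrite le_min => /andP[h1 h2]; nra.
have [N hN] := ta _ (mulr_gt0 e0 e0); exists N => n /hN.
case: (a n) (a0 n) => [r| |]//.
rewrite -EFinM !lee_fin => r0; rewrite -!expr2.
by rewrite ler_pXn2r// nnegrE// ltW.
Qed.

Section norms.
Context {dT} {T : measurableType dT} (mu : {measure set T -> \bar R}).

Lemma Lnorm_sq (k : T -> R) :
  (Lnorm mu 2%:E (EFin \o k) * Lnorm mu 2%:E (EFin \o k) = \int[mu]_x (k x ^+ 2)%:E)%E.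
Proof.
rewrite -poweR2 ?Lnorm_ge0// poweR_Lnorm//.
by apply: eq_integral => x _; rewrite /= powR_mulrn// real_normK ?num_real.
Qed.

End norms.

Lemma memLp2P d (g : euclid R d -> R[i]) : memLp 2%:E g <-> cL2 (leb d) g.
Proof.
have E : n2 (leb d) g = (Lpnorm 2%:E g * Lpnorm 2%:E g)%E by rewrite /Lpnorm Lnorm_sq.
split=> -[mg h]; split => //.
  by rewrite E; apply/(sq_lty (Lnorm_ge0 _ _ _)).
by apply/(sq_lty (Lnorm_ge0 _ _ _)); rewrite -?E.
Qed.

Lemma memLp1P d (g : euclid R d -> R[i]) : memLp 1%:E g <-> cL1 (leb d) g.
Proof.
have E : (\int[leb d]_x (cabs (g x))%:E)%E = Lpnorm 1%:E g.
  by rewrite /Lpnorm Lnorm1; apply: eq_integral => x _; rewrite gee0_abs// lee_fin cabs_ge0.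
by split=> -[mg h]; split => //; rewrite ?E// -?E.
Qed.

Lemma Lpnorm2_cvg0 d (g : nat -> euclid R d -> R[i]) :
  (Lpnorm 2%:E (g n) @[n --> \oo] --> 0%E) <-> tends0 (fun n => n2 (leb d) (g n)).
Proof.
rewrite tends0P; last by move=> n; exact: Lnorm_ge0.
rewrite tends0_sqe; last by move=> n; exact: Lnorm_ge0.
have -> // : (fun n => Lpnorm 2%:E (g n) * Lpnorm 2%:E (g n))%E = (fun n => n2 (leb d) (g n)).
by apply/funext => n; rewrite /Lpnorm Lnorm_sq.
Qed.

(** [is_fourierL2] in terms of squared norms and [tends0]; the equivalence is [fpairP]. *)
Definition fpair d (g G : euclid R d -> R[i]) : Prop :=
  [/\ cL2 (leb d) g, cL2 (leb d) G & exists g_ : nat -> euclid R d -> R[i],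
    [/\ forall n, cL1 (leb d) (g_ n) /\ cL2 (leb d) (g_ n),
        tends0 (fun n => n2 (leb d) (fun x => g_ n x - g x)%R) &
        tends0 (fun n => n2 (leb d) (fun x => fourier (g_ n) x - G x)%R)]].

Lemma fpairP d (g G : euclid R d -> R[i]) : is_fourierL2 g G <-> fpair g G.
Proof.
split => -[l1 l2 [g_ [h1 h2 h3]]]; split; try exact/memLp2P; exists g_; split.
- by move=> n; have [/memLp1P ? /memLp2P ?] := h1 n.
- exact/(Lpnorm2_cvg0 (fun n x => g_ n x - g x)).
- exact/(Lpnorm2_cvg0 (fun n x => fourier (g_ n) x - G x)).
- by move=> n; have [/memLp1P ? /memLp2P ?] := h1 n.
- exact/(Lpnorm2_cvg0 (fun n x => g_ n x - g x)).
- exact/(Lpnorm2_cvg0 (fun n x => fourier (g_ n) x - G x)).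
Qed.

Lemma tends0_en : tends0 (fun n => (@en R n)%:E).
Proof.
move=> e e0; have /cvgrPdist_le /(_ _ e0)[N _ hN] := @cvg_harmonic R.
exists N => n /hN; rewrite sub0r normrN /= lee_fin; apply: le_trans.
exact: ler_norm.
Qed.

Lemma n2_eq_of_tends0 dT (T : measurableType dT) (mu : {measure set T -> \bar R})
    dS (S : measurableType dS) (nu : {measure set S -> \bar R}) F G F' G' :
  (forall n, cL2 mu (F n)) -> cL2 mu G -> (forall n, cL2 nu (F' n)) -> cL2 nu G' ->
  tends0 (fun n => n2 mu (fun x => F n x - G x)%R) ->
  tends0 (fun n => n2 nu (fun x => F' n x - G' x)%R) ->
  (forall n, n2 mu (F n) = n2 nu (F' n)) -> n2 mu G = n2 nu G'.
Proof.
move=> lF lG lF' lG' t t' e.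
have h := n2_cvg lF lG t; have h' := n2_cvg lF' lG' t'.
have E : (fun n => n2 mu (F n)) = (fun n => n2 nu (F' n)) by apply/funext.
by rewrite E in h; exact: cvg_unique h h'.
Qed.

Lemma cL2_fourier d (g : euclid R d -> R[i]) : cL1 (leb d) g -> cL2 (leb d) g ->
  cL2 (leb d) (fourier g).
Proof.
move=> lg [mg g2]; split; first exact: cmeas_fourier.
exact: le_lt_trans (n2_fourier_le lg) g2.
Qed.

Lemma cL2_ifourier d (g : euclid R d -> R[i]) : cL1 (leb d) g -> cL2 (leb d) g ->
  cL2 (leb d) (ifourier g).
Proof.
move=> lg l2; have [mg _] := lg; split; first exact: cmeas_ifourier.
by rewrite n2_ifourier//; case: (cL2_fourier lg l2).
Qed.

(** One inequality is the contraction property. For the other, the norm of [econv (en n) g], an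
    inverse transform of the weighted [fourier g], is at most that of [fourier g] and tends to that
    of [g]. *)
Lemma plancherel_L1 d (g : euclid R d -> R[i]) : cL1 (leb d) g -> cL2 (leb d) g ->
  n2 (leb d) (fourier g) = n2 (leb d) g.
Proof.
move=> lg l2; apply/eqP; rewrite eq_le n2_fourier_le//=.
have [mg _] := lg; have mF := cmeas_fourier mg.
have lF n : cL2 (leb d) (econv (en n) g) by apply: cL2_econv => //; exact: en_gt0.
have h := n2_cvg lF l2 (tends0_econv lg l2).
rewrite -(cvg_lim _ h)//; apply: lime_le; first by apply/cvg_ex; eexists; exact: h.
near=> n; have lp := cL1_fourier_phi (en_gt0 n) lg.
rewrite (@eq_n2 _ _ _ (leb d) _ (ifourier (fun x => (phi (en n) x)%:C * fourier g x))); last first.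
  by move=> x; rewrite ifourier_phi_fourier// en_gt0.
rewrite n2_ifourier; last by case: lp.
apply: le_trans (n2_fourier_le lp) _; apply: le_n2 => //; first by case: lp.
move=> x; rewrite cabsM cabs_phi ler_piMl ?cabs_ge0// phi_le1// ltW// en_gt0.
Unshelve. all: by end_near. Qed.

Lemma fpair_fourier d (g : euclid R d -> R[i]) : cL1 (leb d) g -> cL2 (leb d) g ->
  fpair g (fourier g).
Proof.
move=> lg l2; have lF := cL2_fourier lg l2; split => //.
have z (h : euclid R d -> R[i]) : tends0 (fun n : nat => n2 (leb d) (fun x => h x - h x)%R).
  move=> e e0; exists 0%N => n _.
  rewrite (_ : n2 _ _ = 0%E) ?lee_fin ?ltW//.
  by rewrite /n2; under eq_integral do rewrite subrr cabs0 expr0n; rewrite integral0.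
by exists (fun=> g); split => //; exact: z.
Qed.

Lemma tends0_n2B dT (T : measurableType dT) (mu : {measure set T -> \bar R})
  (f_ g_ : nat -> T -> R[i]) f g : (forall n, cmeas (f_ n)) -> (forall n, cmeas (g_ n)) ->
  cmeas f -> cmeas g ->
  tends0 (fun n => n2 mu (fun x => f_ n x - f x)%R) ->
  tends0 (fun n => n2 mu (fun x => g_ n x - g x)%R) ->
  tends0 (fun n => n2 mu (fun x => (f_ n x - g_ n x) - (f x - g x))%R).
Proof.
move=> mf mg m1 m2 tf tg.
apply: (@tends0_le _ _ (fun n => 2%:E * n2 mu (fun x => f_ n x - f x)%R + 2%:E * n2 mu (fun x => g_ n x - g x)%R)%E); last first.
  by apply: tends0D; apply: tends0Z.
move=> n; have -> : n2 mu (fun x => g_ n x - g x) = n2 mu (fun x => - (g_ n x - g x)) by rewrite n2N.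
apply: le_trans (n2D_le2 _ _ _); [|exact: cmeasB|by apply: cmeasN; exact: cmeasB].
by rewrite le_eqVlt; apply/orP; left; apply/eqP; apply: eq_n2 => x; congr cabs; ring.
Qed.

Lemma fpairB d (g G h H : euclid R d -> R[i]) : fpair g G -> fpair h H ->
  fpair (fun x => g x - h x) (fun x => G x - H x).
Proof.
move=> [lg lG [g_ [g1 g2 g3]]] [lh lH [h_ [h1 h2 h3]]].
split; [exact: cL2B|exact: cL2B|exists (fun n x => g_ n x - h_ n x); split].
- by move=> n; have [? ?] := g1 n; have [? ?] := h1 n; split; [exact: cL1B|exact: cL2B].
- apply: tends0_n2B => //; try by case: lg; case: lh.
  + by move=> n; case: (g1 n) => -[].
  + by move=> n; case: (h1 n) => -[].
have mf n : cmeas (fourier (g_ n)) by apply: cmeas_fourier; case: (g1 n) => -[].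
have mf' n : cmeas (fourier (h_ n)) by apply: cmeas_fourier; case: (h1 n) => -[].
have [mG _] := lG; have [mH _] := lH.
apply: tends0_le (tends0_n2B mf mf' mG mH g3 h3) => n.
rewrite le_eqVlt; apply/orP; left; apply/eqP; apply: eq_n2 => x; congr cabs.
by rewrite fourierB//; [case: (g1 n)|case: (h1 n)].
Qed.

Lemma fpair_plancherel d (g G : euclid R d -> R[i]) : fpair g G -> n2 (leb d) g = n2 (leb d) G.
Proof.
move=> [lg lG [g_ [g1 g2 g3]]].
apply: (n2_eq_of_tends0 (F := g_) (F' := fun n => fourier (g_ n))) => //.
- by move=> n; case: (g1 n).
- by move=> n; case: (g1 n) => ? ?; exact: cL2_fourier.
- by move=> n; case: (g1 n) => ? ?; rewrite plancherel_L1.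
Qed.

Lemma fpair_isometry d (g G h H : euclid R d -> R[i]) : fpair g G -> fpair h H ->
  n2 (leb d) (fun x => g x - h x) = n2 (leb d) (fun x => G x - H x).
Proof. by move=> p q; exact: fpair_plancherel (fpairB p q). Qed.

(** A diagonal choice: from the sequence that approximates the n-th pair one takes a term within 1 /
    (n + 1) of it on both sides. *)
Lemma fpair_closed d (g_ G_ : nat -> euclid R d -> R[i]) g G : cL2 (leb d) g -> cL2 (leb d) G ->
  (forall n, fpair (g_ n) (G_ n)) ->
  tends0 (fun n => n2 (leb d) (fun x => g_ n x - g x)%R) ->
  tends0 (fun n => n2 (leb d) (fun x => G_ n x - G x)%R) -> fpair g G.
Proof.
move=> lg lG p tg tG.
have /choice[h hP] n : exists h : euclid R d -> R[i], [/\ cL1 (leb d) h /\ cL2 (leb d) h,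
    (n2 (leb d) (fun x => h x - g_ n x)%R <= (en n)%:E)%E &
    (n2 (leb d) (fun x => fourier h x - G_ n x)%R <= (en n)%:E)%E].
  have [_ _ [k [k1 k2 k3]]] := p n.
  have [N1 h1] := k2 _ (en_gt0 n); have [N2 h2] := k3 _ (en_gt0 n).
  by exists (k (maxn N1 N2)); split => //; [apply: h1; exact: leq_maxl|apply: h2; exact: leq_maxr].
split => //; exists h.
have mh n : cmeas (h n) by have [[[? _] _] _ _] := hP n.
have [mg _] := lg; have [mG _] := lG.
have aux (a b : nat -> euclid R d -> R[i]) c : (forall n, cmeas (a n)) -> (forall n, cmeas (b n)) -> cmeas c ->
   (forall n, (n2 (leb d) (fun x => a n x - b n x)%R <= (en n)%:E)%E) ->
   tends0 (fun n => n2 (leb d) (fun x => b n x - c x)%R) ->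
   tends0 (fun n => n2 (leb d) (fun x => a n x - c x)%R).
  move=> ma mb mc ab bc.
  apply: (tends0_le (fun n => n2B_trans (leb d) (ma n) (mb n) mc)).
  apply: tends0D; apply: tends0Z => //.
  by apply: (tends0_le (b := fun n => (en n)%:E)) => //; exact: tends0_en.
split.
- by move=> n; case: (hP n).
- apply: (aux _ g_) => //; last by move=> n; case: (hP n).
  by move=> n; case: (p n) => -[].
- apply: (aux _ G_) => //; last by move=> n; case: (hP n).
  + by move=> n; exact: cmeas_fourier.
  + by move=> n; case: (p n) => _ [].
Qed.

Lemma cL12_phi d n (g : euclid R d -> R[i]) : cL2 (leb d) g ->
  cL1 (leb d) (fun x => (phi (en n) x)%:C * g x) /\ cL2 (leb d) (fun x => (phi (en n) x)%:C * g x).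
Proof.
move=> lg; split; first by apply: cL1_mul => //; apply: cL2_phi; exact: en_gt0.
have [mg _] := lg; apply: le_cL2 lg; first by apply: cmeasM => //; exact: cmeas_phi.
by move=> x; rewrite cabsM cabs_phi ler_piMl ?cabs_ge0// phi_le1// ltW// en_gt0.
Qed.

Lemma fpair_exists d (g : euclid R d -> R[i]) : cL2 (leb d) g -> exists G, fpair g G.
Proof.
move=> lg; pose g_ n (x : euclid R d) := (phi (en n) x)%:C * g x.
have l n : cL1 (leb d) (g_ n) /\ cL2 (leb d) (g_ n) by exact: cL12_phi.
have t : tends0 (fun n => n2 (leb d) (fun x => g_ n x - g x)) by exact: tends0_phi.
have lF n : cL2 (leb d) (fourier (g_ n)) by have [? ?] := l n; exact: cL2_fourier.
have p n : fpair (g_ n) (fourier (g_ n)) by have [? ?] := l n; exact: fpair_fourier.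
have mg_ n : cmeas (g_ n) by case: (l n) => -[].
have cF : n2cauchy (leb d) (fun n => fourier (g_ n)).
  move=> e e0; have [N hN] := n2cauchy_of_cvg mg_ (proj1 lg) t e0.
  by exists N => m n Nm Nn; rewrite -(fpair_isometry (p m) (p n)); exact: hN.
have [G [lG tG]] := riesz_fischer lF cF.
by exists G; exact: (fpair_closed lg lG p t tG).
Qed.

(** Inversion in graph form. [ifourier M] need not be integrable, so it is approximated by its
    products with [phi (en n)], whose transforms are the Poisson averages of [M]. *)
Lemma fpair_ifourier d (M : euclid R d -> R[i]) : cL1 (leb d) M -> cL2 (leb d) M ->
  fpair (ifourier M) M.
Proof.
move=> l1 l2; have li := cL2_ifourier l1 l2.
split => //; exists (fun n x => (phi (en n) x)%:C * ifourier M x); split.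
- by move=> n; exact: cL12_phi.
- exact: tends0_phi.
apply: tends0_le (tends0_econv l1 l2) => n.
rewrite le_eqVlt; apply/orP; left; apply/eqP; apply: eq_n2 => x.
by rewrite fourier_phi_ifourier// en_gt0.
Qed.

Lemma fpair_inverse d (G : euclid R d -> R[i]) : cL2 (leb d) G -> exists g, fpair g G.
Proof.
move=> lg; pose g_ n (x : euclid R d) := (phi (en n) x)%:C * G x.
have l n : cL1 (leb d) (g_ n) /\ cL2 (leb d) (g_ n) by exact: cL12_phi.
have t : tends0 (fun n => n2 (leb d) (fun x => g_ n x - G x)) by exact: tends0_phi.
have lF n : cL2 (leb d) (ifourier (g_ n)) by have [? ?] := l n; exact: cL2_ifourier.
have p n : fpair (ifourier (g_ n)) (g_ n) by have [? ?] := l n; exact: fpair_ifourier.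
have mg_ n : cmeas (g_ n) by case: (l n) => -[].
have cF : n2cauchy (leb d) (fun n => ifourier (g_ n)).
  move=> e e0; have [N hN] := n2cauchy_of_cvg mg_ (proj1 lg) t e0.
  by exists N => m n Nm Nn; rewrite (fpair_isometry (p m) (p n)); exact: hN.
have [g [lg' tG]] := riesz_fischer lF cF.
by exists g; exact: (fpair_closed lg' lg p tG t).
Qed.

Lemma cL2_cisM d (h : euclid R d -> R) (G : euclid R d -> R[i]) : measurable_fun setT h ->
  cL2 (leb d) G -> cL2 (leb d) (fun x => cis (h x) * G x).
Proof.
move=> mh lG; have [mG _] := lG; apply: le_cL2 lG; last by move=> x; rewrite cabsM cabs_cis mul1r.
by apply: cmeasM => //; exact: cmeas_cis.
Qed.

Lemma measurable_chirp d (s : R) : measurable_fun setT (fun xi : euclid R d => - (s * sqnorm xi)).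
Proof.
apply: measurable_funN; apply: measurable_funM; first exact: measurable_cst.
by apply: measurable_sqnorm.
Qed.

Lemma schrodingerP d (s : R) (g : euclid R d -> R[i]) : cL2 (leb d) g ->
  exists2 G, fpair g G & fpair (schrodinger s g) (fun xi => cis (- (s * sqnorm xi)) * G xi).
Proof.
move=> lg.
have [u hu] : exists u, is_schrodinger s g u.
  have [G pG] := fpair_exists lg; have [_ lG _] := pG.
  have [u pu] := fpair_inverse (cL2_cisM (measurable_chirp s) lG).
  by exists u, G; exact/fpairP.
(* A witness exists, so [xget] returns an actual solution and not its default 0. *)
have : is_schrodinger s g (schrodinger s g) by exact: (@xgetPex _ (fun=> 0) [set u | is_schrodinger s g u] (ex_intro _ u hu)).
by move=> [G /fpairP h1 /fpairP h2]; exists G.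
Qed.

(** [schrodingerP] only provides some transform of [g]. It is at distance zero from the given [G],
    and closedness of the graph, applied to constant sequences, exchanges one for the other. *)
Lemma schrodinger_pair d (s : R) (g G : euclid R d -> R[i]) : fpair g G ->
  fpair (schrodinger s g) (fun xi => cis (- (s * sqnorm xi)) * G xi).
Proof.
move=> p; have [lg lG _] := p; have [G' p' q] := schrodingerP s lg.
have z : n2 (leb d) (fun x => G' x - G x) = 0%E.
  rewrite -(fpair_isometry p' p) /n2.
  by under eq_integral do rewrite subrr cabs0 expr0n; rewrite integral0.
have lc := cL2_cisM (measurable_chirp s) lG.
have [lu _ _] := q.
have z0 c : 0%E = c -> tends0 (fun n : nat => c : \bar R).
  by move=> <- e e0; exists 0%N => n _; rewrite lee_fin ltW.
apply: (fpair_closed lu lc (fun n : nat => q)); apply: z0.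
  by rewrite /n2; under eq_integral do rewrite subrr cabs0 expr0n; rewrite integral0.
rewrite -[LHS]z; apply: eq_n2 => x.
by rewrite -mulrBr cabsM cabs_cis mul1r.
Qed.

End L2_fourier.

(** * Rotations of a two-dimensional fibre *)

Section rotation.
Context {R : realType}.

Lemma tnth_vadd d (x y : euclid R d) i : tnth (vadd x y) i = tnth x i + tnth y i.
Proof. exact: tnth_mktuple. Qed.

Lemma tnth_scalev d a (x : euclid R d) i : tnth (scalev a x) i = a * tnth x i.
Proof. exact: tnth_mktuple. Qed.

Variable n : nat.
Hypothesis n_2 : n = 2%N.

Fact lt0n2 : (0 < n)%N. Proof. by rewrite n_2. Qed.
Fact lt1n2 : (1 < n)%N. Proof. by rewrite n_2. Qed.
Definition i0 : 'I_n := Ordinal lt0n2.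
Definition i1 : 'I_n := Ordinal lt1n2.

Lemma ord2P (i : 'I_n) : i = i0 \/ i = i1.
Proof.
have := ltn_ord i; rewrite {2}n_2 => hi.
by have [/eqP h|h] := boolP (nat_of_ord i == 0%N); [left|right]; apply: val_inj => //=;
  case: i hi h => -[|[|]].
Qed.

Lemma sum_ord2 (F : 'I_n -> R) : \sum_(i < n) F i = F i0 + F i1.
Proof.
rewrite (bigD1 i0)//= (bigD1 i1)//= big1 ?addr0// => i /andP[h1 h2].
by case: (ord2P i) h1 h2 => ->; rewrite ?eqxx.
Qed.

Definition vec2 (a b : R) : euclid R n := [tuple if i == i0 then a else b | i < n].

Lemma vec2_0 a b : tnth (vec2 a b) i0 = a.
Proof. by rewrite tnth_mktuple eqxx. Qed.

Lemma vec2_1 a b : tnth (vec2 a b) i1 = b.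
Proof. by rewrite tnth_mktuple. Qed.

Lemma eq_vec2 (x y : euclid R n) : tnth x i0 = tnth y i0 -> tnth x i1 = tnth y i1 -> x = y.
Proof. by move=> h0 h1; apply: eq_from_tnth => i; case: (ord2P i) => ->. Qed.

(** Complex multiplication of plane vectors: for [sqnorm e = 1] it is a rotation. Its commutativity
    and associativity stand in for the addition of angles. *)
Definition crot (e x : euclid R n) : euclid R n :=
  vec2 (tnth e i0 * tnth x i0 - tnth e i1 * tnth x i1) (tnth e i1 * tnth x i0 + tnth e i0 * tnth x i1).

Lemma crotC e x : crot e x = crot x e.
Proof. by apply: eq_vec2; rewrite ?vec2_0 ?vec2_1; ring. Qed.

Lemma crotA e f x : crot e (crot f x) = crot (crot e f) x.
Proof. by apply: eq_vec2; rewrite ?vec2_0 ?vec2_1 ?vec2_0 ?vec2_1; ring. Qed.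

Lemma crot_vadd e x y : crot e (vadd x y) = vadd (crot e x) (crot e y).
Proof. by apply: eq_vec2; rewrite !(tnth_vadd, tnth_scalev, vec2_0, vec2_1); ring. Qed.

Lemma dot_crot e x y : dot (crot e x) (crot e y) = sqnorm e * dot x y.
Proof. by rewrite /sqnorm /dot !sum_ord2 !vec2_0 !vec2_1; ring. Qed.

Lemma sqnorm_crot e x : sqnorm (crot e x) = sqnorm e * sqnorm x.
Proof. exact: dot_crot. Qed.

Definition one2 : euclid R n := vec2 1 0.

Lemma crot1 x : crot one2 x = x.
Proof. by apply: eq_vec2; rewrite !(vec2_0, vec2_1); ring. Qed.

Lemma sqnorm_one2 : sqnorm one2 = 1.
Proof. by rewrite /sqnorm /dot sum_ord2 vec2_0 vec2_1; ring. Qed.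

Definition conj2 (e : euclid R n) : euclid R n := vec2 (tnth e i0) (- tnth e i1).

Lemma crot_conj2 e : sqnorm e = 1 -> crot e (conj2 e) = one2.
Proof.
rewrite /sqnorm /dot sum_ord2 => e1.
by apply: eq_vec2; rewrite ?vec2_0 ?vec2_1 ?vec2_0 ?vec2_1 -?e1; ring.
Qed.

(* The value [one2] at [0] keeps [unitv w] on the unit circle. *)
Definition unitv (w : euclid R n) : euclid R n :=
  if sqnorm w == 0 then one2 else scalev (Num.sqrt (sqnorm w))^-1 w.

Lemma sqnorm_unitv w : sqnorm (unitv w) = 1.
Proof.
rewrite /unitv; case: eqP => [_|/eqP w0]; first exact: sqnorm_one2.
rewrite /sqnorm dotZl dotZr mulrA -expr2 exprVn sqr_sqrtr ?sqnorm_ge0//.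
by rewrite mulVf.
Qed.

Lemma crot_scalev a e x : crot e (scalev a x) = scalev a (crot e x).
Proof. by apply: eq_vec2; rewrite !(tnth_vadd, tnth_scalev, vec2_0, vec2_1); ring. Qed.

Lemma unitv_crot e w : sqnorm e = 1 -> sqnorm w != 0 -> unitv (crot e w) = crot e (unitv w).
Proof.
move=> e1 w0; rewrite /unitv sqnorm_crot e1 mul1r (negbTE w0).
by rewrite crot_scalev.
Qed.

(** Polar decomposition; at the origin the default direction multiplies the zero vector. *)
Lemma unitvK w : w = crot (unitv w) (vec2 (Num.sqrt (sqnorm w)) 0).
Proof.
have [w0|w0] := eqVneq (sqnorm w) 0.
  rewrite /unitv w0 eqxx crot1 sqrtr0.
  have := w0; rewrite /sqnorm /dot sum_ord2 => h.
  by apply: eq_vec2; rewrite ?vec2_0 ?vec2_1; nra.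
have s0 : Num.sqrt (sqnorm w) != 0.
  by rewrite sqrtr_eq0 -ltNge lt_def w0 sqnorm_ge0.
by rewrite /unitv (negbTE w0); apply: eq_vec2; rewrite !(tnth_scalev, vec2_0, vec2_1); field.
Qed.

Lemma measurable_vec2 dT (T : measurableType dT) (f g : T -> R) : measurable_fun setT f ->
  measurable_fun setT g -> measurable_fun setT (fun x => vec2 (f x) (g x)).
Proof.
move=> mf mg; apply: (measurable_mktuple (f := fun i x => if i == i0 then f x else g x)) => i.
by case: (i == i0).
Qed.

Lemma measurable_crot dT (T : measurableType dT) (f g : T -> euclid R n) : measurable_fun setT f ->
  measurable_fun setT g -> measurable_fun setT (fun x => crot (f x) (g x)).
Proof.
move=> mf mg; apply: measurable_vec2.
  by apply: measurable_funB; apply: measurable_funM; exact: measurable_tnthR.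
by apply: measurable_funD; apply: measurable_funM; exact: measurable_tnthR.
Qed.

Lemma measurable_unitv : measurable_fun setT unitv.
Proof.
apply: measurable_fun_ifT.
- apply: (measurable_fun_eqr (f := fun w => sqnorm w) (g := fun=> 0)) => //.
  by apply: measurable_sqnorm.
- exact: measurable_cst.
- apply: (measurable_mktuple (f := fun i w => (Num.sqrt (sqnorm w))^-1 * tnth w i)) => i.
  apply: measurable_funM; last by apply: measurable_tnthR.
  have -> : (fun x : euclid R n => (Num.sqrt (sqnorm x))^-1) = (fun x => sqnorm x `^ (- 2^-1)).
    by apply/funext => x; rewrite powRN powR12_sqrt// sqnorm_ge0.
  apply: (measurableT_comp (f := fun x : R => x `^ (- 2^-1))) => //; last by apply: measurable_sqnorm.
Qed.

Lemma mp_crot e : sqnorm e = 1 -> mp (leb n) (leb n) (crot e).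
Proof.
move=> e1; apply: mp_orth.
- by apply: measurable_crot => //; exact: measurable_cst.
- by move=> x y; exact: crot_vadd.
- by move=> y; exists (crot (conj2 e) y); rewrite crotA crot_conj2// crot1.
- by move=> x; rewrite sqnorm_crot e1 mul1r.
Qed.

Section cylinder.
Variable k : nat.
Implicit Types (z : euclid R (n + k)) (F G : euclid R (n + k) -> R[i]).

Definition Rot (e : euclid R n) z : euclid R (n + k) := catv (crot e (lv z), rv z).

Lemma lv_Rot e z : lv (Rot e z) = crot e (lv z). Proof. exact: lv_cat. Qed.
Lemma rv_Rot e z : rv (Rot e z) = rv z. Proof. exact: rv_cat. Qed.

Lemma dot_split z z' : dot z z' = dot (lv z) (lv z') + dot (rv z) (rv z').
Proof. by rewrite -{1}(catvK z) -{1}(catvK z') dot_catv. Qed.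

Lemma dot_Rot e z z' : sqnorm e = 1 -> dot (Rot e z) (Rot e z') = dot z z'.
Proof. by move=> e1; rewrite !dot_split !lv_Rot !rv_Rot dot_crot e1 mul1r. Qed.

Lemma RotA e f z : Rot e (Rot f z) = Rot (crot e f) z.
Proof. by rewrite {1}/Rot lv_Rot rv_Rot crotA. Qed.

Lemma measurable_Rot dT (T : measurableType dT) (f : T -> euclid R n) (g : T -> euclid R (n + k)) :
  measurable_fun setT f -> measurable_fun setT g -> measurable_fun setT (fun x => Rot (f x) (g x)).
Proof.
move=> mf mg; apply: (measurableT_comp (f := @catv R n k)); first exact: measurable_catv.
apply: measurable_fun_pair.
  by apply: measurable_crot => //; apply: (measurableT_comp (f := @lv R n k)) => //; exact: measurable_lv.
by apply: (measurableT_comp (f := @rv R n k)) => //; exact: measurable_rv.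
Qed.

Lemma mp_Rot e : sqnorm e = 1 -> mp (leb (n + k)) (leb (n + k)) (Rot e).
Proof.
move=> e1; apply: mp_orth.
- by apply: measurable_Rot => //; exact: measurable_cst.
- move=> x y; rewrite /Rot -[X in X = _]/(catv _) -(catvK x) -(catvK y) vadd_catv !lv_cat !rv_cat /=.
  by rewrite vadd_catv /= crot_vadd.
- move=> y; exists (Rot (conj2 e) y); rewrite RotA crot_conj2// /Rot crot1.
  exact: catvK.
- by move=> x; rewrite /sqnorm dot_Rot.
Qed.

End cylinder.
End rotation.

(** * Averages over the rotations of the fibre *)

Section rotation_average.
Context {R : realType}.
Variables (n : nat) (n_2 : n = 2%N) (k : nat).
Local Notation Rot := (Rot n_2).
Local Notation unitv := (unitv n_2).
Implicit Types (z : euclid R (n + k)) (F G : euclid R (n + k) -> R[i]).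
Local Notation area := (@disc_area R n).
Local Notation L := (leb (n + k)).

Definition indD (w : euclid R n) : R[i] := (\1_(@disc R n 1) w)%:C.

Lemma cmeas_indD : cmeas indD.
Proof. by apply: cmeas_real; apply: measurable_indic; exact: measurable_disc. Qed.

Lemma cabs_indD w : cabs (indD w) = \1_(@disc R n 1) w.
Proof. by rewrite cabs_real ger0_norm// indicE. Qed.

Lemma indD_idem w : indD w * indD w = indD w.
Proof. by rewrite /indD -real_cM indicE; case: (_ \in _); rewrite ?mulr1 ?mulr0. Qed.

Lemma cabs_indD_sq w : cabs (indD w) ^+ 2 = \1_(@disc R n 1) w.
Proof. by rewrite expr2 -cabsM indD_idem cabs_indD. Qed.

Lemma leb_disc1 : leb n (@disc R n 1) = area%:E.
Proof. by rewrite leb_disc// mulr1. Qed.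

Lemma n2_indD : n2 (leb n) indD = area%:E.
Proof.
rewrite /n2; under eq_integral do rewrite cabs_indD_sq.
have mD := @measurable_disc R n 1.
by rewrite integral_indic// setIT; exact: leb_disc1.
Qed.

Lemma L1_indD : (\int[leb n]_w (cabs (indD w))%:E = area%:E)%E.
Proof.
by rewrite -n2_indD /n2; apply: eq_integral => w _; rewrite cabs_indD_sq cabs_indD.
Qed.

Lemma cL2_indD : cL2 (leb n) indD.
Proof. by split; [exact: cmeas_indD|rewrite n2_indD ltry]. Qed.

Lemma cL1_indD : cL1 (leb n) indD.
Proof. by split; [exact: cmeas_indD|rewrite L1_indD ltry]. Qed.

(* The average of F over the rotations of the two-dimensional fibre, up to the
   factor pi: the rotations are parametrised by the directions of the points of
   the unit disc. *)
Definition tilde F z : R[i] := cint (leb n) (fun w => indD w * F (Rot (unitv w) z)).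

Lemma measurable_Rot_unitv : measurable_fun setT
  (fun p : euclid R n * euclid R (n + k) => Rot (unitv p.1) p.2).
Proof.
apply: measurable_Rot => //; apply: (measurableT_comp (f := unitv)) => //.
exact: measurable_unitv.
Qed.

Lemma cmeas_Rot_unitv F : cmeas F ->
  cmeas (fun p : euclid R n * euclid R (n + k) => indD p.1 * F (Rot (unitv p.1) p.2)).
Proof.
move=> mF; apply: cmeasM; first by apply: (cmeas_comp cmeas_indD).
by apply: (cmeas_comp mF); exact: measurable_Rot_unitv.
Qed.

Lemma cmeas_swap d1 d2 (T1 : measurableType d1) (T2 : measurableType d2) (f : T1 * T2 -> R[i]) :
  cmeas f -> cmeas (fun p : T2 * T1 => f (p.2, p.1)).
Proof. by move=> mf; apply: (cmeas_comp mf); exact: measurable_fun_pair. Qed.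

Lemma cmeas_tilde F : cmeas F -> cmeas (tilde F).
Proof.
move=> mF; apply: (@cmeas_cint1 _ _ _ _ _ (leb n) (fun p => indD p.2 * F (Rot (unitv p.2) p.1))).
exact: (cmeas_swap (cmeas_Rot_unitv mF)).
Qed.

Lemma cmeas_Rot_unitv2 F z : cmeas F -> cmeas (fun w => indD w * F (Rot (unitv w) z)).
Proof.
move=> mF; apply: cmeasM; first exact: cmeas_indD.
apply: (cmeas_comp mF); apply: measurable_Rot; last exact: measurable_cst.
exact: measurable_unitv.
Qed.

Lemma integral_tilde_swap (h : euclid R (n + k) -> \bar R) : measurable_fun setT h ->
  (forall z, 0 <= h z)%E ->
  (\int[L]_z \int[leb n]_w ((cabs (indD w))%:E * h (Rot (unitv w) z)) = area%:E * \int[L]_z h z)%E.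
Proof.
move=> mh h0.
have mk : measurable_fun setT (fun p : euclid R (n + k) * euclid R n =>
     (cabs (indD p.2))%:E * h (Rot (unitv p.2) p.1))%E.
  apply: emeasurable_funM.
    by apply: measurable_EFin_cabs; apply: (cmeas_comp cmeas_indD).
  apply: (measurableT_comp (f := h)) => //.
  by apply: measurable_Rot => //; apply: (measurableT_comp (f := unitv)) => //; exact: measurable_unitv.
have k0 (p : euclid R (n + k) * euclid R n) : (0 <= (cabs (indD p.2))%:E * h (Rot (unitv p.2) p.1))%E.
  by rewrite mule_ge0// lee_fin cabs_ge0.
apply: etrans (fubini_tonelli (m1 := L) (m2 := leb n) _ mk k0) _.
transitivity (\int[leb n]_w \int[L]_z ((cabs (indD w))%:E * h (Rot (unitv w) z)))%E; first by [].
transitivity (\int[leb n]_w ((cabs (indD w))%:E * \int[L]_z h z))%E; last first.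
  rewrite ge0_integralZr ?L1_indD//.
  - by apply: measurable_EFin_cabs; exact: cmeas_indD.
  - by move=> w _; rewrite lee_fin cabs_ge0.
  - by apply: integral_ge0 => z _.
apply: eq_integral => w _; have mw := @mp_Rot R n n_2 k _ (sqnorm_unitv n_2 w).
rewrite ge0_integralZl ?(mp_ge0 mw)//; last by rewrite lee_fin cabs_ge0.
by apply: (measurableT_comp (f := h)) => //; case: mw.
Qed.

(** Cauchy-Schwarz in [w] against [indD] gives the first factor [area]; invariance of Lebesgue
    measure under each rotation gives the second. *)
Lemma n2_tilde_le F : cmeas F -> (n2 L (tilde F) <= area%:E * (area%:E * n2 L F))%E.
Proof.
move=> mF; have mF2 := measurable_EFin_cabs2 mF.
have m1 z : cmeas (fun w => indD w * F (Rot (unitv w) z)) by exact: cmeas_Rot_unitv2.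
have E z : n2 (leb n) (fun w => indD w * F (Rot (unitv w) z)) =
    (\int[leb n]_w ((cabs (indD w))%:E * (cabs (F (Rot (unitv w) z)) ^+ 2)%:E))%E.
  by apply: eq_integral => w _; rewrite cabsM exprMn cabs_indD_sq cabs_indD EFinM.
have P z : ((cabs (tilde F z) ^+ 2)%:E <= area%:E * n2 (leb n) (fun w => (indD w * F (Rot (unitv w) z))%R))%E.
  rewrite -n2_indD; apply: le_trans (cabs_cint_mul_le _ cmeas_indD (m1 z)).
  rewrite (_ : cint _ _ = tilde F z)//; apply: eq_cint => w.
  by rewrite mulrA indD_idem.
have mE : measurable_fun setT (fun z => n2 (leb n) (fun w => indD w * F (Rot (unitv w) z))).
  apply: (@measurable_Fubini1 _ _ _ _ _ (leb n) (fun p => (cabs (indD p.2 * F (Rot (unitv p.2) p.1)) ^+ 2)%:E)).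
  apply: measurable_EFin_cabs2.
  exact: (cmeas_swap (cmeas_Rot_unitv mF)).
rewrite -(integral_tilde_swap mF2); last by move=> z; rewrite lee_fin sqr_ge0.
under [in leRHS]eq_integral do rewrite -E.
rewrite -ge0_integralZl//; last 2 first.
- by move=> z _; exact: n2_ge0.
- by rewrite lee_fin disc_area_ge0.
apply: ge0_le_integral => //.
- by move=> z _; rewrite lee_fin sqr_ge0.
- by apply: measurable_EFin_cabs2; exact: cmeas_tilde.
- by apply: emeasurable_funM => //; exact: measurable_cst.
Qed.

Lemma cL2_tilde F : cL2 L F -> cL2 L (tilde F).
Proof.
move=> [mF F2]; split; first exact: cmeas_tilde.
apply: le_lt_trans (n2_tilde_le mF) _.
have fF : n2 L F \is a fin_num by rewrite ge0_fin_numE// n2_ge0.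
by rewrite -(fineK fF) -!EFinM ltry.
Qed.

(** Square integrability controls [F] on almost every orbit only; there [tilde] is a convergent
    integral, hence additive ([ae_tildeB]). *)
Lemma ae_cL1_tilde F : cL2 L F ->
  {ae L, forall z, cL2 (leb n) (fun w => indD w * F (Rot (unitv w) z)) /\
     cL1 (leb n) (fun w => indD w * F (Rot (unitv w) z))}.
Proof.
move=> [mF F2]; have mF2 := measurable_EFin_cabs2 mF.
have mE : measurable_fun setT (fun z => n2 (leb n) (fun w => indD w * F (Rot (unitv w) z))).
  apply: (@measurable_Fubini1 _ _ _ _ _ (leb n) (fun p => (cabs (indD p.2 * F (Rot (unitv p.2) p.1)) ^+ 2)%:E)).
  apply: measurable_EFin_cabs2.
  exact: (cmeas_swap (cmeas_Rot_unitv mF)).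
have iE : L.-integrable setT (fun z => n2 (leb n) (fun w => indD w * F (Rot (unitv w) z))).
  apply/integrableP; split => //.
  have h0 z : (0 <= (cabs (F z) ^+ 2)%:E)%E by rewrite lee_fin sqr_ge0.
  have := integral_tilde_swap mF2 h0; set I := (X in X = _ -> _) => HI.
  rewrite (_ : integral _ _ _ = I); last first.
    apply: eq_integral => z _; rewrite gee0_abs ?n2_ge0//.
    by apply: eq_integral => w _; rewrite cabsM exprMn cabs_indD_sq cabs_indD EFinM.
  rewrite HI; have fF : n2 L F \is a fin_num by rewrite ge0_fin_numE// n2_ge0.
  by rewrite -/(n2 L F) -(fineK fF) -!EFinM ltry.
have := integrable_ae measurableT iE; apply: filterS => z /(_ I).
rewrite ge0_fin_numE ?n2_ge0// => h.
have l2 : cL2 (leb n) (fun w => indD w * F (Rot (unitv w) z)) by split => //; exact: cmeas_Rot_unitv2.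
split => //; have := cL1_mul cL2_indD l2.
rewrite (_ : (fun x => _) = (fun w => indD w * F (Rot (unitv w) z)))//.
by apply/funext => w; rewrite mulrA indD_idem.
Qed.

Lemma ae_tildeB F G : cL2 L F -> cL2 L G ->
  {ae L, forall z, tilde (fun x => F x - G x) z = tilde F z - tilde G z}.
Proof.
move=> /ae_cL1_tilde hF /ae_cL1_tilde hG; apply: filterS2 hF hG => z [_ lF] [_ lG].
by rewrite /tilde -cintB//; apply: eq_cint => w; rewrite mulrBr.
Qed.

Lemma n2_tildeB F G : cL2 L F -> cL2 L G ->
  (n2 L (fun z => (tilde F z - tilde G z)%R) <= area%:E * (area%:E * n2 L (fun z => (F z - G z)%R)))%E.
Proof.
move=> lF lG; have [mF _] := lF; have [mG _] := lG.
apply: le_trans (n2_tilde_le (cmeasB mF mG)).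
rewrite le_eqVlt; apply/orP; left; apply/eqP; apply: ae_eq_n2.
- by apply: cmeasB; exact: cmeas_tilde.
- by apply: cmeas_tilde; exact: cmeasB.
by apply: filterS (ae_tildeB lF lG) => z ->.
Qed.

Lemma tends0_tilde (F_ : nat -> euclid R (n + k) -> R[i]) F : (forall m, cL2 L (F_ m)) -> cL2 L F ->
  tends0 (fun m => n2 L (fun z => (F_ m z - F z)%R)) ->
  tends0 (fun m => n2 L (fun z => (tilde (F_ m) z - tilde F z)%R)).
Proof.
move=> lF_ lF t; apply: (tends0_le (fun m => n2_tildeB (lF_ m) lF)).
by apply: tends0Z; [exact: disc_area_ge0|apply: tends0Z => //; exact: disc_area_ge0].
Qed.

Lemma null_sqnorm0 : {ae leb n, forall w, sqnorm (w : euclid R n) != 0}.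
Proof.
have h (w : euclid R n) : tnth w (i0 n_2) != 0 -> sqnorm w != 0.
  apply: contra => /eqP w0.
  have := tnth_le_sqnorm w (i0 n_2); rewrite w0 => h.
  by rewrite -sqrf_eq0 eq_le h sqr_ge0.
have h0 : {ae leb n, forall w, (@tnth n (measurableTypeR R) w (i0 n_2) : R) != 0} := null_hyperplane (i0 n_2) 0.
by apply: filterS h0 => w; exact: h.
Qed.

(** Rotating the integration variable by [e] preserves the disc and its measure, and composes the
    direction [unitv w] with [e]. The latter requires [sqnorm w != 0], hence an almost everywhere
    argument. *)
Lemma tilde_Rot F e z : cmeas F -> sqnorm e = 1 -> tilde F (Rot e z) = tilde F z.
Proof.
move=> mF e1; have m1 := cmeas_Rot_unitv2 z mF.
rewrite [RHS]/tilde -(mp_cint (mp_crot n_2 e1) m1); apply: ae_eq_cint.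
- exact: cmeas_Rot_unitv2.
- by apply: (cmeas_comp m1); case: (mp_crot n_2 e1).
apply: filterS null_sqnorm0 => w w0; rewrite unitv_crot// RotA crotC; congr (_ * _).
rewrite /indD !indicE.
have -> // : (crot n_2 e w \in @disc R n 1) = (w \in @disc R n 1).
by apply/idP/idP => /set_mem h; apply/mem_set; move: h; rewrite /disc /= sqnorm_crot e1 mul1r.
Qed.

Lemma cL1_tilde_prod F : cL1 L F ->
  cL1 (L \x leb n)%E (fun p => indD p.2 * F (Rot (unitv p.2) p.1)).
Proof.
move=> [mF F1]; apply: cL1_prod; first exact: (cmeas_swap (cmeas_Rot_unitv mF)).
under eq_integral => z _ do under eq_integral => w _ do rewrite cabsM EFinM.
rewrite (integral_tilde_swap (h := fun z => (cabs (F z))%:E)); last 2 first.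
- exact: measurable_EFin_cabs.
- by move=> z; rewrite lee_fin cabs_ge0.
have fF : (\int[L]_z (cabs (F z))%:E)%E \is a fin_num.
  by rewrite ge0_fin_numE//; apply: integral_ge0 => z _; rewrite lee_fin cabs_ge0.
by rewrite -(fineK fF) -!EFinM ltry.
Qed.

Lemma cL1_tilde F : cL1 L F -> cL1 L (tilde F).
Proof. by move=> /cL1_tilde_prod /cL1_fubini1. Qed.

Lemma cint_tilde F (h : euclid R (n + k) -> R) : cL1 L F ->
  measurable_fun setT h ->
  cint L (fun z => cis (h z) * tilde F z) =
  cint (leb n) (fun w => indD w * cint L (fun z => cis (h z) * F (Rot (unitv w) z))).
Proof.
move=> lF mh; have lk := cL1_tilde_prod lF.
have lk2 : cL1 (L \x leb n)%E (fun p => cis (h p.1) * (indD p.2 * F (Rot (unitv p.2) p.1))).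
  apply: cL1M_bounded_eq => //; last by move=> x; exact: cabs_cis.
  by apply: cmeas_cis; exact: measurableT_comp.
have [mF _] := lF.
transitivity (cint L (fun z => cint (leb n) (fun w => cis (h z) * (indD w * F (Rot (unitv w) z))))).
  apply: ae_eq_cint.
  - by apply: cmeasM; [exact: cmeas_cis|exact: cmeas_tilde].
  - exact: (cmeas_cint1 (leb n) (proj1 lk2)).
  by apply: filterS (cL1_ae1 lk) => z lz; rewrite cintZ.
rewrite (cint_fubini (f := fun z w => cis (h z) * (indD w * F (Rot (unitv w) z))))//.
apply: eq_cint => w; rewrite -cintZ; first by apply: eq_cint => z; ring.
apply: cL1M_bounded_eq; [exact: cmeas_cis|by move=> z; exact: cabs_cis|].
exact: (mp_cL1 (@mp_Rot R n n_2 k _ (sqnorm_unitv n_2 w)) lF).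
Qed.

Lemma fourier_Rot F e zeta : cmeas F -> sqnorm e = 1 ->
  fourier (fun z => F (Rot e z)) zeta = fourier F (Rot e zeta).
Proof.
move=> mF e1; rewrite !fourierE; congr (_ * _).
have mc : cmeas (fun z => cis (- dot z (Rot e zeta)) * F z).
  by apply: cmeasM => //; apply: cmeas_cis; apply: measurable_funN; apply: measurable_dot.
rewrite -(mp_cint (@mp_Rot R n n_2 k _ e1) mc); apply: eq_cint => z.
by rewrite dot_Rot.
Qed.

Lemma fourier_tilde F zeta : cL1 L F -> fourier (tilde F) zeta = tilde (fourier F) zeta.
Proof.
move=> lF; have [mF _] := lF.
rewrite fourierE cint_tilde//; last by apply: measurable_funN; apply: measurable_dot.
rewrite -cintZ; last first.
  have [C hC] := fourier_bounded lF.
  have [E|E] : (fnorm (n + k) : R) = 0 \/ (fnorm (n + k) : R) != 0 by case: eqVneq; [left|right].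
    have := fnorm_sq (R := R) (n + k); rewrite E !mul0r => /eqP.
    by rewrite eq_sym oner_eq0.
  have -> : (fun w => indD w * cint L (fun z => cis (- dot z zeta) * F (Rot (unitv w) z))) =
     (fun w => ((fnorm (n + k))^-1)%:C * (fourier F (Rot (unitv w) zeta) * indD w)).
    apply/funext => w; rewrite -fourier_Rot ?sqnorm_unitv// fourierE !mulrA -real_cM mulVf// mul1r.
    by rewrite mulrC.
  apply: cL1_cst_mul; apply: cL1M_bounded cL1_indD => //.
  apply: (cmeas_comp (cmeas_fourier mF)); apply: measurable_Rot; last exact: measurable_cst.
  exact: measurable_unitv.
apply: eq_cint => w; rewrite mulrCA -[fourier F _]fourier_Rot ?sqnorm_unitv//.
Qed.

Lemma fpair_tilde F G : fpair F G -> fpair (tilde F) (tilde G).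
Proof.
move=> [lF lG [F_ [h1 h2 h3]]].
have l1 m : cL1 L (F_ m) by case: (h1 m).
have l2 m : cL2 L (F_ m) by case: (h1 m).
apply: (@fpair_closed _ _ (fun m => tilde (F_ m)) (fun m => tilde (fourier (F_ m)))).
- exact: cL2_tilde.
- exact: cL2_tilde.
- move=> m; have -> : tilde (fourier (F_ m)) = fourier (tilde (F_ m)).
    by apply/funext => z; rewrite fourier_tilde.
  by apply: fpair_fourier; [exact: cL1_tilde|exact: cL2_tilde].
- exact: tends0_tilde.
- by apply: tends0_tilde => // m; exact: cL2_fourier.
Qed.

End rotation_average.

Lemma pmul_lty {R : realType} (c : R) (x : \bar R) : 0 < c -> (c%:E * x < +oo -> x < +oo)%E.
Proof. by case: x => [r| |] c0; rewrite ?ltry// gt0_muley ?lte_fin. Qed.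

(** * The extension operator of the paraboloid *)

Section transfer.
Context {R : realType} d1 d2 (T : measurableType d1) (S : measurableType d2).
Variables (mu : {measure set T -> \bar R}) (nu : {measure set S -> \bar R}).
Variables (Psi : T -> S) (D : set S) (c : R).
Hypothesis mD : measurable D.
Hypothesis c0 : 0 < c.
(** The image of [mu] under [Psi] is [c] times the restriction of [nu] to [D]. The instance used is
    [integral_psi], where [Psi] forgets the position on a rotation orbit. *)
Hypothesis tr : forall h : S -> \bar R, measurable_fun setT h -> (forall y, 0 <= h y)%E ->
  (\int[mu]_x h (Psi x) = c%:E * \int[nu]_y ((\1_D y)%:E * h y))%E.

Definition cut (f : S -> R[i]) (y : S) : R[i] := (\1_D y)%:C * f y.

Lemma cmeas_cut f : cmeas f -> cmeas (cut f).
Proof. by move=> mf; apply: cmeasM => //; apply: cmeas_real; exact: measurable_indic. Qed.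

Lemma cabs_cut f y : cabs (cut f y) = \1_D y * cabs (f y).
Proof. by rewrite cabsM cabs_real ger0_norm// indicE. Qed.

Lemma transfer_n2 f : cmeas f -> n2 mu (fun x => f (Psi x)) = (c%:E * n2 nu (cut f))%E.
Proof.
move=> mf; rewrite /n2 (tr (h := fun y => (cabs (f y) ^+ 2)%:E)).
- congr (_ * _)%E; apply: eq_integral => y _; rewrite cabs_cut exprMn indicE.
  by case: (_ \in _); rewrite ?expr1n ?expr0n/= ?mul1r ?mul0r ?mul1e ?mul0e.
- exact: measurable_EFin_cabs2.
- by move=> y; rewrite lee_fin sqr_ge0.
Qed.

Lemma transfer_cL1 f : cmeas f -> cL1 mu (fun x => f (Psi x)) -> cL1 nu (cut f).
Proof.
move=> mf [_]; rewrite (tr (h := fun y => (cabs (f y))%:E)); last 2 first.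
- exact: measurable_EFin_cabs.
- by move=> y; rewrite lee_fin cabs_ge0.
under eq_integral do rewrite -EFinM -cabs_cut.
by move=> h; split; [exact: cmeas_cut|exact: pmul_lty h].
Qed.

Lemma transfer_cL2 f : cmeas f -> cL2 mu (fun x => f (Psi x)) -> cL2 nu (cut f).
Proof.
move=> mf [_]; rewrite transfer_n2// => h.
by split; [exact: cmeas_cut|exact: pmul_lty h].
Qed.

(** Positive and negative parts are transferred separately; integrability on the target excludes a
    difference of infinities. *)
Lemma transfer_real (g : S -> R) : measurable_fun setT g ->
  nu.-integrable setT (fun y => (\1_D y * g y)%:E) ->
  (\int[mu]_x (g (Psi x))%:E = c%:E * \int[nu]_y (\1_D y * g y)%:E)%E.
Proof.
move=> mg ig; have mE : measurable_fun setT (EFin \o g) by exact/measurable_EFinP.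
have mp := measurable_funepos mE; have mn := measurable_funeneg mE.
rewrite [LHS]integralE [X in (_ * X)%E]integralE.
have -> : (\int[mu]_x ((fun x => (g (Psi x))%:E)^\+ x) = \int[mu]_x ((EFin \o g)^\+ (Psi x)))%E.
  by apply: eq_integral => x _; rewrite !unlock.
have -> : (\int[mu]_x ((fun x => (g (Psi x))%:E)^\- x) = \int[mu]_x ((EFin \o g)^\- (Psi x)))%E.
  by apply: eq_integral => x _; rewrite !unlock.
rewrite (tr mp (funepos_ge0 _)) (tr mn (funeneg_ge0 _)).
have e1 : (\int[nu]_y ((\1_D y)%:E * (EFin \o g)^\+ y) = \int[nu]_y (fun y => (\1_D y * g y)%:E)^\+ y)%E.
  apply: eq_integral => y _; rewrite !unlock /= indicE.
  by case: (_ \in _); rewrite ?mul1r ?mul0r ?mul1e ?mul0e ?maxxx.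
have e2 : (\int[nu]_y ((\1_D y)%:E * (EFin \o g)^\- y) = \int[nu]_y (fun y => (\1_D y * g y)%:E)^\- y)%E.
  apply: eq_integral => y _; rewrite !unlock /= indicE.
  by case: (_ \in _); rewrite ?mul1r ?mul0r ?mul1e ?mul0e ?oppr0 ?oppe0 ?maxxx.
rewrite e1 e2; apply/esym; apply: muleBr => //.
by apply: fin_num_adde_defr; exact: integrable_pos_fin_num.
Qed.

Lemma transfer_cint f : cmeas f -> cL1 mu (fun x => f (Psi x)) ->
  cint mu (fun x => f (Psi x)) = c%:C * cint nu (cut f).
Proof.
move=> mf l1; have l2 := transfer_cL1 mf l1; have [m1 m2] := mf.
have ERe y : complex.Re (cut f y) = \1_D y * complex.Re (f y) by rewrite cReM /= mul0r subr0.
have EIm y : complex.Im (cut f y) = \1_D y * complex.Im (f y) by rewrite cImM /= mul0r addr0.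
have i1 : nu.-integrable setT (fun y => (\1_D y * complex.Re (f y))%:E).
  by have := cL1_Re l2; apply: eq_integrable => // y _; rewrite ERe.
have i2 : nu.-integrable setT (fun y => (\1_D y * complex.Im (f y))%:E).
  by have := cL1_Im l2; apply: eq_integrable => // y _; rewrite EIm.
have key (g : S -> R) : measurable_fun setT g -> nu.-integrable setT (fun y => (\1_D y * g y)%:E) ->
   Rintegral mu setT (fun x => g (Psi x)) = c * Rintegral nu setT (fun y => \1_D y * g y).
  by move=> mg ig; rewrite /Rintegral transfer_real// fineM//; exact: integrable_fin_num.
apply: complex_eq; rewrite ?cReM ?cImM /= ?mul0r ?subr0 ?addr0.
  by rewrite (key _ m1 i1); congr (_ * fine _); apply: eq_integral => y _; rewrite ERe.
by rewrite (key _ m2 i2); congr (_ * fine _); apply: eq_integral => y _; rewrite EIm.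
Qed.

End transfer.

(** * Plancherel for the extension operator *)

Section paraboloid.
Context {R : realType}.
Variables (n : nat) (n_2 : n = 2%N) (k : nat).
Local Notation Rot := (Rot n_2).
Local Notation area := (@disc_area R n).
Local Notation L := (leb (n + k)).

Lemma integral_mrestr_ge0 dT (T : measurableType dT) (mu : {measure set T -> \bar R}) (D : set T)
  (mD : measurable D) (h : T -> \bar R) : measurable_fun setT h -> (forall x, 0 <= h x)%E ->
  (\int[mrestr mu mD]_x h x = \int[mu]_x ((\1_D x)%:E * h x))%E.
Proof.
move=> mh h0; have mC := measurableC mD.
rewrite -{1}(setUv D) ge0_integral_setU//; last 2 first.
- by rewrite setUv.
- by apply/disj_setPS => x [].
rewrite [X in (_ + X)%E](_ : _ = 0%E) ?adde0; last first.
  apply: null_set_integral => //; first exact: measurable_funTS.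
  by apply: etrans (_ : mu (~` D `&` D) = 0%E); [by []|rewrite setICl measure0].
rewrite (eq_measure_integral mu); last by move=> A mA AD; apply: etrans (_ : mu (A `&` D) = _); [by []|rewrite (setIidl AD)].
rewrite integral_mkcond; apply: eq_integral => x _.
by rewrite patchE indicE; case: (_ \in _); rewrite ?mul1e ?mul0e.
Qed.

Lemma integral_radial (h : measurableTypeR R -> \bar R) : measurable_fun setT h ->
  (forall x, 0 <= h x)%E ->
  (\int[leb n]_w h (sqnorm w) = area%:E * \int[lebesgue_measure]_r ((\1_(`[0, +oo[%classic : set R) r)%:E * h r))%E.
Proof.
move=> mh h0; rewrite -(@integral_mrestr_ge0 _ (measurableTypeR R) lebesgue_measure _ (measurable_itv `[0, +oo[) h mh h0).
rewrite (mp_ge0 (mp_sqnorm n_2) mh h0).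
exact: (ge0_integral_mscale (mrestr lebesgue_measure (measurable_itv `[0, +oo[)) measurableT (NngNum (disc_area_ge0 n))).
Qed.

(** Coordinates of the space of rotation orbits: with z = (w, m), they determine m and |w|. *)
Definition psi (z : euclid R (n + k)) : euclid R k.+1 := consR (sqnorm z, rv z).
(** The image of [psi]: the points on or above the paraboloid, since |z|^2 is at least |m|^2. *)
Definition solid : set (euclid R k.+1) := [set y | sqnorm (uncons y).2 <= (uncons y).1].

Lemma measurable_uncons1 : measurable_fun setT (fun y : euclid R k.+1 => (uncons y).1).
Proof. exact: (measurableT_comp measurable_fst (@measurable_uncons R k)). Qed.

Lemma measurable_uncons2 : measurable_fun setT (fun y : euclid R k.+1 => (uncons y).2).
Proof. exact: (measurableT_comp measurable_snd (@measurable_uncons R k)). Qed.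

Lemma measurable_psi : measurable_fun setT psi.
Proof.
apply: (measurableT_comp (f := @consR R k)); first exact: measurable_consR.
by apply: measurable_fun_pair; [apply: measurable_sqnorm|exact: measurable_rv].
Qed.

Lemma measurable_solid : measurable solid.
Proof.
have mu := @measurable_uncons R k.
have -> : solid = (fun y => (uncons y).1 - sqnorm (uncons y).2) @^-1` `[0, +oo[%classic.
  by apply/seteqP; split => y /=; rewrite in_itv /= andbT subr_ge0.
apply: preimage_measurable; last exact: measurable_itv.
apply: measurable_funB; first exact: (measurableT_comp (f := fst)).
by apply: measurable_sqnorm; exact: (measurableT_comp (f := snd)).
Qed.

(** For fixed m, [integral_radial] replaces w by r = |w|^2 with constant density [area]; the
    translation tau = r + |m|^2 then carries the half-line onto the slice of [solid] over m. *)
Lemma integral_psi (h : euclid R k.+1 -> \bar R) : measurable_fun setT h ->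
  (forall y, 0 <= h y)%E ->
  (\int[L]_z h (psi z) = area%:E * \int[leb k.+1]_y ((\1_solid y)%:E * h y))%E.
Proof.
move=> mh h0; have mS := measurable_solid.
have mc := @measurable_consR R k.
have m1 : measurable_fun setT (fun y => (\1_solid y)%:E * h y)%E.
  by apply: emeasurable_funM => //; apply/measurable_EFinP; exact: measurable_indic.
have i01 y : (0 <= (\1_solid y)%:E :> \bar R)%E by rewrite lee_fin indicE.
rewrite leb_ge0_cons//; last by move=> y; rewrite mule_ge0.
rewrite leb_ge0_cat//; last exact: (measurableT_comp mh measurable_psi).
have E x y : psi (catv (x, y)) = consR (sqnorm x + sqnorm y, y).
  by rewrite /psi rv_cat /sqnorm dot_catv.
under eq_integral => x _ do under eq_integral => y _ do rewrite E.
have mA : measurable_fun setT (fun p : euclid R n * euclid R k => h (consR (sqnorm p.1 + sqnorm p.2, p.2))).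
  apply: (measurableT_comp mh); apply: (measurableT_comp (f := @consR R k)) => //.
  apply: measurable_fun_pair => //.
  by apply: measurable_funD; apply: measurable_sqnorm.
apply: etrans (fubini_tonelli (m1 := leb n) (m2 := leb k) _ mA (fun p => h0 _)) _.
have mB : measurable_fun setT (fun p : measurableTypeR R * euclid R k => (\1_solid (consR p))%:E * h (consR p))%E.
  exact: (measurableT_comp m1 mc).
have i02 p : (0 <= (\1_solid (consR p))%:E * h (consR p) :> \bar R)%E by rewrite mule_ge0.
rewrite [in RHS](fubini_tonelli (m1 := lebesgue_measure) (m2 := leb k) _ mB i02).
rewrite -ge0_integralZl//; last 3 first.
- apply: (@measurable_Fubini1 _ _ _ _ _ lebesgue_measure (fun p => (\1_solid (consR (p.2, p.1)))%:E * h (consR (p.2, p.1)))%E).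
  apply: (measurableT_comp m1); apply: (measurableT_comp mc).
  exact: measurable_fun_pair.
- by move=> y _; apply: integral_ge0.
- by rewrite lee_fin disc_area_ge0.
apply: eq_integral => m _.
transitivity (\int[leb n]_w h (consR ((sqnorm w + sqnorm m)%R, m)))%E; first by [].
have mpair (c : R) : measurable_fun setT (fun r : measurableTypeR R => consR (r + c, m)).
  apply: (measurableT_comp (f := @consR R k)) => //; apply: measurable_fun_pair => //.
  by apply: measurable_funD.
rewrite (integral_radial (h := fun r => h (consR (r + sqnorm m, m))))//; last exact: (measurableT_comp mh (mpair _)).
congr (_ * _)%E.
have mC : measurable_fun setT (fun r : measurableTypeR R => (\1_solid (consR (r, m)))%:E * h (consR (r, m)))%E.
  apply: (measurableT_comp (f := fun y => (\1_solid y)%:E * h y)%E) => //.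
  by have := mpair 0; under eq_fun do rewrite addr0.
rewrite -(mp_ge0 (mp_addR (sqnorm m)) mC) //.
apply: eq_integral => r _; congr ((_ : R)%:E * _)%E; rewrite !indicE.
have -> // : (r \in (`[0, +oo[%classic : set R)) = (consR (r + sqnorm m, m) \in solid).
have hs : solid (consR (r + sqnorm m, m)) = (0 <= r) :> Prop.
  by rewrite /solid -[LHS]/(_ <= _ : Prop) consRK /= lerDr.
have hi : `[0, +oo[%classic r = (0 <= r) :> Prop by rewrite /= in_itv /= andbT.
by apply/idP/idP => /set_mem; rewrite ?hs ?hi => h1; apply/mem_set; rewrite ?hs ?hi.
Qed.

Implicit Types (F : euclid R (n + k) -> R[i]).

Definition phase (a : R) (y : euclid R k.+1) (z : euclid R (n + k)) : R :=
  a * dot (uncons y).2 (rv z) - (uncons y).1 * sqnorm z.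

(* With y = (s, x): the extension operator for the paraboloid, integrating
   e^{i(a x.m - s|z|^2)} F(z) over z = (w, m). *)
Definition ext a F (y : euclid R k.+1) : R[i] := cint L (fun z => cis (phase a y z) * F z).

Lemma phase_Rot a y z e : sqnorm e = 1 -> phase a y (Rot e z) = phase a y z.
Proof. by move=> e1; rewrite /phase rv_Rot /sqnorm dot_Rot. Qed.

Lemma measurable_phase a y : measurable_fun setT (phase a y).
Proof.
apply: measurable_funB; apply: measurable_funM => //; [|by apply: measurable_sqnorm].
by apply: measurable_dot => //; exact: measurable_rv.
Qed.

(** The phase is constant on rotation orbits, so averaging only multiplies by the total mass of
    [indD]. *)
Lemma ext_tilde a F y : cL1 L F -> ext a (tilde n_2 F) y = area%:C * ext a F y.
Proof.
move=> lF; rewrite /ext (cint_tilde n_2 lF (measurable_phase a y)).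
have [mF _] := lF.
have mc : cmeas (fun z => cis (phase a y z) * F z).
  by apply: cmeasM => //; apply: cmeas_cis; exact: measurable_phase.
have E w : cint L (fun z => cis (phase a y z) * F (Rot (unitv n_2 w) z)) = ext a F y.
  rewrite /ext -(mp_cint (@mp_Rot R n n_2 k _ (sqnorm_unitv n_2 w)) mc).
  by apply: eq_cint => z; rewrite phase_Rot// sqnorm_unitv.
under eq_cint do rewrite E mulrC.
rewrite cintZ; last exact: cL1_indD.
rewrite mulrC; congr (_ * _); rewrite cint_real /Rintegral; congr (_%:C).
have := n2_indD n_2 (R := R); rewrite /n2.
by under eq_integral do rewrite cabs_indD_sq; move=> ->.
Qed.

Section radial.
Variable P : euclid R (n + k) -> R[i].
Hypothesis P_Rot : forall e z, sqnorm e = 1 -> P (Rot e z) = P z.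

(** [P] evaluated on the representative of the orbit with w = (sqrt (tau - |m|^2), 0). Off [solid]
    the square root is 0 by default; the values there are removed later by [cut solid]. *)
Definition profile (y : euclid R k.+1) : R[i] :=
  P (catv (vec2 n_2 (Num.sqrt ((uncons y).1 - sqnorm (uncons y).2)) 0, (uncons y).2)).

Lemma profile_psi z : profile (psi z) = P z.
Proof.
rewrite /profile /psi consRK /=.
have -> : sqnorm z - sqnorm (rv z) = sqnorm (lv z) by rewrite /sqnorm (dot_split z z) addrK.
rewrite -(P_Rot (e := unitv n_2 (lv z))); last exact: sqnorm_unitv.
by rewrite /Rot lv_cat rv_cat -unitvK catvK.
Qed.

Lemma cmeas_profile : cmeas P -> cmeas profile.
Proof.
move=> mP; apply: (cmeas_comp mP).
have mu1 := measurable_uncons1; have mu2 := measurable_uncons2.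
apply: (measurableT_comp (f := @catv R n k)); first exact: measurable_catv.
apply: measurable_fun_pair => //; apply: measurable_vec2 => //.
apply: (measurableT_comp (f := Num.sqrt : R -> R)); first by apply: continuous_measurable_fun; exact: sqrt_continuous.
by apply: measurable_funB => //; apply: measurable_sqnorm.
Qed.

End radial.

Lemma area_gt0 : 0 < area.
Proof.
rewrite lt_def disc_area_ge0 andbT; apply/eqP => a0.
have : (leb n (boxr n (1 : R)) <= leb n (@disc R n n%:R))%E.
  apply: le_measure; rewrite ?inE; [exact: measurable_boxr|exact: measurable_disc|].
  move=> x h; rewrite /disc /= /sqnorm /dot -[X in _ <= X%:R]card_ord -sumr_const.
  apply: ler_sum => i _; have := h i; rewrite -expr2 -real_normK ?num_real//.
  by have := normr_ge0 (tnth x i); move: (`|_|) => t; nra.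
rewrite leb_boxr// leb_disc// a0 mul0r lee_fin.
by rewrite leNgt exprn_gt0// -[1 + 1]/2.
Qed.

Lemma n2_scalev (a : R) (f : euclid R k -> R[i]) : 0 < a -> cmeas f ->
  n2 (leb k) (fun x => f (scalev a x)) = ((a^-1 ^+ k)%:E * n2 (leb k) f)%E.
Proof.
move=> a0 mf; have ak : 0 <= a^-1 ^+ k by rewrite exprn_ge0// invr_ge0 ltW.
have m : mp (leb k) (mscale (NngNum ak) (leb k)) (scalev a).
  split; first by apply: measurable_scalev.
  by move=> A mA; exact: leb_scalev.
have mf2 := measurable_EFin_cabs2 mf.
have f0 x : (0 <= (cabs (f x) ^+ 2)%:E)%E by rewrite lee_fin sqr_ge0.
by rewrite /n2 (mp_ge0 m mf2 f0) ge0_integral_mscale.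
Qed.

(** Chosen so that [phase a y z] equals [dot (psi z) (dual_point a y)]. *)
Definition dual_point (a : R) (y : euclid R k.+1) : euclid R k.+1 :=
  consR (- (uncons y).1, scalev a (uncons y).2).

Lemma n2_dual_point (a : R) (f : euclid R k.+1 -> R[i]) : 0 < a -> cmeas f ->
  n2 (leb k.+1) (fun y => f (dual_point a y)) = ((a^-1 ^+ k)%:E * n2 (leb k.+1) f)%E.
Proof.
move=> a0 mf; have mc := @measurable_consR R k.
have mf2 := measurable_EFin_cabs2 mf.
have md : measurable_fun setT (dual_point a).
  have mu := @measurable_uncons R k.
  apply: (measurableT_comp mc); apply: measurable_fun_pair.
    by apply: measurable_funN; exact: (measurableT_comp (f := fst)).
  by apply: measurable_scalev; exact: (measurableT_comp (f := snd)).
have mfd : cmeas (fun y => f (dual_point a y)) by exact: (cmeas_comp mf).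
rewrite /n2 leb_ge0_cons; last 2 first.
- exact: measurable_EFin_cabs2.
- by move=> y; rewrite lee_fin sqr_ge0.
rewrite leb_ge0_cons//; last by move=> y; rewrite lee_fin sqr_ge0.
have mconsr (r : R) : measurable_fun setT (fun x : euclid R k => consR (r, x)).
  by apply: (measurableT_comp mc); exact: measurable_fun_pair.
transitivity (\int[lebesgue_measure]_r ((a^-1 ^+ k)%:E * n2 (leb k) (fun x => f (consR ((- r)%R, x)))))%E.
  apply: eq_integral => r _; rewrite -n2_scalev//; last exact: (cmeas_comp mf).
  by apply: eq_integral => x _; rewrite /dual_point consRK.
have mI : measurable_fun setT (fun r : measurableTypeR R => n2 (leb k) (fun x => f (consR (r, x)))).
  apply: (@measurable_Fubini1 _ _ _ _ _ (leb k) (fun p => (cabs (f (consR p)) ^+ 2)%:E)).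
  exact: (measurableT_comp mf2 mc).
have mIN : measurable_fun setT (fun r : measurableTypeR R => n2 (leb k) (fun x => f (consR ((- r)%R, x)))).
  by apply: (measurableT_comp mI); apply: measurable_funN.
apply: (etrans (ge0_integralZl lebesgue_measure measurableT mIN _ _)).
- by move=> r _; exact: n2_ge0.
- by rewrite lee_fin exprn_ge0// invr_ge0 ltW.
apply: congr1.
by rewrite -[RHS](mp_ge0 mp_oppR mI)// => r; exact: n2_ge0.
Qed.

(** The factors come from the normalisation of [ifourier], from the dilation by [a] in [dual_point],
    and from the density of [psi] when the norm of the average is expressed by its profile. *)
Definition ext_const (a : R) : R := (fnorm k.+1)^-1 ^+ 2 * a^-1 ^+ k * area^-1.

Lemma fnorm_gt0 e : 0 < fnorm e :> R.
Proof. by apply: powR_gt0; rewrite mulr_gt0// pi_gt0. Qed.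

Lemma ext_const_gt0 a : 0 < a -> 0 < ext_const a.
Proof.
move=> a0; apply: mulr_gt0; last by rewrite invr_gt0 area_gt0.
by apply: mulr_gt0; rewrite exprn_gt0// invr_gt0// fnorm_gt0.
Qed.

Theorem n2_ext a F : 0 < a -> cL1 L F -> cL2 L F ->
  cmeas (ext a F) /\
  n2 (leb k.+1) (ext a F) = ((ext_const a)%:E * n2 L (tilde n_2 F))%E.
Proof.
move=> a0 lF l2F; have [mF _] := lF.
set P := tilde n_2 F.
have l1P : cL1 L P by exact: cL1_tilde.
have l2P : cL2 L P by exact: cL2_tilde.
have [mP _] := l1P.
have P_Rot e z : sqnorm e = 1 -> P (Rot e z) = P z by move=> e1; exact: tilde_Rot.
have extP y : cint L (fun z => cis (phase a y z) * P z) = area%:C * ext a F y := ext_tilde a y lF.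
clearbody P.
have Ppsi z : profile P (psi z) = P z by rewrite profile_psi.
have {}Ppsi' : (fun z => profile P (psi z)) = P by apply/funext.
have mprof := cmeas_profile mP.
have mpsi := measurable_psi; have mS := measurable_solid.
pose B := cut solid (profile P).
have l1P' : cL1 L (fun z => profile P (psi z)) by rewrite Ppsi'.
have l2P' : cL2 L (fun z => profile P (psi z)) by rewrite Ppsi'.
have l1B : cL1 (leb k.+1) B := transfer_cL1 mS area_gt0 integral_psi mprof l1P'.
have l2B : cL2 (leb k.+1) B := transfer_cL2 mS area_gt0 integral_psi mprof l2P'.
have [mB _] := l1B.
have n2B : n2 L P = (area%:E * n2 (leb k.+1) B)%E.
  by rewrite -(transfer_n2 integral_psi mprof) Ppsi'.
have aN0 : area%:C != 0 :> R[i] by apply/eqP => -[/eqP]; rewrite gt_eqF// area_gt0.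
have E y : ext a F y = ((fnorm k.+1)^-1)%:C * ifourier B (dual_point a y).
  (* A factor [area] appears on both sides, from the averaging of [F] and from the density of [psi],
     and cancels. *)
  apply: (mulfI aN0); rewrite -extP.
  pose G (y' : euclid R k.+1) := cis (dot y' (dual_point a y)) * profile P y'.
  have mG : cmeas G.
    by apply: cmeasM => //; apply: cmeas_cis; apply: measurable_dot.
  have GE : (fun z => cis (phase a y z) * P z) = (fun z => G (psi z)).
    apply/funext => z; rewrite /G Ppsi; congr (cis _ * _).
    rewrite /phase /psi /dual_point -[X in dot _ (consR X)]/(_, _) dot_consR dotZr (dotC (rv z)).
    by ring.
  have lG : cL1 L (fun z => G (psi z)).
    rewrite -GE; apply: cL1M_bounded_eq => //; last by move=> z; exact: cabs_cis.
    by apply: cmeas_cis; exact: measurable_phase.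
  rewrite GE (transfer_cint mS area_gt0 integral_psi mG lG); congr (_ * _).
  rewrite /ifourier mulrA -real_cM mulVf ?gt_eqF ?fnorm_gt0// mul1r.
  by apply: eq_cint => y'; rewrite /cut /G mulrCA.
have mi : cmeas (ifourier B) by exact: cmeas_ifourier.
have md : measurable_fun setT (dual_point a).
  have mu := @measurable_uncons R k.
  apply: (measurableT_comp (@measurable_consR R k)); apply: measurable_fun_pair.
    by apply: measurable_funN; exact: (measurableT_comp (f := fst)).
  by apply: measurable_scalev; exact: (measurableT_comp (f := snd)).
have mid : cmeas (fun y => ifourier B (dual_point a y)) by exact: (cmeas_comp mi).
have -> : ext a F = (fun y => ((fnorm k.+1)^-1)%:C * ifourier B (dual_point a y)) by apply/funext.
split; first by apply: cmeasM => //; exact: cmeas_cst.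
rewrite n2Z// n2_dual_point// n2_ifourier// plancherel_L1// n2B.
rewrite cabs_real ger0_norm; last by rewrite invr_ge0 fnorm_ge0.
rewrite !muleA -!EFinM; congr (_%:E * _)%E.
by rewrite /ext_const divfK// gt_eqF// area_gt0.
Qed.

End paraboloid.

(** * Space-time solutions and even Strichartz norms *)

Section joint_solution.
Context {R : realType}.

Lemma ccvgM (u v : nat -> R[i]) a b : ccvg u a -> ccvg v b -> ccvg (fun m => u m * v m) (a * b).
Proof.
move=> /ccvg_ReIm[u1 u2] /ccvg_ReIm[v1 v2]; apply/ccvg_ReIm; rewrite cReM cImM; split.
  by under eq_fun do rewrite cReM; apply: cvgB; exact: cvgM.
by under eq_fun do rewrite cImM; apply: cvgD; exact: cvgM.
Qed.

Lemma ccvg_cst (a : R[i]) : ccvg (fun=> a) a.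
Proof. by rewrite /ccvg; under eq_fun do rewrite subrr cabs0; exact: cvg_cst. Qed.

Lemma ccvgX (u : nat -> R[i]) a N : ccvg u a -> ccvg (fun m => u m ^+ N) (a ^+ N).
Proof.
move=> ua; elim: N => [|N IH].
  by under eq_fun do rewrite expr0; rewrite expr0; exact: ccvg_cst.
by under eq_fun do rewrite exprS; rewrite exprS; exact: ccvgM.
Qed.

Variable k : nat.
Implicit Types (g G M : euclid R k -> R[i]).

(** The rate 8^-m is the one that [ae_ccvg_of_summable] turns into almost everywhere convergence. *)
Lemma fast_truncation G : cL2 (leb k) G -> exists M_ : nat -> euclid R k -> R[i],
  [/\ forall m, cL1 (leb k) (M_ m), forall m, cL2 (leb k) (M_ m),
      tends0 (fun m => n2 (leb k) (fun x => (M_ m x - G x)%R)) &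
      forall m, (n2 (leb k) (fun x => (M_ m x - G x)%R) <= (8^-1 ^+ m)%:E)%E].
Proof.
move=> lG; have tG := tends0_phi lG.
have [sg [sgk [_ sgP]]] : exists sg : nat -> nat, (forall j, (j <= sg j)%N) /\
    {homo sg : a b / (a <= b)%N} /\ forall j m, (sg j <= m)%N ->
    (n2 (leb k) (fun x => ((phi (en m) x)%:C * G x - G x)%R) <= (8^-1 ^+ j)%:E)%E.
  apply: (@fast_subsequence (fun j m =>
    (n2 (leb k) (fun x => ((phi (en m) x)%:C * G x - G x)%R) <= (8^-1 ^+ j)%:E)%E)) => j.
  by apply: tG; rewrite exprn_gt0.
exists (fun m x => (phi (en (sg m)) x)%:C * G x); split.
- by move=> m; have [] := cL12_phi (sg m) lG.
- by move=> m; have [] := cL12_phi (sg m) lG.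
- move=> e e0; have [N hN] := tG e e0; exists N => m Nm.
  by apply: hN; exact: leq_trans (sgk m).
- by move=> m; exact: sgP.
Qed.

(** The evolution at [y] = (s, x), without the factor [fnorm k], of data with transform [M]. For
    integrable [M] it is a convergent integral at every point, and it is measurable in (s, x)
    jointly. *)
Definition wave M (y : euclid R k.+1) : R[i] :=
  cint (leb k) (fun xi => cis (dot (uncons y).2 xi - (uncons y).1 * sqnorm xi) * M xi).

Lemma measurable_wave_phase (y : euclid R k.+1) :
  measurable_fun setT (fun xi => dot (uncons y).2 xi - (uncons y).1 * sqnorm xi).
Proof.
apply: measurable_funB; first by apply: measurable_dot => //; exact: measurable_cst.
by apply: measurable_funM; [exact: measurable_cst|apply: measurable_sqnorm].
Qed.

Lemma cmeas_wave M : cmeas M -> cmeas (wave M).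
Proof.
move=> mM; apply: (@cmeas_cint1 _ _ _ _ _ (leb k) (fun p => cis (dot (uncons p.1).2 p.2 - (uncons p.1).1 * sqnorm p.2) * M p.2)).
apply: cmeasM; last by apply: (cmeas_comp mM).
have m1 : measurable_fun setT (fun p : euclid R k.+1 * euclid R k => (uncons p.1).1).
  by apply: (measurableT_comp (f := fun y : euclid R k.+1 => (uncons y).1)); [exact: measurable_uncons1|exact: measurable_fst].
have m2 : measurable_fun setT (fun p : euclid R k.+1 * euclid R k => (uncons p.1).2).
  by apply: (measurableT_comp (f := fun y : euclid R k.+1 => (uncons y).2)); [exact: measurable_uncons2|exact: measurable_fst].
apply: cmeas_cis; apply: measurable_funB; first by apply: measurable_dot.
by apply: measurable_funM => //; apply: measurable_sqnorm.
Qed.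

Lemma ifourier_wave M s x :
  ifourier (fun xi => cis (- (s * sqnorm xi)) * M xi) x = (fnorm k)%:C * wave M (consR (s, x)).
Proof.
rewrite /ifourier /wave; congr (_ * _); apply: eq_cint => xi.
by rewrite consRK /= mulrA -cisD (dotC xi).
Qed.

Lemma cL1_chirp s M : cL1 (leb k) M -> cL1 (leb k) (fun xi => cis (- (s * sqnorm xi)) * M xi).
Proof.
move=> lM; apply: cL1M_bounded_eq => //; last by move=> x; exact: cabs_cis.
by apply: cmeas_cis; exact: measurable_chirp.
Qed.

Lemma cmeas_slice (F : euclid R k.+1 -> R[i]) s : cmeas F -> cmeas (fun x => F (consR (s, x))).
Proof.
move=> mF; apply: (cmeas_comp mF); apply: (measurableT_comp (@measurable_consR R k)).
exact: measurable_fun_pair.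
Qed.

Lemma n2_slices (F : euclid R k.+1 -> R[i]) : cmeas F ->
  n2 (leb k.+1) F = (\int[lebesgue_measure]_s n2 (leb k) (fun x => F (consR (s, x))))%E.
Proof.
move=> mF; rewrite /n2 leb_ge0_cons//; first exact: measurable_EFin_cabs2.
by move=> y; rewrite lee_fin sqr_ge0.
Qed.

Section solution.
Variables (g G : euclid R k -> R[i]) (M_ : nat -> euclid R k -> R[i]).
Hypothesis gG : fpair g G.
Hypothesis l1 : forall m, cL1 (leb k) (M_ m).
Hypothesis l2 : forall m, cL2 (leb k) (M_ m).
Hypothesis fast : forall m, (n2 (leb k) (fun x => (M_ m x - G x)%R) <= (8^-1 ^+ m)%:E)%E.

Definition approx_sol m (y : euclid R k.+1) : R[i] := (fnorm k)%:C * wave (M_ m) y.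

Lemma cmeas_approx_sol m : cmeas (approx_sol m).
Proof. by apply: cmeasM; [exact: cmeas_cst|apply: cmeas_wave; case: (l1 m)]. Qed.

(** The multiplier is unimodular and the transform an isometry, so the error of the truncation is
    the same at all times. *)
Lemma n2_approx_le m s :
  (n2 (leb k) (fun x => (approx_sol m (consR (s, x)) - schrodinger s g x)%R) <= (8^-1 ^+ m)%:E)%E.
Proof.
have p := schrodinger_pair s gG.
have lc := cL1_chirp s (l1 m).
have lc2 : cL2 (leb k) (fun xi => cis (- (s * sqnorm xi)) * M_ m xi).
  by apply: cL2_cisM => //; exact: measurable_chirp.
have q := fpair_ifourier lc lc2.
have := fpair_isometry q p.
rewrite (@eq_n2 _ _ _ (leb k) _ (fun x => approx_sol m (consR (s, x)) - schrodinger s g x)); last first.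
  by move=> x; rewrite ifourier_wave.
move=> ->; rewrite (@eq_n2 _ _ _ (leb k) _ (fun x => M_ m x - G x)) ?fast// => x.
by rewrite -mulrBr cabsM cabs_cis mul1r.
Qed.

Lemma cmeas_schrodinger s : cmeas (schrodinger s g).
Proof. by have [[]] := schrodinger_pair s gG. Qed.

(** A jointly measurable version of the evolution: the representatives [schrodinger s g] are chosen
    independently for different [s], and [solutionE] compares the two at each fixed time. *)
Definition solution : euclid R k.+1 -> R[i] := climit approx_sol.

Lemma cmeas_solution : cmeas solution.
Proof. by apply: cmeas_climit; exact: cmeas_approx_sol. Qed.

Lemma solutionE s : {ae leb k, forall x, solution (consR (s, x)) = schrodinger s g x}.
Proof.
have := @ae_ccvg_of_summable _ _ _ (leb k) (fun m x => approx_sol m (consR (s, x))) (schrodinger s g)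
  (fun m => cmeas_slice s (cmeas_approx_sol m)) (cmeas_schrodinger s) (n2_approx_le^~ s).
by apply: filterS => x; exact: climitE.
Qed.

Lemma n2_approx_solution m s :
  (n2 (leb k) (fun x => (approx_sol m (consR (s, x)) - solution (consR (s, x)))%R) <= (8^-1 ^+ m)%:E)%E.
Proof.
rewrite (ae_eq_n2 (g := fun x => approx_sol m (consR (s, x)) - schrodinger s g x)).
- exact: n2_approx_le.
- by apply: cmeasB; apply: cmeas_slice; [exact: cmeas_approx_sol|exact: cmeas_solution].
- by apply: cmeasB; [apply: cmeas_slice; exact: cmeas_approx_sol|exact: cmeas_schrodinger].
- by have := solutionE s; apply: filterS => x ->.
Qed.

(* An integrable positive weight in s turns the bounds at fixed s into one in
   (s, x), hence almost everywhere convergence in (s, x). *)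
Lemma ae_approx_solution : {ae leb k.+1, forall y, ccvg (approx_sol^~ y) (solution y)}.
Proof.
pose w (y : euclid R k.+1) : R := Num.sqrt (pois 1 (uncons y).1).
have w0 y : 0 < w y.
  by rewrite sqrtr_gt0 /pois !mulr_gt0 ?invr_gt0 ?sqD_gt0 ?pi_gt0.
have mp : measurable_fun setT (fun y : euclid R k.+1 => pois 1 (uncons y).1).
  by apply: (measurableT_comp (measurable_pois ltr01)); exact: measurable_uncons1.
have mw : cmeas (fun y => (w y)%:C).
  apply: cmeas_real; apply: (measurableT_comp (f := Num.sqrt : R -> R)) => //.
  by apply: continuous_measurable_fun; exact: sqrt_continuous.
have mF m : cmeas (fun y => (w y)%:C * approx_sol m y) by apply: cmeasM => //; exact: cmeas_approx_sol.
have mU : cmeas (fun y => (w y)%:C * solution y) by apply: cmeasM => //; exact: cmeas_solution.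
have := @ae_ccvg_of_summable _ _ _ (leb k.+1) _ _ mF mU _.
move=> H; have {H} : {ae leb k.+1, forall y, ccvg (fun m => (w y)%:C * approx_sol m y) ((w y)%:C * solution y)}.
  apply: H => m; rewrite n2_slices; last exact: cmeasB.
  have mB : cmeas (fun y => approx_sol m y - solution y).
    by apply: cmeasB; [exact: cmeas_approx_sol|exact: cmeas_solution].
  have E s : n2 (leb k) (fun x => ((w (consR (s, x)))%:C * approx_sol m (consR (s, x)) - (w (consR (s, x)))%:C * solution (consR (s, x)))%R) =
     ((pois 1 s)%:E * n2 (leb k) (fun x => (approx_sol m (consR (s, x)) - solution (consR (s, x)))%R))%E.
    have -> : (pois 1 s)%:E = (cabs ((w (consR (s, zerov k)))%:C : R[i]) ^+ 2)%:E.
      rewrite cabs_real ger0_norm ?ltW//.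
      by rewrite /w consRK sqr_sqrtr ?pois_ge0.
    rewrite -n2Z; last exact: (cmeas_slice s mB).
    by apply: eq_n2 => x; rewrite -mulrBr /w !consRK.
  under eq_integral do rewrite E.
  apply: (@le_trans _ _ (\int[lebesgue_measure]_s ((pois 1 s)%:E * (8^-1 ^+ m)%:E))%E).
    have mpp : measurable_fun setT (fun s : measurableTypeR R => (pois 1 s)%:E).
      by apply/measurable_EFinP; exact: measurable_pois.
    have p0 s : (0 <= (pois 1 s)%:E)%E by rewrite lee_fin pois_ge0.
    apply: ge0_le_integral => //.
    - by move=> s _; rewrite mule_ge0// n2_ge0.
    - apply: emeasurable_funM => //.
      apply: (@measurable_Fubini1 _ _ _ _ _ (leb k) (fun p => (cabs (approx_sol m (consR p) - solution (consR p)) ^+ 2)%:E)).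
      apply: measurable_EFin_cabs2; apply: (cmeas_comp mB); exact: measurable_consR.
    - by apply: emeasurable_funM => //; exact: measurable_cst.
    - by move=> s _; apply: lee_wpmul2l; [exact: p0|exact: n2_approx_solution].
  rewrite ge0_integralZr//.
  - by rewrite integral_pois// mul1e.
  - by apply/measurable_EFinP; exact: measurable_pois.
  - by move=> s _; rewrite lee_fin pois_ge0.
apply: filterS => y /(ccvgM (ccvg_cst ((w y)^-1)%:C)).
have e z : ((w y)^-1)%:C * ((w y)%:C * z) = z :> R[i].
  by rewrite mulrA -real_cM mulVf ?gt_eqF ?w0// mul1r.
by under eq_fun do rewrite e; rewrite e.
Qed.

End solution.
End joint_solution.

(** * Space-time integrals of even powers *)

Section even_power.
Context {R : realType}.
Variables (n : nat) (n_2 : n = 2%N) (k : nat).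
(** [T] stands for the N-fold tensor power composed with an orthogonal map ([T4], [T6]), and [a] for
    the square root of [N]. The geometry enters through [T_wave] only. *)
Variables (T : (euclid R k -> R[i]) -> euclid R (n + k) -> R[i]) (a : R) (N : nat).
Local Notation L := (leb (n + k)).
Local Notation area := (@disc_area R n).
Hypothesis a0 : 0 < a.
Hypothesis T_cL1 : forall M, cL1 (leb k) M -> cL1 L (T M).
Hypothesis T_cL2 : forall M, cL2 (leb k) M -> cL2 L (T M).
Hypothesis T_wave : forall M y, cL1 (leb k) M -> wave M y ^+ N = ext a (T M) y.
Hypothesis T_tends0 : forall (M_ : nat -> euclid R k -> R[i]) G, (forall m, cL2 (leb k) (M_ m)) ->
  cL2 (leb k) G -> tends0 (fun m => n2 (leb k) (fun x => (M_ m x - G x)%R)) ->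
  tends0 (fun m => n2 L (fun z => (T (M_ m) z - T G z)%R)).
Hypothesis T_fpair : forall g G, fpair g G -> fpair (T g) (T G).

(** The power of [fnorm k] restores the normalisation missing from the N factors [wave]. *)
Definition strichartz_const : R := (fnorm k ^+ N) ^+ 2 * ext_const n k a.

Lemma strichartz_const_gt0 : 0 < strichartz_const.
Proof.
apply: mulr_gt0; first by rewrite !exprn_gt0// fnorm_gt0.
exact: (ext_const_gt0 n_2).
Qed.

Lemma extB F F' (y : euclid R k.+1) : cL1 L F -> cL1 L F' ->
  ext a (fun z => F z - F' z) y = ext a F y - ext a F' y.
Proof.
move=> l l'; have aux H : cL1 L H -> cL1 L (fun z => cis (phase a y z) * H z).
  move=> lH; apply: cL1M_bounded_eq => //; last by move=> z; exact: cabs_cis.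
  by apply: cmeas_cis; exact: measurable_phase.
rewrite /ext -cintB; [|exact: aux|exact: aux].
by apply: eq_cint => z; rewrite mulrBr.
Qed.

(** For the truncations [M_ m] the power is an extension and [n2_ext] applies. The power is not
    linear in the data but [ext] is linear in [T (M_ m)], so the powers [v m] form a Cauchy
    sequence; almost everywhere convergence of the approximate solutions shows that its limit is
    [V]. *)
Theorem even_power_identity g : cL2 (leb k) g ->
  (\int[lebesgue_measure]_s \int[leb k]_x (cabs (schrodinger s g x) ^+ (2 * N))%:E =
    strichartz_const%:E * n2 L (tilde n_2 (T g)))%E.
Proof.
move=> lg; have [G p] := fpair_exists lg; have [_ lG _] := p.
have [M_ [l1 l2 tM fast]] := fast_truncation lG.
pose c : R[i] := (fnorm k ^+ N)%:C.
pose v m (y : euclid R k.+1) : R[i] := (approx_sol M_ m y) ^+ N.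
pose V (y : euclid R k.+1) : R[i] := (solution M_ y) ^+ N.
have lT1 m : cL1 L (T (M_ m)) by exact: T_cL1.
have lT2 m : cL2 L (T (M_ m)) by exact: T_cL2.
have lTG : cL2 L (T G) by exact: T_cL2.
have tT := T_tends0 l2 lG tM.
have vE m y : v m y = c * ext a (T (M_ m)) y.
  by rewrite /v /approx_sol exprMn T_wave// /c rmorphXn.
have mv m : cmeas (v m) by apply: cmeasX; exact: cmeas_approx_sol.
have mV : cmeas V by apply: cmeasX; exact: cmeas_solution.
have sq : cabs c ^+ 2 = (fnorm k ^+ N) ^+ 2.
  by rewrite /c cabs_real ger0_norm// exprn_ge0// fnorm_ge0.
have n2v F : cL1 L F -> cL2 L F -> n2 (leb k.+1) (fun y => c * ext a F y) =
    (strichartz_const%:E * n2 L (tilde n_2 F))%E.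
  move=> lF lF2; have [me e] := n2_ext n_2 a0 lF lF2.
  by rewrite n2Z// e sq muleA -EFinM.
have n2vm m : n2 (leb k.+1) (v m) = (strichartz_const%:E * n2 L (tilde n_2 (T (M_ m))))%E.
  by rewrite -n2v//; apply: eq_n2 => y; rewrite vE.
have ltT m := cL2_tilde n_2 (lT2 m).
have ltG := cL2_tilde n_2 lTG.
have s0 := strichartz_const_gt0.
have lv m : cL2 (leb k.+1) (v m).
  split => //; rewrite n2vm.
  have fin : n2 L (tilde n_2 (T (M_ m))) \is a fin_num by rewrite ge0_fin_numE ?n2_ge0//; case: (ltT m).
  by rewrite -(fineK fin) -EFinM ltry.
have cv : n2cauchy (leb k.+1) v.
  move=> e e0.
  have A0 := disc_area_ge0 (R := R) n.
  pose q := strichartz_const * area * area + 1.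
  have q0 : 0 < q.
    by apply: ltr_wpDl => //; apply: mulr_ge0 => //; apply: mulr_ge0 => //; exact: ltW.
  have [P hP] := n2cauchy_of_cvg (fun m => proj1 (lT2 m)) (proj1 lTG) tT (divr_gt0 e0 q0).
  exists P => m j Pm Pj.
  rewrite (@eq_n2 _ _ _ (leb k.+1) _ (fun y => c * ext a (fun z => T (M_ m) z - T (M_ j) z) y)); last first.
    by move=> y; rewrite !vE extB// mulrBr.
  rewrite n2v; [|exact: cL1B|exact: cL2B].
  apply: (@le_trans _ _ (strichartz_const%:E * (area%:E * (area%:E * (e / q)%:E)))%E).
    apply: lee_wpmul2l; first by rewrite lee_fin ltW.
    apply: le_trans (n2_tilde_le n_2 _) _; first by apply: cmeasB; [case: (lT1 m)|case: (lT1 j)].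
    by apply: lee_wpmul2l; rewrite ?lee_fin//; apply: lee_wpmul2l; rewrite ?lee_fin//; exact: hP.
  rewrite -!EFinM lee_fin !mulrA ler_pdivrMr// mulrC ler_wpM2l ?ltW//.
  by rewrite /q ltrDl.
have tv : tends0 (fun m => n2 (leb k.+1) (fun y => (v m y - V y)%R)).
  move=> e e0; have [P hP] := cv e e0; exists P => m Pm.
  rewrite n2Bsym; apply: (@n2_fatou _ _ _ (leb k.+1) v V (v m) e%:E P) => //.
    by have := ae_approx_solution p l1 l2 fast; apply: filterS => y; exact: ccvgX.
  by move=> j Pj; exact: hP.
have lV : cL2 (leb k.+1) V.
  split => //; have [P hP] := tv 1 ltr01.
  have := cL2B (lv P) (_ : cL2 (leb k.+1) (fun y => v P y - V y)).
  case; first by split; [exact: cmeasB|apply: le_lt_trans (hP P (leqnn _)) _; rewrite ltry].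
  move=> _; rewrite (@eq_n2 _ _ _ (leb k.+1) _ V)// => y; congr cabs; ring.
(* The constant is absorbed into the function, so that both sides are values of [n2] and pass to the
   limit together. *)
pose sc : R[i] := (Num.sqrt strichartz_const)%:C.
have sc2 : cabs sc ^+ 2 = strichartz_const.
  by rewrite /sc cabs_real ger0_norm ?sqrtr_ge0// sqr_sqrtr// ltW.
have key : n2 (leb k.+1) V = n2 L (fun z => sc * tilde n_2 (T G) z).
  apply: (n2_eq_of_tends0 (F := v) (F' := fun m z => sc * tilde n_2 (T (M_ m)) z)) => //.
  - move=> m; split; first by apply: cmeasM; [exact: cmeas_cst|case: (ltT m)].
    rewrite n2Z ?sc2 -?n2vm; [by case: (lv m)|by case: (ltT m)].
  - split; first by apply: cmeasM; [exact: cmeas_cst|case: ltG].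
    rewrite n2Z ?sc2; last by case: ltG.
    have fin : n2 L (tilde n_2 (T G)) \is a fin_num by rewrite ge0_fin_numE ?n2_ge0//; case: ltG.
    by rewrite -(fineK fin) -EFinM ltry.
  - apply: tends0_le (tends0Z (ltW s0) (tends0_tilde n_2 lT2 lTG tT)) => m.
    rewrite -sc2 -n2Z; last by apply: cmeasB; [case: (ltT m)|case: ltG].
    by rewrite le_eqVlt; apply/orP; left; apply/eqP; apply: eq_n2 => z; rewrite mulrBr.
  - by move=> m; rewrite n2vm n2Z ?sc2//; case: (ltT m).
transitivity (n2 (leb k.+1) V).
  rewrite n2_slices//; apply: eq_integral => s _.
  apply: ge0_ae_eq_integral => //.
  - apply: (@eq_measurable_fun _ _ _ _ setT (fun x => (cabs (schrodinger s g x ^+ N) ^+ 2)%:E)).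
      by move=> x _; rewrite cabsX -exprM mulnC.
    by apply: measurable_EFin_cabs2; apply: cmeasX; exact: (cmeas_schrodinger p).
  - by apply: measurable_EFin_cabs2; exact: cmeas_slice.
  - by move=> x _; rewrite lee_fin mulnC exprM sqr_ge0.
  - by move=> x _; rewrite lee_fin sqr_ge0.
  have := solutionE p l1 l2 fast s; apply: filterS => x e _.
  by rewrite /V e cabsX -exprM mulnC.
rewrite key n2Z ?sc2; last by case: ltG.
(* Back from frequencies to space: [tilde (T G)] is the transform of [tilde (T g)]. *)
by rewrite (fpair_plancherel (fpair_tilde n_2 (T_fpair p))).
Qed.

End even_power.

(** * Tensor powers *)

Section tensor.
Context {R : realType}.
Variables (a b : nat).
Implicit Types (f : euclid R a -> R[i]) (g : euclid R b -> R[i]).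

Definition tens f g (v : euclid R (a + b)) : R[i] := f (lv v) * g (rv v).

Lemma cmeas_tens f g : cmeas f -> cmeas g -> cmeas (tens f g).
Proof.
move=> mf mg; apply: cmeasM.
  by apply: (cmeas_comp mf); exact: measurable_lv.
by apply: (cmeas_comp mg); exact: measurable_rv.
Qed.

Lemma cL1_tens f g : cL1 (leb a) f -> cL1 (leb b) g -> cL1 (leb (a + b)) (tens f g).
Proof. by move=> lf lg; exact: (mp_cL1 (mp_uncatv a b) (cL1_tensor2 lf lg)). Qed.

Lemma cint_tens f g : cL1 (leb a) f -> cL1 (leb b) g ->
  cint (leb (a + b)) (tens f g) = cint (leb a) f * cint (leb b) g.
Proof.
move=> lf lg; have lt := cL1_tensor2 lf lg.
rewrite (mp_cint (mp_uncatv a b) (proj1 lt)) -cint_fubini1//.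
rewrite mulrC -cintZ//; apply: eq_cint => x.
by rewrite /= cintZ// mulrC.
Qed.

Lemma n2_tens f g : cmeas f -> cmeas g ->
  n2 (leb (a + b)) (tens f g) = (n2 (leb a) f * n2 (leb b) g)%E.
Proof.
move=> mf mg; have mf2 := measurable_EFin_cabs2 mf; have mg2 := measurable_EFin_cabs2 mg.
rewrite {1}/n2 leb_ge0_cat; last 2 first.
- by apply: measurable_EFin_cabs2; exact: cmeas_tens.
- by move=> v; rewrite lee_fin sqr_ge0.
under eq_integral => x _.
  under eq_integral => y _ do rewrite /tens lv_cat rv_cat -[X in f X]/x -[X in g X]/y cabsM exprMn EFinM.
  rewrite ge0_integralZl//; last 2 first.
  - by move=> y _; rewrite lee_fin sqr_ge0.
  - by rewrite lee_fin sqr_ge0.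
  over.
by rewrite ge0_integralZr//; [move=> x _; rewrite lee_fin sqr_ge0|exact: n2_ge0].
Qed.

Lemma cL2_tens f g : cL2 (leb a) f -> cL2 (leb b) g -> cL2 (leb (a + b)) (tens f g).
Proof.
move=> [mf f2] [mg g2]; split; first exact: cmeas_tens.
rewrite n2_tens//; apply: lte_mul_pinfty => //; first exact: n2_ge0.
by rewrite ge0_fin_numE// n2_ge0.
Qed.

Lemma dot_lrv (x y : euclid R (a + b)) : dot x y = dot (lv x) (lv y) + dot (rv x) (rv y).
Proof. exact: dot_split. Qed.

Lemma fnorm_add : fnorm (a + b) = fnorm a * fnorm b :> R.
Proof.
have n0 : 2 * pi != 0 :> R by rewrite gt_eqF// mulr_gt0// pi_gt0.
rewrite /fnorm -powRD ?n0 ?implybT//.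
by congr (_ `^ _); rewrite natrD; field.
Qed.

Lemma fourier_tens f g zeta : cL1 (leb a) f -> cL1 (leb b) g ->
  fourier (tens f g) zeta = tens (fourier f) (fourier g) zeta.
Proof.
move=> lf lg; rewrite /tens !fourierE fnorm_add.
rewrite (_ : (fun x => _) = tens (fun x => cis (- dot x (lv zeta)) * f x)
   (fun x => cis (- dot x (rv zeta)) * g x)); last first.
  by apply/funext => x; rewrite /tens dot_lrv opprD cisD; ring.
rewrite cint_tens; [|exact: cL1_cisN_dot|exact: cL1_cisN_dot].
by rewrite real_cM; ring.
Qed.

Lemma tends0M (u v : nat -> \bar R) : (forall m, 0 <= u m)%E -> (forall m, 0 <= v m)%E ->
  tends0 u -> tends0 v -> tends0 (fun m => u m * v m)%E.
Proof.
move=> u0 v0 tu tv e e0; have [N1 h1] := tu e e0; have [N2 h2] := tv 1 ltr01.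
exists (maxn N1 N2) => m; rewrite geq_max => /andP[/h1 k1 /h2 k2].
by rewrite -[leRHS]mule1; apply: lee_pmul.
Qed.

(** The difference of the tensor products splits into one with left factor [f_ m - f] and one with
    right factor [g_ m - g]. In the former, the norm of [g_ m] is bounded through [g] and
    [g_ m - g], whence the term [A m * B m]. *)
Lemma tends0_tens (f_ : nat -> euclid R a -> R[i]) (g_ : nat -> euclid R b -> R[i]) f g :
  (forall m, cL2 (leb a) (f_ m)) -> (forall m, cL2 (leb b) (g_ m)) -> cL2 (leb a) f -> cL2 (leb b) g ->
  tends0 (fun m => n2 (leb a) (fun x => (f_ m x - f x)%R)) ->
  tends0 (fun m => n2 (leb b) (fun x => (g_ m x - g x)%R)) ->
  tends0 (fun m => n2 (leb (a + b)) (fun v => (tens (f_ m) (g_ m) v - tens f g v)%R)).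
Proof.
move=> lf_ lg_ lf lg tf tg.
have mf_ m : cmeas (f_ m) by case: (lf_ m).
have mg_ m : cmeas (g_ m) by case: (lg_ m).
have [mf f2] := lf; have [mg g2] := lg.
have ff : n2 (leb a) f \is a fin_num by rewrite ge0_fin_numE// n2_ge0.
have fg : n2 (leb b) g \is a fin_num by rewrite ge0_fin_numE// n2_ge0.
have f0 : 0 <= fine (n2 (leb a) f) by rewrite fine_ge0// n2_ge0.
have g0 : 0 <= fine (n2 (leb b) g) by rewrite fine_ge0// n2_ge0.
pose A m := n2 (leb a) (fun x => (f_ m x - f x)%R).
pose B m := n2 (leb b) (fun x => (g_ m x - g x)%R).
have A0 m : (0 <= A m)%E by exact: n2_ge0.
have B0 m : (0 <= B m)%E by exact: n2_ge0.
apply: (@tends0_le _ _ (fun m => 2%:E * (2%:E * (A m * B m) + 2%:E * ((fine (n2 (leb b) g))%:E * A m)) + 2%:E * ((fine (n2 (leb a) f))%:E * B m))%E); last first.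
  by apply: tends0D; apply: tends0Z => //; [apply: tends0D; apply: tends0Z => //; [exact: tends0M|exact: tends0Z]|exact: tends0Z].
move=> m.
have E v : tens (f_ m) (g_ m) v - tens f g v =
   tens (fun x => f_ m x - f x) (g_ m) v + tens f (fun x => g_ m x - g x) v.
  by rewrite /tens; ring.
rewrite (@eq_n2 _ _ _ (leb (a + b)) _ (fun v => tens (fun x => f_ m x - f x) (g_ m) v + tens f (fun x => g_ m x - g x) v)); last by move=> v; rewrite E.
apply: le_trans (n2D_le2 _ _ _) _.
- by apply: cmeas_tens => //; exact: cmeasB.
- by apply: cmeas_tens => //; exact: cmeasB.
rewrite !n2_tens//; try exact: cmeasB.
rewrite !fineK// -/(A m) -/(B m); apply: leeD => //.
apply: lee_wpmul2l => //.
have h : (n2 (leb b) (g_ m) <= 2%:E * B m + 2%:E * n2 (leb b) g)%E.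
  apply: le_trans (n2D_le2 _ _ mg); last exact: cmeasB.
  by rewrite (@eq_n2 _ _ _ (leb b) _ (g_ m))// => x; rewrite subrK.
apply: (@le_trans _ _ (A m * (2%:E * B m + 2%:E * n2 (leb b) g))%E); first exact: lee_wpmul2l.
rewrite ge0_muleDr; [|by rewrite mule_ge0|by rewrite mule_ge0// n2_ge0].
have e1 : (A m * (2%:E * B m) = 2%:E * (A m * B m))%E by exact: muleCA.
have e2 : (A m * (2%:E * n2 (leb b) g) = 2%:E * (n2 (leb b) g * A m))%E.
  by rewrite muleCA (muleC (A m)).
by rewrite e1 e2.
Qed.

Lemma fpair_tens f F g G : fpair f F -> fpair g G -> fpair (tens f g) (tens F G).
Proof.
move=> [lf lF [f_ [f1 f2 f3]]] [lg lG [g_ [g1 g2 g3]]].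
have l1f m : cL1 (leb a) (f_ m) by case: (f1 m).
have l2f m : cL2 (leb a) (f_ m) by case: (f1 m).
have l1g m : cL1 (leb b) (g_ m) by case: (g1 m).
have l2g m : cL2 (leb b) (g_ m) by case: (g1 m).
have lFf m : cL2 (leb a) (fourier (f_ m)) by exact: cL2_fourier.
have lFg m : cL2 (leb b) (fourier (g_ m)) by exact: cL2_fourier.
split; [exact: cL2_tens|exact: cL2_tens|exists (fun m => tens (f_ m) (g_ m)); split].
- by move=> m; split; [exact: cL1_tens|exact: cL2_tens].
- exact: tends0_tens.
- apply: tends0_le (tends0_tens lFf lFg lF lG f3 g3) => m.
  rewrite le_eqVlt; apply/orP; left; apply/eqP; apply: eq_n2 => x.
  by rewrite fourier_tens.
Qed.

End tensor.

(** * Orthogonal changes of variables *)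

Section orthogonal_maps.
Context {R : realType}.
Variable D : nat.

Definition orthmap (Phi : euclid R D -> euclid R D) : Prop :=
  mp (leb D) (leb D) Phi /\ forall x y, dot (Phi x) (Phi y) = dot x y.

Lemma orthmapP (Phi Psi : euclid R D -> euclid R D) : measurable_fun setT Phi ->
  (forall x y, Phi (vadd x y) = vadd (Phi x) (Phi y)) -> (forall y, Phi (Psi y) = y) ->
  (forall x y, dot (Phi x) (Phi y) = dot x y) -> orthmap Phi.
Proof.
move=> mP aP sP dP; split => //; apply: mp_orth => //.
- by move=> y; exists (Psi y).
- by move=> x; exact: dP.
Qed.

Variable Phi : euclid R D -> euclid R D.
Hypothesis oP : orthmap Phi.

Lemma fourier_orth f zeta : cmeas f -> fourier (fun x => f (Phi x)) zeta = fourier f (Phi zeta).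
Proof.
move=> mf; have [mP dP] := oP; rewrite !fourierE; congr (_ * _).
have mc : cmeas (fun z => cis (- dot z (Phi zeta)) * f z).
  by apply: cmeasM => //; apply: cmeas_cis; apply: measurable_funN; apply: measurable_dot.
by rewrite -(mp_cint mP mc); apply: eq_cint => z; rewrite dP.
Qed.

Lemma tends0_orth (f_ : nat -> euclid R D -> R[i]) f : (forall m, cmeas (f_ m)) -> cmeas f ->
  tends0 (fun m => n2 (leb D) (fun x => (f_ m x - f x)%R)) ->
  tends0 (fun m => n2 (leb D) (fun x => (f_ m (Phi x) - f (Phi x))%R)).
Proof.
move=> mf_ mf t; apply: tends0_le t => m.
by rewrite (mp_n2 (proj1 oP) (f := fun x => f_ m x - f x))//; exact: cmeasB.
Qed.

Lemma fpair_orth f F : fpair f F -> fpair (fun x => f (Phi x)) (fun x => F (Phi x)).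
Proof.
move=> [lf lF [f_ [h1 h2 h3]]]; have [mP _] := oP.
have l1 m : cL1 (leb D) (f_ m) by case: (h1 m).
have l2 m : cL2 (leb D) (f_ m) by case: (h1 m).
have mf_ m : cmeas (f_ m) by case: (l1 m).
split; [exact: (mp_cL2 mP)|exact: (mp_cL2 mP)|exists (fun m x => f_ m (Phi x)); split].
- by move=> m; split; [exact: (mp_cL1 mP)|exact: (mp_cL2 mP)].
- by apply: tends0_orth => //; case: lf.
- have mF m : cmeas (fourier (f_ m)) by exact: cmeas_fourier.
  apply: tends0_le (tends0_orth mF (proj1 lF) h3) => m.
  rewrite le_eqVlt; apply/orP; left; apply/eqP; apply: eq_n2 => x.
  by rewrite fourier_orth.
Qed.

End orthogonal_maps.

(** * Fourth powers in dimension two *)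

Section quartic.
Context {R : realType}.
Variables (n : nat) (n_2 : n = 2%N).
Local Notation c := ((Num.sqrt 2)^-1 : R).

Lemma sqrt2_sq : Num.sqrt 2 ^+ 2 = 2 :> R. Proof. by rewrite sqr_sqrtr. Qed.

Lemma isqrt2_sq : c ^+ 2 = 2^-1. Proof. by rewrite exprVn sqrt2_sq. Qed.

(* Coordinates z = (w, m) on pairs (x1, x2) in which m = (x1 + x2) / sqrt 2 is
   the total frequency and w is its orthogonal complement. *)
Definition Phi4 (z : euclid R (n + n)) : euclid R (n + n) :=
  catv (scalev c (vadd (rv z) (lv z)), scalev c (subv (rv z) (lv z))).

Definition Psi4 (z : euclid R (n + n)) : euclid R (n + n) :=
  catv (scalev c (subv (lv z) (rv z)), scalev c (vadd (lv z) (rv z))).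

Lemma lv_vadd a b (x y : euclid R (a + b)) : lv (vadd x y) = vadd (lv x) (lv y).
Proof. by apply: eq_from_tnth => i; rewrite !tnth_mktuple. Qed.

Lemma rv_vadd a b (x y : euclid R (a + b)) : rv (vadd x y) = vadd (rv x) (rv y).
Proof. by apply: eq_from_tnth => i; rewrite !tnth_mktuple. Qed.

Lemma tnth_subv d (x y : euclid R d) i : tnth (subv x y) i = tnth x i - tnth y i.
Proof. exact: tnth_mktuple. Qed.

Lemma orthmap_Phi4 : orthmap Phi4.
Proof.
have c2 := isqrt2_sq.
have mr : measurable_fun setT (@rv R n n) by exact: measurable_rv.
have ml : measurable_fun setT (@lv R n n) by exact: measurable_lv.
apply: (@orthmapP _ _ Phi4 Psi4).
- apply: (measurableT_comp (f := @catv R n n)); first exact: measurable_catv.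
  apply: measurable_fun_pair; apply: measurable_scalev; [exact: measurable_vadd|exact: measurable_subv].
- move=> x y; rewrite /Phi4 vadd_catv !lv_vadd !rv_vadd /=.
  by congr (catv (_, _)); apply: eq_from_tnth => i; rewrite !(tnth_scalev, tnth_vadd, tnth_subv); ring.
- move=> y; rewrite /Phi4 /Psi4 lv_cat rv_cat /= -[RHS](catvK y).
  congr (catv (_, _)); apply: eq_from_tnth => i; rewrite !(tnth_scalev, tnth_vadd, tnth_subv).
    transitivity (c ^+ 2 * (2 * tnth (lv y) i)); first by ring.
    by rewrite c2; field.
  transitivity (c ^+ 2 * (2 * tnth (rv y) i)); first by ring.
  by rewrite c2; field.
- move=> x y; rewrite /Phi4 dot_catv /= !(dotZl, dotZr, dotDl, dotDr, dotBl, dotBr) (dot_lrv x y).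
  transitivity (c ^+ 2 * (2 * (dot (lv x) (lv y) + dot (rv x) (rv y)))); first by ring.
  by rewrite c2; field.
Qed.

Definition T4 (M : euclid R n -> R[i]) (z : euclid R (n + n)) : R[i] := tens M M (Phi4 z).

Lemma wave_T4 M y : cL1 (leb n) M -> wave M y ^+ 2 = ext (Num.sqrt 2) (T4 M) y.
Proof.
move=> lM; have [mM _] := lM.
pose e xi := cis (dot (uncons y).2 xi - (uncons y).1 * sqnorm xi) * M xi.
have le : cL1 (leb n) e.
  apply: cL1M_bounded_eq => //; last by move=> x; exact: cabs_cis.
  by apply: cmeas_cis; exact: measurable_wave_phase.
rewrite /wave -/e expr2 -cint_tens//.
have [mP dP] := orthmap_Phi4.
rewrite -(mp_cint mP); last by case: (cL1_tens le le).
apply: eq_cint => z; rewrite /tens /T4 /e mulrACA -cisD; congr (cis _ * _).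
rewrite /phase -[sqnorm z]dP (dot_lrv (Phi4 z) (Phi4 z)).
(* The phases of the two factors add up. Orthogonality of [Phi4] turns |x1|^2 + |x2|^2 into |z|^2,
   and x1 + x2 = sqrt 2 * m, which is where the parameter [sqrt 2] of [ext] comes from. *)
have -> : Num.sqrt 2 * dot (uncons y).2 (rv z) = dot (uncons y).2 (lv (Phi4 z)) + dot (uncons y).2 (rv (Phi4 z)).
  rewrite /Phi4 lv_cat rv_cat /= !(dotZl, dotZr, dotDl, dotDr, dotBl, dotBr).
  transitivity (c * (2 * dot (uncons y).2 (rv z))); last by ring.
  by rewrite mulrA -[X in c * X * _]sqrt2_sq expr2 mulKf// gt_eqF// sqrtr_gt0.
by rewrite /sqnorm; ring.
Qed.

Lemma quartic_identity g : cL2 (leb n) g ->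
  (\int[lebesgue_measure]_s \int[leb n]_x (cabs (schrodinger s g x) ^+ 4)%:E =
    (strichartz_const n n (Num.sqrt 2) 2)%:E * n2 (leb (n + n)) (tilde n_2 (T4 g)))%E.
Proof.
have oP := orthmap_Phi4; have [mP dP] := oP.
apply: (@even_power_identity _ _ _ _ T4 (Num.sqrt 2) 2).
- by rewrite sqrtr_gt0.
- by move=> M lM; exact: (mp_cL1 mP (cL1_tens lM lM)).
- by move=> M lM; exact: (mp_cL2 mP (cL2_tens lM lM)).
- exact: wave_T4.
- move=> M_ G lM lG t; apply: (tends0_orth oP (f_ := fun m => tens (M_ m) (M_ m)) (f := tens G G)).
  + by move=> m; case: (cL2_tens (lM m) (lM m)).
  + by case: (cL2_tens lG lG).
  + exact: tends0_tens.
- by move=> f F p; apply: (fpair_orth oP); exact: fpair_tens.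
Qed.

End quartic.

(** * Sixth powers in dimension one *)

Section sextic.
Context {R : realType}.
Variables (o : nat) (o_2 : (o + o = 2)%N).
(** These normalise the orthogonal basis (1, 1, 1), (2, -1, -1), (0, 1, -1) of the space of triples.
    It acts on blocks of size [o], equal to 1; the last two vectors span the plane of w. *)
Local Notation al := ((Num.sqrt 3)^-1 : R).
Local Notation be := ((Num.sqrt 6)^-1 : R).
Local Notation ga := ((Num.sqrt 2)^-1 : R).

Lemma isqrt_sq (r : R) : 0 <= r -> (Num.sqrt r)^-1 ^+ 2 = r^-1.
Proof. by move=> r0; rewrite exprVn sqr_sqrtr. Qed.

(* z = (w, m) with m = (x1 + x2 + x3) / sqrt 3 and w in the orthogonal plane. *)
Definition Phi6 (z : euclid R ((o + o) + o)) : euclid R ((o + o) + o) :=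
  let m := scalev al (rv z) in let u := scalev be (lv (lv z)) in let v := scalev ga (rv (lv z)) in
  catv (catv (vadd m (scalev 2 u), vadd (subv m u) v), subv (subv m u) v).

Definition Psi6 (z : euclid R ((o + o) + o)) : euclid R ((o + o) + o) :=
  let x := lv (lv z) in let y := rv (lv z) in let t := rv z in
  catv (catv (scalev be (subv (subv (scalev 2 x) y) t), scalev ga (subv y t)), scalev al (vadd (vadd x y) t)).

Lemma Phi6_1 z : lv (lv (Phi6 z)) = vadd (scalev al (rv z)) (scalev 2 (scalev be (lv (lv z)))).
Proof. by rewrite /Phi6 /= lv_cat /= lv_cat. Qed.

Lemma Phi6_2 z : rv (lv (Phi6 z)) =
  vadd (subv (scalev al (rv z)) (scalev be (lv (lv z)))) (scalev ga (rv (lv z))).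
Proof. by rewrite /Phi6 /= lv_cat /= rv_cat. Qed.

Lemma Phi6_3 z : rv (Phi6 z) =
  subv (subv (scalev al (rv z)) (scalev be (lv (lv z)))) (scalev ga (rv (lv z))).
Proof. by rewrite /Phi6 /= rv_cat. Qed.

Lemma Psi6_1 z : lv (lv (Psi6 z)) = scalev be (subv (subv (scalev 2 (lv (lv z))) (rv (lv z))) (rv z)).
Proof. by rewrite /Psi6 /= lv_cat /= lv_cat. Qed.

Lemma Psi6_2 z : rv (lv (Psi6 z)) = scalev ga (subv (rv (lv z)) (rv z)).
Proof. by rewrite /Psi6 /= lv_cat /= rv_cat. Qed.

Lemma Psi6_3 z : rv (Psi6 z) = scalev al (vadd (vadd (lv (lv z)) (rv (lv z))) (rv z)).
Proof. by rewrite /Psi6 /= rv_cat. Qed.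

Lemma eq_catv3 (x y : euclid R ((o + o) + o)) : lv (lv x) = lv (lv y) -> rv (lv x) = rv (lv y) ->
  rv x = rv y -> x = y.
Proof. by move=> h1 h2 h3; rewrite -(catvK x) -(catvK y) -(catvK (lv x)) -(catvK (lv y)) h1 h2 h3. Qed.

Lemma dot_catv3 (x y : euclid R ((o + o) + o)) :
  dot x y = dot (lv (lv x)) (lv (lv y)) + dot (rv (lv x)) (rv (lv y)) + dot (rv x) (rv y).
Proof. by rewrite (dot_lrv x y) (dot_lrv (lv x) (lv y)). Qed.

Lemma orthmap_Phi6 : orthmap Phi6.
Proof.
have a2 : al ^+ 2 = 3^-1 by exact: isqrt_sq.
have b2 : be ^+ 2 = 6^-1 by exact: isqrt_sq.
have g2 : ga ^+ 2 = 2^-1 by exact: isqrt_sq.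
have mr : measurable_fun setT (@rv R (o + o) o) by exact: measurable_rv.
have ml : measurable_fun setT (@lv R (o + o) o) by exact: measurable_lv.
have mlr : measurable_fun setT (fun z : euclid R ((o + o) + o) => rv (lv z)).
  by apply: (measurableT_comp (f := @rv R o o)) => //; exact: measurable_rv.
have mll : measurable_fun setT (fun z : euclid R ((o + o) + o) => lv (lv z)).
  by apply: (measurableT_comp (f := @lv R o o)) => //; exact: measurable_lv.
have m1 : measurable_fun setT (fun z : euclid R ((o + o) + o) => scalev al (rv z)) by exact: measurable_scalev.
have m2 : measurable_fun setT (fun z : euclid R ((o + o) + o) => scalev be (lv (lv z))) by exact: measurable_scalev.
have m3 : measurable_fun setT (fun z : euclid R ((o + o) + o) => scalev ga (rv (lv z))) by exact: measurable_scalev.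
apply: (@orthmapP _ _ Phi6 Psi6).
- apply: (measurableT_comp (f := @catv R (o + o) o)); first exact: measurable_catv.
  apply: measurable_fun_pair.
    apply: (measurableT_comp (f := @catv R o o)); first exact: measurable_catv.
    apply: measurable_fun_pair; apply: measurable_vadd => //; last exact: measurable_subv.
    exact: measurable_scalev.
  by apply: measurable_subv => //; exact: measurable_subv.
- move=> x y; apply: eq_catv3;
    rewrite !(lv_vadd, rv_vadd, Phi6_1, Phi6_2, Phi6_3);
    by apply: eq_from_tnth => i; rewrite !(tnth_scalev, tnth_vadd, tnth_subv); ring.
- move=> y; apply: eq_catv3; rewrite ?(Phi6_1, Phi6_2, Phi6_3) !(Psi6_1, Psi6_2, Psi6_3);
    apply: eq_from_tnth => i; rewrite !(tnth_scalev, tnth_vadd, tnth_subv).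
  + transitivity (al ^+ 2 * (tnth (lv (lv y)) i + tnth (rv (lv y)) i + tnth (rv y) i) +
      be ^+ 2 * (2 * (2 * tnth (lv (lv y)) i - tnth (rv (lv y)) i - tnth (rv y) i))); first by ring.
    by rewrite a2 b2; field.
  + transitivity (al ^+ 2 * (tnth (lv (lv y)) i + tnth (rv (lv y)) i + tnth (rv y) i) -
      be ^+ 2 * (2 * tnth (lv (lv y)) i - tnth (rv (lv y)) i - tnth (rv y) i) +
      ga ^+ 2 * (tnth (rv (lv y)) i - tnth (rv y) i)); first by ring.
    by rewrite a2 b2 g2; field.
  + transitivity (al ^+ 2 * (tnth (lv (lv y)) i + tnth (rv (lv y)) i + tnth (rv y) i) -
      be ^+ 2 * (2 * tnth (lv (lv y)) i - tnth (rv (lv y)) i - tnth (rv y) i) -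
      ga ^+ 2 * (tnth (rv (lv y)) i - tnth (rv y) i)); first by ring.
    by rewrite a2 b2 g2; field.
- move=> x y; rewrite (dot_catv3 (Phi6 x)) (dot_catv3 x) !(Phi6_1, Phi6_2, Phi6_3).
  rewrite !(dotZl, dotZr, dotDl, dotDr, dotBl, dotBr).
  transitivity (al ^+ 2 * (3 * dot (rv x) (rv y)) + be ^+ 2 * (6 * dot (lv (lv x)) (lv (lv y)))
    + ga ^+ 2 * (2 * dot (rv (lv x)) (rv (lv y)))); first by ring.
  by rewrite a2 b2 g2; field.
Qed.

Definition T6 (M : euclid R o -> R[i]) (z : euclid R ((o + o) + o)) : R[i] :=
  tens (tens M M) M (Phi6 z).

Lemma wave_T6 M y : cL1 (leb o) M -> wave M y ^+ 3 = ext (Num.sqrt 3) (T6 M) y.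
Proof.
move=> lM; have [mM _] := lM.
pose e xi := cis (dot (uncons y).2 xi - (uncons y).1 * sqnorm xi) * M xi.
have le : cL1 (leb o) e.
  apply: cL1M_bounded_eq => //; last by move=> x; exact: cabs_cis.
  by apply: cmeas_cis; exact: measurable_wave_phase.
rewrite /wave -/e exprSr expr2 -cint_tens// -cint_tens//; last exact: cL1_tens.
have [mP dP] := orthmap_Phi6.
rewrite -(mp_cint mP); last by case: (cL1_tens (cL1_tens le le) le).
apply: eq_cint => z; rewrite /tens /T6 /e.
rewrite [X in X * _ = _]mulrACA -cisD mulrACA -cisD; congr (cis _ * _).
rewrite /phase -[sqnorm z]dP (dot_lrv (Phi6 z) (Phi6 z)) (dot_lrv (lv (Phi6 z)) (lv (Phi6 z))).
(* The three blocks of [Phi6 z] add up to sqrt 3 times m: the contributions of w cancel. *)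
have -> : Num.sqrt 3 * dot (uncons y).2 (rv z) = dot (uncons y).2 (lv (lv (Phi6 z))) +
    dot (uncons y).2 (rv (lv (Phi6 z))) + dot (uncons y).2 (rv (Phi6 z)).
  rewrite !(Phi6_1, Phi6_2, Phi6_3) !(dotZl, dotZr, dotDl, dotDr, dotBl, dotBr, dotZl, dotZr).
  transitivity (al * (3 * dot (uncons y).2 (rv z))); last by ring.
  have s3 : Num.sqrt 3 ^+ 2 = 3 :> R by rewrite sqr_sqrtr.
  by rewrite mulrA -[X in al * X * _]s3 expr2 mulKf// gt_eqF// sqrtr_gt0.
by rewrite /sqnorm; ring.
Qed.

Lemma sextic_identity g : cL2 (leb o) g ->
  (\int[lebesgue_measure]_s \int[leb o]_x (cabs (schrodinger s g x) ^+ 6)%:E =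
    (strichartz_const (o + o) o (Num.sqrt 3) 3)%:E * n2 (leb ((o + o) + o)) (tilde o_2 (T6 g)))%E.
Proof.
have oP := orthmap_Phi6; have [mP dP] := oP.
apply: (@even_power_identity _ _ _ _ T6 (Num.sqrt 3) 3).
- by rewrite sqrtr_gt0.
- by move=> M lM; exact: (mp_cL1 mP (cL1_tens (cL1_tens lM lM) lM)).
- by move=> M lM; exact: (mp_cL2 mP (cL2_tens (cL2_tens lM lM) lM)).
- exact: wave_T6.
- move=> M_ G lM lG t; apply: (tends0_orth oP (f_ := fun m => tens (tens (M_ m) (M_ m)) (M_ m)) (f := tens (tens G G) G)).
  + by move=> m; case: (cL2_tens (cL2_tens (lM m) (lM m)) (lM m)).
  + by case: (cL2_tens (cL2_tens lG lG) lG).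
  + apply: (tends0_tens (f_ := fun m => tens (M_ m) (M_ m))) => //.
    * by move=> m; exact: cL2_tens.
    * exact: cL2_tens.
    * exact: tends0_tens.
- by move=> f F p; apply: (fpair_orth oP); apply: fpair_tens => //; exact: fpair_tens.
Qed.

End sextic.

(** * Heat flow *)

Section heat_kernel.
Context {R : realType}.

Lemma heat_kernel_ge0 d (t : R) (x : euclid R d) : 0 <= heat_kernel t x.
Proof. by rewrite mulr_ge0 ?powR_ge0 ?expR_ge0. Qed.

Lemma four_pi_gt0 (t : R) : 0 < t -> 0 < 4 * pi * t.
Proof. by move=> t0; rewrite !mulr_gt0// pi_gt0. Qed.

(** The factors are centred normal densities of variance 2t, which brings in their integrability and
    total mass one. *)
Lemma heat_kernelE d (t : R) (x : euclid R d) : 0 < t ->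
  heat_kernel t x = \prod_(i < d) normal_pdf 0 (Num.sqrt (2 * t)) (tnth x i).
Proof.
move=> t0; have s0 : Num.sqrt (2 * t) != 0 by rewrite gt_eqF// sqrtr_gt0 mulr_gt0.
have s2 : Num.sqrt (2 * t) ^+ 2 = 2 * t by rewrite sqr_sqrtr// mulr_ge0// ltW.
have p0 := four_pi_gt0 t0.
under eq_bigr => i _ do rewrite /normal_pdf (negbTE s0) /normal_peak /normal_fun s2 subr0.
rewrite big_split /= prodr_const card_ord -expR_sum; congr (_ * expR _); last first.
  rewrite /sqnorm /dot mulr_suml -sumrN; apply: eq_bigr => i _.
  by rewrite -mulr_natl -expr2; field; rewrite gt_eqF.
rewrite (_ : 2 * t * pi *+ 2 = 4 * pi * t); last by rewrite -mulr_natl; ring.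
rewrite -powR12_sqrt ?ltW// -powRN -powR_mulrn ?powR_ge0// -powRrM; congr (_ `^ _).
by field.
Qed.

Lemma measurable_heat_kernel d (t : R) dT (T : measurableType dT) (f : T -> euclid R d) :
  measurable_fun setT f -> measurable_fun setT (fun x => heat_kernel t (f x)).
Proof.
move=> mf; apply: measurable_funM; first exact: measurable_cst.
apply: (measurableT_comp (f := expR : R -> R)) => //.
apply: measurable_funN; apply: measurable_funM; last exact: measurable_cst.
exact: measurable_sqnorm.
Qed.

Lemma integral_heat_kernel d (t : R) : 0 < t -> (\int[leb d]_x (heat_kernel t x)%:E = 1)%E.
Proof.
move=> t0; set s := Num.sqrt (2 * t).
have l (i : 'I_d) : cL1 lebesgue_measure ((fun x => (normal_pdf 0 s x)%:C) : measurableTypeR R -> R[i]).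
  apply: cL1_real; first by move=> x; exact: normal_pdf_ge0.
  exact: integrable_normal_pdf.
have [l1 e1] := cL1_cint_tprod l.
have E : tprod (fun (i : 'I_d) x => (normal_pdf 0 s x)%:C) = fun x => (heat_kernel t x)%:C.
  by apply/funext => x; rewrite heat_kernelE// real_prod.
rewrite E in l1 e1.
have := cL1_Re l1 => /= /(integrable_fin_num measurableT) fin.
rewrite -(fineK fin); congr (_%:E); apply: (@complexI R).
transitivity (cint (leb d) (fun x => (heat_kernel t x)%:C)); first by rewrite cint_real.
rewrite e1 big1// => i _; rewrite (cint_real _ (normal_pdf 0 s : measurableTypeR R -> R)).
by rewrite /Rintegral integral_normal_pdf.
Qed.

Lemma heat_kernelB d (t : R) (x y : euclid R d) : heat_kernel t (subv x y) = heat_kernel t (subv y x).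
Proof.
have e : sqnorm (subv x y) = sqnorm (subv y x).
  by apply: eq_bigr => i _; rewrite !tnth_subv; ring.
by rewrite /heat_kernel e.
Qed.

Lemma integral_heat_kernell d (t : R) (v : euclid R d) : 0 < t ->
  (\int[leb d]_x (heat_kernel t (subv v x))%:E = 1)%E.
Proof.
move=> t0; rewrite -[RHS](integral_heat_kernel d t0).
rewrite -[RHS](mp_ge0 (mp_subvl v) (f := fun x => (heat_kernel t x)%:E))//.
  by apply/measurable_EFinP; exact: measurable_heat_kernel.
by move=> x; rewrite lee_fin heat_kernel_ge0.
Qed.

Lemma integral_heat_kernelr d (t : R) (v : euclid R d) : 0 < t ->
  (\int[leb d]_x (heat_kernel t (subv x v))%:E = 1)%E.
Proof. by move=> t0; under eq_integral do rewrite heat_kernelB; exact: integral_heat_kernell. Qed.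

(* Completing the square. *)
Lemma heat_kernel_conv d (t h : R) (x y : euclid R d) : 0 < t -> 0 < h ->
  heat_kernel h (subv x y) * heat_kernel t y =
  heat_kernel (t + h) x * heat_kernel (t * h / (t + h)) (subv y (scalev (t / (t + h)) x)).
Proof.
move=> t0 h0; have th0 : 0 < t + h by rewrite addr_gt0.
have sg0 : 0 < t * h / (t + h) by rewrite divr_gt0// mulr_gt0.
rewrite /heat_kernel mulrACA [RHS]mulrACA -!expRD -!powRM ?ltW ?four_pi_gt0//.
congr (_ `^ _ * expR _); first by field; rewrite gt_eqF.
rewrite /sqnorm !(dotBl, dotBr, dotZl, dotZr) (dotC y x).
by field; rewrite !gt_eqF.
Qed.

End heat_kernel.

Section heat_flow.
Context {R : realType} {d : nat}.
Local Notation L := (leb d).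
Implicit Types (f g A B : euclid R d -> R).

Definition nnL1 f : Prop :=
  [/\ measurable_fun setT f, forall x, 0 <= f x & (\int[L]_x (f x)%:E < +oo)%E].

Lemma measurable_heat_int t f : measurable_fun setT f ->
  measurable_fun setT (fun p : euclid R d * euclid R d => (heat_kernel t (subv p.1 p.2) * f p.2)%:E).
Proof.
move=> mf; apply/measurable_EFinP; apply: measurable_funM.
  by apply: measurable_heat_kernel; apply: measurable_subv.
exact: measurableT_comp.
Qed.

Lemma measurable_heat_int1 t f x : measurable_fun setT f ->
  measurable_fun setT (fun y : euclid R d => (heat_kernel t (subv x y) * f y)%:E).
Proof.
move=> mf; apply/measurable_EFinP; apply: measurable_funM => //.
by apply: measurable_heat_kernel; apply: measurable_subv.
Qed.

(** For positive time the kernel is bounded, so the integral is finite at every point and the [fine]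
    inside [heat] loses nothing ([heat_fin]). *)
Lemma heat_int_lty t f x : 0 < t -> nnL1 f ->
  (\int[L]_y (heat_kernel t (subv x y) * f y)%:E < +oo)%E.
Proof.
move=> t0 [mf f0 fi]; pose c : R := (4 * pi * t) `^ (- (d%:R / 2)).
apply: (@le_lt_trans _ _ (\int[L]_y (c%:E * (f y)%:E))%E).
  apply: ge0_le_integral => //.
  - by move=> y _; rewrite lee_fin mulr_ge0 ?heat_kernel_ge0.
  - exact: measurable_heat_int1.
  - by apply: emeasurable_funM; [exact: measurable_cst|exact/measurable_EFinP].
  move=> y _; rewrite -EFinM lee_fin ler_wpM2r// /heat_kernel ler_piMr ?powR_ge0//.
  rewrite -[leRHS]expR0 ler_expR oppr_le0 divr_ge0 ?sqnorm_ge0// mulr_ge0// ltW//.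
rewrite ge0_integralZl//.
- by apply: lte_mul_pinfty => //; rewrite lee_fin powR_ge0.
- exact/measurable_EFinP.
- by move=> y _; rewrite lee_fin.
- by rewrite lee_fin powR_ge0.
Qed.

Lemma heat_fin t f x : 0 < t -> nnL1 f ->
  (heat t f x)%:E = (\int[L]_y (heat_kernel t (subv x y) * f y)%:E)%E.
Proof.
move=> t0 nf; have := heat_int_lty x t0 nf; have [mf f0 fi] := nf => h.
rewrite /heat /Rintegral fineK// ge0_fin_numE//.
by apply: integral_ge0 => y _; rewrite lee_fin mulr_ge0 ?heat_kernel_ge0.
Qed.

Lemma heat_ge0 t f x : (forall y, 0 <= f y) -> 0 <= heat t f x.
Proof.
move=> f0; rewrite /heat /Rintegral fine_ge0//.
by apply: integral_ge0 => y _; rewrite lee_fin mulr_ge0 ?heat_kernel_ge0.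
Qed.

Lemma measurable_heat t f : measurable_fun setT f -> measurable_fun setT (heat t f).
Proof.
move=> mf; apply: (measurableT_comp (f := @fine R)) => //.
exact: (@measurable_Fubini1 _ _ _ _ _ L (fun p => (heat_kernel t (subv p.1 p.2) * f p.2)%:E) (measurable_heat_int t mf)).
Qed.

Lemma integral_heat_mul t (h : euclid R d -> \bar R) : 0 < t -> measurable_fun setT h ->
  (forall y, 0 <= h y)%E ->
  (\int[L]_x \int[L]_y ((heat_kernel t (subv x y))%:E * h y) = \int[L]_y h y)%E.
Proof.
move=> t0 mh h0.
have mk : measurable_fun setT (fun z : euclid R d * euclid R d => (heat_kernel t (subv z.1 z.2))%:E * h z.2)%E.
  apply: emeasurable_funM; last exact: measurableT_comp.
  by apply/measurable_EFinP; apply: measurable_heat_kernel; apply: measurable_subv.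
have k0 (z : euclid R d * euclid R d) : (0 <= (heat_kernel t (subv z.1 z.2))%:E * h z.2)%E.
  by rewrite mule_ge0// lee_fin heat_kernel_ge0.
apply: etrans (fubini_tonelli (m1 := L) (m2 := L) _ mk k0) _.
transitivity (\int[L]_y \int[L]_x ((heat_kernel t (subv x y))%:E * h y))%E; first by [].
apply: eq_integral => y _; rewrite ge0_integralZr//.
- by rewrite integral_heat_kernelr// mul1e.
- by apply/measurable_EFinP; apply: measurable_heat_kernel; apply: measurable_subv.
- by move=> x _; rewrite lee_fin heat_kernel_ge0.
Qed.

Lemma integral_heat t f : 0 < t -> nnL1 f -> (\int[L]_x (heat t f x)%:E = \int[L]_x (f x)%:E)%E.
Proof.
move=> t0 nf; have [mf f0 fi] := nf.
rewrite -(integral_heat_mul t0 (h := fun y => (f y)%:E)).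
- by apply: eq_integral => x _; rewrite heat_fin.
- exact/measurable_EFinP.
- by move=> y; rewrite lee_fin.
Qed.

Lemma nnL1_heat t f : 0 < t -> nnL1 f -> nnL1 (heat t f).
Proof.
move=> t0 nf; have [mf f0 fi] := nf; split.
- exact: measurable_heat.
- by move=> x; exact: heat_ge0.
- by rewrite integral_heat.
Qed.

Lemma heat_semigroup t h f x : 0 < t -> 0 < h -> nnL1 f -> heat (t + h) f x = heat h (heat t f) x.
Proof.
move=> t0 h0 nf; have th0 : 0 < t + h by rewrite addr_gt0.
have sg0 : 0 < t * h / (t + h) by rewrite divr_gt0// mulr_gt0.
have nh := nnL1_heat t0 nf; have [mf f0 fi] := nf.
suff : (heat (t + h) f x)%:E = (heat h (heat t f) x)%:E by case.
rewrite !heat_fin//.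
transitivity (\int[L]_v \int[L]_y ((heat_kernel h (subv x v) * heat_kernel t (subv v y)) * f y)%:E)%E; last first.
  apply: eq_integral => v _; rewrite EFinM heat_fin// -ge0_integralZl//.
  - by apply: eq_integral => y _; rewrite -EFinM; congr (_%:E); exact/esym/mulrA.
  - exact: measurable_heat_int1.
  - by move=> y _; rewrite lee_fin mulr_ge0 ?heat_kernel_ge0.
  - by rewrite lee_fin heat_kernel_ge0.
have mk : measurable_fun setT (fun z : euclid R d * euclid R d =>
    ((heat_kernel h (subv x z.1) * heat_kernel t (subv z.1 z.2)) * f z.2)%:E).
  apply/measurable_EFinP; apply: measurable_funM; last exact: measurableT_comp.
  apply: measurable_funM; apply: measurable_heat_kernel; apply: measurable_subv => //; exact: measurable_cst.
have k0 (z : euclid R d * euclid R d) : (0 <= ((heat_kernel h (subv x z.1) * heat_kernel t (subv z.1 z.2)) * f z.2)%:E)%E.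
  by rewrite lee_fin; apply: mulr_ge0 => //; apply: mulr_ge0; exact: heat_kernel_ge0.
rewrite (fubini_tonelli (m1 := L) (m2 := L) _ mk k0).
apply: eq_integral => y _.
transitivity (\int[L]_v ((heat_kernel h (subv x v) * heat_kernel t (subv v y))%:E * (f y)%:E))%E; last first.
  by apply: eq_integral => v _; rewrite -EFinM.
have mk1 : measurable_fun setT (fun v : euclid R d => (heat_kernel h (subv x v) * heat_kernel t (subv v y))%:E).
  apply/measurable_EFinP; apply: measurable_funM; apply: measurable_heat_kernel; apply: measurable_subv => //; exact: measurable_cst.
rewrite ge0_integralZr//; last 2 first.
- by move=> v _; rewrite lee_fin mulr_ge0 ?heat_kernel_ge0.
- by rewrite lee_fin.
rewrite EFinM; congr (_ * _)%E.
have k1 v : (0 <= (heat_kernel h (subv x v) * heat_kernel t (subv v y))%:E)%E.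
  by rewrite lee_fin mulr_ge0 ?heat_kernel_ge0.
(* With [y] as origin the two kernels have the form of [heat_kernel_conv]: their product is the
   kernel at time [t + h] times a kernel of mass one in [v]. *)
rewrite -[RHS](mp_ge0 (mp_vadd y) mk1 k1).
transitivity (\int[L]_v ((heat_kernel (t + h) (subv x y))%:E *
   (heat_kernel (t * h / (t + h)) (subv v (scalev (t / (t + h)) (subv x y))))%:E))%E.
  rewrite ge0_integralZl//.
  - by rewrite integral_heat_kernelr// mule1.
  - by apply/measurable_EFinP; apply: measurable_heat_kernel; apply: measurable_subv.
  - by move=> v _; rewrite lee_fin heat_kernel_ge0.
  - by rewrite lee_fin heat_kernel_ge0.
apply: eq_integral => v _; rewrite -EFinM -heat_kernel_conv//.
have -> : subv (vadd v y) y = v by exact: vaddK.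
have -> : subv x (vadd v y) = subv (subv x y) v.
  by apply: eq_from_tnth => i; rewrite !(tnth_subv, tnth_vadd); ring.
by [].
Qed.

Lemma sqnorm_orth (Phi : euclid R d -> euclid R d) x y : orthmap Phi ->
  sqnorm (subv (Phi x) (Phi y)) = sqnorm (subv x y).
Proof. by move=> [_ dP]; rewrite /sqnorm !(dotBl, dotBr) !dP. Qed.

Lemma heat_orth (Phi : euclid R d -> euclid R d) t f x : orthmap Phi ->
  measurable_fun setT f -> (forall y, 0 <= f y) -> heat t f (Phi x) = heat t (fun y => f (Phi y)) x.
Proof.
move=> oP mf f0; have [mP dP] := oP; rewrite /heat /Rintegral; congr fine.
have m1 := measurable_heat_int1 t (Phi x) mf.
rewrite -(mp_ge0 mP m1); last by move=> y; rewrite lee_fin mulr_ge0 ?heat_kernel_ge0.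
by apply: eq_integral => y _; rewrite /heat_kernel sqnorm_orth.
Qed.

Lemma nnL1_orth (Phi : euclid R d -> euclid R d) f : orthmap Phi -> nnL1 f -> nnL1 (fun x => f (Phi x)).
Proof.
move=> [mP _] [mf f0 fi]; split => //.
- by apply: measurableT_comp => //; case: mP.
- rewrite (mp_ge0 mP (f := fun x => (f x)%:E))//.
  exact/measurable_EFinP.
Qed.

Lemma sqrt_heat_mono t h A B : 0 < t -> 0 < h -> nnL1 A -> nnL1 B ->
  (\int[L]_x (Num.sqrt (heat t A x) * Num.sqrt (heat t B x))%:E <=
   \int[L]_x (Num.sqrt (heat (t + h) A x) * Num.sqrt (heat (t + h) B x))%:E)%E.
Proof.
move=> t0 h0 nA nB; have th0 : 0 < t + h by rewrite addr_gt0.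
have nhA := nnL1_heat t0 nA; have nhB := nnL1_heat t0 nB.
have [mA A0 _] := nhA; have [mB B0 _] := nhB.
have msqrt dT (T : measurableType dT) (g : T -> R) : measurable_fun setT g -> measurable_fun setT (fun x => Num.sqrt (g x)).
  move=> mg; apply: (measurableT_comp (f := Num.sqrt : R -> R)) => //.
  by apply: continuous_measurable_fun; exact: sqrt_continuous.
pose p v := Num.sqrt (heat t A v) * Num.sqrt (heat t B v).
have mp : measurable_fun setT p by apply: measurable_funM; exact: msqrt.
have p0 v : 0 <= p v by rewrite mulr_ge0 ?sqrtr_ge0.
rewrite -(integral_heat_mul h0 (h := fun x => (p x)%:E)); last 2 first.
- exact/measurable_EFinP.
- by move=> x; rewrite lee_fin.
have mk (x : euclid R d) : measurable_fun setT (fun v : euclid R d => heat_kernel h (subv x v)).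
  by apply: measurable_heat_kernel; apply: measurable_subv.
have mhA : measurable_fun setT (heat (t + h) A) by apply: measurable_heat; case: nA.
have mhB : measurable_fun setT (heat (t + h) B) by apply: measurable_heat; case: nB.
apply: ge0_le_integral => //.
- move=> x _; apply: integral_ge0 => v _; rewrite mule_ge0// lee_fin// heat_kernel_ge0//.
- apply: (@measurable_Fubini1 _ _ _ _ _ L (fun z => (heat_kernel h (subv z.1 z.2))%:E * (p z.2)%:E)%E).
  apply: emeasurable_funM; last by apply/measurable_EFinP; exact: measurableT_comp.
  by apply/measurable_EFinP; apply: measurable_heat_kernel; apply: measurable_subv.
- by apply/measurable_EFinP; apply: measurable_funM; exact: msqrt.
move=> x _.
(* The kernel is shared evenly between the two factors: [q A * q B] is the kernel times [p], and the
   squares integrate to [heat (t + h) A x] and [heat (t + h) B x]. *)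
pose q (C : euclid R d -> R) v := Num.sqrt (heat_kernel h (subv x v) * heat t C v).
have mq C : measurable_fun setT (heat t C) -> measurable_fun setT (q C).
  by move=> mC; apply: msqrt; exact: measurable_funM.
have cs := cauchy_schwarz L (mq A mA) (mq B mB).
have qsq C : nnL1 C -> (\int[L]_v (q C v ^+ 2)%:E = (heat (t + h) C x)%:E)%E.
  move=> nC; have nhC := nnL1_heat t0 nC; rewrite heat_semigroup// heat_fin//.
  apply: eq_integral => v _; rewrite /q sqr_sqrtr// mulr_ge0 ?heat_kernel_ge0//.
  by case: nhC.
rewrite !qsq// in cs.
have E : (\int[L]_v `|q A v * q B v|%:E = \int[L]_v ((heat_kernel h (subv x v))%:E * (p v)%:E))%E.
  apply: eq_integral => v _; rewrite -EFinM; congr (_%:E).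
  have k0 := heat_kernel_ge0 h (subv x v).
  rewrite ger0_norm; last by apply: mulr_ge0; exact: sqrtr_ge0.
  by rewrite /q (sqrtrM _ k0) (sqrtrM _ k0) mulrACA -expr2 sqr_sqrtr.
rewrite E in cs.
have a0 : 0 <= heat (t + h) A x by apply: heat_ge0; case: nA.
have b0 : 0 <= heat (t + h) B x by apply: heat_ge0; case: nB.
have : (0 <= \int[L]_v ((heat_kernel h (subv x v))%:E * (p v)%:E))%E.
  by apply: integral_ge0 => v _; rewrite mule_ge0// lee_fin// heat_kernel_ge0.
case: (integral _ _ _) cs => [r| |]//.
rewrite -!EFinM !lee_fin => cs r0.
by rewrite -sqrtrM// -(ler_pXn2r (_ : 0 < 2)%N) ?nnegrE ?sqrtr_ge0// sqr_sqrtr ?mulr_ge0// expr2.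
Qed.

End heat_flow.

(** * Rotation averages along the heat flow *)

Section average_monotone.
Context {R : realType}.
Variables (n : nat) (n_2 : n = 2%N) (k : nat).
Local Notation L := (leb (n + k)).
Local Notation Rot := (Rot n_2).
Local Notation unitv := (unitv n_2).
Local Notation iD w := (\1_(@disc R n 1) w : R).

Lemma orthmap_Rot e : sqnorm e = 1 -> orthmap (Rot e : euclid R (n + k) -> _).
Proof. by move=> e1; split; [exact: mp_Rot|move=> x y; exact: dot_Rot]. Qed.

Lemma measurable_iD : measurable_fun setT (fun w : euclid R n => iD w).
Proof. by apply: measurable_indic; exact: measurable_disc. Qed.

(* Expanding the square of the average turns its L^2 norm into a double average
   of correlations of F along two rotations. *)
Lemma n2_tilde_real (F : euclid R (n + k) -> R) : (forall z, 0 <= F z) ->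
  cL2 L (fun z => (F z)%:C) ->
  n2 L (tilde n_2 (fun z => (F z)%:C)) =
  (\int[leb n]_w \int[leb n]_w' ((iD w * iD w')%:E *
     \int[L]_z (F (Rot (unitv w) z) * F (Rot (unitv w') z))%:E))%E.
Proof.
move=> F0 lF; have [[mF _] _] := lF; rewrite /= in mF.
have i0 w : 0 <= iD w by rewrite indicE.
pose f (z : euclid R (n + k)) (w : euclid R n) := iD w * F (Rot (unitv w) z).
have f0 z w : 0 <= f z w by exact: mulr_ge0.
have mi := measurable_iD.
have mR dT (T : measurableType dT) (g : T -> euclid R n) (h : T -> euclid R (n + k)) :
    measurable_fun setT g -> measurable_fun setT h -> measurable_fun setT (fun x => F (Rot (unitv (g x)) (h x))).
  move=> mg mh; apply: (measurableT_comp mF); apply: measurable_Rot => //.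
  by apply: (measurableT_comp (f := unitv)) => //; exact: measurable_unitv.
have mf dT (T : measurableType dT) (g : T -> euclid R n) (h : T -> euclid R (n + k)) :
    measurable_fun setT g -> measurable_fun setT h -> measurable_fun setT (fun x => f (h x) (g x)).
  by move=> mg mh; apply: measurable_funM; [exact: (measurableT_comp mi)|exact: mR].
pose E z := (\int[leb n]_w (f z w)%:E)%E.
have E0 z : (0 <= E z)%E by apply: integral_ge0 => w _; rewrite lee_fin.
have mE : measurable_fun setT E.
  apply: (@measurable_Fubini1 _ _ _ _ _ (leb n) (fun p => (f p.1 p.2)%:E)).
  by apply/measurable_EFinP; exact: mf.
have mff : measurable_fun setT (fun p : (euclid R (n + k) * euclid R n) * euclid R n =>
    (f p.1.1 p.1.2 * f p.1.1 p.2)%:E).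
  apply/measurable_EFinP; apply: measurable_funM; apply: mf => //; exact: measurableT_comp.
have sqE z : (E z * E z = \int[leb n]_w \int[leb n]_w' (f z w * f z w')%:E)%E.
  rewrite {1}/E -ge0_integralZr//; last 2 first.
  - by apply/measurable_EFinP; apply: mf => //; exact: measurable_cst.
  - by move=> w _; rewrite lee_fin.
  apply: eq_integral => w _; rewrite /E -ge0_integralZl//.
  - by apply/measurable_EFinP; apply: mf => //; exact: measurable_cst.
  - by move=> w' _; rewrite lee_fin.
  - by rewrite lee_fin.
transitivity (\int[L]_z (E z * E z))%E.
  apply: ge0_ae_eq_integral => //.
  - by apply: measurable_EFin_cabs2; apply: cmeas_tilde; case: lF.
  - exact: emeasurable_funM.
  - by move=> z _; rewrite lee_fin sqr_ge0.
  - by move=> z _; exact: mule_ge0.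
  have := ae_cL1_tilde n_2 lF; apply: filterS => z [_ l1] _.
  have fE : (fun w => indD w * (F (Rot (unitv w) z))%:C) = (fun w => (f z w)%:C).
    by apply/funext => w; rewrite /indD -real_cM.
  rewrite fE in l1.
  have fin : E z \is a fin_num by have := cL1_Re l1 => /(integrable_fin_num measurableT).
  rewrite /tilde fE cint_real cabs_real real_normK ?num_real// expr2 EFinM.
  by rewrite /Rintegral fineK.
under eq_integral do rewrite sqE.
pose G1 z w := (\int[leb n]_w' (f z w * f z w')%:E)%E.
have mG1 : measurable_fun setT (fun p : euclid R (n + k) * euclid R n => G1 p.1 p.2).
  exact: (@measurable_Fubini1 _ _ _ _ _ (leb n) (fun p : (euclid R (n + k) * euclid R n) * euclid R n => (f p.1.1 p.1.2 * f p.1.1 p.2)%:E)).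
have G10 (p : euclid R (n + k) * euclid R n) : (0 <= G1 p.1 p.2)%E.
  by apply: integral_ge0 => w' _; rewrite lee_fin mulr_ge0.
apply: etrans (fubini_tonelli (m1 := L) (m2 := leb n) _ mG1 G10) _.
apply: eq_integral => w _.
have mG2 : measurable_fun setT (fun p : euclid R (n + k) * euclid R n => (f p.1 w * f p.1 p.2)%:E).
  apply/measurable_EFinP; apply: measurable_funM; apply: mf => //; exact: measurable_cst.
have G20 (p : euclid R (n + k) * euclid R n) : (0 <= (f p.1 w * f p.1 p.2)%:E)%E.
  by rewrite lee_fin mulr_ge0.
apply: etrans (fubini_tonelli (m1 := L) (m2 := leb n) _ mG2 G20) _.
apply: eq_integral => w' _.
rewrite -ge0_integralZl//; last 2 first.
- apply/measurable_EFinP; apply: measurable_funM; apply: mR => //; exact: measurable_cst.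
- by move=> z _; rewrite lee_fin mulr_ge0.
by apply: eq_integral => z _; rewrite -EFinM /f mulrACA.
Qed.

Lemma nnL1_sqrt_cL2 (A : euclid R (n + k) -> R) : nnL1 A -> cL2 L (fun z => (Num.sqrt (A z))%:C).
Proof.
move=> [mA A0 Ai]; split.
  apply: cmeas_real; apply: (measurableT_comp (f := Num.sqrt : R -> R)) => //.
  by apply: continuous_measurable_fun; exact: sqrt_continuous.
apply: le_lt_trans Ai; rewrite le_eqVlt; apply/orP; left; apply/eqP.
by apply: eq_integral => z _; rewrite cabs_real real_normK ?num_real// sqr_sqrtr.
Qed.

Lemma n2_tilde_heat_mono (A : euclid R (n + k) -> R) (t h : R) : 0 < t -> 0 < h -> nnL1 A ->
  (n2 L (tilde n_2 (fun z => (Num.sqrt (heat t A z))%:C)) <=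
   n2 L (tilde n_2 (fun z => (Num.sqrt (heat (t + h) A z))%:C)))%E.
Proof.
move=> t0 h0 nA; have th0 : 0 < t + h by rewrite addr_gt0.
have [mA A0 _] := nA.
have i0 w : 0 <= iD w by rewrite indicE.
have mi := measurable_iD.
have l1 := nnL1_sqrt_cL2 (nnL1_heat t0 nA); have l2 := nnL1_sqrt_cL2 (nnL1_heat th0 nA).
have s0 s z : 0 <= Num.sqrt (heat s A z) by exact: sqrtr_ge0.
have e1 := @n2_tilde_real (fun z => Num.sqrt (heat t A z)) (s0 t) l1.
have e2 := @n2_tilde_real (fun z => Num.sqrt (heat (t + h) A z)) (s0 (t + h)) l2.
have tr (a b c d : \bar R) : a = b -> c = d -> (b <= d)%E -> (a <= c)%E by move=> -> ->.
apply: (tr _ _ _ _ e1 e2); clear e1 e2 l1 l2.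
pose I s (w w' : euclid R n) := ((iD w * iD w')%:E * \int[L]_z
   (Num.sqrt (heat s A (Rot (unitv w) z)) * Num.sqrt (heat s A (Rot (unitv w') z)))%:E)%E.
have I0 s w w' : (0 <= I s w w')%E.
  apply: mule_ge0; first by rewrite lee_fin mulr_ge0.
  by apply: integral_ge0 => z _; rewrite lee_fin mulr_ge0 ?sqrtr_ge0.
have mI s : measurable_fun setT (fun p : euclid R n * euclid R n => I s p.1 p.2).
  apply: emeasurable_funM.
    apply/measurable_EFinP; apply: measurable_funM.
      exact: (measurableT_comp mi measurable_fst).
    exact: (measurableT_comp mi measurable_snd).
  apply: (@measurable_Fubini1 _ _ _ _ _ L (fun q : (euclid R n * euclid R n) * euclid R (n + k) =>
    (Num.sqrt (heat s A (Rot (unitv q.1.1) q.2)) * Num.sqrt (heat s A (Rot (unitv q.1.2) q.2)))%:E)).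
  apply/measurable_EFinP.
  have aux (g : (euclid R n * euclid R n) * euclid R (n + k) -> euclid R n) : measurable_fun setT g ->
     measurable_fun setT (fun q => Num.sqrt (heat s A (Rot (unitv (g q)) q.2))).
    move=> mg; apply: (measurableT_comp (f := Num.sqrt : R -> R)).
      by apply: continuous_measurable_fun; exact: sqrt_continuous.
    apply: (measurableT_comp (measurable_heat s mA)); apply: measurable_Rot => //.
    by apply: (measurableT_comp (f := unitv)) => //; exact: measurable_unitv.
  by apply: measurable_funM; apply: aux; exact: measurableT_comp.
have le_I w w' : (I t w w' <= I (t + h)%R w w')%E.
  apply: lee_wpmul2l; first by rewrite lee_fin mulr_ge0.
  have o1 := orthmap_Rot (sqnorm_unitv n_2 w); have o2 := orthmap_Rot (sqnorm_unitv n_2 w').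
  (* The heat flow commutes with rotations, so the correlation is that of the flows of two rotated
     copies of [A], as in [sqrt_heat_mono]. *)
  have E s : (\int[L]_z (Num.sqrt (heat s A (Rot (unitv w) z)) * Num.sqrt (heat s A (Rot (unitv w') z)))%:E =
     \int[L]_z (Num.sqrt (heat s (fun z => A (Rot (unitv w) z)) z) *
       Num.sqrt (heat s (fun z => A (Rot (unitv w') z)) z))%:E)%E.
    by apply: eq_integral => z _; rewrite (heat_orth s z o1 mA A0) (heat_orth s z o2 mA A0).
  exact: (tr _ _ _ _ (E t) (E (t + h)) (sqrt_heat_mono t0 h0 (nnL1_orth o1 nA) (nnL1_orth o2 nA))).
have mI1 s w : measurable_fun setT (I s w).
  have mp : measurable_fun setT (fun w' : euclid R n => (w, w')) by exact: measurable_fun_pair.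
  by have H := measurableT_comp (mI s) mp; exact: H.
have m1 s : measurable_fun setT (fun w => \int[leb n]_w' I s w w')%E.
  by have H := @measurable_Fubini1 _ _ _ _ _ (leb n) (fun p => I s p.1 p.2) (mI s); exact: H.
suff : (\int[leb n]_w \int[leb n]_w' I t w w' <= \int[leb n]_w \int[leb n]_w' I (t + h)%R w w')%E by [].
clearbody I.
apply: ge0_le_integral.
- exact: measurableT.
- by move=> w _; apply: integral_ge0 => w' _; exact: I0.
- exact: m1.
- exact: m1.
- move=> w _; apply: ge0_le_integral.
  + exact: measurableT.
  + by move=> w' _; exact: I0.
  + exact: mI1.
  + exact: mI1.
  + by move=> w' _; exact: le_I.
Qed.

End average_monotone.

(** * Heat flow of tensor products *)

Section heat_tensor.
Context {R : realType}.

Lemma subv_lv a b (x y : euclid R (a + b)) : lv (subv x y) = subv (lv x) (lv y).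
Proof. by apply: eq_from_tnth => i; rewrite !tnth_mktuple. Qed.

Lemma subv_rv a b (x y : euclid R (a + b)) : rv (subv x y) = subv (rv x) (rv y).
Proof. by apply: eq_from_tnth => i; rewrite !tnth_mktuple. Qed.

Lemma heat_kernel_cat a b (t : R) (x : euclid R (a + b)) : 0 < t ->
  heat_kernel t x = heat_kernel t (lv x) * heat_kernel t (rv x).
Proof.
move=> t0; have n0 : 4 * pi * t != 0 by rewrite gt_eqF// four_pi_gt0.
rewrite /heat_kernel mulrACA -expRD -powRD ?n0 ?implybT//; congr (_ `^ _ * expR _).
  by rewrite natrD; field.
rewrite /sqnorm (dot_lrv x x); field; by rewrite gt_eqF.
Qed.

Definition rtens a b (f : euclid R a -> R) (g : euclid R b -> R) (v : euclid R (a + b)) : R :=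
  f (lv v) * g (rv v).

Lemma measurable_rtens a b (f : euclid R a -> R) (g : euclid R b -> R) :
  measurable_fun setT f -> measurable_fun setT g -> measurable_fun setT (rtens f g).
Proof.
move=> mf mg; apply: measurable_funM.
  by apply: (measurableT_comp mf); exact: measurable_lv.
by apply: (measurableT_comp mg); exact: measurable_rv.
Qed.

Lemma integral_rtens a b (f : euclid R a -> R) (g : euclid R b -> R) :
  measurable_fun setT f -> measurable_fun setT g -> (forall x, 0 <= f x) -> (forall x, 0 <= g x) ->
  (\int[leb (a + b)]_v (rtens f g v)%:E = \int[leb a]_x (f x)%:E * \int[leb b]_y (g y)%:E)%E.
Proof.
move=> mf mg f0 g0; rewrite leb_ge0_cat; last 2 first.
- by apply/measurable_EFinP; exact: measurable_rtens.
- by move=> v; rewrite lee_fin mulr_ge0.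
have mf' : measurable_fun setT (fun x => (f x)%:E) by exact/measurable_EFinP.
have mg' : measurable_fun setT (fun x => (g x)%:E) by exact/measurable_EFinP.
transitivity (\int[leb a]_x ((f x)%:E * \int[leb b]_y (g y)%:E))%E.
  apply: eq_integral => x _; rewrite -ge0_integralZl//.
  - by apply: eq_integral => y _; rewrite /rtens lv_cat rv_cat EFinM.
  - by move=> y _; rewrite lee_fin.
  - by rewrite lee_fin.
rewrite ge0_integralZr//; first by move=> x _; rewrite lee_fin.
by apply: integral_ge0 => y _; rewrite lee_fin.
Qed.

Lemma nnL1_rtens a b (f : euclid R a -> R) (g : euclid R b -> R) : nnL1 f -> nnL1 g -> nnL1 (rtens f g).
Proof.
move=> [mf f0 fi] [mg g0 gi]; split.
- exact: measurable_rtens.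
- by move=> v; exact: mulr_ge0.
rewrite integral_rtens//; apply: lte_mul_pinfty => //.
  by apply: integral_ge0 => x _; rewrite lee_fin.
by rewrite ge0_fin_numE//; apply: integral_ge0 => x _; rewrite lee_fin.
Qed.

Lemma heat_rtens a b (t : R) (f : euclid R a -> R) (g : euclid R b -> R) (v : euclid R (a + b)) :
  0 < t -> nnL1 f -> nnL1 g -> heat t (rtens f g) v = heat t f (lv v) * heat t g (rv v).
Proof.
move=> t0 nf ng; have nfg := nnL1_rtens nf ng; have [mf f0 _] := nf; have [mg g0 _] := ng.
suff : (heat t (rtens f g) v)%:E = ((heat t f (lv v))%:E * (heat t g (rv v))%:E)%E.
  by rewrite -EFinM => -[].
rewrite !heat_fin// -integral_rtens.
- apply: eq_integral => y _; congr (_%:E).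
  by rewrite heat_kernel_cat// subv_lv subv_rv /rtens mulrACA.
- by apply: measurable_funM => //; apply: measurable_heat_kernel; apply: measurable_subv.
- by apply: measurable_funM => //; apply: measurable_heat_kernel; apply: measurable_subv.
- by move=> x; rewrite mulr_ge0// heat_kernel_ge0.
- by move=> x; rewrite mulr_ge0// heat_kernel_ge0.
Qed.

(** With h = |f|^2 this is the initial datum in [Q]. *)
Definition root_heat d (t : R) (h : euclid R d -> R) (x : euclid R d) : R[i] :=
  (Num.sqrt (heat t h x))%:C.

Lemma cL2_root_heat d (t : R) (h : euclid R d -> R) : 0 < t -> nnL1 h -> cL2 (leb d) (root_heat t h).
Proof.
move=> t0 nh; have [mA A0 Ai] := nnL1_heat t0 nh; split.
  apply: cmeas_real; apply: (measurableT_comp (f := Num.sqrt : R -> R)) => //.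
  by apply: continuous_measurable_fun; exact: sqrt_continuous.
apply: le_lt_trans Ai; rewrite le_eqVlt; apply/orP; left; apply/eqP.
by apply: eq_integral => z _; rewrite cabs_real real_normK ?num_real// sqr_sqrtr.
Qed.

Lemma tens_root_heat a b (t : R) (f : euclid R a -> R) (g : euclid R b -> R) :
  0 < t -> nnL1 f -> nnL1 g -> tens (root_heat t f) (root_heat t g) = root_heat t (rtens f g).
Proof.
move=> t0 nf ng; apply/funext => v.
have f0 : 0 <= heat t f (lv v) by apply: heat_ge0; case: nf.
by rewrite /tens /root_heat heat_rtens// -real_cM sqrtrM.
Qed.

Lemma root_heat_orth d (Phi : euclid R d -> euclid R d) (t : R) h : orthmap Phi -> nnL1 h ->
  (fun z => root_heat t h (Phi z)) = root_heat t (fun z => h (Phi z)).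
Proof.
by move=> oP [mh h0 _]; apply/funext => z; rewrite /root_heat heat_orth.
Qed.

End heat_tensor.

(** * Space-time integrals along the heat flow *)

Section monotone.
Context {R : realType}.

Definition power_norm d (N : nat) (t : R) (h : euclid R d -> R) : \bar R :=
  (\int[lebesgue_measure]_s \int[leb d]_x (cabs (schrodinger s (root_heat t h) x) ^+ N)%:E)%E.

(** The square root of a heat flow is compatible with tensor powers and with [Phi4], so [T4] of the
    datum is again such a root and [n2_tilde_heat_mono] applies. It serves with [n = d] for (2,4,4)
    and with [n = d + d] for (1,8,4). *)
Lemma quartic_mono n (n_2 : n = 2%N) (h : euclid R n -> R) (t e : R) : 0 < t -> 0 < e -> nnL1 h ->
  (power_norm 4 t h <= power_norm 4 (t + e) h)%E.
Proof.
move=> t0 e0 nh; have te0 : 0 < t + e by rewrite addr_gt0.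
have oP := @orthmap_Phi4 R n; have nhh := nnL1_rtens nh nh.
have E s : 0 < s -> power_norm 4 s h = ((strichartz_const n n (Num.sqrt 2) 2)%:E *
   n2 (leb (n + n)) (tilde n_2 (root_heat s (fun z => rtens h h (Phi4 z)))))%E.
  move=> s0; have TE : T4 (root_heat s h) = root_heat s (fun z => rtens h h (Phi4 z)).
    by rewrite -(root_heat_orth s oP nhh) -(tens_root_heat s0 nh nh).
  by rewrite -TE; exact: quartic_identity (cL2_root_heat s0 nh).
have tr (a b c d : \bar R) : a = b -> c = d -> (b <= d)%E -> (a <= c)%E by move=> -> ->.
apply: (tr _ _ _ _ (E t t0) (E _ te0)); apply: lee_wpmul2l.
  by rewrite lee_fin ltW// (strichartz_const_gt0 n_2)// sqrtr_gt0.
exact: (n2_tilde_heat_mono n_2 t0 e0 (nnL1_orth oP nhh)).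
Qed.

Lemma sextic_mono o (o_2 : (o + o = 2)%N) (h : euclid R o -> R) (t e : R) : 0 < t -> 0 < e -> nnL1 h ->
  (power_norm 6 t h <= power_norm 6 (t + e) h)%E.
Proof.
move=> t0 e0 nh; have te0 : 0 < t + e by rewrite addr_gt0.
have oP := @orthmap_Phi6 R o; have nhh := nnL1_rtens nh nh; have nhhh := nnL1_rtens nhh nh.
have E s : 0 < s -> power_norm 6 s h = ((strichartz_const (o + o) o (Num.sqrt 3) 3)%:E *
   n2 (leb ((o + o) + o)) (tilde o_2 (root_heat s (fun z => rtens (rtens h h) h (Phi6 z)))))%E.
  move=> s0; have TE : T6 (root_heat s h) = root_heat s (fun z => rtens (rtens h h) h (Phi6 z)).
    by rewrite -(root_heat_orth s oP nhhh) -(tens_root_heat s0 nhh nh) -(tens_root_heat s0 nh nh).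
  by rewrite -TE; exact: sextic_identity (cL2_root_heat s0 nh).
have tr (a b c d : \bar R) : a = b -> c = d -> (b <= d)%E -> (a <= c)%E by move=> -> ->.
apply: (tr _ _ _ _ (E t t0) (E _ te0)); apply: lee_wpmul2l.
  by rewrite lee_fin ltW// (strichartz_const_gt0 o_2)// sqrtr_gt0.
exact: (n2_tilde_heat_mono o_2 t0 e0 (nnL1_orth oP nhhh)).
Qed.

Lemma fpair_unique d (g g' G : euclid R d -> R[i]) : fpair g G -> fpair g' G ->
  {ae leb d, forall x, g x = g' x}.
Proof.
move=> p p'; have [[mg _] _ _] := p; have [[mg' _] _ _] := p'.
have : n2 (leb d) (fun x => g x - g' x) = 0%E.
  rewrite (fpair_isometry p p') /n2.
  by under eq_integral do rewrite subrr cabs0 expr0n; rewrite integral0.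
move=> /(n2_eq0 (cmeasB mg mg')); apply: filterS => x /eqP.
by rewrite subr_eq0 => /eqP.
Qed.

(** |xi|^2 is additive over the two blocks of coordinates, so the multiplier is a tensor product;
    equality is almost everywhere because [schrodinger] picks representatives. *)
Lemma schrodinger_tens a b (f : euclid R a -> R[i]) (g : euclid R b -> R[i]) (s : R) :
  cL2 (leb a) f -> cL2 (leb b) g ->
  {ae leb (a + b), forall v, schrodinger s (tens f g) v = tens (schrodinger s f) (schrodinger s g) v}.
Proof.
move=> lf lg; have [F p] := fpair_exists lf; have [G q] := fpair_exists lg.
have := fpair_tens (schrodinger_pair s p) (schrodinger_pair s q).
have -> : tens (fun xi => cis (- (s * sqnorm xi)) * F xi) (fun xi => cis (- (s * sqnorm xi)) * G xi) =
   (fun xi => cis (- (s * sqnorm xi)) * tens F G xi).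
  apply/funext => v; rewrite /tens mulrACA -cisD; congr (cis _ * _).
  by rewrite {3}/sqnorm (dot_lrv v v) mulrDr opprD.
by move=> r; exact: fpair_unique (schrodinger_pair s (fpair_tens p q)) r.
Qed.

(** For p = 8 and q = 4 the inner integral enters squared, that is, as a single integral over pairs
    of points. *)
Lemma power_norm_tens o (h : euclid R o -> R) (t : R) : 0 < t -> nnL1 h ->
  power_norm 4 t (rtens h h) = (\int[lebesgue_measure]_s
    ((\int[leb o]_x (cabs (schrodinger s (root_heat t h) x) ^+ 4)%:E) *
     (\int[leb o]_x (cabs (schrodinger s (root_heat t h) x) ^+ 4)%:E)))%E.
Proof.
move=> t0 nh; apply: eq_integral => s _; rewrite -tens_root_heat//.
have lg := cL2_root_heat t0 nh; set g := root_heat t h in lg *.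
have [G p] := fpair_exists lg; have mu := cmeas_schrodinger p s.
have [_ _ [_ [_ _ _]]] := fpair_tens p p.
have mu2 := cmeas_schrodinger (fpair_tens p p) s.
have m4 d (u : euclid R d -> R[i]) : cmeas u -> measurable_fun setT (fun x => cabs (u x) ^+ 4).
  by move=> m; apply: measurable_funX; exact: measurable_cabs.
rewrite -(integral_rtens (f := fun x => cabs (schrodinger s g x) ^+ 4) (g := fun x => cabs (schrodinger s g x) ^+ 4)).
- apply: ge0_ae_eq_integral => //.
  + by apply/measurable_EFinP; exact: m4.
  + by apply/measurable_EFinP; apply: measurable_rtens; exact: m4.
  + by move=> v _; rewrite lee_fin exprn_ge0// cabs_ge0.
  + by move=> v _; rewrite lee_fin mulr_ge0// exprn_ge0// cabs_ge0.
  have := schrodinger_tens s lg lg; apply: filterS => v e _.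
  by rewrite e /tens /rtens cabsM exprMn.
- exact: m4.
- exact: m4.
- by move=> x; rewrite exprn_ge0// cabs_ge0.
- by move=> x; rewrite exprn_ge0// cabs_ge0.
Qed.

End monotone.

(** * Monotonicity *)

Section mixed_norms.
Context {R : realType}.

Lemma LnormE dT (T : measurableType dT) (mu : {measure set T -> \bar R}) (r : R) (f : T -> \bar R) :
  r != 0 -> Lnorm mu r%:E f = ((\int[mu]_x (`|f x| `^ r)) `^ r^-1)%E.
Proof.
by move=> r0; rewrite -poweR_Lnorm// -poweRrM mulfV// poweRe1// Lnorm_ge0.
Qed.

Lemma Lpnorm_pow d (q : nat) (u : euclid R d -> R[i]) : (0 < q)%N ->
  Lpnorm q%:R%:E u = ((\int[leb d]_x (cabs (u x) ^+ q)%:E) `^ q%:R^-1)%E.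
Proof.
move=> q0; rewrite /Lpnorm LnormE ?pnatr_eq0 -?lt0n//; congr (_ `^ _)%E.
apply: eq_integral => x _; rewrite gee0_abs ?lee_fin ?cabs_ge0// poweR_EFin.
by rewrite powR_mulrn// cabs_ge0.
Qed.

(** Divisibility of p by q makes the exponent m = p / q of the inner integral an integer: 1 in the
    diagonal cases, 2 for (1,8,4). *)
Lemma mixed_norm_pow d (q m : nat) (v : R -> euclid R d -> R[i]) : (0 < q)%N -> (0 < m)%N ->
  mixed_norm (q * m)%:R%:E q%:R%:E v =
  ((\int[lebesgue_measure]_s ((\int[leb d]_x (cabs (v s x) ^+ q)%:E) `^ m%:R)) `^ (q * m)%:R^-1)%E.
Proof.
move=> q0 m0; have p0 : (q * m)%:R != 0 :> R by rewrite pnatr_eq0 -lt0n muln_gt0 q0.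
rewrite /mixed_norm LnormE//; congr (_ `^ _)%E; apply: eq_integral => s _.
rewrite gee0_abs; last by exact: Lnorm_ge0.
rewrite Lpnorm_pow// -poweRrM; congr (_ `^ _)%E.
by rewrite natrM mulKf// pnatr_eq0 -lt0n.
Qed.

Lemma Q_mono d (p q m : nat) (f : euclid R d -> R[i]) (t1 t2 : R) : p = (q * m)%N -> (0 < q)%N -> (0 < m)%N ->
  (\int[lebesgue_measure]_s ((\int[leb d]_x (cabs (schrodinger s (root_heat t1 (fun y => (cabs (f y) ^+ 2)%R)) x) ^+ q)%:E) `^ m%:R)
   <= \int[lebesgue_measure]_s ((\int[leb d]_x (cabs (schrodinger s (root_heat t2 (fun y => (cabs (f y) ^+ 2)%R)) x) ^+ q)%:E) `^ m%:R))%E ->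
  (Q p%:R%:E q%:R%:E f t1 <= Q p%:R%:E q%:R%:E f t2)%E.
Proof.
move=> -> q0 m0 h.
have mono (a b : \bar R) : (0 <= a -> 0 <= b -> a <= b -> a `^ (q * m)%:R^-1 <= b `^ (q * m)%:R^-1)%E.
  by move=> a0 b0 ab; apply: gt0_ler_poweR; rewrite ?invr_ge0// in_itv /= ?a0 ?b0 leey.
have tr (a b a' b' : \bar R) : a = a' -> b = b' -> (a' <= b')%E -> (a <= b)%E by move=> -> ->.
have E t : Q (q * m)%:R%:E q%:R%:E f t = ((\int[lebesgue_measure]_s ((\int[leb d]_x
   (cabs (schrodinger s (root_heat t (fun y => (cabs (f y) ^+ 2)%R)) x) ^+ q)%:E) `^ m%:R)) `^ (q * m)%:R^-1)%E.
  exact: mixed_norm_pow q0 m0.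
apply: (tr _ _ _ _ (E t1) (E t2)); apply: mono.
- by apply: integral_ge0 => s _; exact: poweR_ge0.
- by apply: integral_ge0 => s _; exact: poweR_ge0.
- exact: h.
Qed.

(** Clearing denominators turns admissibility into 4q + 2dp = dpq, and p = mq into dm(q - 2) = 4. As
    q - 2 is even it is 2 or 4, which leaves dm = 2 with q = 4, or dm = 1 with q = 6. *)
Lemma admissibleP (d p q : nat) :
  [/\ schrodinger_admissible d (p%:R%:E : \bar R) (q%:R%:E : \bar R), ~~ odd q & (q %| p)%N] <->
  (d, p, q) \in [:: (1, 6, 6); (1, 8, 4); (2, 4, 4)]%N.
Proof.
have EE (d' p' q' : nat) : (0 < p')%N -> (0 < q')%N ->
   ((2%:E / p'%:R%:E + d'%:R%:E / q'%:R%:E = (d'%:R / 2)%:E :> \bar R)%E <->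
    (4 * q' + 2 * d' * p' = d' * p' * q')%N).
  move=> p0 q0; have pn : p'%:R != 0 :> R by rewrite pnatr_eq0 -lt0n.
  have qn : q'%:R != 0 :> R by rewrite pnatr_eq0 -lt0n.
  rewrite !inver (negbTE pn) (negbTE qn) -!EFinM -EFinD; split.
    move=> [h]; apply/eqP; rewrite -(eqr_nat R) natrD !natrM; apply/eqP.
    have := congr1 (fun x => x * (2 * p'%:R * q'%:R)) h.
    have -> : (2 / p'%:R + d'%:R / q'%:R) * (2 * p'%:R * q'%:R) = 4 * q'%:R + 2 * d'%:R * p'%:R :> R.
      by field; rewrite pn qn.
    by move=> ->; field.
  move=> h; congr (_%:E); have := congr1 (fun x => x%:R : R) h; rewrite natrD !natrM => h'.
  have : (2 / p'%:R + d'%:R / q'%:R) * (2 * p'%:R * q'%:R) = (d'%:R / 2) * (2 * p'%:R * q'%:R) :> R.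
    transitivity (4 * q'%:R + 2 * d'%:R * p'%:R : R); first by field; rewrite pn qn.
    by rewrite h'; field.
  by apply: mulIf; rewrite !mulf_neq0// pnatr_eq0.
have ge2 (r : nat) : (2%:E <= (r%:R%:E : \bar R))%E = (2 <= r)%N by rewrite lee_fin ler_nat.
split.
  move=> [[d0 p2 q2 _ e] oq /dvdnP[m pE]].
  rewrite !ge2 in p2 q2.
  have {e} := proj1 (EE d p q (leq_trans _ p2) (leq_trans _ q2)) e.
  move=> /(_ isT isT) e.
  have {}e : (d * m * (q - 2) = 4)%N.
    have q0 : (0 < q)%N by apply: leq_trans q2.
    apply/eqP; rewrite -(eqn_pmul2r q0); apply/eqP; move: e; rewrite pE.
    have -> : q = (q - 2 + 2)%N by rewrite subnK.
    move: (q - 2)%N => r; nia.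
  have qE : q = (q - 2 + 2)%N by rewrite subnK.
  move: oq; rewrite pE qE oddD /= addbF; move: (q - 2)%N e => r e oddr.
  have rle : (r <= 4)%N.
    by rewrite -e leq_pmull// muln_gt0; case: d m e {d0 pE} => [|d'] [|m']; rewrite ?mul0n ?muln0.
  have dmle : (d * m <= 4)%N.
    by rewrite -e leq_pmulr//; case: r e {oddr rle} => //; rewrite muln0.
  case: r e oddr rle => [|[|[|[|[|r]]]]] //= e _ _; first by rewrite muln0 in e.
    have {}e : (d * m = 2)%N by lia.
    move: e; clear; case: d => [|[|[|d]]]; case: m => [|[|[|m]]] => // e; exfalso; nia.
  have {}e : (d * m = 1)%N by lia.
  move: e; clear; case: d => [|[|d]]; case: m => [|[|m]] => // e; exfalso; nia.
have sol (d' p' q' : nat) : (0 < d')%N -> (2 <= p')%N -> (2 <= q')%N ->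
   (4 * q' + 2 * d' * p' = d' * p' * q')%N -> schrodinger_admissible d' (p'%:R%:E : \bar R) (q'%:R%:E : \bar R).
  move=> d0 p2 q2 e; split => //; rewrite ?ge2//; first by case.
  by apply/(EE d' p' q') => //; [exact: leq_trans p2|exact: leq_trans q2].
by rewrite !inE => /or3P[] /eqP[-> -> ->]; split => //; exact: sol.
Qed.

Lemma Q_mono_sextic d (d_1 : d = 1%N) (f : euclid R d -> R[i]) (t1 t2 : R) :
  nnL1 (fun y => cabs (f y) ^+ 2) -> 0 < t1 -> t1 < t2 -> (Q 6%:R%:E 6%:R%:E f t1 <= Q 6%:R%:E 6%:R%:E f t2)%E.
Proof.
move=> nh t0 t12; have e0 : 0 < t2 - t1 by rewrite subr_gt0.
have dd : (d + d = 2)%N by rewrite d_1.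
have := sextic_mono dd t0 e0 nh; rewrite addrC subrK => h.
apply: (@Q_mono d 6 6 1 f t1 t2 erefl isT isT).
have E t : (\int[lebesgue_measure]_s ((\int[leb d]_x
   (cabs (schrodinger s (root_heat t (fun y => (cabs (f y) ^+ 2)%R)) x) ^+ 6)%:E) `^ 1%:R))%E =
   power_norm 6 t (fun y => (cabs (f y) ^+ 2)%R).
  apply: eq_integral => s _; apply: poweRe1.
  by apply: integral_ge0 => x _; rewrite lee_fin exprn_ge0// cabs_ge0.
have tr (a b a' b' : \bar R) : a = a' -> b = b' -> (a' <= b')%E -> (a <= b)%E by move=> -> ->.
exact: (tr _ _ _ _ (E t1) (E t2) h).
Qed.

Lemma Q_mono_quartic d (d_2 : d = 2%N) (f : euclid R d -> R[i]) (t1 t2 : R) :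
  nnL1 (fun y => cabs (f y) ^+ 2) -> 0 < t1 -> t1 < t2 -> (Q 4%:R%:E 4%:R%:E f t1 <= Q 4%:R%:E 4%:R%:E f t2)%E.
Proof.
move=> nh t0 t12; have e0 : 0 < t2 - t1 by rewrite subr_gt0.
have := quartic_mono d_2 t0 e0 nh; rewrite addrC subrK => h.
apply: (@Q_mono d 4 4 1 f t1 t2 erefl isT isT).
have E t : (\int[lebesgue_measure]_s ((\int[leb d]_x
   (cabs (schrodinger s (root_heat t (fun y => (cabs (f y) ^+ 2)%R)) x) ^+ 4)%:E) `^ 1%:R))%E =
   power_norm 4 t (fun y => (cabs (f y) ^+ 2)%R).
  apply: eq_integral => s _; apply: poweRe1.
  by apply: integral_ge0 => x _; rewrite lee_fin exprn_ge0// cabs_ge0.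
have tr (a b a' b' : \bar R) : a = a' -> b = b' -> (a' <= b')%E -> (a <= b)%E by move=> -> ->.
exact: (tr _ _ _ _ (E t1) (E t2) h).
Qed.

Lemma Q_mono_octic d (d_1 : d = 1%N) (f : euclid R d -> R[i]) (t1 t2 : R) :
  nnL1 (fun y => cabs (f y) ^+ 2) -> 0 < t1 -> t1 < t2 -> (Q 8%:R%:E 4%:R%:E f t1 <= Q 8%:R%:E 4%:R%:E f t2)%E.
Proof.
move=> nh t0 t12; have e0 : 0 < t2 - t1 by rewrite subr_gt0.
have dd : (d + d = 2)%N by rewrite d_1.
have := quartic_mono dd t0 e0 (nnL1_rtens nh nh); rewrite addrC subrK => h.
apply: (@Q_mono d 8 4 2 f t1 t2 erefl isT isT).
have E t : 0 < t -> (\int[lebesgue_measure]_s ((\int[leb d]_x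
   (cabs (schrodinger s (root_heat t (fun y => (cabs (f y) ^+ 2)%R)) x) ^+ 4)%:E) `^ 2%:R))%E =
   power_norm 4 t (rtens (fun y => (cabs (f y) ^+ 2)%R) (fun y => (cabs (f y) ^+ 2)%R)).
  move=> t_0; rewrite power_norm_tens//; apply: eq_integral => s _; apply: poweR2.
  by apply: integral_ge0 => x _; rewrite lee_fin exprn_ge0// cabs_ge0.
have tr (a b a' b' : \bar R) : a = a' -> b = b' -> (a' <= b')%E -> (a <= b)%E by move=> -> ->.
exact: (tr _ _ _ _ (E t1 t0) (E t2 (lt_trans t0 t12)) h).
Qed.

End mixed_norms.

Theorem theorem1p1 (R : realType) (d p q : nat) :
  ([/\ schrodinger_admissible d (p%:R%:E : \bar R) (q%:R%:E : \bar R),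
       ~~ odd q & (q %| p)%N] <->
   (d, p, q) \in [:: (1, 6, 6); (1, 8, 4); (2, 4, 4)]%N) /\
  ([/\ schrodinger_admissible d (p%:R%:E : \bar R) (q%:R%:E : \bar R),
       ~~ odd q & (q %| p)%N] ->
   forall f : euclid R d -> R[i], memLp 2%:E f ->
   forall t1 t2 : R, 0 < t1 -> t1 <= t2 ->
     (Q p%:R%:E q%:R%:E f t1 <= Q p%:R%:E q%:R%:E f t2)%E).
Proof.
split; first exact: admissibleP.
move=> /admissibleP adm f /memLp2P lf t1 t2 t0.
rewrite le_eqVlt => /orP[/eqP -> //|t12].
have nh : nnL1 (fun y => cabs (f y) ^+ 2).
  have [mf f2] := lf; split => //; first exact: measurable_cabs2.
  by move=> x; exact: sqr_ge0.
move: adm; rewrite !inE => /or3P[] /eqP[dE pE qE]; rewrite pE qE.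
- exact: Q_mono_sextic.
- exact: Q_mono_octic.
- exact: Q_mono_quartic.
Qed.
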